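(* Let $r\in\{0,\ldots,d-1\}$. Fix $\alpha\in(0,1)$ and $i\in\{0,1,2\}$. The tests $\varphi_{\alpha,i}=\mathbf 1(\lambda_{r+1}(\widehat C^{t,h})>\kappa_{\alpha,i})$ are consistent under local alternatives $\mathcal H_1(I_{t,h},\underline\lambda_{r+1})$ whenever $M\kappa_{\alpha,i}/\underline\lambda_{r+1}\to0$. More precisely, uniform local consistency holds: $$\lim_{R\to\infty}\ \inf_{\Sigma\in\mathcal H_1(I_{t,h},RM\kappa_{\alpha,i})}\mathbb P_\Sigma(\varphi_{\alpha,i}=1)=1,$$ where the parameters $n$, $h$ and $M\ge r+1$ can vary arbitrarily as $R\to\infty$.
   Context: Setting. Let $d\ge1$, $\eta>0$, $n\in\mathbb N$. $\mathbb R^{d\times d}_{spd}$ denotes the symmetric positive semi-definite $d\times d$ matrices; $\lambda_{max}(S)=\lambda_1(S)\ge\cdots\ge\lambda_d(S)$ are the ordered eigenvalues of a symmetric matrix $S$. Let $X(t)=X(0)+\int_0^t\sigma(s)\,dB(s)$, $t\in[0,1]$, with a given initial value $X(0)$, a $p$-dimensional standard Brownian motion $B$, deterministic $\sigma\in L^2([0,1];\mathbb R^{d\times p})$, and $\Sigma(t)=\sigma(t)\sigma(t)^\top$. One observes $dY(t)=X(t)\,dt+\eta n^{-1/2}\,dW(t)$, $t\in[0,1]$, with a $d$-dimensional standard Brownian motion $W$ independent of $X$. $\mathbb P_\Sigma$ denotes the law of the observations. For $t\in[0,1)$, $h\in(0,1-t]$ let $I_{t,h}=[t,t+h]$, and for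 $j\ge1$ let $\Phi_j(s)=\sqrt{2/h}\sin(j\pi(s-t)/h)$, $S_j=\int_{I_{t,h}}\Phi_j'(s)\,dY(s)\in\mathbb R^d$, $\varepsilon_{n,h}=\pi h^{-1}\eta n^{-1/2}$. For $M\ge1$ define $w_j=c_wM^{-1}(1+j^2/M^2)^{-2}$, $j\ge1$, with $c_w>0$ such that $\sum_{j\ge1}w_j=1$, and $\widehat C^{t,h}=\sum_{j\ge1}w_jS_jS_j^\top$, $B_w=\sum_{j\ge1}w_jj^2$. Critical values. For parameters $\beta\in(0,1]$, $L>0$, $\underline\lambda_r\ge0$ (of the null hypothesis) put $\mathrm{BIAS}_0^\Sigma(h)=\min\big(2Lh^\beta,(r+4)L^2h^{2\beta}/\underline\lambda_r\big)$ (second term $+\infty$ if $\underline\lambda_r=0$), $\mathcal W(x)=\max(x,\sqrt x)$, and $$\kappa_{\alpha,0}=\big(4\,\mathrm{BIAS}_0^\Sigma(h)+\varepsilon_{n,h}^2\tfrac{M^2}{2}\big)\Big(1+\log(4(d-r))\mathcal W\big(\tfrac{6d}{M}\big)+\tfrac{21\log(2\alpha^{-1})}{M}\Big),$$ $$\kappa_{\alpha,1}=\big(B_w+(2\pi)^{-1/2}M^{3/2}q_{1-\alpha;\lambda_{max}(GOE(d-r))}\big)\varepsilon_{n,h}^2,\qquad\kappa_{\alpha,2}=q_{1-\alpha,\Lambda_M}\varepsilon_{n,h}^2,$$ where $q_{1-\alpha;\lambda_{max}(GOE(d-r))}$ is the $(1-\alpha)$-quantile of $\lambda_{max}(Z)$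 for $Z\sim GOE(d-r)$ (symmetric $(d-r)\times(d-r)$ matrix with independent entries $Z_{i,i}\sim N(0,2)$, $Z_{i,j}\sim N(0,1)$ for $j>i$), and $q_{1-\alpha,\Lambda_M}$ is the $(1-\alpha)$-quantile of $\Lambda_M=\lambda_{max}(\sum_{j\ge1}w_jj^2\zeta_j\zeta_j^\top)$ with independent $\zeta_j\sim N(0,I_{d-r})$. Alternatives. For $\underline\lambda_{r+1}>0$, $$\mathcal H_1(I_{t,h},\underline\lambda_{r+1})=\{\Sigma\in L^1([0,1];\mathbb R^{d\times d}_{spd})\,:\,\lambda_{r+1}(\Sigma(s))\ge\underline\lambda_{r+1}\text{ for all }s\in I_{t,h}\}.$$ Consistency under local alternatives means that $\inf_{\Sigma\in\mathcal H_1(I_{t,h},\underline\lambda_{r+1})}\mathbb P_\Sigma(\varphi_{\alpha,i}=1)\to1$. *)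

(* Defs.v *)
From HB Require Import structures.
From mathcomp Require Import all_boot all_order all_algebra.
From mathcomp Require Import all_classical all_reals all_analysis.

Set Implicit Arguments.
Unset Strict Implicit.
Unset Printing Implicit Defensive.

Import Order.TTheory GRing.Theory Num.Theory.
Import numFieldNormedType.Exports.

Local Open Scope classical_set_scope.
Local Open Scope ring_scope.

(** ** Matrices *)

(* The eigenvalues in nonincreasing order, repeated according to their
   multiplicity in the characteristic polynomial.  The list is unique when it
   exists, and it exists for every symmetric matrix; otherwise it is [::]. *)
Definition eigenvalues (R : realType) (d : nat) (A : 'M[R]_d) : seq R :=
  xget [::] [set s : seq R |
    sorted (fun x y => y <= x) s /\ char_poly A = \prod_(a <- s) ('X - a%:P)].

(* Numbered from 1. *)
Definition lambda (R : realType) (d : nat) (k : nat) (A : 'M[R]_d) : R :=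
  nth 0 (eigenvalues A) k.-1.

Definition lambda_max (R : realType) (d : nat) (A : 'M[R]_d) : R := lambda 1 A.

Definition spd (R : realType) (d : nat) (A : 'M[R]_d) : Prop :=
  A \is symmetricmx /\ forall v : 'cV[R]_d, 0 <= (v^T *m A *m v) 0 0.

(** ** Probability *)

Definition mutually_independent (R : realType) (disp : measure_display)
    (T : measurableType disp) (P : probability T R) (I : eqType)
    (X : I -> T -> R) : Prop :=
  forall (J : seq I) (A : I -> set R), uniq J -> (forall i, measurable (A i)) ->
  P (\big[setI/setT]_(i <- J) (X i @^-1` A i)) =
  (\prod_(i <- J) P (X i @^-1` A i))%E.

(* [X] is a real random variable with law N(m, v), v > 0; the second parameter
   of [normal_prob] is the standard deviation. *)
Definition is_normal (R : realType) (disp : measure_display)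
    (T : measurableType disp) (P : probability T R) (m v : R) (X : T -> R) :
    Prop :=
  measurable_fun setT X /\
  forall A : set R, measurable A ->
    P (X @^-1` A) = normal_prob m (Num.sqrt v) A.

Definition quantile (R : realType) (disp : measure_display)
    (T : measurableType disp) (P : probability T R) (u : R) (X : T -> R) : R :=
  inf [set x : R | (u%:E <= P [set w | (X w <= x)%R])%E].

Definition cvg_in_probability (R : realType) (disp : measure_display)
    (T : measurableType disp) (P : probability T R)
    (X_ : nat -> T -> R) (X : T -> R) : Prop :=
  forall e : R, 0 < e ->
    P [set w | e <= `|X_ k w - X w|] @[k --> \oo] --> 0%E.

(* Processes are indexed by all reals, only times in [0, 1] being relevant. *)

Definition continuous_paths (R : realType) (T : Type) (q : nat)
    (Z : R -> T -> 'cV[R]_q) : Prop :=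
  forall w k, {within `[0, 1], continuous (fun s : R => Z s w k 0)}.

Definition measurable_process (R : realType) (disp : measure_display)
    (T : measurableType disp) (q : nat) (Z : R -> T -> 'cV[R]_q) : Prop :=
  forall s k, 0 <= s <= 1 -> measurable_fun setT (fun w => Z s w k 0).

Definition process_sigma_algebra (R : realType) (T : Type) (q : nat)
    (Z : R -> T -> 'cV[R]_q) : set (set T) :=
  <<s [set E | exists s k (A : set R), [/\ 0 <= s <= 1, measurable A &
         E = (fun w => Z s w k 0) @^-1` A]] >>.

Definition independent_processes (R : realType) (disp : measure_display)
    (T : measurableType disp) (P : probability T R) (p q : nat)
    (Z : R -> T -> 'cV[R]_p) (Z' : R -> T -> 'cV[R]_q) : Prop :=
  forall E F, process_sigma_algebra Z E -> process_sigma_algebra Z' F ->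
    P (E `&` F) = (P E * P F)%E.

Definition brownian_motion (R : realType) (disp : measure_display)
    (T : measurableType disp) (P : probability T R) (q : nat)
    (B : R -> T -> 'cV[R]_q) : Prop :=
  [/\ measurable_process B,
      continuous_paths B,
      forall w, B 0 w = 0,
      forall s u k, 0 <= s -> s < u -> u <= 1 ->
        is_normal P 0 (u - s) (fun w => B u w k 0 - B s w k 0) &
      (* increments over disjoint intervals and distinct coordinates *)
      forall (m : nat) (s : nat -> R), 0 <= s 0%N -> s m <= 1 ->
        (forall i, (i < m)%N -> s i <= s i.+1) ->
        mutually_independent P (fun ki : 'I_q * 'I_m =>
          fun w => B (s ki.2.+1) w ki.1 0 - B (s ki.2) w ki.1 0)].

Definition step_fun (R : realType) (m : nat) (s c : nat -> R) (x : R) : R :=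
  \sum_(i < m) c i * \1_(`]s i, s i.+1]) x.

Definition step_integral (R : realType) (T : Type) (Z : R -> T -> R)
    (m : nat) (s c : nat -> R) (w : T) : R :=
  \sum_(i < m) c i * (Z (s i.+1) w - Z (s i) w).

(* [I] is a version of the stochastic integral of the deterministic function
   [f] against the real process [Z] over [a, b]: the limit in probability of the
   integrals of step functions tending to [f] in L^2([a, b]).  For a Brownian
   motion this is the Wiener integral (Gaussian variables converge in
   probability iff they converge in L^2); for dZ = X ds + c dW with X continuous
   it is \int f X ds + c \int f dW. *)
Definition stoch_integral (R : realType) (disp : measure_display)
    (T : measurableType disp) (P : probability T R)
    (Z : R -> T -> R) (a b : R) (f : R -> R) (I : T -> R) : Prop :=
  measurable_fun setT I /\
  exists (m : nat -> nat) (s c : nat -> nat -> R),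
    [/\ forall k, [/\ s k 0%N = a, s k (m k) = b &
          forall i, (i < m k)%N -> s k i <= s k i.+1],
        (\int[lebesgue_measure]_(x in `[a, b])
           ((step_fun (m k) (s k) (c k) x - f x) ^+ 2)%:E)%E
          @[k --> \oo] --> 0%E &
        cvg_in_probability P
          (fun k => step_integral Z (m k) (s k) (c k)) I].

(** ** The observation model *)

Definition L1_spd (R : realType) (d : nat) (Sigma : R -> 'M[R]_d) : Prop :=
  (forall i k, lebesgue_measure.-integrable `[0, 1]
     (fun s : R => (Sigma s i k)%:E)) /\
  (forall s, 0 <= s <= 1 -> spd (Sigma s)).

Definition L2_mx (R : realType) (d p : nat) (sigma : R -> 'M[R]_(d, p)) : Prop :=
  forall i k, measurable_fun (`[0, 1] : set R) (fun s : R => sigma s i k) /\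
    lebesgue_measure.-integrable `[0, 1] (fun s : R => (sigma s i k ^+ 2)%:E).

(* dX = sigma dB, for a Brownian motion B of some dimension p. *)
Definition signal_model (R : realType) (disp : measure_display)
    (T : measurableType disp) (P : probability T R) (d : nat)
    (Sigma : R -> 'M[R]_d) (X : R -> T -> 'cV[R]_d) : Prop :=
  [/\ measurable_process X,
      continuous_paths X &
      exists (p : nat) (sigma : R -> 'M[R]_(d, p)) (B : R -> T -> 'cV[R]_p),
        [/\ brownian_motion P B,
            L2_mx sigma,
            forall s, 0 <= s <= 1 -> Sigma s = sigma s *m (sigma s)^T &
            forall s, 0 <= s <= 1 ->
            exists J : 'I_d -> 'I_p -> T -> R,
              (forall i k, stoch_integral P (fun u w => B u w k 0) 0 s
                 (fun u => sigma u i k) (J i k)) /\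
              {ae P, forall w, forall i,
                 X s w i 0 = X 0 w i 0 + \sum_(k < p) J i k w}]].

Definition observation_law (R : realType) (disp : measure_display)
    (T : measurableType disp) (P : probability T R) (d : nat)
    (Sigma : R -> 'M[R]_d) (X W : R -> T -> 'cV[R]_d) : Prop :=
  [/\ signal_model P Sigma X, brownian_motion P W & independent_processes P X W].

(* dY = X ds + eta n^(-1/2) dW, Y(0) = 0. *)
Definition observation (R : realType) (T : Type) (d : nat) (eta : R)
    (X W : R -> T -> 'cV[R]_d) (n : nat) (s : R) (w : T) : 'cV[R]_d :=
  \col_k ((\int[lebesgue_measure]_(u in `[0%R, s]) X u w k 0)
          + eta / Num.sqrt n%:R * W s w k 0).

(** ** Spectral statistics and the test *)

Definition Phi (R : realType) (t h : R) (j : nat) (s : R) : R :=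
  Num.sqrt (2 / h) * sin (j%:R * pi * (s - t) / h).

Definition eps (R : realType) (eta : R) (n : nat) (h : R) : R :=
  pi * h^-1 * (eta / Num.sqrt n%:R).

(* [S n h j] is a version of \int_[t, t+h] Phi_j' dY, under the law P. *)
Definition spectral_statistics (R : realType) (disp : measure_display)
    (T : measurableType disp) (P : probability T R) (d : nat) (t : R)
    (Y : nat -> R -> T -> 'cV[R]_d) (S : nat -> R -> nat -> T -> 'cV[R]_d) :
    Prop :=
  forall (n : nat) (h : R) (j : nat) (k : 'I_d),
    (0 < n)%N -> 0 < h <= 1 - t -> (0 < j)%N ->
    stoch_integral P (fun s w => Y n s w k 0) t (t + h)
      (fun s => derive1 (Phi t h j) s) (fun w => S n h j w k 0).

Definition series_from1 (R : realType) (u : nat -> R) : R :=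
  limn (fun n => \sum_(1 <= j < n) u j).

(* The normalizing constant c_w, so that the weights sum to 1. *)
Definition cw (R : realType) (M : R) : R :=
  (series_from1 (fun j => M^-1 * (1 + j%:R ^+ 2 / M ^+ 2) ^- 2))^-1.

Definition weight (R : realType) (M : R) (j : nat) : R :=
  cw M * M^-1 * (1 + j%:R ^+ 2 / M ^+ 2) ^- 2.

Definition Bw (R : realType) (M : R) : R :=
  series_from1 (fun j => weight M j * j%:R ^+ 2).

Definition Chat (R : realType) (d : nat) (M : R) (S : nat -> 'cV[R]_d) :
    'M[R]_d :=
  \matrix_(i, k) series_from1 (fun j => weight M j * (S j *m (S j)^T) i k).

Definition test (R : realType) (d : nat) (r : nat) (kap M : R)
    (S : nat -> 'cV[R]_d) : bool :=
  kap < lambda r.+1 (Chat M S).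

(** ** Critical values *)

Definition GOE (R : realType) (disp : measure_display)
    (T : measurableType disp) (P : probability T R) (m : nat)
    (Z : T -> 'M[R]_m) : Prop :=
  [/\ forall w, Z w \is symmetricmx,
      forall i, is_normal P 0 2 (fun w => Z w i i),
      forall i j : 'I_m, (i < j)%N -> is_normal P 0 1 (fun w => Z w i j) &
      mutually_independent P (fun ij : {ij : 'I_m * 'I_m | (ij.1 <= ij.2)%N} =>
        fun w => Z w (val ij).1 (val ij).2)].

Definition iid_standard_normal (R : realType) (disp : measure_display)
    (T : measurableType disp) (P : probability T R) (m : nat)
    (zeta : nat -> T -> 'cV[R]_m) : Prop :=
  (forall j k, is_normal P 0 1 (fun w => zeta j w k 0)) /\
  mutually_independent P (fun jk : nat * 'I_m => fun w => zeta jk.1 w jk.2 0).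

Definition Lambda (R : realType) (m : nat) (M : R) (zeta : nat -> 'cV[R]_m) : R :=
  lambda_max (\matrix_(i, k)
    series_from1
      (fun j => weight M j * j%:R ^+ 2 * (zeta j *m (zeta j)^T) i k)).

Definition bias0 (R : realType) (r : nat) (beta L lam_r h : R) : R :=
  if lam_r == 0 then 2 * L * h `^ beta
  else Num.min (2 * L * h `^ beta)
         ((r%:R + 4) * L ^+ 2 * h `^ (2 * beta) / lam_r).

Definition calW (R : realType) (x : R) : R := Num.max x (Num.sqrt x).

Definition kappa0 (R : realType) (d r : nat) (alpha eta beta L lam_r : R)
    (n : nat) (h M : R) : R :=
  (4 * bias0 r beta L lam_r h + eps eta n h ^+ 2 * (M ^+ 2 / 2)) *
  (1 + ln (4 * (d - r)%:R) * calW (6 * d%:R / M) + 21 * ln (2 * alpha^-1) / M).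

(* [q] stands for the quantile of lambda_max(GOE(d-r)) *)
Definition kappa1 (R : realType) (eta q : R) (n : nat) (h M : R) : R :=
  (Bw M + (Num.sqrt (2 * pi))^-1 * M `^ (3 / 2) * q) * eps eta n h ^+ 2.

(* [q] stands for the quantile of Lambda_M *)
Definition kappa2 (R : realType) (eta q : R) (n : nat) (h : R) : R :=
  q * eps eta n h ^+ 2.

(* The quantiles are taken under the law [Q], which carries a matrix
   [Z] ~ GOE(d-r) and a sequence [zeta] of independent N(0, I_(d-r)). *)
Definition kappa (R : realType) (disp : measure_display)
    (T : measurableType disp) (Q : probability T R) (d r : nat)
    (Z : T -> 'M[R]_(d - r)) (zeta : nat -> T -> 'cV[R]_(d - r))
    (alpha eta beta L lam_r : R) (i : 'I_3) (n : nat) (h M : R) : R :=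
  nth 0 [:: kappa0 d r alpha eta beta L lam_r n h M;
            kappa1 eta (quantile Q (1 - alpha) (fun w => lambda_max (Z w))) n h M;
            kappa2 eta (quantile Q (1 - alpha)
              (fun w => Lambda M (fun j => zeta j w))) n h] i.

(** ** Alternatives *)

(* The defining formula is meaningful for every real [lam]; for [lam <= 0] the
   constraint on the eigenvalue is void. *)
Definition H1 (R : realType) (d r : nat) (t h lam : R) : set (R -> 'M[R]_d) :=
  [set Sigma | L1_spd Sigma /\
     forall s, t <= s <= t + h -> lam <= lambda r.+1 (Sigma s)].

(* Main.v *)
(** The critical values play no role beyond their size: for every [e] there is a
    [delta], depending only on [d], [r] and [e], such that
    [lambda_{r+1}(Chat) > delta (lam + eps^2) / M] with probability at least [1 - e]
    whenever [lambda_{r+1}(Sigma) >= lam] on [[t, t + h]].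

    Since [Chat >= (c / M) S S^T] almost surely, with [S = (S_1, ..., S_{r+1})], one
    needs a small ball estimate for [lambda_{r+1}(S S^T)].  This eigenvalue is at
    least [f^2 / |adj|^2] for every maximal minor [f] of [S].  Up to small errors in
    probability [S] is a sum of rank one matrices [g_i u_i v_i] with independent
    standard normal [g_i], coming from the increments of the Brownian motions driving
    the signal and the noise, so that [f] is multiaffine in the [g_i].  The
    orthonormality of the [Phi_j] bounds the sum of the squared partial derivatives of
    the minors below by [(lam + eps^2) / 4] times the sum of the squared cofactors;
    hence the expectation of [f^2], for the best minor, dominates that of
    [(lam + eps^2) |adj|^2].

    That [f^2] is rarely much smaller than its expectation, uniformly in the number of
    variables, follows by combining independent copies [x_a] of [g] along a polynomial
    curve [sum_a b_a(s) x_a]: [f] is a polynomial along the curve, of bounded degree,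
    small values at many [s] force by interpolation small values at all copies, and
    the latter is excluded by the Paley-Zygmund inequality and hypercontractivity. *)

Require Import Defs.
From HB Require Import structures.
From mathcomp Require Import all_boot all_order all_algebra.
From mathcomp Require Import all_fingroup.
From mathcomp Require Import all_classical all_reals all_analysis.
From mathcomp Require Import measurable_realfun.
From mathcomp Require Import complex ring lra zify.

Set Implicit Arguments.
Unset Strict Implicit.
Unset Printing Implicit Defensive.

Import Order.TTheory GRing.Theory Num.Theory.
Import numFieldNormedType.Exports.

Local Open Scope classical_set_scope.
Local Open Scope ring_scope.

(** * Eigenvalues and maximal minors *)

Section linear_algebra.
Context {R : realType}.

(** Two features of the model prevent a reduction to a Wishart matrix. The space on which [Sigma s]
    is at least [lam] may have only dimension [r.+1] and may turn with [s], so the signal is not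
    bounded below by one with constant covariance. What survives integration over [s] are sums of
    squared minors, because by Cauchy-Binet they do not depend on the orthonormal basis in which
    [Sigma s] is diagonalised. Moreover the driver [B] need not be independent of [W]: only [X] is.
    The estimates are carried to the product of two copies of the space, with [B] read on the first
    and [W] on the second. This requires approximations of the coefficients that separate [X] from
    [W]; summation by parts, [Phi] vanishing at both ends, then links the part in [X] to increments
    of [B]. The grid depends on how well [sigma] is approximated by step functions, so no constant
    may depend on the number of increments. Finally [Chat] is built from [limn], a default value for
    divergent series, so that keeping finitely many of its terms requires almost sure
    convergence. *)

Lemma det_1Duv (F : comNzRingType) n (u : 'cV[F]_n) (v : 'rV[F]_n) :
  \det (1%:M + u *m v) = 1 + (v *m u) 0 0.
Proof.
(* The same block matrix is factored by eliminating one or the other diagonal block; the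
   determinants of the two factorisations are compared. *)
have H1 : block_mx 1%:M v (- u) 1%:M =
    block_mx 1%:M 0 (- u) 1%:M *m block_mx 1%:M v 0 (1%:M + u *m v).
  by rewrite mulmx_block !mul1mx !mulmx1 mulmx0 !mul0mx !addr0 mulNmx addrC addrK.
have H2 : block_mx 1%:M v (- u) 1%:M =
    block_mx (1%:M + v *m u) v 0 1%:M *m block_mx 1%:M 0 (- u) 1%:M.
  rewrite mulmx_block !mul1mx !mul0mx !mulmx0 !mulmx1 ?addr0 ?add0r.
  by rewrite mulmxN addrK.
have := congr1 determinant H1; rewrite {1}H2 !det_mulmx !det_lblock !det_ublock.
rewrite !det1 !mul1r !mulr1 => <-; rewrite det_mx11.
by rewrite !mxE eqxx.
Qed.

Lemma det_rank1_unit (F : fieldType) n (A : 'M[F]_n) (u : 'cV[F]_n) (v : 'rV[F]_n) :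
  A \in unitmx -> \det (A + u *m v) = \det A + (v *m \adj A *m u) 0 0.
Proof.
move=> Au.
have -> : A + u *m v = A *m (1%:M + invmx A *m u *m v).
  by rewrite mulmxDr mulmx1 !mulmxA mulmxV // mul1mx.
rewrite det_mulmx det_1Duv mulrDr mulr1; congr (_ + _).
have -> : \adj A = \det A *: invmx A.
  by rewrite /invmx Au scalerA mulrV // scale1r.
by rewrite -scalemxAr -scalemxAl [RHS]mxE mulmxA.
Qed.

(** Singular matrices are reached through [A + 'X%:M], whose determinant is a monic polynomial: it
    is invertible over the field of fractions, and evaluating the resulting polynomial identity at 0
    returns [A]. *)
Lemma det_rank1 n (A : 'M[R]_n) (u : 'cV[R]_n) (v : 'rV[R]_n) :
  \det (A + u *m v) = \det A + (v *m \adj A *m u) 0 0.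
Proof.
pose f : R -> {fraction {poly R}} := @tofrac {poly R} \o polyC.
pose A' := map_mx polyC A + 'X%:M.
pose u' := map_mx (@polyC R) u; pose v' := map_mx (@polyC R) v.
have dA' : \det A' != 0.
  have -> : \det A' = char_poly (- A).
    by rewrite /char_poly /char_poly_mx raddfN opprK addrC.
  exact: monic_neq0 (char_poly_monic _).
have key : \det (A' + u' *m v') = \det A' + (v' *m \adj A' *m u') 0 0.
  apply/eqP; rewrite -tofrac_eq rmorphD /= -!det_map_mx.
  rewrite [map_mx _ (_ + _)]map_mxD map_mxM /= det_rank1_unit.
    apply/eqP; congr (_ + _); rewrite -map_mx_adj -!map_mxM.
    by rewrite [LHS]mxE.
  by rewrite unitmxE det_map_mx unitfE tofrac_eq0.
have e0 (m k : nat) (B : 'M[R]_(m, k)) : map_mx (horner_eval 0) (map_mx polyC B) = B.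
  by apply/matrixP => i j; rewrite !mxE /horner_eval hornerC.
have eA : map_mx (horner_eval 0) A' = A.
  by rewrite map_mxD e0 map_scalar_mx /= /horner_eval hornerX raddf0 addr0.
have := congr1 (horner_eval 0) key; rewrite rmorphD /= -!det_map_mx.
rewrite map_mxD map_mxM /= eA /u' /v' !e0 => ->; congr (_ + _).
transitivity ((map_mx (horner_eval 0)
    (map_mx polyC v *m \adj A' *m map_mx polyC u)) 0 0); first by rewrite [RHS]mxE.
by rewrite !map_mxM map_mx_adj /= eA !e0.
Qed.

(** The determinant is affine along [u *m v], so its derivative in this direction is the same at
    every point of the line. *)
Lemma adj_rank1 n (A : 'M[R]_n) (u : 'cV[R]_n) (v : 'rV[R]_n) (c : R) :
  (v *m \adj (A + c *: (u *m v)) *m u) 0 0 = (v *m \adj A *m u) 0 0.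
Proof.
have H (e : R) : \det (A + e *: (u *m v)) = \det A + e * (v *m \adj A *m u) 0 0.
  by rewrite scalemxAl det_rank1 -scalemxAr mxE.
have := det_rank1 (A + c *: (u *m v)) u v.
rewrite -addrA -{2}(scale1r (u *m v)) -scalerDl !H mulrDl mul1r.
by move=> /eqP; rewrite -addrA (can_eq (addKr _)) (can_eq (addKr _)) => /eqP.
Qed.

(** A complex eigenvalue exists; pairing its eigenvector with the conjugate shows that it is real,
    and a real eigenvalue of a real matrix has a real eigenvector. *)
Lemma real_symmetric_eigenvalue n (A : 'M[R]_n.+1) : A^T = A ->
  exists a : R, exists2 v : 'rV[R]_n.+1, v != 0 & v *m A = a *: v.
Proof.
move=> sA; pose C := R[i].
have [z /eigenvalueP[x xA x0]] := eigenvalue_closed (map_mx (real_complex R) A) (ltn0Sn n).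
suff [a za] : exists a : R, z = real_complex R a.
  have : eigenvalue (map_mx (real_complex R) A) (real_complex R a).
    by apply/eigenvalueP; exists x; rewrite -?za.
  rewrite eigenvalue_map => /eigenvalueP[v vA v0]; by exists a, v.
pose xs := (map_mx Num.conj x)^T.
have nx : (x *m xs) 0 0 = \sum_i `|x 0 i| ^+ 2.
  by rewrite mxE; apply: eq_bigr => i _; rewrite !mxE normCK.
have nx0 : (x *m xs) 0 0 != 0.
  rewrite nx psumr_eq0; last by move=> i _; rewrite exprn_ge0.
  apply: contraNN x0 => /allP h; apply/eqP/rowP => i; rewrite mxE.
  have := h i; rewrite mem_index_enum => /(_ isT) /=.
  by rewrite expf_eq0 /= normr_eq0 => /eqP.
have As : map_mx Num.conj (map_mx (real_complex R) A) = map_mx (real_complex R) A.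
  by apply/matrixP => i j; rewrite !mxE conj_Creal // complex_real.
have e1 : x *m map_mx (real_complex R) A *m xs = z *: (x *m xs).
  by rewrite xA -scalemxAl.
have hx : (map_mx Num.conj xs)^T = x.
  by apply/matrixP => i j; rewrite !mxE conjCK.
have AT : (map_mx (real_complex R) A)^T = map_mx (real_complex R) A.
  by rewrite map_trmx sA.
have conjT (B : 'M[C]_1) : B = z *: (x *m xs) -> (map_mx Num.conj B)^T = z^* *: (x *m xs).
  move=> ->; rewrite map_mxZ /= linearZ /= map_mxM trmx_mul hx; congr (_ *: (_ *m _)).
have e2 : x *m map_mx (real_complex R) A *m xs = z^* *: (x *m xs).
  rewrite -(conjT _ e1) !map_mxM !trmx_mul /= As AT hx mulmxA; congr (_ *m _ *m _).
have zr : z^* = z.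
  move: e2; rewrite e1 => /matrixP/(_ 0 0); rewrite [LHS]mxE [RHS]mxE => /(mulIf nx0) //.
have zR : z \is Num.real by apply/CrealP.
by exists (complex.Re z); rewrite RRe_real.
Qed.

Lemma row_normE n (w : 'rV[R]_n) : (w *m w^T) 0 0 = \sum_j w 0 j ^+ 2.
Proof. by rewrite mxE; apply: eq_bigr => j _; rewrite mxE expr2. Qed.

Lemma row_norm_ge0 n (w : 'rV[R]_n) : 0 <= (w *m w^T) 0 0.
Proof. by rewrite row_normE sumr_ge0 // => i _; rewrite sqr_ge0. Qed.

Lemma row_norm_eq0 n (w : 'rV[R]_n) : (w *m w^T) 0 0 = 0 -> w = 0.
Proof.
rewrite row_normE => /eqP; rewrite psumr_eq0; last by move=> j _; rewrite sqr_ge0.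
move=> /allP h; apply/rowP => i; have := h i; rewrite mem_index_enum => /(_ isT).
by rewrite sqrf_eq0 mxE => /eqP.
Qed.

(** Householder reflection exchanging the first basis vector and [v]; when they coincide the
    reflection is undefined and the identity is taken. *)
Lemma orthogonal_first_row n (v : 'rV[R]_n.+1) : (v *m v^T) 0 0 = 1 ->
  exists2 H : 'M[R]_n.+1, H *m H^T = 1%:M & delta_mx 0 0 *m H = v.
Proof.
move=> v1; pose e : 'rV[R]_n.+1 := delta_mx 0 0; have [w wE] : exists w, w = e - v by exists (e - v).
have ee : e *m e^T = 1%:M.
  by rewrite trmx_delta mul_delta_mx; apply/matrixP => i j; rewrite !mxE !ord1.
have vv : v *m v^T = 1%:M by rewrite [LHS]mx11_scalar v1.
pose s := (w *m w^T) 0 0; pose c := (e *m v^T) 0 0.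
have ev : e *m v^T = c%:M by rewrite [LHS]mx11_scalar.
have ve : v *m e^T = c%:M.
  by rewrite -[LHS]trmxK trmx_mul trmxK ev tr_scalar_mx.
have ww : w *m w^T = s%:M by rewrite [LHS]mx11_scalar.
have sE : s = 2 - 2 * c.
  rewrite /s wE linearB /= mulmxBl !mulmxBr ee vv ev ve !mxE eqxx !mulr1n; ring.
have [s0|s0] := eqVneq s 0.
  have w0 : e - v = 0 by rewrite -wE; apply: row_norm_eq0.
  exists 1%:M; first by rewrite trmx1 mulmx1.
  by rewrite mulmx1; apply/eqP; rewrite -subr_eq0; apply/eqP.
pose H := 1%:M - (2 / s) *: (w^T *m w).
have HT : H^T = H.
  by rewrite /H linearB /= linearZ /= trmx1 trmx_mul trmxK.
exists H.
  rewrite HT /H mulmxBl !mulmxBr !mul1mx mulmx1 -!scalemxAl -!scalemxAr.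
  have -> : w^T *m w *m (w^T *m w) = s *: (w^T *m w).
    by rewrite mulmxA -(mulmxA w^T) ww mul_mx_scalar -scalemxAl.
  rewrite !scalerA (_ : 2 / s * (2 / s) * s = 2 / s + 2 / s); last by field.
  by rewrite opprB scalerDl addrK subrK.
rewrite /H mulmxBr mulmx1 -scalemxAr mulmxA.
have -> : e *m w^T = (s / 2)%:M.
  rewrite wE linearB /= mulmxBr ee ev -raddfB /=; congr (_%:M); rewrite sE; by field.
rewrite mul_scalar_mx scalerA (_ : 2 / s * (s / 2) = 1) ?scale1r; last by field.
by rewrite wE opprB addrCA subrr addr0.
Qed.

(** Induction on the size: after rotating a unit eigenvector to the first basis vector, symmetry
    makes the matrix block diagonal. *)
Lemma real_spectral n (A : 'M[R]_n) : A^T = A ->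
  exists (O : 'M[R]_n) (t : 'rV[R]_n), O *m O^T = 1%:M /\ A = O^T *m diag_mx t *m O.
Proof.
elim: n A => [A _|n IH A sA].
  by exists 1%:M, 0; split; [rewrite trmx1 mulmx1 | rewrite [LHS]flatmx0 [RHS]flatmx0].
have [a [u u0 uA]] := real_symmetric_eigenvalue sA.
pose N := (u *m u^T) 0 0.
have N0 : 0 < N.
  rewrite lt_neqAle row_norm_ge0 andbT eq_sym.
  by apply: contra u0 => /eqP /row_norm_eq0 ->.
pose v := (Num.sqrt N)^-1 *: u.
have v1 : (v *m v^T) 0 0 = 1.
  rewrite /v linearZ /= -scalemxAl -scalemxAr scalerA mxE -expr2 exprVn.
  by rewrite sqr_sqrtr ?(ltW N0) // mulVf // gt_eqF.
have vA : v *m A = a *: v by rewrite /v -scalemxAl uA !scalerA mulrC.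
have [H HH eH] := orthogonal_first_row v1.
have HtH : H^T *m H = 1%:M by apply: mulmx1C.
have [B BE] : exists B : 'M[R]_(1 + n), B = H *m A *m H^T by eexists.
have sB : B^T = B by rewrite BE !trmx_mul trmxK sA mulmxA.
have eB : delta_mx 0 0 *m B = a *: (delta_mx 0 0 : 'rV_(1 + n)).
  by rewrite BE !mulmxA eH vA -scalemxAl -eH -mulmxA HH mulmx1.
have B0 j : B 0 j = a * (j == 0)%:R.
  have := congr1 (fun M : 'rV_(1 + n) => M 0 j) eB.
  by rewrite -rowE !mxE eqxx.
have uB : ulsubmx B = a%:M.
  by apply/matrixP => i j; rewrite !ord1 !mxE (_ : lshift n 0 = 0) ?B0 ?eqxx;
    [rewrite mulr1 mulr1n|apply/val_inj].
have urB : ursubmx B = 0.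
  apply/matrixP => i j; rewrite !ord1 !mxE (_ : lshift n 0 = 0) ?B0; last exact/val_inj.
  by rewrite (_ : (rshift 1 j == 0) = false) ?mulr0.
have dlB : dlsubmx B = 0.
  by rewrite -[LHS]trmxK trmx_dlsub sB urB trmx0.
have sD : (drsubmx B)^T = drsubmx B by rewrite trmx_drsub sB.
have [U [t [OO DE]]] := IH _ sD.
pose O1 : 'M[R]_(1 + n) := block_mx 1%:M 0 0 U.
have O1T : O1^T = block_mx 1%:M 0 0 U^T by rewrite /O1 tr_block_mx trmx1 !trmx0.
have O1O1 : O1 *m O1^T = 1%:M.
  rewrite O1T /O1 (mulmx_block 1%:M 0 0 U 1%:M 0 0 U^T).
  by rewrite !mul1mx !mulmx0 !mul0mx !addr0 !add0r OO -scalar_mx_block.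
have BB : O1^T *m diag_mx (row_mx a%:M t) *m O1 = B.
  rewrite -[RHS](@submxK _ 1 n 1 n) uB urB dlB DE diag_mx_row O1T /O1.
  rewrite (mulmx_block 1%:M 0 0 U^T) (mulmx_block _ _ _ _ 1%:M 0 0 U).
  rewrite !mul1mx !mulmx0 !mul0mx !mulmx1 !addr0 !add0r.
  rewrite ?mul0mx ?mulmx0; congr (block_mx _ 0 0 _).
  by apply/matrixP => i j; rewrite !ord1 !mxE.
exists (O1 *m H), (row_mx a%:M t); split.
  by rewrite trmx_mul mulmxA -(mulmxA O1) HH mulmx1 O1O1.
transitivity (H^T *m (O1^T *m diag_mx (row_mx a%:M t) *m O1) *m H).
  by rewrite BB BE !mulmxA HtH mul1mx -mulmxA HtH mulmx1.
by rewrite trmx_mul !mulmxA.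
Qed.

End linear_algebra.

(** * Ordered eigenvalues and their variational characterisation *)

Section spectrum.
Context {R : realType}.

Lemma symmetricmxP n (A : 'M[R]_n) : A \is symmetricmx <-> A^T = A.
Proof.
have E : map_mx (@idfun R) A^T = A^T by apply/matrixP => i j; rewrite !mxE.
split=> [/is_hermitianmxP|h]; first by rewrite expr0 scale1r E => {2}->.
by apply/is_hermitianmxP; rewrite expr0 scale1r E h.
Qed.

Definition qform n (A : 'M[R]_n) (x : 'rV[R]_n) : R := (x *m A *m x^T) 0 0.
Definition sqnorm n (x : 'rV[R]_n) : R := (x *m x^T) 0 0.

Lemma sqnormE n (x : 'rV[R]_n) : sqnorm x = \sum_i x 0 i ^+ 2.
Proof. exact: row_normE. Qed.

Lemma qform_diag n (U : 'M[R]_n) (t : 'rV[R]_n) x :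
  qform (U^T *m diag_mx t *m U) x = \sum_i t 0 i * (x *m U^T) 0 i ^+ 2.
Proof.
rewrite /qform !mulmxA -mulmxA -{2}(trmxK U) -trmx_mul mxE.
apply: eq_bigr => i _; rewrite mxE (bigD1 i) //= big1 ?addr0.
  by rewrite !mxE eqxx mulr1n [in RHS]expr2; ring.
by move=> j ji; rewrite [diag_mx t j i]mxE (negPf ji) mulr0n mulr0.
Qed.

Lemma sqnorm_orth n (U : 'M[R]_n) x : U *m U^T = 1%:M ->
  \sum_i (x *m U^T) 0 i ^+ 2 = sqnorm x.
Proof.
move=> /mulmx1C UU; rewrite -row_normE /sqnorm trmx_mul trmxK mulmxA.
by rewrite -(mulmxA x) UU mulmx1.
Qed.

Lemma char_poly_orth_diag n (U : 'M[R]_n) (t : 'rV[R]_n) : U *m U^T = 1%:M ->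
  char_poly (U^T *m diag_mx t *m U) = \prod_(a <- [seq t 0 i | i <- enum 'I_n]) ('X - a%:P).
Proof.
move=> UU; have UtU := mulmx1C UU.
transitivity (char_poly (diag_mx t)); last first.
  rewrite char_poly_trig ?diag_mx_is_trig // big_map big_enum /=.
  by apply: eq_bigr => i _; rewrite mxE eqxx mulr1n.
rewrite /char_poly /char_poly_mx.
have -> : 'X%:M - map_mx polyC (U^T *m diag_mx t *m U) =
  map_mx polyC U^T *m ('X%:M - map_mx polyC (diag_mx t)) *m map_mx polyC U.
  rewrite mulmxBr mulmxBl !map_mxM /=; congr (_ - _).
  by rewrite mul_mx_scalar -scalemxAl -map_mxM UtU map_mx1 scalemx1.
rewrite !det_mulmx mulrAC -det_mulmx -map_mxM UtU map_mx1 det1 mul1r //.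
Qed.

(** Shows that the choice in [eigenvalues] does not fall back on [[::]]: the sorted diagonal of a
    spectral decomposition is a witness, and unique factorisation makes the chosen list a
    permutation of that diagonal. *)
Lemma eigenvalues_spec n (A : 'M[R]_n) : A^T = A ->
  exists (U : 'M[R]_n) (t : 'rV[R]_n), [/\ U *m U^T = 1%:M, A = U^T *m diag_mx t *m U,
    sorted (fun x y => y <= x) (eigenvalues A) &
    perm_eq (eigenvalues A) [seq t 0 i | i <- enum 'I_n]].
Proof.
move=> sA; have [U [t [UU AE]]] := real_spectral sA.
exists U, t.
suff [h1 h2] : sorted (fun x y => y <= x) (eigenvalues A) /\
    char_poly A = \prod_(a <- eigenvalues A) ('X - a%:P).
  split => //; apply: prod_XsubC_eq; rewrite -h2 {1}AE.
  exact: char_poly_orth_diag.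
rewrite /eigenvalues; apply: (@xgetPex _ [::] [set s : seq R |
    sorted (fun x y => y <= x) s /\ char_poly A = \prod_(a <- s) ('X - a%:P)]).
exists (sort (fun x y => y <= x) [seq t 0 i | i <- enum 'I_n]); split.
  by apply: sort_sorted => x y; rewrite le_total.
rewrite {1}AE char_poly_orth_diag //; apply: perm_big.
by rewrite perm_sym perm_sort.
Qed.

(** The diagonal [t] comes in no particular order, so the rank of [lambda q A] is expressed by
    counting: at least [q] entries lie above it and at least [n - q + 1] below it, both weakly. *)
Lemma spectral_lambda n (A : 'M[R]_n) q : A^T = A -> (0 < q <= n)%N ->
  exists (U : 'M[R]_n) (t : 'rV[R]_n), [/\ U *m U^T = 1%:M, A = U^T *m diag_mx t *m U,
    (q <= #|[pred i | (lambda q A <= t 0 i)%R]|)%N &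
    (n < q + #|[pred i | (t 0 i <= lambda q A)%R]|)%N].
Proof.
move=> sA /andP[q0 qn]; have [U [t [UU AE so pe]]] := eigenvalues_spec sA.
have sz : size (eigenvalues A) = n.
  by rewrite (perm_size pe) size_map size_enum_ord.
have cnt (p : pred R) : #|[pred i | p (t 0 i)]| = count p (eigenvalues A).
  rewrite (seq.permP pe) -sum1_card -sum1_count big_map big_enum_cond /=.
  by apply: eq_bigl.
have tr : transitive (fun x y : R => y <= x) by move=> x y z /[swap]; apply: le_trans.
have nthl := sorted_leq_nth tr (@lexx _ R) 0 so.
have q1n : (q.-1 < n)%N by rewrite prednK.
exists U, t; split => //.
  rewrite (cnt (fun x => lambda q A <= x)) -(cat_take_drop q (eigenvalues A)) count_cat.
  apply: leq_trans (leq_addr _ _); rewrite (_ : count _ _ = q) //.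
  rewrite -[RHS](@size_takel q _ (eigenvalues A)) ?sz //; apply/eqP; rewrite -all_count.
  apply/(all_nthP 0) => i; rewrite size_takel ?sz // => iq; rewrite nth_take //.
  by apply: nthl; rewrite ?inE ?sz // ?(leq_trans iq) // -ltnS prednK.
rewrite (cnt (fun x => x <= lambda q A)) -(cat_take_drop q.-1 (eigenvalues A)) count_cat.
rewrite (_ : count _ (drop _ _) = n - q.-1)%N; first lia.
rewrite -[RHS](_ : size (drop q.-1 (eigenvalues A)) = _)%N; last by rewrite size_drop sz.
apply/eqP; rewrite -all_count.
apply/(all_nthP 0) => i; rewrite size_drop sz => iq; rewrite nth_drop.
by apply: nthl; rewrite ?inE ?sz //; lia.
Qed.

(* The Courant-Fischer characterisation, split into its two halves. *)
Lemma lambda_gt n (A : 'M[R]_n) q (k : R) (V : 'M[R]_(q, n)) :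
  A^T = A -> (0 < q <= n)%N ->
  (forall x : 'rV_q, x != 0 -> k * sqnorm (x *m V) < qform A (x *m V)) ->
  k < lambda q A.
Proof.
move=> sA qn h; rewrite ltNge; apply/negP => lk.
have [U [t [UU AE _ J]]] := spectral_lambda sA qn.
pose J' := [pred i | ~~ (t 0 i <= lambda q A)].
have JJ : (#|J'| < q)%N.
  have := cardC [pred i | t 0 i <= lambda q A]; rewrite card_ord.
  move: J; set a := #|_|; rewrite (_ : #|predC _| = #|J'|); last by apply: eq_card.
  by move: a #|J'| => a b; lia.
(* Coordinates of the rows of [V] along the eigenvectors whose eigenvalue exceeds [lambda q A].
   There are fewer than [q] of these, so a nonzero combination of the rows avoids them all. *)
pose W : 'M[R]_(q, #|J'|) := V *m U^T *m \matrix_(i, j) (i == enum_val j)%:R.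
have [x x0 xW] : exists2 x : 'rV_q, x != 0 & x *m W = 0.
  have : (\rank (kermx W) != 0)%N.
    by rewrite mxrank_ker subn_eq0 -ltnNge (leq_ltn_trans (rank_leq_col W)).
  rewrite mxrank_eq0 => /rowV0Pn[x /sub_kermxP xW x0]; by exists x.
have yJ i : i \in J' -> (x *m V *m U^T) 0 i = 0.
  move=> iJ; have := congr1 (fun M : 'rV_#|J'| => M 0 (enum_rank_in iJ i)) xW.
  rewrite /W !mulmxA [LHS]mxE [RHS]mxE (bigD1 i) //= [X in _ * X]mxE enum_rankK_in //.
  rewrite eqxx mulr1 big1 ?addr0 //.
  by move=> k' ki; rewrite [X in _ * X]mxE enum_rankK_in // (negPf ki) mulr0.
have := h x x0; rewrite {1}AE qform_diag -(sqnorm_orth _ UU) mulr_sumr ltNge => /negP; apply.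
apply: ler_sum => i _; have [iJ|] := boolP (i \in J'); first by rewrite yJ // expr0n !mulr0.
rewrite inE negbK => ti; rewrite ler_wpM2r ?sqr_ge0 //; exact: le_trans lk.
Qed.

Lemma lambda_ge_space n (A : 'M[R]_n) q : A^T = A -> (0 < q <= n)%N ->
  exists V : 'M[R]_(q, n), (forall x : 'rV_q, x != 0 -> 0 < sqnorm (x *m V)) /\
  forall x : 'rV_q, lambda q A * sqnorm (x *m V) <= qform A (x *m V).
Proof.
move=> sA qn; have [U [t [UU AE J _]]] := spectral_lambda sA qn.
pose J' := [pred i | lambda q A <= t 0 i].
pose f (i : 'I_q) : 'I_n := enum_val (widen_ord J i).
have fi : injective f.
  by move=> i j /enum_val_inj /(congr1 val) /= /val_inj.
pose E : 'M[R]_(q, n) := \matrix_(i, j) (f i == j)%:R.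
have VU x : x *m (E *m U) *m U^T = x *m E.
  by rewrite !mulmxA -mulmxA UU mulmx1.
have xE (x : 'rV_q) (i : 'I_q) : (x *m E) 0 (f i) = x 0 i.
  rewrite mxE (bigD1 i) //= mxE eqxx mulr1 big1 ?addr0 // => j ji.
  by rewrite mxE (inj_eq fi) (negPf ji) mulr0.
exists (E *m U); split.
  move=> x x0; rewrite -(sqnorm_orth _ UU) VU lt_neqAle sumr_ge0 ?andbT; last first.
    by move=> i _; rewrite sqr_ge0.
  rewrite eq_sym; apply: contra x0 => /eqP s0; apply/eqP/rowP => i.
  rewrite [RHS]mxE -xE; apply/eqP; rewrite -sqrf_eq0.
  by move/eqP: s0; rewrite psumr_eq0 => [/allP/(_ (f i))|j _];
    [rewrite mem_index_enum => /(_ isT)|rewrite sqr_ge0].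
move=> x; rewrite {2}AE qform_diag -(sqnorm_orth _ UU) VU mulr_sumr.
apply: ler_sum => i _; have [iJ|iJ] := boolP (i \in J').
  by rewrite ler_wpM2r ?sqr_ge0 //; rewrite inE in iJ.
rewrite mxE big1 ?expr0n ?mulr0 // => j _; rewrite mxE; case: eqP => [ji|]; last by rewrite mulr0.
by case/negP: iJ; rewrite -ji; exact: enum_valP.
Qed.

(** The [q]-dimensional space on which the form of [A] is at least [lambda q A] serves as test space
    for [B]. *)
Lemma lambda_le n (A B : 'M[R]_n) q (c e : R) : A^T = A -> B^T = B -> (0 < q <= n)%N ->
  0 < c -> (forall x, qform A x <= c * qform B x + e * sqnorm x) ->
  lambda q A <= c * lambda q B + e.
Proof.
move=> sA sB qn c0 h; rewrite leNgt; apply/negP => lt.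
have [V [V0 hV]] := lambda_ge_space sA qn.
suff : lambda q B < lambda q B by rewrite ltxx.
apply: (lambda_gt (V := V)) => // x x0.
rewrite -(ltr_pM2l c0) mulrA -(ltrD2r (e * sqnorm (x *m V))) -mulrDl.
apply: lt_le_trans (h _); apply: lt_le_trans (hV x).
by rewrite ltr_pM2r // V0.
Qed.

End spectrum.

(** * Cauchy-Binet and rotation invariant sums of minors *)

Section minors.
Context {R : realType}.

(** Cauchy-Binet. All maps [rho] are allowed: those that are not injective contribute nothing, and
    every set of rows occurs once per ordering, whence the factorial. *)
Lemma sum_minors_mul d q (A B : 'M[R]_(d, q)) :
  \sum_(rho : {ffun 'I_q -> 'I_d}) \det (rowsub rho A) * \det (rowsub rho B) =
  q`!%:R * \det (A^T *m B).
Proof.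
have detE : \det (A^T *m B) =
    \sum_(rho : {ffun 'I_q -> 'I_d}) (\prod_i A (rho i) i) * \det (rowsub rho B).
  rewrite /determinant.
  under eq_bigr => s _.
    under eq_bigr => i _ do rewrite mxE.
    rewrite bigA_distr_bigA /= mulr_sumr; over.
  rewrite exchange_big /=; apply: eq_bigr => rho _; rewrite mulr_sumr.
  apply: eq_bigr => s _; rewrite mulrCA; congr (_ * _).
  by rewrite -big_split /=; apply: eq_bigr => i _; rewrite !mxE.
(* Reordering [rho] by [pi] changes the sign of the minor of [B] and permutes the product; the sum
   over all [pi] turns the product into a minor of [A]. *)
have detpi (pi : 'S_q) : \det (A^T *m B) = \sum_(rho : {ffun 'I_q -> 'I_d})
    ((-1) ^+ pi * \prod_i A (rho (pi i)) i) * \det (rowsub rho B).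
  rewrite detE (reindex_inj (h := fun rho : {ffun 'I_q -> 'I_d} => [ffun i => rho (pi i)])).
    apply: eq_bigr => rho _.
    have -> : rowsub [ffun i => rho (pi i)] B = row_perm pi (rowsub rho B).
      by apply/matrixP => i j; rewrite !mxE ffunE.
    rewrite row_permE det_mulmx det_perm mulrCA mulrA; congr (_ * _ * _).
    by apply: eq_bigr => i _; rewrite ffunE.
  move=> f g /ffunP h; apply/ffunP => i; have := h (pi^-1 i)%g.
  by rewrite !ffunE permKV.
transitivity (\sum_(pi : 'S_q) \det (A^T *m B)); last first.
  by rewrite sumr_const card_Sn mulr_natl.
under [RHS]eq_bigr => pi _ do rewrite (detpi pi).
rewrite exchange_big /=; apply: eq_bigr => rho _; rewrite -mulr_suml; congr (_ * _).
rewrite -det_tr /determinant; apply: eq_bigr => s _; congr (_ * _).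
by apply: eq_bigr => i _; rewrite !mxE.
Qed.

(* [minor_diff S rho u v] is det (S_rho + u_rho v) - det S_rho. *)
Definition minor_diff d q (S : 'M[R]_(d, q)) (rho : {ffun 'I_q -> 'I_d})
    (u : 'cV[R]_d) (v : 'rV[R]_q) : R :=
  (v *m \adj (rowsub rho S) *m rowsub rho u) 0 0.

Lemma minor_diffE d q (S : 'M[R]_(d, q)) rho u v :
  minor_diff S rho u v = \det (rowsub rho (S + u *m v)) - \det (rowsub rho S).
Proof.
have -> : rowsub rho (S + u *m v) = rowsub rho S + rowsub rho u *m v.
  by rewrite mul_rowsub_mx; apply/matrixP => i j; rewrite !mxE.
by rewrite det_rank1 addrC addKr.
Qed.

Definition minor_diff_sum d q (S : 'M[R]_(d, q)) u v : R :=
  \sum_(rho : {ffun 'I_q -> 'I_d}) minor_diff S rho u v ^+ 2.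

(** By Cauchy-Binet the sum depends on [S] and [u] only through Gram matrices, which an isometry
    preserves. This permits computing in an eigenbasis of the covariance. *)
Lemma minor_diff_sum_orth d q (U : 'M[R]_d) (S : 'M[R]_(d, q)) u v :
  U^T *m U = 1%:M ->
  minor_diff_sum (U *m S) (U *m u) v = minor_diff_sum S u v.
Proof.
move=> UU.
have E (S' : 'M[R]_(d, q)) (u' : 'cV[R]_d) : minor_diff_sum S' u' v =
    q`!%:R * (\det ((S' + u' *m v)^T *m (S' + u' *m v))
      - 2 * \det ((S' + u' *m v)^T *m S') + \det (S'^T *m S')).
  rewrite mulrDr mulrBr mulrCA -!sum_minors_mul mulr_sumr -sumrB -big_split /=.
  by apply: eq_bigr => rho _; rewrite minor_diffE; ring.
rewrite !E -mulmxA -mulmxDr !trmx_mul.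
by rewrite !mulmxA -!(mulmxA _ U^T U) UU !mulmx1.
Qed.

Lemma cofactor_expand r (X : 'M[R]_(1 + r, r.+1)) (v : 'rV[R]_r.+1) :
  \det (col_mx v (dsubmx X)) = (v *m \adj X) 0 ord0.
Proof.
rewrite (expand_det_row _ ord0) [RHS]mxE; apply: eq_bigr => k _.
rewrite [\adj X _ _]mxE; congr (_ * _).
  by rewrite mxE; case: splitP => j // _; rewrite !ord1.
congr (_ * \det _); apply/matrixP => i j; rewrite !mxE.
rewrite (_ : lift ord0 i = rshift 1 i); last exact/val_inj.
by case: splitP => [[[|//] ?] // | k']; rewrite ?mxE => /= /addnI/val_inj ->.
Qed.

(** The derivative of a maximal minor in the direction of adding [v] to one of its rows; [rho] lists
    the [r] other rows. *)
Definition minor_row d r (S : 'M[R]_(d, r.+1)) (rho : {ffun 'I_r -> 'I_d})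
    (v : 'rV[R]_r.+1) : R := \det (col_mx v (rowsub rho S) : 'M[R]_(1 + r)).

Definition minor_row_sum d r (S : 'M[R]_(d, r.+1)) v : R :=
  \sum_(rho : {ffun 'I_r -> 'I_d}) minor_row S rho v ^+ 2.

Lemma minor_rowE d r (S : 'M[R]_(d, r.+1)) rho v :
  minor_row S rho v = \sum_k v 0 k * ((-1) ^+ k * \det (rowsub rho (col' k S))).
Proof.
rewrite /minor_row (expand_det_row _ ord0); apply: eq_bigr => k _.
congr (_ * _).
  by rewrite mxE; case: splitP => j // _; rewrite !ord1.
rewrite /cofactor add0n; congr (_ * \det _); apply/matrixP => i j; rewrite !mxE.
rewrite (_ : lift ord0 i = rshift 1 i); last exact/val_inj.
by case: splitP => [[[|//] ?] // | k']; rewrite ?mxE => /= /addnI/val_inj ->.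
Qed.

(** Expansion along the row [v] leaves Gram determinants of [S] with one column removed on each
    side, to which Cauchy-Binet applies. *)
Lemma minor_row_sum_orth d r (U : 'M[R]_d) (S : 'M[R]_(d, r.+1)) v :
  U^T *m U = 1%:M -> minor_row_sum (U *m S) v = minor_row_sum S v.
Proof.
move=> UU.
have E (S' : 'M[R]_(d, r.+1)) : minor_row_sum S' v = \sum_k \sum_l
    v 0 k * (-1) ^+ k * (v 0 l * (-1) ^+ l) * (r`!%:R * \det ((col' k S')^T *m col' l S')).
  transitivity (\sum_(rho : {ffun 'I_r -> 'I_d}) \sum_k \sum_l
      v 0 k * (-1) ^+ k * (v 0 l * (-1) ^+ l) *
        (\det (rowsub rho (col' k S')) * \det (rowsub rho (col' l S')))).
    apply: eq_bigr => rho _; rewrite minor_rowE expr2 mulr_suml.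
    apply: eq_bigr => k _; rewrite mulr_sumr; apply: eq_bigr => l _; ring.
  rewrite exchange_big /=; apply: eq_bigr => k _.
  rewrite exchange_big /=; apply: eq_bigr => l _.
  by rewrite -mulr_sumr sum_minors_mul.
rewrite !E; apply: eq_bigr => k _; apply: eq_bigr => l _; congr (_ * (_ * \det _)).
have cE m : col' m (U *m S) = U *m col' m S.
  by apply/matrixP => i j; rewrite !mxE; apply: eq_bigr => x _; rewrite !mxE.
by rewrite !cE trmx_mul mulmxA -(mulmxA _ U^T) UU mulmx1.
Qed.

(** If [b] is not in the image of [rho], adding [v] to row [b] changes the minor with rows [b] and
    [rho] by exactly [minor_row S rho v]. These minors are only some of those on the right. *)
Lemma minor_diff_sum_delta d r (S : 'M[R]_(d, r.+1)) (b : 'I_d) v :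
  \sum_(rho : {ffun 'I_r -> 'I_d} | b \notin codom rho) minor_row S rho v ^+ 2 <=
  minor_diff_sum S (delta_mx b 0) v.
Proof.
pose h (rho : {ffun 'I_r -> 'I_d}) : {ffun 'I_r.+1 -> 'I_d} :=
  [ffun i => if unlift ord0 i is Some j then rho j else b].
have h0 rho : h rho ord0 = b by rewrite ffunE unlift_none.
have hS rho j : h rho (lift ord0 j) = rho j by rewrite ffunE liftK.
have hi : injective h.
  by move=> f g /ffunP hfg; apply/ffunP => j; rewrite -!hS hfg.
have -> : \sum_(rho : {ffun 'I_r -> 'I_d} | b \notin codom rho) minor_row S rho v ^+ 2 =
    \sum_(rho : {ffun 'I_r -> 'I_d} | b \notin codom rho)
      minor_diff S (h rho) (delta_mx b 0) v ^+ 2.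
  apply: eq_bigr => rho bn; congr (_ ^+ 2).
  rewrite /minor_diff.
  have -> : rowsub (h rho) (delta_mx b 0 : 'cV[R]_d) = delta_mx ord0 0.
    apply/matrixP => i j; rewrite !mxE !ord1 eqxx !andbT; congr (nat_of_bool _)%:R.
    have [k ->|->] := unliftP ord0 i; last by rewrite h0 !eqxx.
    rewrite hS [RHS]eq_sym (negbTE (neq_lift _ _)).
    by apply: contraNF bn => /eqP <-; exact: codom_f.
  rewrite -colE mxE.
  rewrite -(@cofactor_expand r (rowsub (h rho) S)) /minor_row; congr (\det (col_mx _ _)).
  apply/matrixP => i j; rewrite !mxE; congr (S _ _).
  by rewrite -hS; congr (h rho _); apply/val_inj.
rewrite /minor_diff_sum -(big_imset (fun f => minor_diff S f (delta_mx b 0) v ^+ 2)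
  (in2W hi)) /=.
set B := (X in \sum_(j in X) _).
rewrite [leRHS](bigID (fun f => f \in B)) /=.
by rewrite lerDl sumr_ge0 // => i _; rewrite sqr_ge0.
Qed.

(** In an eigenbasis of the covariance the right side is a sum over eigenvectors weighted by
    eigenvalues. At least [r.+1] eigenvalues reach [lam], and [r] rows always miss one of the
    corresponding eigenvectors, so each term on the left is found on the right with weight at least
    [lam]. *)
Lemma minor_diff_sum_ge d p r (lam : R) (sigma : 'M[R]_(d, p)) (S : 'M[R]_(d, r.+1)) v :
  (r < d)%N -> 0 <= lam <= lambda r.+1 (sigma *m sigma^T) ->
  lam * minor_row_sum S v <= \sum_l minor_diff_sum S (col l sigma) v.
Proof.
move=> rd /andP[lam0 laml].
have sA : (sigma *m sigma^T)^T = sigma *m sigma^T by rewrite trmx_mul trmxK.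
have [U [t [UU AE J _]]] := spectral_lambda (q := r.+1) sA rd.
have UtU := mulmx1C UU.
have t0 i : 0 <= t 0 i.
  have := qform_diag U t (delta_mx 0 i *m U).
  rewrite -AE -mulmxA UU mulmx1 (bigD1 i) //= big1 ?addr0.
    rewrite mxE !eqxx expr1n mulr1 => <-.
    rewrite /qform !mulmxA -mulmxA -trmx_mul; exact: row_norm_ge0.
  by move=> j ji; rewrite mxE (negPf ji) andbF expr0n mulr0.
have E : \sum_l minor_diff_sum S (col l sigma) v =
    \sum_b t 0 b * minor_diff_sum (U *m S) (delta_mx b 0) v.
  (* [minor_diff] is linear in [u] with coefficient vector [y rho]; summing squares over the columns
     of [sigma] gives a quadratic form in the covariance. *)
  pose y (rho : {ffun 'I_r.+1 -> 'I_d}) : 'rV[R]_d :=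
    v *m \adj (rowsub rho S) *m rowsub rho 1%:M.
  have yE rho u : minor_diff S rho u v = (y rho *m u) 0 0.
    by rewrite /minor_diff /y -[RHS]/((_ *m _) 0 0) -[in RHS]mulmxA mul_rowsub_mx mul1mx.
  transitivity (\sum_rho qform (sigma *m sigma^T) (y rho)).
    rewrite exchange_big /=; apply: eq_bigr => rho _.
    rewrite /qform !mulmxA -mulmxA -trmx_mul row_normE; apply: eq_bigr => l _.
    by rewrite yE colE mulmxA -colE; congr (_ ^+ 2); rewrite mxE.
  under eq_bigr => rho _ do rewrite AE qform_diag.
  rewrite exchange_big /=; apply: eq_bigr => b _; rewrite -mulr_sumr; congr (_ * _).
  have -> : delta_mx b 0 = U *m (U^T *m delta_mx b 0) :> 'cV[R]_d.
    by rewrite mulmxA UU mul1mx.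
  rewrite minor_diff_sum_orth //; apply: eq_bigr => rho _.
  by rewrite yE mulmxA -colE [in RHS]mxE.
rewrite E -(minor_row_sum_orth S v UtU).
apply: (@le_trans _ _ (\sum_(b | lam <= t 0 b) lam * minor_diff_sum (U *m S) (delta_mx b 0) v)).
  rewrite -mulr_sumr ler_wpM2l //.
  apply: (@le_trans _ _ (\sum_(b | lam <= t 0 b)
     \sum_(rho : {ffun 'I_r -> 'I_d} | b \notin codom rho) minor_row (U *m S) rho v ^+ 2)).
    rewrite (exchange_big_dep predT) //=; apply: ler_sum => rho _.
    (* Pigeonhole: the [r] values of [rho] cannot exhaust the [r.+1] or more indices of large
       eigenvalues. *)
    have [b /andP[tb bn]] : exists b, (lam <= t 0 b) && (b \notin codom rho).
      apply/existsP; apply: contraTT J; rewrite negb_exists => /forallP h.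
      rewrite -ltnNge ltnS; apply: (@leq_trans #|codom rho|).
        apply: subset_leq_card; apply/fintype.subsetP => b; rewrite inE => tb.
        have := h b; rewrite (le_trans laml tb) /= negbK //.
      by rewrite (leq_trans (card_size _)) // size_codom card_ord.
    rewrite (bigD1 b) ?tb //= lerDl sumr_ge0 // => i _; exact: sqr_ge0.
  by apply: ler_sum => b _; exact: minor_diff_sum_delta.
rewrite [leRHS](bigID (fun b => lam <= t 0 b)) /= -[leLHS]addr0; apply: lerD.
  apply: ler_sum => b tb; rewrite ler_wpM2r // sumr_ge0 // => i _; exact: sqr_ge0.
apply: sumr_ge0 => b _; rewrite mulr_ge0 // sumr_ge0 // => i _; exact: sqr_ge0.
Qed.

End minors.

(** * Eigenvalues of Gram matrices: minors, perturbation, measurability *)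

Section lambda_bounds.
Context {R : realType}.

(** Lagrange's identity. *)
Lemma sum_cauchy_schwarz (I : finType) (a b : I -> R) :
  (\sum_i a i * b i) ^+ 2 <= (\sum_i a i ^+ 2) * (\sum_i b i ^+ 2).
Proof.
rewrite -subr_ge0 -(pmulr_rge0 _ (ltr0n R 2)).
have -> : 2 * ((\sum_i a i ^+ 2) * (\sum_i b i ^+ 2) - (\sum_i a i * b i) ^+ 2) =
    \sum_i \sum_j (a i * b j - a j * b i) ^+ 2.
  transitivity (\sum_i \sum_j (a i ^+ 2 * b j ^+ 2 + b i ^+ 2 * a j ^+ 2
     - 2 * (a i * b i * (a j * b j)))); last first.
    by apply: eq_bigr => i _; apply: eq_bigr => j _; ring.
  under [RHS]eq_bigr => i _ do
    rewrite big_split big_split /= sumrN -!mulr_sumr.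
  rewrite big_split big_split /= sumrN -!mulr_suml -mulr_sumr -mulr_suml; ring.
by apply: sumr_ge0 => i _; apply: sumr_ge0 => j _; rewrite sqr_ge0.
Qed.

(** The squared Frobenius norm. *)
Definition entries_sqsum m n (M : 'M[R]_(m, n)) : R := \sum_i \sum_j M i j ^+ 2.

Lemma entries_sqsum_ge0 m n (M : 'M[R]_(m, n)) : 0 <= entries_sqsum M.
Proof. by apply: sumr_ge0 => i _; apply: sumr_ge0 => j _; rewrite sqr_ge0. Qed.

Lemma sqnorm_mulmx m n (x : 'rV[R]_m) (M : 'M[R]_(m, n)) :
  sqnorm (x *m M) <= sqnorm x * entries_sqsum M.
Proof.
rewrite !sqnormE /entries_sqsum exchange_big /= mulr_sumr; apply: ler_sum => j _.
by rewrite mxE; exact: sum_cauchy_schwarz.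
Qed.

Lemma sqnorm_gt0 n (x : 'rV[R]_n) : x != 0 -> 0 < sqnorm x.
Proof.
move=> x0; rewrite lt_neqAle eq_sym [_ <= _]row_norm_ge0 andbT.
by apply: contra x0 => /eqP h; apply/eqP; exact: row_norm_eq0 h.
Qed.

(** With [X = rowsub rho S], multiplying [x *m X] by the adjugate returns [\det X] times [x], so
    [x *m X] cannot be short unless [x] is. The test space is spanned by the basis vectors selected
    by [rho], which is injective since the minor is nonzero. *)
Lemma lambda_gt_minor d q (S : 'M[R]_(d, q)) (rho : {ffun 'I_q -> 'I_d}) (k : R) :
  (0 < q <= d)%N -> 0 <= k ->
  k * entries_sqsum (\adj (rowsub rho S)) < \det (rowsub rho S) ^+ 2 ->
  k < lambda q (S *m S^T).
Proof.
move=> qd k0 h.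
have d0 : \det (rowsub rho S) != 0.
  apply: contraTneq h => ->; rewrite expr0n /= -leNgt mulr_ge0 //.
  exact: entries_sqsum_ge0.
have inj i j : rho i = rho j -> i = j.
  move=> e; apply: contra_neq_eq d0 => ij.
  by apply: (determinant_alternate ij) => k'; rewrite !mxE e.
pose V : 'M[R]_(q, d) := rowsub rho 1%:M.
have VV : V *m V^T = 1%:M.
  apply/matrixP => i j; rewrite mxE (bigD1 (rho i)) //= !mxE eqxx mul1r big1 ?addr0.
    by rewrite eq_sym; congr (nat_of_bool _)%:R; apply/eqP/eqP => [/inj|->].
  by move=> a ai; rewrite !mxE eq_sym (negPf ai) mul0r.
have sA : (S *m S^T)^T = S *m S^T by rewrite trmx_mul trmxK.
apply: (lambda_gt (V := V)) => // x x0.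
have -> : sqnorm (x *m V) = sqnorm x.
  by rewrite /sqnorm trmx_mul mulmxA -(mulmxA x) VV mulmx1.
have -> : qform (S *m S^T) (x *m V) = sqnorm (x *m rowsub rho S).
  rewrite /qform /sqnorm !mulmxA -mulmxA -trmx_mul -!(mulmxA x V).
  by rewrite /V mul_rowsub_mx mul1mx.
set X := rowsub rho S in h d0 *.
have h1 : \det X ^+ 2 * sqnorm x <= sqnorm (x *m X) * entries_sqsum (\adj X).
  apply: le_trans (sqnorm_mulmx _ _); rewrite -mulmxA mul_mx_adj mul_mx_scalar.
  by rewrite /sqnorm linearZ /= -scalemxAl -scalemxAr scalerA [leRHS]mxE expr2.
have x2 := sqnorm_gt0 x0.
have a0 : 0 < entries_sqsum (\adj X).
  rewrite lt_neqAle entries_sqsum_ge0 andbT; apply/negP => /eqP a0.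
  by move: h1; rewrite -a0 mulr0 leNgt mulr_gt0 // exprn_even_gt0.
rewrite -(ltr_pM2r a0); apply: lt_le_trans h1.
by rewrite mulrAC ltr_pM2r.
Qed.

(** All minors of order [r] together, so that one quantity controls the adjugates of all maximal
    minors. *)
Definition minors_sqsum d r (S : 'M[R]_(d, r.+1)) : R :=
  \sum_(rho : {ffun 'I_r -> 'I_d}) \sum_k \det (rowsub rho (col' k S)) ^+ 2.

(** The factor counts the omitted rows; for each of them the cofactors are among the minors summed
    in [minors_sqsum]. *)
Lemma adj_minors d r (S : 'M[R]_(d, r.+1)) (rho : {ffun 'I_r.+1 -> 'I_d}) :
  entries_sqsum (\adj (rowsub rho S)) <= r.+1%:R * minors_sqsum S.
Proof.
rewrite /entries_sqsum exchange_big /=.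
rewrite mulr_natl -[leRHS](_ : \sum_(j < r.+1) minors_sqsum S = _); last first.
  by rewrite sumr_const card_ord.
apply: ler_sum => j _; pose rho' : {ffun 'I_r -> 'I_d} := [ffun i => rho (lift j i)].
rewrite /minors_sqsum (bigD1 rho') //= -[leLHS]addr0; apply: lerD; last first.
  by apply: sumr_ge0 => f _; apply: sumr_ge0 => k _; rewrite sqr_ge0.
apply: ler_sum => k _; rewrite mxE /cofactor exprMn -exprM mulnC exprM sqrrN !expr1n mul1r.
suff -> : row' j (col' k (rowsub rho S)) = rowsub rho' (col' k S) by [].
by apply/matrixP => a b; rewrite !mxE ffunE.
Qed.

(** Products of coordinates are at most the mean of the two squares, so the two forms differ by at
    most [n%:R * e] times the squared norm. *)
Lemma lambda_perturb n (A B : 'M[R]_n) q (e : R) : A^T = A -> B^T = B ->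
  (0 < q <= n)%N -> (forall i j, `|A i j - B i j| <= e) ->
  lambda q A <= lambda q B + n%:R * e.
Proof.
move=> sA sB qn h; rewrite -[lambda q B]mul1r; apply: lambda_le => // x.
rewrite mul1r -lerBlDl.
have e0 : 0 <= e by case/andP: qn => q0 qn; apply: le_trans (h (Ordinal (leq_trans q0 qn)) (Ordinal (leq_trans q0 qn))).
have qE (C : 'M[R]_n) : qform C x = \sum_i \sum_j x 0 i * C i j * x 0 j.
  rewrite /qform mxE exchange_big /=; apply: eq_bigr => j _; rewrite !mxE mulr_suml.
  by apply: eq_bigr.
rewrite !qE -sumrB.
apply: (@le_trans _ _ (\sum_i \sum_j e * ((x 0 i ^+ 2 + x 0 j ^+ 2) / 2))).
  apply: ler_sum => i _; rewrite -sumrB; apply: ler_sum => j _.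
  rewrite -mulrBl -mulrBr; apply: le_trans (ler_norm _) _.
  rewrite mulrAC normrM mulrC; apply: ler_pM => //.
  rewrite ler_norml; have := sqr_ge0 (x 0 i + x 0 j); have := sqr_ge0 (x 0 i - x 0 j); nra.
under eq_bigr => i _ do
  rewrite -mulr_sumr -mulr_suml big_split /= sumr_const card_ord -sqnormE.
rewrite -mulr_sumr -mulr_suml big_split /= sumr_const card_ord sumrMnl -sqnormE.
rewrite -mulr_natl; lra.
Qed.

Lemma rat_approx (x e : R) : 0 < e -> exists a : rat, `|x - ratr a| <= e.
Proof.
move=> e0; have /rat_in_itvoo[a] : x - e < x + e by lra.
rewrite in_itv /= => /andP[h1 h2]; exists a.
by rewrite ler_norml; apply/andP; split; lra.
Qed.

(** [lambda] comes from a choice, so measurability is obtained indirectly: the event is a countable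
    union of boxes around rational symmetric matrices, on each of which [lambda_perturb] keeps the
    eigenvalue above [k]. *)
Lemma measurable_lambda_gt disp (T : measurableType disp) n (C : T -> 'M[R]_n) q (k : R) :
  (0 < q <= n)%N -> (forall w, (C w)^T = C w) ->
  (forall i j, measurable_fun setT (fun w => C w i j)) ->
  measurable [set w | k < lambda q (C w)].
Proof.
move=> qn sC mC.
pose F (p : 'M[rat]_n * rat) : set T :=
  if (p.1^T == p.1) && (k + n%:R * ratr p.2 < lambda q (map_mx ratr p.1))
  then \bigcap_(ij in [set: 'I_n * 'I_n]) [set w | `|C w ij.1 ij.2 - ratr (p.1 ij.1 ij.2)| <= ratr p.2]
  else set0.
have mF p : measurable (F p).
  rewrite /F; case: ifP => // _; apply: fin_bigcap_measurable => [|ij _].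
    exact: finite_finset.
  have mf : measurable_fun setT (fun w => `|C w ij.1 ij.2 - ratr (p.1 ij.1 ij.2)|).
    apply: measurableT_comp => //; apply: measurable_funB => //.
  rewrite (_ : [set _ | _] = (fun w => `|C w ij.1 ij.2 - ratr (p.1 ij.1 ij.2)|) @^-1` `]-oo, ratr p.2]).
    by rewrite -[X in measurable X]setTI; apply: mf.
  by apply/seteqP; split => w /=; rewrite in_itv /=.
rewrite (_ : [set w | _] = \bigcup_(m in setT) (if unpickle m is Some p then F p else set0)).
  by apply: bigcupT_measurable => m; case: unpickle.
apply/seteqP; split => w /=; last first.
  move=> [m _]; case: unpickle => // p; rewrite /F; case: ifP => // /andP[/eqP sp lt] h.
  rewrite -(ltrD2r (n%:R * ratr p.2)); apply: lt_le_trans lt _.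
  apply: lambda_perturb => //; first by rewrite map_trmx sp.
  by move=> i j; have := h (i, j) I => /=; rewrite mxE distrC.
move=> lt; have n0 : (0 : R) < n%:R by case/andP: qn => q0 qn; rewrite ltr0n (leq_trans q0).
(* A quarter of the gap, divided by [n]: the approximation error [e] and a rational radius below
   [2 * e] together use at most three quarters of the gap. *)
pose e : R := (lambda q (C w) - k) / (4 * n%:R).
have e0 : 0 < e by rewrite divr_gt0 ?mulr_gt0 // subr_gt0.
have /rat_in_itvoo[e'] : e < 2 * e by lra.
rewrite in_itv /= => /andP[e1 e2].
have ap i j : exists a : rat, `|C w i j - ratr a| <= e by exact: rat_approx.
(* Only the entries with [i <= j] are approximated, the others are copied, to keep the rational
   matrix symmetric. *)
pose A := \matrix_(i, j) (if (i <= j)%N then xchoose (ap i j) else xchoose (ap j i)).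
have sA : A^T = A.
  apply/matrixP => i j; rewrite !mxE; case: (ltngtP i j) => // /val_inj -> //.
have hA i j : `|C w i j - ratr (A i j)| <= e.
  rewrite mxE; case: ifP => _; first exact: xchooseP (ap i j).
  by have := xchooseP (ap j i); rewrite -{1}(sC w) mxE.
have nE : n%:R * e = (lambda q (C w) - k) / 4 by rewrite /e; field; rewrite gt_eqF.
exists (pickle (A, e')) => //; rewrite pickleK /F /= sA eqxx /= ifT; last first.
  have : lambda q (C w) <= lambda q (map_mx ratr A) + n%:R * e.
    apply: lambda_perturb => //; first by rewrite map_trmx sA.
    by move=> i j; rewrite mxE.
  have : n%:R * ratr e' <= n%:R * (2 * e) by rewrite ler_pM2l // ltW.
  rewrite mulrCA nE; lra.
by move=> [i j] _ /=; apply: le_trans (hA i j) _; rewrite ltW.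
Qed.

End lambda_bounds.

(** * Gaussian families *)

Section normal_law.
Context {R : realType}.
Notation mu := (@lebesgue_measure R).
Import HBNNSimple.

(** By uniqueness of Lebesgue measure it is enough to look at half-open intervals; a negative [c]
    exchanges their ends, which leaves the length unchanged. *)
Lemma ge0_integral_scale (c : R) (f : R -> \bar R) : c != 0 ->
  measurable_fun setT f -> (forall x, (0 <= f x)%E) ->
  (\int[mu]_x f x = `|c|%:E * \int[mu]_x f (c * x)%R)%E.
Proof.
move=> c0 mf f0.
have mphi : measurable_fun setT ( *%R c : R -> R) by exact: mulrl_measurable.
have cn0 : 0 <= `|c| by [].
pose phi : measurableTypeR R -> measurableTypeR R := *%R c.
have E A : measurable A -> mu A = mscale (NngNum cn0) (pushforward mu phi) A.
  move=> mA; apply: lebesgue_measure_unique => // _ [[a b]] _ <-.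
  change (mu `]a, b]%classic = (`|c|%:E * mu [set x : R | (c * x)%R \in `]a, b]])%E).
  have [c1|c1|c1] := ltgtP c 0; last by rewrite c1 eqxx in c0.
    have -> : [set x : R | c * x \in `]a, b]] = `[b / c, a / c[%classic.
      apply/seteqP; split=> x /=; rewrite !in_itv /=.
        by move=> /andP[h1 h2]; rewrite ler_ndivrMr // ltr_ndivlMr // ![x * c]mulrC h1 h2.
      by rewrite ler_ndivrMr // ltr_ndivlMr // ![x * c]mulrC andbC.
    rewrite !lebesgue_measure_itv /= !lte_fin ltr_nM2r ?invr_lt0 //.
    case: ifPn => // _; rewrite ?mule0 //.
    rewrite ltr0_norm // -!EFinB -EFinM; congr EFin; field; by rewrite lt_eqF.
  have -> : [set x : R | c * x \in `]a, b]] = `]a / c, b / c]%classic.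
    by apply/seteqP; split=> x /=; rewrite !in_itv /= ltr_pdivrMr // ler_pdivlMr // (mulrC x).
  rewrite !lebesgue_measure_itv /= !lte_fin ltr_pM2r ?invr_gt0 //.
  case: ifPn => // _; rewrite ?mule0 //.
  rewrite gtr0_norm // -!EFinB -EFinM; congr EFin; field; by rewrite gt_eqF.
rewrite (eq_measure_integral (mscale (NngNum cn0) (pushforward mu phi))); last first.
  by move=> A mA _; exact: E.
rewrite ge0_integral_mscale //=; congr (_ * _)%E.
by rewrite ge0_integral_pushforward.
Qed.

(** Extension from indicators to simple functions and then by monotone convergence. *)
Lemma ge0_integral_density d (T : measurableType d) (m nu : {measure set T -> \bar R})
    (p : T -> R) (f : T -> \bar R) :
  measurable_fun setT p -> (forall x, 0 <= p x) ->
  (forall A, measurable A -> nu A = \int[m]_(x in A) (p x)%:E)%E ->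
  measurable_fun setT f -> (forall x, (0 <= f x)%E) ->
  (\int[nu]_x f x = \int[m]_x (f x * (p x)%:E))%E.
Proof.
move=> mp p0 nuE mf f0; pose f_ := nnsfun_approx measurableT mf.
have mpE : measurable_fun setT (EFin \o p) by exact/measurable_EFinP.
transitivity (lim (\int[nu]_x (f_ n x)%:E @[n --> \oo])%E).
  rewrite -monotone_convergence//=.
  - by apply: eq_integral => ? /[!inE] xD; apply/esym/cvg_lim => //=; exact: cvg_nnsfun_approx.
  - by move=> n; exact/measurable_EFinP/measurable_funTS.
  - by move=> n ? _; rewrite lee_fin.
  - by move=> ? _ ? ? mn; rewrite lee_fin; exact/lefP/nd_nnsfun_approx.
rewrite [RHS](_ : _ = lim (\int[m]_x ((f_ n x)%:E * (p x)%:E) @[n --> \oo])%E); last first.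
  rewrite -monotone_convergence//=.
  - apply: eq_integral => x _; apply/esym/cvg_lim => //=.
    by apply: cvgeZr => //; exact: cvg_nnsfun_approx.
  - move=> n; apply: emeasurable_funM => //; exact/measurable_EFinP/measurable_funTS.
  - by move=> n ? _; rewrite mule_ge0 ?lee_fin.
  - move=> x _ ? ? mn; rewrite lee_wpmul2r ?lee_fin //; exact/lefP/nd_nnsfun_approx.
apply: congr_lim; apply/funext => n.
under [LHS]eq_integral do rewrite fimfunE -fsumEFin//.
rewrite [LHS]ge0_integral_fsum//; last 2 first.
- by move=> r; exact/measurable_EFinP/measurableT_comp.
- by move=> k x _; rewrite EFinM nnfun_muleindic_ge0.
under [RHS]eq_integral.
  move=> x xD; rewrite fimfunE -fsumEFin// ge0_mule_fsuml; last first.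
    by move=> r; rewrite EFinM nnfun_muleindic_ge0.
  over.
rewrite [RHS]ge0_integral_fsum//; last 2 first.
- move=> r; apply: emeasurable_funM => //; exact/measurable_EFinP/measurableT_comp.
- by move=> k x _; apply: mule_ge0; [rewrite EFinM nnfun_muleindic_ge0 | rewrite lee_fin].
apply: eq_fsbigr => r _.
have [r0|r0] := ltP r 0.
  have e0 x : (r * \1_(f_ n @^-1` [set r]) x = 0)%R.
    by rewrite preimage_nnfun0 // indic0 mulr0.
  by rewrite !integral0_eq // => x _; rewrite e0 ?mul0e.
under [LHS]eq_integral do rewrite EFinM.
under [RHS]eq_integral do rewrite EFinM -muleA.
rewrite !ge0_integralZl//=.
- congr (_ * _)%E; rewrite integral_indic// setIT nuE// integral_mkcond.
  apply: eq_integral => x _; rewrite patchE indicE.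
  by case: ifP => _; rewrite ?mul1e ?mul0e.
- apply: emeasurable_funM => //; exact/measurable_EFinP/measurable_indic.
- by move=> x _; rewrite mule_ge0 ?lee_fin.
- exact/measurable_EFinP/measurable_indic.
Qed.

(** Serves to normalise Brownian increments, and with [c = -1] gives the symmetry of the law. *)
Lemma normal_prob_scale (c s : R) (A : set R) : c != 0 -> 0 < s -> measurable A ->
  normal_prob 0 s [set x | A (c * x)] = normal_prob 0 (`|c| * s) A.
Proof.
move=> c0 s0 mA.
have mcA : measurable [set x | A (c * x)].
  by rewrite -[X in measurable X]setTI; apply: (mulrl_measurable c).
rewrite /normal_prob [RHS]integral_mkcond [LHS]integral_mkcond.
have cn0 : `|c| != 0 by rewrite normr_eq0.
rewrite [RHS](ge0_integral_scale c0); last 2 first.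
- apply/(measurable_restrictT _ _).1 => //; apply: measurable_funTS.
  by apply/measurable_EFinP; exact: measurable_normal_pdf.
- by move=> x; rewrite patchE; case: ifP => // _; rewrite lee_fin normal_pdf_ge0.
rewrite -ge0_integralZl //=; last 2 first.
- apply: (@measurableT_comp _ _ _ _ _ _ ((fun x => (normal_pdf 0 (`|c| * s) x)%:E) \_ A) _ ( *%R c)) => //.
    apply/(measurable_restrictT _ _).1 => //; apply: measurable_funTS.
    by apply/measurable_EFinP; exact: measurable_normal_pdf.
- by move=> x _; rewrite patchE; case: ifP => // _; rewrite lee_fin normal_pdf_ge0.
apply: eq_integral => x _; rewrite !patchE.
have -> : (x \in [set x | A (c * x)]) = ((c * x)%R \in A).
  by apply/idP/idP; rewrite !inE.
case: ifP => _; last by rewrite mule0.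
rewrite -EFinM; congr EFin; rewrite !normal_pdfE ?gt_eqF ?mulr_gt0 ?normr_gt0 //.
rewrite mulrA /normal_fun !subr0; congr (_ * expR _); last first.
  rewrite !exprMn real_normK ?num_real //; field.
  by rewrite c0 gt_eqF.
have E : (`|c| * s) ^+ 2 * pi *+ 2 = `|c| ^+ 2 * (s ^+ 2 * pi *+ 2).
  by ring.
rewrite /normal_peak E [in RHS]sqrtrM ?sqr_ge0 // sqrtr_sqr normr_id invfM.
by rewrite mulrA mulfV // mul1r.
Qed.

(** The integrand is dominated by a multiple of the normal density of variance 2, since
    [x ^+ 4 <= 64 * expR (x ^+ 2 / 4)]; this follows by squaring [1 + y <= expR y] at
    [y = x ^+ 2 / 8]. *)
Lemma integral_normal_X4 : (\int[normal_prob 0 1]_x ((x : R) ^+ 4)%:E < +oo)%E.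
Proof.
rewrite (@ge0_integral_density _ _ mu (normal_prob 0 1) (normal_pdf 0 1)) //; last 3 first.
- by move=> x; rewrite normal_pdf_ge0.
- apply/measurable_EFinP; exact: measurable_funX.
- by move=> x; rewrite lee_fin exprn_even_ge0.
pose C : R := 64 * normal_peak 1 / normal_peak (Num.sqrt 2).
have s2 : Num.sqrt 2 != 0 :> R by rewrite sqrtr_eq0 -ltNge.
have C0 : 0 <= C.
  by rewrite /C mulr_ge0 ?invr_ge0 ?mulr_ge0 ?normal_peak_ge0.
have H (x : R) : x ^+ 4 * normal_pdf 0 1 x <= C * normal_pdf 0 (Num.sqrt 2) x.
  rewrite !normal_pdfE ?oner_neq0 // /C.
  rewrite [leLHS](_ : _ = normal_peak 1 * (x ^+ 4 * normal_fun 0 1 x)); last by ring.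
  rewrite [leRHS](_ : _ = normal_peak 1 * (64 * normal_fun 0 (Num.sqrt 2) x)); last first.
    by field; rewrite gt_eqF // normal_peak_gt0.
  rewrite ler_wpM2l ?normal_peak_ge0 // /normal_fun !subr0 expr1n sqr_sqrtr // mulr2n.
  have -> : - x ^+ 2 / (1 + 1) = - x ^+ 2 / 4 + - x ^+ 2 / (2 *+ 2) by field.
  rewrite expRD mulrA ler_wpM2r ?expR_ge0 //.
  have h : x ^+ 4 <= 64 * expR (x ^+ 2 / 4).
    have := @expR_ge1Dx R (x ^+ 2 / 8); have -> : x ^+ 2 / 4 = x ^+ 2 / 8 + x ^+ 2 / 8 by field.
    rewrite expRD; have : 0 <= x ^+ 2 by exact: sqr_ge0.
    have -> : x ^+ 4 = (x ^+ 2) ^+ 2 by rewrite -exprM.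
    set y := x ^+ 2; set E := expR _ => y0 hE.
    have : (1 + y / 8) * (1 + y / 8) <= E * E by apply: ler_pM => //; lra.
    by nra.
  by rewrite mulNr expRN ler_pdivrMr ?expR_gt0.
apply: (@le_lt_trans _ _ (\int[mu]_x (C%:E * (normal_pdf 0 (Num.sqrt 2) x)%:E))%E).
  apply: ge0_le_integral => //=.
  - by move=> x _; rewrite mule_ge0 // lee_fin ?normal_pdf_ge0 // (exprn_even_ge0).
  - apply: emeasurable_funM; apply/measurable_EFinP; first exact: measurable_funX.
    exact: measurable_normal_pdf.
  - apply: emeasurable_funM => //; apply/measurable_EFinP; exact: measurable_normal_pdf.
  - by move=> x _; rewrite -!EFinM lee_fin; exact: H.
rewrite ge0_integralZl //=.
- by rewrite integral_normal_pdf mule1 ltry.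
- apply/measurable_EFinP; exact: measurable_normal_pdf.
- by move=> x _; rewrite lee_fin normal_pdf_ge0.
- exact: measurable_normal_pdf.
Qed.

(** A vanishing integral would concentrate the law at 0, a null set for Lebesgue measure. *)
Lemma integral_normal_X2 : (0 < \int[normal_prob 0 1]_x ((x : R) ^+ 2)%:E)%E.
Proof.
rewrite lt_neqAle integral_ge0 ?andbT; last by move=> x _; rewrite lee_fin sqr_ge0.
apply/negP => /eqP /esym i0.
have mf : measurable_fun setT (fun x : R => (x ^+ 2)%:E).
  by apply/measurable_EFinP; exact: measurable_funX.
have /(ae_eq_integral_abs (normal_prob 0 1) measurableT mf) [N [mN N0 hN]] :
    (\int[normal_prob 0 1]_x `|((x : R) ^+ 2)%:E| = 0)%E.
  by rewrite -i0; apply: eq_integral => x _; rewrite gee0_abs // lee_fin sqr_ge0.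
have z0 : normal_prob 0 1 [set (0 : R)] = 0%E.
  have /null_content_dominatesP h := @normal_prob_dominates R 0 1.
  by apply: h => //; exact: lebesgue_measure_set1.
pose Z : set R := [set 0].
have : (normal_prob 0 1 (N `|` Z) <= 0)%E.
  apply: (@le_trans _ _ (normal_prob 0 1 N + normal_prob 0 1 Z)%E).
    by apply: measureU2 => //; exact: measurable_set1.
  by rewrite N0 z0 adde0.
rewrite (_ : N `|` _ = setT) ?probability_setT ?lee_fin ?ler10 //.
apply/seteqP; split => // x _ /=; have [->|x0] := eqVneq x 0; first by right.
by left; apply: hN => /= h; have [] := h I; apply/eqP; rewrite sqrf_eq0.
Qed.

End normal_law.

(** * Joint laws and independence tested on boxes *)

Section independence.
Context {R : realType}.

Definition box N (A : nat -> set R) : set (N.-tuple R) :=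
  [set t | forall i : 'I_N, A i (tnth t i)].

Lemma measurable_box N A : (forall i, measurable (A i)) -> measurable (box (N := N) A).
Proof.
move=> mA; rewrite (_ : box A = \bigcap_(i in [set: 'I_N]) ((fun t => tnth t i) @^-1` A i)).
  apply: fin_bigcap_measurable => [|i _]; first exact: finite_finset.
  by rewrite -[X in measurable X]setTI; exact: measurable_tnth.
by apply/seteqP; split => t h; [move=> i _; exact: h|move=> i; exact: (h i I)].
Qed.

(** Boxes are stable under intersection and generate the sigma-algebra of tuples. *)
Lemma box_measure_unique N (m1 m2 : {measure set (N.-tuple R) -> \bar R}) :
  (m1 setT < +oo)%E ->
  (forall A, (forall i, measurable (A i)) -> m1 (box A) = m2 (box A)) ->
  forall X, measurable X -> m1 X = m2 X.
Proof.
move=> m1oo h; apply: (measure_unique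
  [set B | exists A, (forall i, measurable (A i)) /\ B = box (N := N) A] (fun=> setT)).
- apply/seteqP; split.
    apply: smallest_sub; first exact: smallest_sigma_algebra.
    move=> B; rewrite -bigcup_seq => -[i _ [A mA <-]]; apply: sub_sigma_algebra.
    exists (fun j => if j == i :> nat then A else setT); split.
      by move=> j; case: ifP.
    rewrite setTI; apply/seteqP; split => t /=.
      by move=> At j; case: ifP => // /eqP ji; rewrite (_ : j = i) //; exact/val_inj.
    by move=> /(_ i); rewrite eqxx.
  apply: smallest_sub; first exact: sigma_algebra_measurable.
  by move=> B [A [mA ->]]; exact: measurable_box.
- move=> _ _ [A [mA ->]] [B [mB ->]]; exists (fun i => A i `&` B i); split.
    by move=> i; exact: measurableI.
  by apply/seteqP; split => t; [move=> [h1 h2] i; split|move=> h1; split => i; case: (h1 i)].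
- move=> _; exists (fun=> setT); split => //.
  by apply/seteqP; split.
- by rewrite bigcup_const //; exists 0%N.
- by move=> _ [A [mA ->]]; exact: h.
- by move=> _.
Qed.

Section family.
Context d (T : measurableType d) (P : probability T R).

(** Box probabilities encode the marginals and the independence at once. Indexing by [nat] with a
    bound makes blocks and subfamilies a matter of arithmetic on indices. *)
Definition gaussian_family N (g : nat -> T -> R) : Prop :=
  (forall i, (i < N)%N -> measurable_fun setT (g i)) /\
  forall A : nat -> set R, (forall i, measurable (A i)) ->
    P [set w | forall i, (i < N)%N -> A i (g i w)] = (\prod_(i < N) normal_prob 0 1 (A i))%E.

Definition first_terms N (g : nat -> T -> R) (w : T) : N.-tuple R :=
  [tuple g i w | i < N].

Lemma measurable_first_terms N g : (forall i, (i < N)%N -> measurable_fun setT (g i)) ->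
  measurable_fun setT (first_terms N g).
Proof.
move=> mg; apply/measurable_fun_tnthP => i /=.
rewrite (_ : _ \o _ = g i); first exact: mg.
by apply/funext => w /=; rewrite tnth_mktuple.
Qed.

Lemma first_terms_box N g A :
  first_terms N g @^-1` box A = [set w | forall i, (i < N)%N -> A i (g i w)].
Proof.
apply/seteqP; split => w /= h i; last by rewrite tnth_mktuple; exact: h.
by move=> iN; have := h (Ordinal iN); rewrite tnth_mktuple.
Qed.

Lemma preimage_first_terms N g X : (forall i, (i < N)%N -> measurable_fun setT (g i)) ->
  measurable X -> measurable (first_terms N g @^-1` X).
Proof.
by move=> mg mX; rewrite -[X in measurable X]setTI; apply: measurable_first_terms.
Qed.

Lemma gaussian_family_sub N M g : (M <= N)%N -> gaussian_family N g -> gaussian_family M g.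
Proof.
move=> MN [mg h]; split=> [i iM|A mA]; first exact/mg/(leq_trans iM).
pose B i := if (i < M)%N then A i else setT.
rewrite (_ : [set w | _] = [set w | forall i, (i < N)%N -> B i (g i w)]).
  rewrite h; last by move=> i; rewrite /B; case: ifP.
  rewrite (big_ord_widen_cond N xpredT (fun i => normal_prob 0 1 (A i))) //=.
  rewrite [RHS]big_mkcond; apply: eq_bigr => i _; rewrite /B; case: ifP => // _.
  by rewrite probability_setT.
apply/seteqP; split => w /= hw i iN; rewrite /B; first by case: ifP => // iM; exact: hw.
by have := hw i (leq_trans iN MN); rewrite /B iN.
Qed.

Lemma gaussian_family_reindex N M (f : nat -> nat) g :
  (forall i, (i < M)%N -> (f i < N)%N) ->
  (forall i j, (i < M)%N -> (j < M)%N -> f i = f j -> i = j) ->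
  gaussian_family N g -> gaussian_family M (fun i => g (f i)).
Proof.
move=> fN fi [mg h]; split=> [i iM|A mA]; first exact/mg/fN.
(* Indices outside the range of [f] are left unconstrained and contribute the factor 1. *)
pose B j := if [pick i : 'I_M | f i == j] is Some i then A i else setT.
have Bf i : (i < M)%N -> B (f i) = A i.
  move=> iM; rewrite /B; case: pickP => [k /eqP /fi -> //|/(_ (Ordinal iM))].
  by rewrite eqxx.
rewrite (_ : [set w | _] = [set w | forall i, (i < N)%N -> B i (g i w)]).
  rewrite h; last by move=> i; rewrite /B; case: pickP.
  pose F (i : 'I_M) : 'I_N := Ordinal (fN i (ltn_ord i)).
  have Fi : injective F.
    by move=> i j /(congr1 val) /= /fi e; apply/val_inj/e.
  rewrite (bigID (fun j => j \in [set F i | i in 'I_M]%SET)) /= [X in (_ * X)%E]big1 ?mule1.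
    rewrite big_imset /=; last by move=> i j _ _; exact: Fi.
    by apply: eq_bigr => i _; rewrite Bf.
  move=> j jn; rewrite /B; case: pickP => [i /eqP e|]; last by rewrite probability_setT.
  by case/imsetP: jn; exists i => //; apply/val_inj.
apply/seteqP; split => w /= hw i iN.
  rewrite /B; case: pickP => // k /eqP <-; exact: hw.
by rewrite -(Bf _ iN); apply: hw; exact: fN.
Qed.

Definition indep_tuples N M (V1 : T -> N.-tuple R) (V2 : T -> M.-tuple R) :=
  forall X Y, measurable X -> measurable Y ->
    P (V1 @^-1` X `&` V2 @^-1` Y) = (P (V1 @^-1` X) * P (V2 @^-1` Y))%E.

(** Uniqueness of measures is applied twice, one variable at a time: [P] restricted to a fixed event
    of one tuple is compared with a multiple of the law of the other tuple. *)
Lemma box_indep N M (V1 : T -> N.-tuple R) (V2 : T -> M.-tuple R) :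
  measurable_fun setT V1 -> measurable_fun setT V2 ->
  (forall A B, (forall i, measurable (A i)) -> (forall i, measurable (B i)) ->
    P (V1 @^-1` box A `&` V2 @^-1` box B) = (P (V1 @^-1` box A) * P (V2 @^-1` box B))%E) ->
  indep_tuples V1 V2.
Proof.
move=> mV1 mV2 h X Y mX mY.
have m1 Z : measurable Z -> measurable (V1 @^-1` Z).
  by move=> mZ; rewrite -[X in measurable X]setTI; exact: mV1.
have m2 Z : measurable Z -> measurable (V2 @^-1` Z).
  by move=> mZ; rewrite -[X in measurable X]setTI; exact: mV2.
have fin Z : measurable Z -> exists c : {nonneg R}, P Z = c%:num%:E.
  move=> mZ; have p0 : 0 <= fine (P Z) by rewrite fine_ge0.
  by exists (NngNum p0); rewrite /= fineK // fin_num_measure.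
have step B : (forall i, measurable (B i)) ->
    P (V1 @^-1` X `&` V2 @^-1` box B) = (P (V1 @^-1` X) * P (V2 @^-1` box B))%E.
  move=> mB; have mVB := m2 _ (measurable_box mB); have [c Pc] := fin _ mVB.
  have := @box_measure_unique N (pushforward (mrestr P mVB) V1) (mscale c (pushforward P V1)).
  rewrite Pc muleC; apply => //.
    apply: (@le_lt_trans _ _ (P setT)); last by rewrite probability_setT ltry.
    apply: le_measure; rewrite ?inE //; first exact: measurableI (m1 _ _) mVB.
  move=> A mA; rewrite /mscale /= /pushforward /mrestr /= h // Pc; exact: muleC.
have mVX := m1 _ mX; have [c Pc] := fin _ mVX.
have := @box_measure_unique M (pushforward (mrestr P mVX) V2) (mscale c (pushforward P V2)).
rewrite Pc setIC; apply => //.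
  apply: (@le_lt_trans _ _ (P setT)); last by rewrite probability_setT ltry.
  apply: le_measure; rewrite ?inE //; first exact: measurableI (m2 _ _) mVX.
by move=> A mA; rewrite /mscale /= /pushforward /mrestr /= setIC step // Pc.
Qed.

Lemma gaussian_family_indep N M g : gaussian_family (N + M) g ->
  indep_tuples (first_terms N g) (first_terms M (fun i => g (N + i)%N)).
Proof.
move=> hg; have [mg h] := hg.
have hN := gaussian_family_sub (leq_addr M N) hg.
have hM : gaussian_family M (fun i => g (N + i)%N).
  apply: gaussian_family_reindex hg => [i iM|i j _ _ /addnI //]; by rewrite ltn_add2l.
apply: box_indep; [exact/measurable_first_terms/hN.1|exact/measurable_first_terms/hM.1|].
move=> A B mA mB; rewrite !first_terms_box hN.2 // hM.2 //.
pose C i := if (i < N)%N then A i else B (i - N)%N.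
rewrite (_ : _ `&` _ = [set w | forall i, (i < N + M)%N -> C i (g i w)]).
  rewrite h; last by move=> i; rewrite /C; case: ifP.
  rewrite big_split_ord /=; congr (_ * _)%E; apply: eq_bigr => i _; rewrite /C.
    by rewrite ltn_ord.
  by rewrite ltnNge leq_addr /= addKn.
apply/seteqP; split => w /=.
  move=> [h1 h2] i iNM; rewrite /C; case: ifPn => [/h1//|]; rewrite -leqNgt => Ni.
  have := h2 (i - N)%N; rewrite subnKC //; apply; lia.
move=> h1; split => i iN.
  by have := h1 i (leq_trans iN (leq_addr _ _)); rewrite /C iN.
have := h1 (N + i)%N; rewrite ltn_add2l => /(_ iN).
by rewrite /C ltnNge leq_addr /= addKn.
Qed.

End family.

(** The two families may live on different spaces, which allows probabilities to be moved to an
    auxiliary space and back. *)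
Lemma gaussian_family_law d (T : measurableType d) (P : probability T R) d' (T' : measurableType d')
    (P' : probability T' R) N g g' (X : set (N.-tuple R)) :
  gaussian_family P N g -> gaussian_family P' N g' -> measurable X ->
  P (first_terms N g @^-1` X) = P' (first_terms N g' @^-1` X).
Proof.
move=> [mg h] [mg' h'] mX.
have m1 := measurable_first_terms mg; have m2 := measurable_first_terms mg'.
apply: (@box_measure_unique N (pushforward P (first_terms N g)) (pushforward P' (first_terms N g'))) => //.
  apply: (@le_lt_trans _ _ (P setT)); last by rewrite probability_setT ltry.
  exact: lexx.
move=> A mA; have := h A mA; have := h' A mA.
by rewrite -!first_terms_box => e1 e2; exact: (etrans e2 (esym e1)).
Qed.

End independence.

(** * Moments of multiaffine functions of Gaussian variables *)

Section expectation.
Context {R : realType} d (T : measurableType d) (P : probability T R).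
Implicit Types f g h k : T -> R.

Definition integrable_rv f := P.-integrable setT (EFin \o f).

Lemma integrable_rv_le f g : measurable_fun setT f -> integrable_rv g ->
  (forall w, `|f w| <= g w) -> integrable_rv f.
Proof.
move=> mf ig fg; apply: (le_integrable _ _ _ ig) => //; first exact/measurable_EFinP.
move=> w _ /=; rewrite lee_fin (le_trans (fg w)) //; exact: ler_norm.
Qed.

Lemma integrable_rvD f g : integrable_rv f -> integrable_rv g ->
  integrable_rv (fun w => f w + g w).
Proof. by move=> h1 h2; exact: (integrableD measurableT h1 h2). Qed.

Lemma integrable_rvZ (c : R) f : integrable_rv f -> integrable_rv (fun w => c * f w).
Proof.
move=> h1; have := integrableZl measurableT c h1.
by apply: eq_integrable => // w _ /=.
Qed.

Lemma integrable_rv_cst (c : R) : integrable_rv (fun=> c).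
Proof. exact: finite_measure_integrable_cst. Qed.

Lemma measurable_integrable_rv f : integrable_rv f -> measurable_fun setT f.
Proof. by move=> /measurable_int /measurable_EFinP. Qed.

Lemma integrable_rv_eq f g : f =1 g -> integrable_rv f -> integrable_rv g.
Proof. by move=> /funext ->. Qed.

Lemma integrable_rv_sum (I : Type) (s : seq I) (F : I -> T -> R) :
  (forall i, integrable_rv (F i)) -> integrable_rv (fun w => \sum_(i <- s) F i w).
Proof.
move=> h; elim: s => [|i s IH].
  by apply: integrable_rv_eq (integrable_rv_cst 0) => w; rewrite big_nil.
by apply: integrable_rv_eq (integrable_rvD (h i) IH) => w; rewrite big_cons.
Qed.

Lemma Rintegral_sum (I : Type) (s : seq I) (F : I -> T -> R) :
  (forall i, integrable_rv (F i)) ->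
  \int[P]_w (\sum_(i <- s) F i w) = \sum_(i <- s) \int[P]_w F i w.
Proof.
move=> h; elim: s => [|i s IH].
  rewrite big_nil; transitivity (\int[P]_w (0 : R)); last by rewrite Rintegral_cst // mul0r.
  by apply: eq_Rintegral => w _; rewrite big_nil.
rewrite big_cons -IH -RintegralD //; [|exact: h|exact: integrable_rv_sum].
by apply: eq_Rintegral => w _; rewrite big_cons.
Qed.

Lemma Rintegral_prob_cst (c : R) : \int[P]_w c = c.
Proof. by rewrite Rintegral_cst //; have := @probability_setT _ _ _ P => /= ->; rewrite mulr1. Qed.

Lemma prob_ge_le f (a : R) : measurable_fun setT f -> (forall w, 0 <= f w) -> 0 < a ->
  (a%:E * P [set w | (a <= f w)%R] <= \int[P]_w (f w)%:E)%E.
Proof.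
move=> mf f0 a0; have mA : measurable [set w | a <= f w].
  rewrite (_ : [set _ | _] = f @^-1` `[a, +oo[).
    by rewrite -[X in measurable X]setTI; exact: mf.
  by apply/seteqP; split => w /=; rewrite in_itv /= andbT.
rewrite -integral_cst // [leLHS]integral_mkcond; apply: ge0_le_integral => //.
- by move=> w _; rewrite patchE; case: ifP => // _; rewrite lee_fin ltW.
- exact/(measurable_restrictT _ _).1.
- exact/measurable_EFinP.
- move=> w _; rewrite patchE; case: ifPn => [|_]; last by rewrite lee_fin.
  by rewrite inE lee_fin.
Qed.

Definition indep_rv f g := forall A B : set R, measurable A -> measurable B ->
  P (f @^-1` A `&` g @^-1` B) = (P (f @^-1` A) * P (g @^-1` B))%E.

(** Independence identifies the joint law with the product of the marginals; Tonelli gives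
    integrability and Fubini the value. *)
Lemma indep_expectation f g : indep_rv f g -> integrable_rv f -> integrable_rv g ->
  integrable_rv (fun w => f w * g w) /\
  \int[P]_w (f w * g w) = (\int[P]_w f w) * (\int[P]_w g w).
Proof.
move=> ind i_f i_g; have mf := measurable_integrable_rv i_f; have mg := measurable_integrable_rv i_g.
pose f' : {RV P >-> R} := HB.pack f (isMeasurableFun.Build _ _ _ _ f mf).
pose g' : {RV P >-> R} := HB.pack g (isMeasurableFun.Build _ _ _ _ g mg).
have mfg : measurable_fun setT (fun w => (f w, g w)) by exact/measurable_fun_pair.
pose fg' : {mfun T >-> (R * R)%type} :=
  HB.pack (fun w => (f w, g w)) (isMeasurableFun.Build _ _ _ _ (fun w => (f w, g w)) mfg).
have E X : measurable X -> (distribution P f' \x distribution P g')%E X = distribution P fg' X.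
  by move=> mX; apply: product_measure_unique => //.
pose m : R * R -> \bar R := fun z => (z.1 * z.2)%:E.
have mm : measurable_fun setT m.
  apply/measurable_EFinP; apply: measurable_funM; [exact: measurable_fst|exact: measurable_snd].
have mabs : measurable_fun [set: R] (fun x : R => `|x|%:E).
  by apply/measurable_EFinP; exact: normr_measurable.
have absm : (\int[(distribution P f' \x distribution P g')%E]_z `|m z| =
   \int[P]_w `|f w|%:E * \int[P]_w `|g w|%:E)%E.
  rewrite fubini_tonelli1 //; last exact: measurableT_comp.
  rewrite /fubini_F; transitivity (\int[distribution P f']_x (`|x|%:E * \int[P]_w `|g w|%:E))%E.
    apply: eq_integral => x _; rewrite -ge0_integralZl //.
      rewrite ge0_integral_distribution //=.
        by apply: eq_integral => w _; rewrite /m /= normrM EFinM.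
      by apply/measurable_EFinP; apply: measurableT_comp => //; exact: measurable_funM.
    by apply/measurable_EFinP; exact: measurableT_comp.
  rewrite ge0_integralZr ?integral_ge0 //.
  by rewrite ge0_integral_distribution.
have ab_f : (\int[P]_w `|f w|%:E < +oo)%E by have /integrableP[_] := i_f.
have ab_g : (\int[P]_w `|g w|%:E < +oo)%E by have /integrableP[_] := i_g.
have im : (distribution P f' \x distribution P g')%E.-integrable setT m.
  apply/integrableP; split => //; rewrite absm.
  by rewrite lte_mul_pinfty // ?ge0_fin_numE // integral_ge0.
have im2 : (distribution P fg').-integrable setT m.
  apply/integrableP; split => //; rewrite (eq_measure_integral (distribution P f' \x distribution P g')%E).
    by have /integrableP[] := im.
  by move=> A mA _; exact: (esym (E A mA)).
have i_fg : integrable_rv (fun w => f w * g w).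
  apply/integrableP; split; first exact/measurable_EFinP/measurable_funM.
  have /integrableP[_] := im2; rewrite ge0_integral_distribution //; exact: measurableT_comp.
split => //; rewrite /Rintegral -fineM; last 2 first.
- exact: integrable_fin_num.
- exact: integrable_fin_num.
congr fine.
transitivity (\int[distribution P fg']_z m z)%E.
  by rewrite integral_distribution.
rewrite (eq_measure_integral (distribution P f' \x distribution P g')%E); last first.
  by move=> A mA _; exact: (esym (E A mA)).
rewrite -integral12_prod_meas1 // /fubini_F.
transitivity (\int[distribution P f']_x (x%:E * \int[P]_w (g w)%:E))%E.
  apply: eq_integral => x _; rewrite -integralZl //.
  rewrite integral_distribution //.
    by apply/measurable_EFinP; exact: mulrl_measurable.
  by have := integrableZl measurableT x i_g; apply: eq_integrable.
have [c cE] : exists c, (\int[P]_w (g w)%:E = c%:E)%E.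
  exists (fine (\int[P]_w (g w)%:E)%E); rewrite fineK //; exact: integrable_fin_num.
rewrite cE -integralZr //.
  rewrite integral_distribution //; last by have := integrableZr measurableT c i_f; apply: eq_integrable.
  by apply/measurable_EFinP; exact: mulrr_measurable.
Qed.

(* Fourth powers are integrable: all products of at most four such variables are. *)
Definition L4 f := measurable_fun setT f /\ integrable_rv (fun w => f w ^+ 4).

Lemma L4_mul f g h k : L4 f -> L4 g -> L4 h -> L4 k ->
  integrable_rv (fun w => f w * g w * (h w * k w)).
Proof.
move=> [mf i_f] [mg i_g] [mh i_h] [mk i_k].
apply: (integrable_rv_le _ (integrable_rvD (integrable_rvD i_f i_g) (integrable_rvD i_h i_k))).
  by do ?apply: measurable_funM.
move=> w; rewrite ler_norml; move: (f w) (g w) (h w) (k w) => a b c e.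
have hh (x y : R) : (x * y) ^+ 2 <= (x ^+ 4 + y ^+ 4) / 2.
  have -> : x ^+ 4 = (x ^+ 2) ^+ 2 by rewrite -exprM.
  have -> : y ^+ 4 = (y ^+ 2) ^+ 2 by rewrite -exprM.
  have := sqr_ge0 (x ^+ 2 - y ^+ 2); rewrite exprMn; nra.
have := hh a b; have := hh c e; have := exprn_even_ge0 a (isT : ~~ odd 4).
have := exprn_even_ge0 b (isT : ~~ odd 4); have := exprn_even_ge0 c (isT : ~~ odd 4).
have := exprn_even_ge0 e (isT : ~~ odd 4).
have := sqr_ge0 (a * b + c * e); have := sqr_ge0 (a * b - c * e).
move: (a * b) (c * e) (a ^+ 4) (b ^+ 4) (c ^+ 4) (e ^+ 4) => x y a4 b4 c4 e4 *.
apply/andP; split; nra.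
Qed.

Lemma L4_cst (c : R) : L4 (fun=> c).
Proof. by split; [exact: measurable_cst|exact: integrable_rv_cst]. Qed.

Lemma L4_mul2 f g : L4 f -> L4 g -> integrable_rv (fun w => f w * g w).
Proof.
move=> hf hg; apply: integrable_rv_eq (L4_mul hf hg (L4_cst 1) (L4_cst 1)) => w.
by rewrite !mulr1.
Qed.

Lemma L4_sqr f : L4 f -> integrable_rv (fun w => f w ^+ 2).
Proof. by move=> hf; apply: integrable_rv_eq (L4_mul2 hf hf) => w; rewrite expr2. Qed.

Lemma L4D f g : L4 f -> L4 g -> L4 (fun w => f w + g w).
Proof.
move=> [mf i_f] [mg i_g]; split; first exact: measurable_funD.
apply: (integrable_rv_le _ (integrable_rvZ 8 (integrable_rvD i_f i_g))).
  by apply: measurable_funX; exact: measurable_funD.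
move=> w; rewrite ger0_norm ?exprn_even_ge0 //; move: (f w) (g w) => a b.
have := sqr_ge0 (a ^+ 2 - b ^+ 2); have := sqr_ge0 (a - b) => h1 h2.
have h3 : (a + b) ^+ 2 <= 2 * (a ^+ 2 + b ^+ 2) by nra.
have : (a + b) ^+ 4 <= (2 * (a ^+ 2 + b ^+ 2)) ^+ 2.
  rewrite (_ : 4 = 2 * 2)%N // exprM ler_pXn2r ?nnegrE ?sqr_ge0 //.
  by rewrite mulr_ge0 // addr_ge0 // sqr_ge0.
have -> : a ^+ 4 = (a ^+ 2) ^+ 2 by rewrite -exprM.
have -> : b ^+ 4 = (b ^+ 2) ^+ 2 by rewrite -exprM.
nra.
Qed.

Lemma expectation_cauchy_schwarz f g : integrable_rv (fun w => f w ^+ 2) ->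
  integrable_rv (fun w => g w ^+ 2) -> integrable_rv (fun w => f w * g w) ->
  (\int[P]_w (f w * g w)) ^+ 2 <= (\int[P]_w (f w ^+ 2)) * (\int[P]_w (g w ^+ 2)).
Proof.
move=> i_f i_g i_fg; set F := \int[P]_w (f w ^+ 2); set G := \int[P]_w (g w ^+ 2).
set H := \int[P]_w (f w * g w).
have key (s : R) : 0 <= F + 2 * s * H + s ^+ 2 * G.
  have -> : F + 2 * s * H + s ^+ 2 * G = \int[P]_w ((f w + s * g w) ^+ 2).
    have i1 := integrable_rvZ (2 * s) i_fg; have i2 := integrable_rvZ (s ^+ 2) i_g.
    have i3 := integrable_rvD i_f i1.
    rewrite /F /G /H -!RintegralZl // -!RintegralD //.
    by apply: eq_Rintegral => w _; ring.
  by apply: Rintegral_ge0 => w _; exact: sqr_ge0.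
have G0 : 0 <= G by apply: Rintegral_ge0 => w _; exact: sqr_ge0.
have [G1|G1] := eqVneq G 0.
  rewrite G1 mulr0; have [->|H0] := eqVneq H 0; first by rewrite expr0n.
  (* For [G = 0] the quadratic is affine in [s]; at this point it takes the value -1. *)
  have := key (- (F + 1) / (2 * H)); rewrite G1 mulr0 addr0.
  have -> : 2 * (- (F + 1) / (2 * H)) * H = - (F + 1) by field.
  lra.
have G2 : 0 < G by rewrite lt_neqAle eq_sym G1.
have := key (- H / G); have -> : F + 2 * (- H / G) * H + (- H / G) ^+ 2 * G = (F * G - H ^+ 2) / G.
  by field.
by rewrite pmulr_lge0 ?invr_gt0 // subr_ge0.
Qed.

End expectation.

(** * Moments of standard normal variables *)

Section normal_moments.
Context {R : realType}.

(** Equal to 1, and [normal_m4] to 3; both are carried along as symbols, the first being shown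
    positive. *)
Definition normal_m2 : R := \int[normal_prob 0 1]_x ((x : R) ^+ 2).
Definition normal_m4 : R := \int[normal_prob 0 1]_x ((x : R) ^+ 4).

Context d (T : measurableType d) (P : probability T R).

Definition std_normal (X : T -> R) := measurable_fun setT X /\
  forall A, measurable A -> P (X @^-1` A) = normal_prob 0 1 A.

Lemma std_normal_ge0_integral X (f : R -> \bar R) : std_normal X ->
  measurable_fun setT f -> (forall x, (0 <= f x)%E) ->
  (\int[P]_w f (X w) = \int[normal_prob 0 1]_x f x)%E.
Proof.
move=> [mX hX] mf f0.
have mX' : measurable_fun setT (X : T -> measurableTypeR R) := mX.
pose X' : {RV P >-> measurableTypeR R} := HB.pack (X : T -> measurableTypeR R) (isMeasurableFun.Build _ _ _ _ _ mX').
rewrite -(@ge0_integral_distribution _ _ _ _ _ P X') //.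
by apply: eq_measure_integral => A mA _; exact: hX.
Qed.

Lemma std_normal_L4 X : std_normal X -> L4 P X.
Proof.
move=> hX; have [mX _] := hX; split => //; apply/integrableP; split.
  by apply/measurable_EFinP; exact: measurable_funX.
under eq_integral => w _.
  rewrite /= ger0_norm ?exprn_even_ge0 //; over.
rewrite (std_normal_ge0_integral (f := fun x => (x ^+ 4)%:E) hX); first exact: integral_normal_X4.
  by apply/measurable_EFinP; exact: measurable_funX.
by move=> x; rewrite lee_fin exprn_even_ge0.
Qed.

Lemma std_normal_E2 X : std_normal X -> \int[P]_w (X w ^+ 2) = normal_m2.
Proof.
move=> hX; congr fine; apply: (std_normal_ge0_integral (f := fun x => (x ^+ 2)%:E) hX).
  by apply/measurable_EFinP; exact: measurable_funX.
by move=> x; rewrite lee_fin sqr_ge0.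
Qed.

Lemma std_normal_E4 X : std_normal X -> \int[P]_w (X w ^+ 4) = normal_m4.
Proof.
move=> hX; congr fine; apply: (std_normal_ge0_integral (f := fun x => (x ^+ 4)%:E) hX).
  by apply/measurable_EFinP; exact: measurable_funX.
by move=> x; rewrite lee_fin exprn_even_ge0.
Qed.

Lemma std_normalN X : std_normal X -> std_normal (fun w => - X w).
Proof.
move=> [mX hX]; split=> [|A mA]; first exact: measurableT_comp.
have := @normal_prob_scale R (-1) 1 A; rewrite normrN normr1 mulr1 => <- //.
rewrite -hX; last first.
  by rewrite -[X in measurable X]setTI; apply: (mulrl_measurable (-1)).
by congr (P _); apply/seteqP; split => w /=; rewrite mulN1r.
Qed.

(** [X] and [- X] have the same law. *)
Lemma std_normal_odd X k : std_normal X -> odd k ->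
  integrable_rv P (fun w => X w ^+ k) -> \int[P]_w (X w ^+ k) = 0.
Proof.
move=> hX ok iX; have hN := std_normalN hX; have [mX hX1] := hX; have [mN hN1] := hN.
have mX' : measurable_fun setT (X : T -> measurableTypeR R) := mX.
pose X' : {RV P >-> measurableTypeR R} := HB.pack (X : T -> measurableTypeR R) (isMeasurableFun.Build _ _ _ _ _ mX').
have mN' : measurable_fun setT ((fun w => - X w) : T -> measurableTypeR R) := mN.
pose N' : {RV P >-> measurableTypeR R} := HB.pack ((fun w => - X w) : T -> measurableTypeR R) (isMeasurableFun.Build _ _ _ _ _ mN').
have iN : P.-integrable setT ((fun x : R => (x ^+ k)%:E) \o N').
  apply: (integrable_rv_eq _ (integrable_rvZ (-1) iX)) => w.
  by rewrite /= -[- X w]mulN1r exprMn -signr_odd ok.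
have mk : measurable_fun setT (fun x : R => (x ^+ k)%:E).
  by apply/measurable_EFinP; exact: measurable_funX.
have : \int[P]_w (X w ^+ k) = \int[P]_w ((- X w) ^+ k).
  congr fine; rewrite -(integral_distribution (X := X') (f := fun x => (x ^+ k)%:E)) //.
  rewrite -(integral_distribution (X := N') (f := fun x => (x ^+ k)%:E)) //.
  by apply: eq_measure_integral => A mA _; exact: (etrans (hX1 A mA) (esym (hN1 A mA))).
have -> : \int[P]_w ((- X w) ^+ k) = - \int[P]_w (X w ^+ k).
  rewrite -mulN1r -RintegralZl //; apply: eq_Rintegral => w _.
  by rewrite -[- X w]mulN1r exprMn -signr_odd ok.
lra.
Qed.

(** Since [fine] sends infinity to 0, finiteness is needed as well; it follows from
    [x ^+ 2 <= 1 + x ^+ 4]. *)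
Lemma normal_m2_gt0 : 0 < normal_m2.
Proof.
rewrite /normal_m2 /Rintegral fine_gt0 // integral_normal_X2 /=.
have le : (\int[normal_prob 0 1]_x ((x : R) ^+ 2)%:E <=
    \int[normal_prob 0 1]_x (1 + ((x : R) ^+ 4)%:E))%E.
  apply: ge0_le_integral => //.
  - by move=> x _; rewrite lee_fin sqr_ge0.
  - by apply/measurable_EFinP; exact: measurable_funX.
  - apply: emeasurable_funD => //; by apply/measurable_EFinP; exact: measurable_funX.
  - move=> x _; rewrite -EFinD lee_fin; have -> : x ^+ 4 = (x ^+ 2) ^+ 2 by rewrite -exprM.
    have := sqr_ge0 (x ^+ 2 - 1); have := sqr_ge0 x; nra.
apply: le_lt_trans le _; rewrite ge0_integralD //.
- rewrite integral_cst //; have := @probability_setT _ _ R (normal_prob 0 1) => /= ->; rewrite mule1.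
  by rewrite lte_add_pinfty ?ltry // integral_normal_X4.
- by move=> x _; rewrite lee_fin exprn_even_ge0.
- by apply/measurable_EFinP; exact: measurable_funX.
Qed.

Lemma gaussian_family_std N g i : gaussian_family P N g -> (i < N)%N -> std_normal (g i).
Proof.
move=> hg iN.
have [mg h] : gaussian_family P 1 (fun=> g i).
  by apply: (gaussian_family_reindex (f := fun=> i) _ _ hg) => // -[|?] [|?].
split; first exact: (mg 0%N).
move=> A mA; have := h (fun=> A) (fun=> mA); rewrite big_ord1 => <-; congr (P _).
by apply/seteqP; split => w /=; [move=> ? []|move=> /(_ 0%N isT)].
Qed.

End normal_moments.

(** * Multiaffine functions and their partial derivatives *)

Section multiaffine.
Context {R : realType}.
Implicit Types F a b : (nat -> R) -> R.

(* Polynomial functions of degree at most [q] of the first [N] variables, of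
   degree at most one in each of them. *)
Fixpoint multiaffine N q F : Prop :=
  if N is N'.+1 then exists a b, [/\ multiaffine N' q a,
      (if q is q'.+1 then multiaffine N' q' b else forall x, b x = 0) &
      forall x, F x = a x + x N' * b x]
  else exists c, forall x, F x = c.

Lemma multiaffine_eq N q F G : F =1 G -> multiaffine N q F -> multiaffine N q G.
Proof. by move=> /funext ->. Qed.

Lemma multiaffine_cst N q (c : R) : multiaffine N q (fun=> c).
Proof.
elim: N q c => [|N IH] q c /=; first by exists c.
exists (fun=> c), (fun=> 0); split => //; first by case: q.
by move=> x; rewrite mulr0 addr0.
Qed.

Lemma multiaffineW N q F : multiaffine N q F -> multiaffine N q.+1 F.
Proof.
elim: N q F => [//|N IH] q F /= [a [b [ha hb FE]]]; exists a, b; split => //.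
  exact: IH.
case: q hb {ha} => [b0|q /IH //]; apply: (multiaffine_eq (F := fun=> 0)) => [x|].
  by rewrite b0.
exact: multiaffine_cst.
Qed.

Lemma multiaffine_succ N q F : multiaffine N q F -> multiaffine N.+1 q F.
Proof.
move=> h; exists F, (fun=> 0); split => //.
  by case: q h => // q _; exact: multiaffine_cst.
by move=> x; rewrite mulr0 addr0.
Qed.

Lemma multiaffine_lin N q (s t : R) F G : multiaffine N q F -> multiaffine N q G ->
  multiaffine N q (fun x => s * F x + t * G x).
Proof.
elim: N q F G => [|N IH] q F G /=.
  by move=> [c Fc] [e Ge]; exists (s * c + t * e) => x; rewrite Fc Ge.
move=> [a [b [ha hb FE]]] [a' [b' [ha' hb' GE]]].
exists (fun x => s * a x + t * a' x), (fun x => s * b x + t * b' x); split.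
- exact: IH.
- case: q hb hb' {ha ha'} => [b0 b0' x|q hb hb']; last exact: IH.
  by rewrite b0 b0' !mulr0 addr0.
- by move=> x; rewrite FE GE; ring.
Qed.

Lemma multiaffine_sum N q (I : Type) (s : seq I) (c : I -> R) (F : I -> (nat -> R) -> R) :
  (forall i, multiaffine N q (F i)) -> multiaffine N q (fun x => \sum_(i <- s) c i * F i x).
Proof.
move=> h; elim: s => [|i s IH].
  by apply: multiaffine_eq (multiaffine_cst N q 0) => x; rewrite big_nil.
apply: multiaffine_eq (multiaffine_lin (c i) 1 (h i) IH) => x.
by rewrite big_cons mul1r.
Qed.

Lemma multiaffine_local N q F x y : multiaffine N q F ->
  (forall i, (i < N)%N -> x i = y i) -> F x = F y.
Proof.
elim: N q F => [|N IH] q F /=; first by move=> [c Fc] _; rewrite !Fc.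
move=> [a [b [ha hb FE]]] h; rewrite !FE h //.
have h' i : (i < N)%N -> x i = y i by move=> iN; apply: h; rewrite ltnS ltnW.
rewrite (IH _ _ ha h'); congr (_ + _ * _).
by case: q hb {ha} => [b0|q hb]; [rewrite !b0|exact: (IH _ _ hb)].
Qed.

Definition upd (x : nat -> R) i (c : R) : nat -> R := fun j => if j == i then c else x j.

(** The partial derivative in the variable [i]; for a multiaffine function it equals this finite
    difference. *)
Definition slope i F x : R := F (upd x i 1) - F (upd x i 0).

Lemma multiaffine_slope N q F i : multiaffine N q F -> multiaffine N q (slope i F).
Proof.
elim: N q F => [|N IH] q F.
  by move=> [c Fc]; exists 0 => x; rewrite /slope !Fc subrr.
move=> [a [b [ha hb FE]]].
have [->|iN] := eqVneq i N.
  apply: (multiaffine_eq (F := b)) => [x|].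
    rewrite /slope !FE /upd eqxx mul0r addr0 mul1r.
    have e c : a (upd x N c) = a x.
      by apply: (multiaffine_local ha) => j jN; rewrite /upd ltn_eqF.
    have e' c : b (upd x N c) = b x.
      case: q hb {ha} => [b0|q hb]; first by rewrite !b0.
      by apply: (multiaffine_local hb) => j jN; rewrite /upd ltn_eqF.
    by rewrite -/(upd x N 1) -/(upd x N 0) !e e' addrC addKr.
  case: q hb {ha} => [b0|q hb]; last by apply: (@multiaffine_succ N); exact: multiaffineW.
  by apply: (multiaffine_eq (F := fun=> 0)) => [x|]; [rewrite b0|exact: (multiaffine_cst N.+1)].
exists (slope i a), (slope i b); split; first exact: IH.
  case: q hb {ha} => [b0 x|q hb]; last exact: IH.
  by rewrite /slope !b0 subrr.
by move=> x; rewrite /slope !FE /upd (eq_sym N) (negPf iN); ring.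
Qed.

Lemma cofactor_sum_rank1 N q (u : nat -> 'cV[R]_q.+1) (v : nat -> 'rV[R]_q.+1) x i j :
  row' i (col' j (\sum_(n < N) x n *: (u n *m v n))) =
  \sum_(n < N) x n *: (row' i (u n) *m col' j (v n)).
Proof.
apply/matrixP => k l; rewrite !mxE !summxE; apply: eq_bigr => n _.
by rewrite !mxE !big_ord1 !mxE.
Qed.

(** Adding a rank one term changes the determinant linearly, the coefficient being a combination of
    determinants of order one less. The induction on the number of terms therefore runs over all
    orders at once. *)
Lemma multiaffine_det N q (u : nat -> 'cV[R]_q) (v : nat -> 'rV[R]_q) :
  multiaffine N q (fun x => \det (\sum_(i < N) x i *: (u i *m v i))).
Proof.
elim: N q u v => [|N IH] q u v.
  by exists (\det (0 : 'M[R]_q)) => x; rewrite big_ord0.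
exists (fun x => \det (\sum_(i < N) x i *: (u i *m v i))),
  (fun x => (v N *m \adj (\sum_(i < N) x i *: (u i *m v i)) *m u N) 0 0); split => //.
  case: q u v => [|q] u v.
    by move=> x; rewrite mxE big_ord0.
  apply: (multiaffine_eq (F := fun x => \sum_l u N l 0 * \sum_k (v N 0 k * (-1) ^+ (l + k)) *
      \det (\sum_(i < N) x i *: (row' l (u i) *m col' k (v i))))).
    move=> x; rewrite mxE; apply: eq_bigr => l _; rewrite mxE mulrC; congr (_ * _).
    apply: eq_bigr => k _; rewrite mxE /cofactor cofactor_sum_rank1 mulrA //.
  apply: (@multiaffine_sum _ _ _ _ (fun l => u N l 0) (fun l x => \sum_k (v N 0 k * (-1) ^+ (l + k)) *
      \det (\sum_(i < N) x i *: (row' l (u i) *m col' k (v i))))) => l.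
  apply: (@multiaffine_sum _ _ _ _ (fun k => v N 0 k * (-1) ^+ (l + k)) (fun k x =>
      \det (\sum_(i < N) x i *: (row' l (u i) *m col' k (v i))))) => k.
  exact: (IH q (fun i => row' l (u i)) (fun i => col' k (v i))).
move=> x; rewrite big_ord_recr /= scalemxAl det_rank1 -scalemxAr mxE //.
Qed.

(** By [adj_rank1] the adjugate may be taken at [x] itself instead of at [x] with the variable [i]
    set to 0. *)
Lemma slope_det N q (u : nat -> 'cV[R]_q) (v : nat -> 'rV[R]_q) x i : (i < N)%N ->
  slope i (fun x => \det (\sum_(n < N) x n *: (u n *m v n))) x =
  (v i *m \adj (\sum_(n < N) x n *: (u n *m v n)) *m u i) 0 0.
Proof.
move=> iN; pose A := \sum_(n < N | n != i :> nat) x n *: (u n *m v n).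
have E c : \sum_(n < N) upd x i c n *: (u n *m v n) = A + c *: (u i *m v i).
  rewrite (bigD1 (Ordinal iN)) //= addrC /upd eqxx; congr (_ + _).
  apply: eq_big => [n|n ni]; first by rewrite -val_eqE.
  by have -> : (nat_of_ord n == i) = false by apply: negbTE.
have E' : \sum_(n < N) x n *: (u n *m v n) = A + x i *: (u i *m v i).
  rewrite -E; apply: eq_bigr => n _; rewrite /upd.
  by case: eqP => // ->.
rewrite /slope !E E' adj_rank1 scale0r addr0 scale1r det_rank1.
by rewrite addrC addKr.
Qed.

End multiaffine.

(** * Moments of functions of finitely many Gaussian variables *)

Section moments.
Context {R : realType}.
Notation m2 := (@normal_m2 R).
Notation m4 := (@normal_m4 R).

(** Measurability is asked along every measurable family, so that it applies to the coordinates of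
    tuples as well as to random variables on any space. *)
Definition cylinder N (G : (nat -> R) -> R) : Prop :=
  (forall x y, (forall i, (i < N)%N -> x i = y i) -> G x = G y) /\
  forall d (T : measurableType d) (g : nat -> T -> R),
    (forall i, (i < N)%N -> measurable_fun setT (g i)) ->
    measurable_fun setT (fun w => G (g ^~ w)).

Lemma cylinderM N G H : cylinder N G -> cylinder N H -> cylinder N (fun x => G x * H x).
Proof.
move=> [h1 h2] [h3 h4]; split => [x y xy|d T g mg]; first by rewrite (h1 _ _ xy) (h3 _ _ xy).
by apply: measurable_funM; [exact: h2|exact: h4].
Qed.

Lemma cylinderX N G k : cylinder N G -> cylinder N (fun x => G x ^+ k).
Proof.
move=> [h1 h2]; split => [x y xy|d T g mg]; first by rewrite (h1 _ _ xy).
by apply: measurable_funX; exact: h2.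
Qed.

Lemma multiaffine_cylinder N q F : multiaffine N q F -> cylinder N F.
Proof.
split=> [x y|]; first exact: (multiaffine_local H).
elim: N q F H => [|N IH] q F /=.
  by move=> [c Fc] d T g _; rewrite (_ : (fun w => _) = cst c) //; apply/funext => w; rewrite Fc.
move=> [a [b [ha hb FE]]] d T g mg.
rewrite (_ : (fun w => _) = (fun w => a (g ^~ w) + g N w * b (g ^~ w))); last first.
  by apply/funext => w; rewrite FE.
have mg' i : (i < N)%N -> measurable_fun setT (g i) by move=> iN; apply: mg; rewrite ltnS ltnW.
apply: measurable_funD; first exact: (IH _ _ ha).
apply: measurable_funM; first exact: mg.
case: q hb {ha} => [b0|q hb]; last exact: (IH _ _ hb).
rewrite (_ : (fun w => _) = cst 0) //; apply/funext => w; by rewrite b0.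
Qed.

Context d (T : measurableType d) (P : probability T R).

Lemma first_terms_cylinder N (g : nat -> T -> R) G w : cylinder N G ->
  G (nth 0 (first_terms N g w)) = G (g ^~ w).
Proof.
move=> [h _]; apply: h => i iN; have := tnth_mktuple (fun i : 'I_N => g i w) (Ordinal iN).
by rewrite (tnth_nth 0).
Qed.

Lemma measurable_cylinder_tuple N G : cylinder N G ->
  measurable_fun setT (fun t : N.-tuple R => G (nth 0 t)).
Proof.
move=> [_ h]; apply: (h _ _ (fun i (t : N.-tuple R) => nth 0 t i)) => i iN.
rewrite (_ : (fun t => _) = (fun t : N.-tuple R => tnth t (Ordinal iN))).
  exact: measurable_tnth.
by apply/funext => t; rewrite (tnth_nth 0).
Qed.

Lemma cylinder_indep N M g G H : gaussian_family P (N + M) g ->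
  cylinder N G -> cylinder M H ->
  indep_rv P (fun w => G (g ^~ w)) (fun w => H (fun i => g (N + i)%N w)).
Proof.
move=> hg cG cH A B mA mB; have := gaussian_family_indep hg => ind.
have mA' : measurable [set t : N.-tuple R | A (G (nth 0 t))].
  rewrite -[X in measurable X]setTI.
  by have /(_ measurableT _ mA) := measurable_cylinder_tuple cG.
have mB' : measurable [set t : M.-tuple R | B (H (nth 0 t))].
  rewrite -[X in measurable X]setTI.
  by have /(_ measurableT _ mB) := measurable_cylinder_tuple cH.
have eA : (fun w => G (g ^~ w)) @^-1` A = first_terms N g @^-1` [set t | A (G (nth 0 t))].
  by apply/seteqP; split => w /=; rewrite first_terms_cylinder.
have eB : (fun w => H (fun i => g (N + i)%N w)) @^-1` B =
    first_terms M (fun i => g (N + i)%N) @^-1` [set t | B (H (nth 0 t))].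
  by apply/seteqP; split => w /=; rewrite (@first_terms_cylinder M (fun i => g (N + i)%N)).
rewrite eA eB; exact: ind.
Qed.

Section top_variable.
Variables (N : nat) (g : nat -> T -> R).
Hypothesis hg : gaussian_family P N.+1 g.

Let gN := gaussian_family_std hg (ltnSn N).
Let L4g : L4 P (g N) := std_normal_L4 gN.

Lemma top_expectation G k : cylinder N G -> (k <= 4)%N ->
  integrable_rv P (fun w => G (g ^~ w)) ->
  integrable_rv P (fun w => G (g ^~ w) * g N w ^+ k) /\
  \int[P]_w (G (g ^~ w) * g N w ^+ k) = \int[P]_w G (g ^~ w) * \int[P]_w (g N w ^+ k).
Proof.
move=> cG k4 iG; apply: indep_expectation => //; last first.
  have one := L4_cst P (1 : R).
  case: k k4 => [|[|[|[|[|//]]]]] _.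
  - exact: (integrable_rv_cst P 1).
  - by apply: integrable_rv_eq (L4_mul2 L4g one) => w; rewrite mulr1.
  - exact: L4_sqr.
  - by apply: integrable_rv_eq (L4_mul L4g L4g L4g one) => w; rewrite mulr1 -expr2 -exprSr.
  - by have [] := L4g.
have hg1 : gaussian_family P (N + 1) g by rewrite addn1.
have cH : cylinder 1 (fun x => x 0%N ^+ k : R).
  split=> [x y ->//|d' T' g' mg']; apply: measurable_funX; exact: mg'.
have := cylinder_indep hg1 cG cH; rewrite addn0; exact.
Qed.

Lemma top_odd k : odd k -> (k <= 4)%N -> \int[P]_w (g N w ^+ k) = 0.
Proof.
move=> ok k4; apply: (std_normal_odd gN ok).
have c1 : cylinder N (fun=> 1 : R) by split => // *; exact: measurable_cst.
have [h _] := top_expectation c1 k4 (integrable_rv_cst P 1).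
by apply: integrable_rv_eq h => w; rewrite mul1r.
Qed.

Variables a b : (nat -> R) -> R.
Hypotheses (ca : cylinder N a) (cb : cylinder N b).
Hypotheses (La : L4 P (fun w => a (g ^~ w))) (Lb : L4 P (fun w => b (g ^~ w))).

Lemma top_L4 : L4 P (fun w => a (g ^~ w) + g N w * b (g ^~ w)).
Proof.
apply: L4D => //; split.
  by apply: measurable_funM; [case: gN|case: Lb].
have [h _] := top_expectation (cylinderX 4 cb) (leqnn 4) Lb.2.
by apply: integrable_rv_eq h => w; rewrite exprMn mulrC.
Qed.

Lemma top_second_moment :
  \int[P]_w ((a (g ^~ w) + g N w * b (g ^~ w)) ^+ 2) =
  \int[P]_w (a (g ^~ w) ^+ 2) + m2 * \int[P]_w (b (g ^~ w) ^+ 2).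
Proof.
have [i1 e1] := top_expectation (cylinderM ca cb) (isT : (1 <= 4)%N) (L4_mul2 La Lb).
have [i2 e2] := top_expectation (cylinderX 2 cb) (isT : (2 <= 4)%N) (L4_sqr Lb).
transitivity (\int[P]_w (a (g ^~ w) ^+ 2 + (2 * (a (g ^~ w) * b (g ^~ w) * g N w ^+ 1)
    + b (g ^~ w) ^+ 2 * g N w ^+ 2))).
  by apply: eq_Rintegral => w _; ring.
rewrite RintegralD //; last 2 first.
- exact: L4_sqr.
- by apply: integrable_rvD => //; exact: integrable_rvZ.
rewrite RintegralD //; last exact: integrable_rvZ.
rewrite RintegralZl // e1 e2 (std_normal_E2 gN) (top_odd (k := 1)) //.
by rewrite mulr0 mulr0 add0r [in RHS]mulrC.
Qed.

Lemma top_fourth_moment :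
  \int[P]_w ((a (g ^~ w) + g N w * b (g ^~ w)) ^+ 4) =
  \int[P]_w (a (g ^~ w) ^+ 4) + 6 * m2 * \int[P]_w (a (g ^~ w) ^+ 2 * b (g ^~ w) ^+ 2)
  + m4 * \int[P]_w (b (g ^~ w) ^+ 4).
Proof.
have iab (j l : 'I_5) : (j + l <= 4)%N ->
    integrable_rv P (fun w => a (g ^~ w) ^+ j * b (g ^~ w) ^+ l).
  have one := L4_cst P (1 : R) => jl.
  (* Every monomial of degree at most four is written as a product of four factors, padded with 1,
     to which [L4_mul] applies. *)
  pose u i : T -> R := if (i < j)%N then fun w => a (g ^~ w)
     else if (i < j + l)%N then fun w => b (g ^~ w) else fun=> 1.
  have Lu i : L4 P (u i) by rewrite /u; do 2 (case: ifP => // _).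
  apply: integrable_rv_eq (L4_mul (Lu 0%N) (Lu 1%N) (Lu 2%N) (Lu 3%N)) => w.
  rewrite /u; case: j l jl {u Lu} => [j jlt] [l llt] /= jl.
  case: j {jlt} jl => [|[|[|[|[|//]]]]]; case: l {llt} => [|[|[|[|[|//]]]]] //= _; ring.
have H (k j l : 'I_5) : (j + l <= 4)%N ->
    integrable_rv P (fun w => a (g ^~ w) ^+ j * b (g ^~ w) ^+ l * g N w ^+ k) /\
    \int[P]_w (a (g ^~ w) ^+ j * b (g ^~ w) ^+ l * g N w ^+ k) =
    \int[P]_w (a (g ^~ w) ^+ j * b (g ^~ w) ^+ l) * \int[P]_w (g N w ^+ k).
  move=> jl; apply: (top_expectation (G := fun x => a x ^+ j * b x ^+ l)).
  - by apply: cylinderM; exact: cylinderX.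
  - by rewrite -ltnS.
  - exact: iab.
have [i1 e1] := H (inord 1) (inord 3) (inord 1) ltac:(by rewrite !inordK).
have [i2 e2] := H (inord 2) (inord 2) (inord 2) ltac:(by rewrite !inordK).
have [i3 e3] := H (inord 3) (inord 1) (inord 3) ltac:(by rewrite !inordK).
have [i4 e4] := H (inord 4) (inord 0) (inord 4) ltac:(by rewrite !inordK).
rewrite !inordK // in i1 e1 i2 e2 i3 e3 i4 e4.
transitivity (\int[P]_w (a (g ^~ w) ^+ 4 + (4 * (a (g ^~ w) ^+ 3 * b (g ^~ w) ^+ 1 * g N w ^+ 1)
    + (6 * (a (g ^~ w) ^+ 2 * b (g ^~ w) ^+ 2 * g N w ^+ 2)
    + (4 * (a (g ^~ w) ^+ 1 * b (g ^~ w) ^+ 3 * g N w ^+ 3)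
    + a (g ^~ w) ^+ 0 * b (g ^~ w) ^+ 4 * g N w ^+ 4))))).
  by apply: eq_Rintegral => w _; ring.
have j1 := integrable_rvZ 4 i1; have j2 := integrable_rvZ 6 i2; have j3 := integrable_rvZ 4 i3.
have k3 := integrable_rvD j3 i4; have k2 := integrable_rvD j2 k3; have k1 := integrable_rvD j1 k2.
have i0 := La.2.
rewrite RintegralD // RintegralD // RintegralD // RintegralD // !RintegralZl //.
rewrite e1 e2 e3 e4 (std_normal_E2 gN) (std_normal_E4 gN) !top_odd //.
rewrite !mulr0 !add0r addrA mulrA; congr (_ + _ + _); first by ring.
by rewrite mulrC; congr (_ * _); apply: eq_Rintegral => w _; rewrite expr0 mul1r.
Qed.

End top_variable.

(** The square of [c = 3 + m4 / m2 ^+ 2]. In the induction step [3 <= c] absorbs the binomial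
    coefficient 6 of the mixed term, and [m4 <= c ^+ 2 * m2 ^+ 2] the last term. *)
Definition hyper_cst : R := (3 + m4 / m2 ^+ 2) ^+ 2.

(* Hypercontractivity, together with an Efron-Stein type bound on the slopes. *)
Lemma multiaffine_moments N q F g : gaussian_family P N g -> multiaffine N q F ->
  [/\ L4 P (fun w => F (g ^~ w)),
      \int[P]_w (F (g ^~ w) ^+ 4) <= hyper_cst ^+ q * (\int[P]_w (F (g ^~ w) ^+ 2)) ^+ 2,
      \int[P]_w (F (g ^~ w) ^+ 2) = 0 -> forall x, F x = 0 &
      m2 * \sum_(i < N) \int[P]_w (slope i F (g ^~ w) ^+ 2) <= q%:R * \int[P]_w (F (g ^~ w) ^+ 2)].
Proof.
have m20 := @normal_m2_gt0 R.
have m40 : 0 <= m4 by apply: Rintegral_ge0 => x _; exact: exprn_even_ge0.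
set c := 3 + m4 / m2 ^+ 2; have c3 : 3 <= c.
  by rewrite lerDl mulr_ge0 // invr_ge0 exprn_ge0 // ltW.
have K0 : 0 <= hyper_cst by exact: sqr_ge0.
have K1 : 1 <= hyper_cst by rewrite /hyper_cst -/c; nra.
have sq0 (f : T -> R) : 0 <= \int[P]_w (f w ^+ 2) by apply: Rintegral_ge0 => w _; exact: sqr_ge0.
elim: N q F => [|N IH] q F hg.
  move=> [e Fe]; rewrite (_ : F = fun=> e); last exact/funext.
  split; [exact: L4_cst| | |].
  - have e4 : e ^+ 4 = (e ^+ 2) ^+ 2 by rewrite -exprM.
    rewrite !Rintegral_prob_cst e4; apply: ler_peMl; first exact: sqr_ge0.
    exact: exprn_ege1.
  - by rewrite Rintegral_prob_cst => /eqP; rewrite sqrf_eq0 => /eqP ->.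
  - by rewrite big_ord0 mulr0 mulr_ge0.
have hgN := gaussian_family_sub (leqnSn N) hg.
have SM q1 q2 a b : multiaffine N q1 a -> multiaffine N q2 b ->
    \int[P]_w ((a (g ^~ w) + g N w * b (g ^~ w)) ^+ 2) =
    \int[P]_w (a (g ^~ w) ^+ 2) + m2 * \int[P]_w (b (g ^~ w) ^+ 2).
  move=> ha hb; apply: top_second_moment => //.
  - exact: multiaffine_cylinder ha.
  - exact: multiaffine_cylinder hb.
  - by have [] := IH _ _ hgN ha.
  - by have [] := IH _ _ hgN hb.
move=> hF; have [a [b [ha hb FE]]] := hF.
have sN x : slope N F x = b x.
  have e k : a (upd x N k) = a x.
    by apply: (multiaffine_local ha) => j jN; rewrite /upd ltn_eqF.
  have e' k : b (upd x N k) = b x.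
    case: q hb {ha hF} => [b0|q hb]; first by rewrite !b0.
    by apply: (multiaffine_local hb) => j jN; rewrite /upd ltn_eqF.
  by rewrite /slope !FE !e !e' /upd eqxx mul0r addr0 mul1r addrC addKr.
have sE i x : (i < N)%N -> slope i F x = slope i a x + x N * slope i b x.
  move=> iN; rewrite /slope !FE /upd (gtn_eqF iN); ring.
case: q hb ha hF => [b0|q hb] ha hF.
  have Fa : F = a by apply/funext => x; rewrite FE b0 mulr0 addr0.
  have [h1 h2 h3 h4] := IH _ _ hgN ha.
  rewrite Fa; split => //; rewrite big_ord_recr /= [X in _ + X](_ : _ = 0) ?addr0 //.
  transitivity (\int[P]_w (0 : R)); last by rewrite Rintegral_prob_cst.
  by apply: eq_Rintegral => w _; rewrite -Fa sN b0 expr0n.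
have [La a4 a0 sa] := IH _ _ hgN ha; have [Lb b4 b0 sb] := IH _ _ hgN hb.
have ca := multiaffine_cylinder ha; have cb := multiaffine_cylinder hb.
have FE' w : F (g ^~ w) = a (g ^~ w) + g N w * b (g ^~ w) by rewrite FE.
have E2 : \int[P]_w (F (g ^~ w) ^+ 2) =
    \int[P]_w (a (g ^~ w) ^+ 2) + m2 * \int[P]_w (b (g ^~ w) ^+ 2).
  by rewrite -(SM _ _ _ _ ha hb); apply: eq_Rintegral => w _; rewrite FE'.
have E4 := top_fourth_moment hg ca cb La Lb.
have CS := expectation_cauchy_schwarz (P := P) (f := fun w => a (g ^~ w) ^+ 2)
  (g := fun w => b (g ^~ w) ^+ 2).
have e22 (h : T -> R) : (fun w => (h w ^+ 2) ^+ 2) = (fun w => h w ^+ 4).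
  by apply/funext => w; rewrite -exprM.
rewrite (e22 (fun w => a (g ^~ w))) (e22 (fun w => b (g ^~ w))) in CS.
have iab : integrable_rv P (fun w => a (g ^~ w) ^+ 2 * b (g ^~ w) ^+ 2).
  by apply: integrable_rv_eq (L4_mul La La Lb Lb) => w; rewrite !expr2.
have {}CS := CS La.2 Lb.2 iab.
have A0 := sq0 (fun w => a (g ^~ w)); have B0 := sq0 (fun w => b (g ^~ w)).
split.
- have h := top_L4 hg cb La Lb.
  suff -> : (fun w => F (g ^~ w)) = (fun w => a (g ^~ w) + g N w * b (g ^~ w)) by [].
  by apply/funext => w; rewrite FE'.
- have -> : \int[P]_w (F (g ^~ w) ^+ 4) = \int[P]_w ((a (g ^~ w) + g N w * b (g ^~ w)) ^+ 4).
    by apply: eq_Rintegral => w _; rewrite FE'.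
  rewrite E4 E2; move: CS a4 b4 A0 B0.
  set A4 := \int[P]_w (a _ ^+ 4); set B4 := \int[P]_w (b _ ^+ 4).
  set A := \int[P]_w (a _ ^+ 2); set B := \int[P]_w (b _ ^+ 2).
  set X := \int[P]_w (_ * _); rewrite [hyper_cst ^+ q.+1]exprSr; set Kq := hyper_cst ^+ q => CS a4 b4 A0 B0.
  have Kq0 : 0 <= Kq by exact: exprn_ge0.
  have KE : hyper_cst = c ^+ 2 by [].
  (* Cauchy-Schwarz with the induction hypotheses for [a] and [b]: their degrees differ by one,
     which leaves a single factor [hyper_cst], whose root is [c]. *)
  have X1 : X <= Kq * c * A * B.
    have r0 : 0 <= Kq * c * A * B by rewrite !mulr_ge0 //; lra.
    have [X0|X0] := leP X 0; first exact: le_trans r0.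
    rewrite -(@ler_pXn2r _ 2) ?nnegrE ?(ltW X0) //.
    apply: (le_trans CS); have B40 : 0 <= B4 by apply: Rintegral_ge0 => w _; exact: exprn_even_ge0.
    apply: (@le_trans _ _ ((Kq * hyper_cst * A ^+ 2) * (Kq * B ^+ 2))).
      apply: ler_pM => //; by apply: Rintegral_ge0 => w _; exact: exprn_even_ge0.
    by rewrite KE le_eqVlt; apply/orP; left; apply/eqP; ring.
  have m4c : m4 <= hyper_cst * m2 ^+ 2.
    have h : m4 = (c - 3) * m2 ^+ 2 by rewrite /c addrC addKr divfK // gt_eqF // exprn_gt0.
    rewrite [leLHS]h ler_wpM2r ?sqr_ge0 // KE; nra.
  have t1 : 6 * m2 * X <= 6 * m2 * (Kq * c * A * B).
    by rewrite ler_wpM2l // mulr_ge0 // ltW.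
  have t2 : m4 * B4 <= hyper_cst * m2 ^+ 2 * (Kq * B ^+ 2).
    apply: ler_pM => //; by apply: Rintegral_ge0 => w _; exact: exprn_even_ge0.
  have t3 : 6 * m2 * (Kq * c * A * B) <= 2 * m2 * (Kq * hyper_cst * A * B).
    have -> : 2 * m2 * (Kq * hyper_cst * A * B) = 2 * c * (m2 * (Kq * c * A * B)).
      by rewrite KE; ring.
    have : 0 <= m2 * (Kq * c * A * B) by rewrite !mulr_ge0 //; lra.
    nra.
  have -> : Kq * hyper_cst * (A + m2 * B) ^+ 2 = Kq * hyper_cst * A ^+ 2 +
    2 * m2 * (Kq * hyper_cst * A * B) + hyper_cst * m2 ^+ 2 * (Kq * B ^+ 2) by ring.
  lra.
- rewrite E2 => e0 x; rewrite FE.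
  have m2B : 0 <= m2 * \int[P]_w (b (g ^~ w) ^+ 2) by rewrite mulr_ge0 // ltW.
  have B1 : \int[P]_w (b (g ^~ w) ^+ 2) = 0.
    by apply/eqP; have : m2 * \int[P]_w (b (g ^~ w) ^+ 2) == 0 by [apply/eqP; lra];
      rewrite mulf_eq0 (gt_eqF m20).
  rewrite (b0 B1) mulr0 addr0; apply: a0; move: e0; rewrite B1 mulr0; lra.
- rewrite big_ord_recr /= (_ : \int[P]_w (slope N F _ ^+ 2) = \int[P]_w (b (g ^~ w) ^+ 2)); last first.
    by apply: eq_Rintegral => w _; rewrite sN.
  under eq_bigr => i _.
    rewrite (_ : \int[P]_w _ = \int[P]_w (slope i a (g ^~ w) ^+ 2) +
        m2 * \int[P]_w (slope i b (g ^~ w) ^+ 2)); last first.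
      rewrite -(SM _ _ _ _ (multiaffine_slope i ha) (multiaffine_slope i hb)).
      by apply: eq_Rintegral => w _; rewrite sE.
    over.
  rewrite /= big_split /= -mulr_sumr E2 -(natr1 q).
  (* The slopes of [b] account for [q] times its share of the second moment, and [b] itself, the
     slope in the last variable, for once more. *)
  have : m2 * (m2 * \sum_(i < N) \int[P]_w slope i b (g^~ w) ^+ 2) <= m2 * (q%:R * \int[P]_w b (g^~ w) ^+ 2).
    by rewrite ler_pM2l.
  move: sa; rewrite -(natr1 q); nra.
Qed.

End moments.

(** * Gaussian families made of Brownian increments *)

Section brownian_families.
Context {R : realType}.

(** The variant for index types such as pairs of a coordinate and a time interval;
    [gaussian_fin_family] enumerates it. *)
Definition gaussian_fin d (T : measurableType d) (P : probability T R) (I : finType)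
    (g : I -> T -> R) : Prop :=
  (forall i, measurable_fun setT (g i)) /\
  forall A : I -> set R, (forall i, measurable (A i)) ->
    P [set w | forall i, A i (g i w)] = (\prod_i normal_prob 0 1 (A i))%E.

Lemma gaussian_fin_family d (T : measurableType d) (P : probability T R) (I : finType)
    (g : I -> T -> R) M (f : nat -> I) :
  (forall i j, (i < M)%N -> (j < M)%N -> f i = f j -> i = j) ->
  gaussian_fin P g -> gaussian_family P M (fun i => g (f i)).
Proof.
move=> fi [mg h]; split=> [i iM|A mA]; first exact: mg.
pose B j := if [pick i : 'I_M | f i == j] is Some i then A i else setT.
have Bf i : (i < M)%N -> B (f i) = A i.
  move=> iM; rewrite /B; case: pickP => [k /eqP /fi -> //|/(_ (Ordinal iM))].
  by rewrite eqxx.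
rewrite (_ : [set w | _] = [set w | forall i, B i (g i w)]).
  rewrite h; last by move=> i; rewrite /B; case: pickP.
  pose F (i : 'I_M) := f i.
  have Fi : injective F by move=> i j /fi e; apply/val_inj/e.
  rewrite (bigID (fun j => j \in [set F i | i in 'I_M]%SET)) /= [X in (_ * X)%E]big1 ?mule1.
    rewrite big_imset /=; last by move=> i j _ _; exact: Fi.
    by apply: eq_bigr => i _; rewrite Bf.
  move=> j jn; rewrite /B; case: pickP => [i /eqP e|]; last by rewrite probability_setT.
  by case/imsetP: jn; exists i.
apply/seteqP; split => w /= hw i.
  rewrite /B; case: pickP => // k /eqP <-; exact: hw.
by move=> iM; rewrite -(Bf _ iM); apply: hw.
Qed.

Lemma bigsetI_forall (T : Type) (I : eqType) (J : seq I) (F : I -> set T) :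
  \big[setI/setT]_(i <- J) F i = [set w | forall i, i \in J -> F i w].
Proof.
elim: J => [|i J IH]; first by rewrite big_nil; apply/seteqP; split.
rewrite big_cons IH; apply/seteqP; split => w /=.
  by move=> [h1 h2] j; rewrite in_cons => /orP[/eqP ->//|/h2].
move=> h; split; first by apply: h; rewrite mem_head.
by move=> j jJ; apply: h; rewrite in_cons jJ orbT.
Qed.

Lemma brownian_gaussian_fin d (T : measurableType d) (P : probability T R) p
    (B : R -> T -> 'cV[R]_p) n (s : nat -> R) : brownian_motion P B ->
  0 <= s 0%N -> s n <= 1 -> (forall i, (i < n)%N -> s i < s i.+1) ->
  gaussian_fin P (fun (ki : 'I_p * 'I_n) w =>
    (B (s ki.2.+1) w ki.1 0 - B (s ki.2) w ki.1 0) / Num.sqrt (s ki.2.+1 - s ki.2)).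
Proof.
move=> [_ _ _ hnorm hind] s0 sn smono.
have sinc i j : (i <= j <= n)%N -> s i <= s j.
  move=> /andP[]; elim: j => [|j IH]; first by rewrite leqn0 => /eqP ->.
  rewrite leq_eqVlt => /orP[/eqP -> //|ij] jn.
  by apply: le_trans (IH ij (ltnW jn)) _; exact/ltW/smono.
have hn (ki : 'I_p * 'I_n) : is_normal P 0 (s ki.2.+1 - s ki.2)
    (fun w => B (s ki.2.+1) w ki.1 0 - B (s ki.2) w ki.1 0).
  apply: hnorm; [|exact: smono|].
    by apply: le_trans s0 _; apply: sinc; rewrite leq0n ltnW.
  by apply: le_trans sn; apply: sinc; rewrite leqnn ltn_ord.
have sd (ki : 'I_p * 'I_n) : 0 < Num.sqrt (s ki.2.+1 - s ki.2).
  by rewrite sqrtr_gt0 subr_gt0; exact: smono.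
split=> [ki|A mA].
  by apply: measurable_funM => //; have [] := hn ki.
pose A' ki : set R := [set x | A ki ((Num.sqrt (s ki.2.+1 - s ki.2))^-1 * x)].
have mA' ki : measurable (A' ki).
  by rewrite -[X in measurable X]setTI; apply: (mulrl_measurable _).
have := hind n s s0 sn (fun i h => ltW (smono i h)) (enum {: 'I_p * 'I_n}) A' (enum_uniq _) mA'.
rewrite bigsetI_forall big_enum /= => h; rewrite [LHS](_ : _ = P [set w | forall i : 'I_p * 'I_n,
    i \in enum {: 'I_p * 'I_n} -> A' i (B (s i.2.+1) w i.1 0 - B (s i.2) w i.1 0)]).
  rewrite h; apply: eq_bigr => ki _; have k0 := sd ki.
  have k1 : (Num.sqrt (s ki.2.+1 - s ki.2))^-1 != 0 by rewrite invr_eq0 gt_eqF.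
  apply: etrans ((hn ki).2 _ (mA' ki)) _; apply: etrans (normal_prob_scale k1 k0 (mA ki)) _.
  have k2 : 0 <= (Num.sqrt (s ki.2.+1 - s ki.2))^-1 by rewrite invr_ge0 ltW.
  by rewrite (ger0_norm k2) (mulVf (negbT (gt_eqF k0))).
congr (P _); apply/seteqP; split => w /= hw i; first by move=> _; rewrite /A' /= mulrC.
by have := hw i; rewrite mem_enum => /(_ isT); rewrite /A' /= mulrC.
Qed.

Lemma gaussian_family_ext d (T : measurableType d) (P : probability T R) N
    (g g' : nat -> T -> R) : (forall i, (i < N)%N -> g i = g' i) ->
  gaussian_family P N g -> gaussian_family P N g'.
Proof.
move=> e [mg h]; split=> [i iN|A mA]; first by rewrite -e //; exact: mg.
rewrite -h //; congr (P _); apply/seteqP; split => w /= hw i iN.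
  by rewrite e //; exact: hw.
by rewrite -e //; exact: hw.
Qed.

Lemma brownian_increments d (T : measurableType d) (P : probability T R) p
    (W : R -> T -> 'cV[R]_p) (k : 'I_p) n (s : nat -> R) : brownian_motion P W ->
  0 <= s 0%N -> s n <= 1 -> (forall i, (i < n)%N -> s i < s i.+1) ->
  gaussian_family P n (fun i w => (W (s i.+1) w k 0 - W (s i) w k 0) / Num.sqrt (s i.+1 - s i)).
Proof.
move=> hW s0 sn smono; case: n sn smono => [|n] sn smono.
  split=> // A _; rewrite big_ord0 (_ : [set w | _] = setT) ?probability_setT //.
  by apply/seteqP; split.
have hg := brownian_gaussian_fin hW s0 sn smono.
have inj i j : (i < n.+1)%N -> (j < n.+1)%N ->
    (k, inord i : 'I_n.+1) = (k, inord j) -> i = j.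
  by move=> iN jN [] /(congr1 (@nat_of_ord _)); rewrite !inordK.
apply: gaussian_family_ext (gaussian_fin_family inj hg) => i iN.
by apply/funext => w /=; rewrite inordK.
Qed.

(* Independent families add up to a gaussian family, because a Brownian motion
   realises both sides of the identity. *)
Lemma gaussian_family_combine d (T : measurableType d) (P : probability T R) p
    (W : R -> T -> 'cV[R]_p.+1) d' (T' : measurableType d') (Q : probability T' R)
    m N (b : nat -> R) (x : nat -> T' -> R) :
  brownian_motion P W -> (0 < N)%N -> (0 < m)%N -> (forall a, 0 < b a) ->
  gaussian_family Q (m * N) x ->
  gaussian_family Q N (fun i w =>
    (\sum_(a < m) b a * x (a * N + i)%N w) / Num.sqrt (\sum_(a < m) b a ^+ 2)).
Proof.
move=> hW N0 m0 b0 hx; set S := \sum_(a < m) b a ^+ 2.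
have S0 : 0 < S.
  rewrite /S; case: m m0 {hx S} => // m _; rewrite big_ord_recl /= ltr_pwDl ?exprn_gt0 //.
  by apply: sumr_ge0 => i _; exact: sqr_ge0.
have NR : (0 : R) < N%:R by rewrite ltr0n.
(* Lengths of time cells: [[0, 1]] is cut into [N] blocks of length [1 / N], and each block into [m]
   cells of lengths proportional to [b a ^+ 2]. Weighting the normalised increments of a block by
   [b] gives its whole increment up to a constant. *)
pose c l := b (l %% m)%N ^+ 2 / (S * N%:R).
have c0 l : 0 < c l by rewrite divr_gt0 ?exprn_gt0 // mulr_gt0.
pose t j := \sum_(l < j) c l.
have tS j : t j.+1 = t j + c j by rewrite /t big_ord_recr.
have tim i a : (a <= m)%N -> t (i * m + a)%N = t (i * m)%N + (\sum_(a' < a) b a' ^+ 2) / (S * N%:R).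
  elim: a => [_|a IH am]; first by rewrite addn0 big_ord0 mul0r addr0.
  rewrite addnS tS IH ?(ltnW am) // big_ord_recr /= mulrDl addrA; congr (_ + _ / _).
  by rewrite modnMDl modn_small.
have ti i : t (i * m)%N = i%:R / N%:R.
  elim: i => [|i IH]; first by rewrite mul0n /t big_ord0 mul0r.
  rewrite mulSn addnC tim // IH -/S -natr1 mulrDl; congr (_ + _).
  by rewrite invfM mulrA mulfV ?gt_eqF.
have t1 : t (N * m)%N <= 1 by rewrite ti divff // gt_eqF.
have tmono l : (l < N * m)%N -> t l < t l.+1 by move=> _; rewrite tS ltrDl.
have t00 : 0 <= t 0%N by rewrite /t big_ord0.
have hinc := brownian_increments 0 hW t00 t1 tmono.
(* Variable [i] of copy [a] is the increment over cell [a] of block [i]. *)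
pose z n w := let l := ((n %% N) * m + n %/ N)%N in (W (t l.+1) w 0 0 - W (t l) w 0 0) / Num.sqrt (t l.+1 - t l).
have hz : gaussian_family P (m * N) z.
  apply: (gaussian_family_reindex (f := fun n => ((n %% N) * m + n %/ N)%N) _ _ hinc).
    move=> n nm; have h1 : (n %% N < N)%N by rewrite ltn_mod.
    have h2 : (n %/ N < m)%N by rewrite ltn_divLR.
    by apply: leq_trans (_ : ((n %% N).+1 * m <= _)%N); [rewrite mulSn addnC ltn_add2r|rewrite leq_mul2r h1 orbT].
  move=> n n' nm nm' e.
  have h1 : (n %/ N < m)%N by rewrite ltn_divLR.
  have h2 : (n' %/ N < m)%N by rewrite ltn_divLR.
  have e1 := congr1 (fun k => k %/ m)%N e; have e2 := congr1 (fun k => k %% m)%N e.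
  rewrite !divnMDl // (divn_small h1) (divn_small h2) !addn0 in e1; rewrite !modnMDl (modn_small h1) (modn_small h2) in e2.
  by rewrite (divn_eq n N) (divn_eq n' N) e1 e2.
pose u i := t (i * m)%N.
have hu : gaussian_family P N (fun i w => (W (u i.+1) w 0 0 - W (u i) w 0 0) / Num.sqrt (u i.+1 - u i)).
  apply: brownian_increments hW _ _ _; rewrite /u ?ti ?mul0r // ?divff ?gt_eqF //.
  by move=> i _; rewrite !ti ltr_pM2r ?invr_gt0 // ltr_nat.
have comb i w : (i < N)%N -> (\sum_(a < m) b a * z (a * N + i)%N w) / Num.sqrt S =
    (W (u i.+1) w 0 0 - W (u i) w 0 0) / Num.sqrt (u i.+1 - u i).
  move=> iN; have tel a : (a <= m)%N -> \sum_(a' < a) b a' * z (a' * N + i)%N w =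
      (W (t (i * m + a)%N) w 0 0 - W (u i) w 0 0) * Num.sqrt (S * N%:R).
    elim: a => [_|a IH am]; first by rewrite big_ord0 addn0 subrr mul0r.
    rewrite big_ord_recr /= IH ?(ltnW am) // /z modnMDl modn_small // divnMDl // divn_small // addn0.
    have -> : t (i * m + a).+1 - t (i * m + a)%N = b a ^+ 2 / (S * N%:R).
      by rewrite tS addrC addKr /c modnMDl modn_small.
    have -> : Num.sqrt (b a ^+ 2 / (S * N%:R)) = b a / Num.sqrt (S * N%:R).
      by rewrite sqrtrM ?sqr_ge0 // sqrtr_sqr gtr0_norm // sqrtrV // mulr_ge0 ?ltW.
    rewrite addnS invf_div; have ba := b0 a; move: (Num.sqrt _) => k.
    by field; rewrite gt_eqF.
  rewrite tel // -[X in (_ * _ / _) = (W X _ _ _ - _) / _]/(t _) {2}/u mulSn [(m + _)%N]addnC -mulrA; congr (_ * _).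
  rewrite /u !ti -mulrBl -natr1 addrC addKr mul1r sqrtrV ?ltW // invrK sqrtrM ?ltW //.
  by rewrite mulrAC mulfV ?mul1r // gt_eqF // sqrtr_gt0.
have mx := hx.1; split=> [i iN|A mA].
  apply: measurable_funM => //; apply: measurable_sum => a.
  apply: measurable_funM => //; apply: mx.
  by apply: leq_trans (_ : (a.+1 * N <= _)%N); [rewrite mulSn addnC ltn_add2r|rewrite leq_mul2r (ltn_ord a) orbT].
(* The event is expressed as a set of tuples, so that [x] may be exchanged for the Brownian family
   [z] with the same law. *)
pose G (v : (m * N).-tuple R) i := (\sum_(a < m) b a * nth 0 v (a * N + i)%N) / Num.sqrt S.
have mnth j : measurable_fun setT (fun v : (m * N).-tuple R => nth 0 v j).
  have [jN|jN] := ltnP j (m * N).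
    rewrite (_ : (fun v => _) = (fun v : (m * N).-tuple R => tnth v (Ordinal jN))).
      exact: measurable_tnth.
    by apply/funext => v; rewrite (tnth_nth 0).
  rewrite (_ : (fun v => _) = cst 0); first exact: measurable_cst.
  by apply/funext => v; rewrite nth_default // size_tuple.
pose X : set ((m * N).-tuple R) := [set v | forall i : 'I_N, A i (G v i)].
have mX : measurable X.
  rewrite (_ : X = \bigcap_(i in [set: 'I_N]) ((fun v => G v i) @^-1` A i)).
    apply: fin_bigcap_measurable => [|i _]; first exact: finite_finset.
    rewrite -[Y in measurable Y]setTI; apply: (_ : measurable_fun setT (fun v => G v i)) => //.
    by apply: measurable_funM => //; apply: measurable_sum => a; apply: measurable_funM.
  by apply/seteqP; split => v hv; [move=> i _; exact: hv|move=> i; exact: (hv i I)].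
have GX d0 (T0 : measurableType d0) (y : nat -> T0 -> R) : first_terms (m * N) y @^-1` X =
    [set w | forall i, (i < N)%N -> A i ((\sum_(a < m) b a * y (a * N + i)%N w) / Num.sqrt S)].
  have e w i : (i < N)%N -> G (first_terms (m * N) y w) i =
      (\sum_(a < m) b a * y (a * N + i)%N w) / Num.sqrt S.
    move=> iN; rewrite /G; congr (_ / _); apply: eq_bigr => a _; congr (_ * _).
    have aN : (a * N + i < m * N)%N.
      by apply: leq_trans (_ : (a.+1 * N <= _)%N); [rewrite mulSn addnC ltn_add2r|rewrite leq_mul2r (ltn_ord a) orbT].
    by rewrite -[(a * N + i)%N]/(nat_of_ord (Ordinal aN)) -tnth_nth tnth_mktuple.
  apply/seteqP; split => w /= h i; first by move=> iN; rewrite -e //; exact: (h (Ordinal iN)).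
  by rewrite e //; exact: h.
rewrite -GX (gaussian_family_law hx hz mX) GX -hu.2 //; congr (P _).
by apply/seteqP; split => w /= h i iN; [rewrite -comb //|rewrite comb //]; exact: h.
Qed.

End brownian_families.

(** * Anti-concentration of determinants *)

Section interpolation.
Context {R : realType}.

(* Newton's divided differences: subtracting [p.[x]] and dividing by ['X - x]
   at most doubles the values at the other nodes. *)
Lemma poly_interpolation_bound (L e a : R) (s : seq R) (p : {poly R}) :
  0 <= e -> 0 <= L -> pairwise (fun x y => 1 <= `|x - y|) s ->
  (forall x, x \in s -> `|a - x| <= L) -> (size p <= size s)%N ->
  (forall x, x \in s -> `|p.[x]| <= e) ->
  `|p.[a]| <= (1 + 2 * L) ^+ size s * e.
Proof.
move=> e0 L0; elim: s e e0 p => [|x s IH] e e0 p /=.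
  by move=> _ _; rewrite leqn0 size_poly_eq0 => /eqP -> _; rewrite horner0 normr0 mul1r.
move=> /andP[xs ps] hL szp hp; have /factor_theorem[p1 pE] : root (p - p.[x]%:P) x.
  by rewrite /root !hornerE subrr.
have {}pE : p = p1 * ('X - x%:P) + p.[x]%:P by rewrite -pE subrK.
have px : `|p.[x]| <= e by apply: hp; rewrite mem_head.
have sz1 : (size p1 <= size s)%N.
  have [->|p10] := eqVneq p1 0; first by rewrite size_poly0.
  have := szp; rewrite pE size_polyDl; last first.
    rewrite size_Mmonic ?monicXsubC // size_XsubC addn2 /=.
    by apply: leq_ltn_trans (size_polyC_leq1 _) _; rewrite ltnS size_poly_gt0.
  by rewrite size_Mmonic ?monicXsubC // size_XsubC addn2.
have h1 : `|p1.[a]| <= (1 + 2 * L) ^+ size s * (2 * e).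
  apply: IH => // [|y ys|y ys]; first by rewrite mulr_ge0.
    by apply: hL; rewrite in_cons ys orbT.
  have py : `|p.[y]| <= e by apply: hp; rewrite in_cons ys orbT.
  have d1 : 1 <= `|x - y| by move/allP: xs => /(_ _ ys).
  have : p1.[y] * (y - x) = p.[y] - p.[x] by rewrite {1}pE !hornerE addrK.
  move=> /(congr1 (fun z => `|z|)); rewrite normrM [`|y - x|]distrC => E1.
  apply: le_trans (_ : `|p1.[y]| * `|x - y| <= _); first by rewrite ler_peMr.
  by rewrite E1; apply: le_trans (ler_normB _ _) _; lra.
rewrite pE !hornerE; apply: le_trans (ler_normD _ _) _; rewrite normrM.
have aL : `|a - x| <= L by apply: hL; rewrite mem_head.
have pow1 : 1 <= (1 + 2 * L) ^+ size s by rewrite exprn_ege1 // lerDl mulr_ge0.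
apply: le_trans (lerD (ler_pM _ _ h1 aL) px) _ => //.
rewrite exprS; move: pow1; set c := _ ^+ _ => c1.
by have : e <= c * e by [rewrite ler_peMl]; nra.
Qed.

(* These weights separate the points 0, ..., m-1. *)
Definition node_weight (m a : nat) (x : R) : R := \prod_(b < m | b != a :> nat) (x - b%:R) ^+ 2.

Lemma node_weight_ge1 m a n : (m <= n)%N -> 1 <= node_weight m a n%:R.
Proof.
move=> mn; rewrite /node_weight; elim/big_ind: _ => // [x y|b _]; first exact: mulr_ege1.
rewrite exprn_ege1 //; have bm := ltn_ord b.
by rewrite -natrB ?ler1n ?subn_gt0 ?(leq_trans bm) // ltnW // (leq_trans bm).
Qed.

Lemma node_weight_self m a : (a < m)%N -> 1 <= node_weight m a a%:R.
Proof.
move=> am; rewrite /node_weight; elim/big_ind: _ => // [x y|b ba]; first exact: mulr_ege1.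
rewrite -real_normK ?num_real // exprn_ege1 //.
have [ab|ab] := ltnP a b.
  by rewrite distrC -natrB ?(ltnW ab) // normr_nat ler1n subn_gt0.
have {}ab : (b < a)%N by rewrite ltn_neqAle ba.
by rewrite -natrB ?(ltnW ab) // normr_nat ler1n subn_gt0.
Qed.

Lemma node_weight_other m a b : (b < m)%N -> b != a -> node_weight m a b%:R = 0.
Proof.
move=> bm ba; rewrite /node_weight (bigD1 (Ordinal bm)) //=.
by rewrite subrr expr0n mul0r.
Qed.

(** Along the curve the determinant is a polynomial of degree at most [q * (m * 2)], so smallness at
    one more node than this degree bounds it at every point of the range. At the point [a] all
    matrices but [Y a] drop out, and the remaining weight is at least 1. *)
Lemma det_node_weight_bound m K q (Y : nat -> 'M[R]_q) (s : seq nat) e a :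
  0 <= e -> uniq s -> (forall n, n \in s -> (m <= n < m + K)%N) ->
  size s = (q * (m * 2)).+1 -> (a < m)%N ->
  (forall n, n \in s -> `|\det (\sum_(b < m) node_weight m b n%:R *: Y b)| <= e) ->
  `|\det (Y a)| <= (1 + 2 * (m + K)%:R) ^+ (q * (m * 2)).+1 * e.
Proof.
move=> e0 us hs szs am hdet.
pose w b : {poly R} := \prod_(c < m | c != b :> nat) ('X - (c%:R)%:P) ^+ 2.
have wE b x : (w b).[x] = node_weight m b x.
  by rewrite horner_prod; apply: eq_bigr => c _; rewrite !hornerE.
have szw b : (size (w b) <= (m * 2).+1)%N.
  apply: leq_trans (size_prod_leq _ _) _.
  rewrite (eq_bigr (fun=> 3%N)); last by move=> c _; rewrite size_exp_XsubC.
  rewrite sum_nat_const -/(#|_|); set k := #|_|; have : (k <= m)%N.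
    by rewrite /k -[X in (_ <= X)%N]card_ord max_card.
  lia.
pose A : 'M[{poly R}]_q := \matrix_(k, l) \sum_(b < m) w b * (Y b k l)%:P.
have szA k l : (size (A k l) <= (m * 2).+1)%N.
  rewrite mxE; apply: leq_trans (size_sum _ _ _) _; apply/bigmax_leqP => b _.
  apply: leq_trans (size_polyMleq _ _) _; have := szw b; have := size_polyC_leq1 (Y b k l).
  by move: (size _) (size _) => x y; lia.
have szdet : (size (\det A) <= (q * (m * 2)).+1)%N.
  rewrite /determinant; apply: leq_trans (size_sum _ _ _) _; apply/bigmax_leqP => sg _.
  rewrite (_ : size _ = size (\prod_(i < q) A i (sg i))); last first.
    by case: (odd_perm sg); rewrite /= ?expr0 ?mul1r ?expr1 ?mulN1r ?size_polyN.
  apply: leq_trans (size_prod_leq _ _) _; rewrite cardT size_enum_ord.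
  have : (\sum_(i < q) size (A i (sg i)) <= \sum_(i < q) (m * 2).+1)%N by apply: leq_sum.
  rewrite sum_nat_const cardT size_enum_ord; set t := (\sum_(_ < _) _)%N; nia.
have detE x : (\det A).[x] = \det (\sum_(b < m) node_weight m b x *: Y b).
  rewrite -[LHS]/(horner_eval x _) -det_map_mx; congr (\det _); apply/matrixP => k l.
  rewrite !mxE summxE /= /horner_eval horner_sum; apply: eq_bigr => b _.
  by rewrite !hornerE wE mxE.
have aE : (\det A).[a%:R] = node_weight m a a%:R ^+ q * \det (Y a).
  rewrite detE (bigD1 (Ordinal am)) //= big1 ?addr0 ?detZ // => b ba.
  by rewrite node_weight_other ?scale0r // eq_sym.
have h := @poly_interpolation_bound (m + K)%:R e a%:R [seq n%:R | n <- s] (\det A) e0 (ler0n _ _).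
apply: (@le_trans _ _ `|(\det A).[a%:R]|).
  rewrite aE normrM ler_peMl // ger0_norm ?exprn_ege1 ?exprn_ge0 ?node_weight_self //.
  by apply: le_trans (node_weight_self am).
rewrite -szs -(size_map (fun n => n%:R : R)); apply: h.
- rewrite pairwise_map; apply: sub_pairwise (_ : pairwise (fun x y => x != y) s); last first.
    by rewrite -uniq_pairwise.
  move=> x y xy /=; have [xy'|xy'|/eqP] := ltngtP x y; last by rewrite (negPf xy).
    by rewrite distrC -natrB ?(ltnW xy') // normr_nat ler1n subn_gt0.
  by rewrite -natrB ?(ltnW xy') // normr_nat ler1n subn_gt0.
- move=> _ /mapP[n /hs /andP[mn nK] ->]; have an : (a <= n)%N by lia.
  by rewrite distrC -natrB // normr_nat ler_nat; lia.
- by rewrite size_map szs.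
- by move=> _ /mapP[n ns ->]; rewrite detE; exact: hdet.
Qed.

End interpolation.

(** * The small ball estimate for a determinant *)

Section anticoncentration.
Context {R : realType}.

Section space.
Context d (T : measurableType d) (P : probability T R).

Lemma integrable_rv_indic (A : set T) : measurable A -> integrable_rv P (\1_A : T -> R).
Proof.
move=> mA; apply: (integrable_rv_le _ (integrable_rv_cst P 1)) => [|w].
  exact: measurable_indic.
by rewrite ger0_norm ?ler0n // lern1 leq_b1.
Qed.

Lemma Rintegral_indicE (A : set T) : measurable A ->
  \int[P]_w (\1_A w : R) = fine (P A).
Proof. by move=> mA; rewrite /Rintegral integral_indic // setIT. Qed.

(* Paley-Zygmund. *)
Lemma prob_small_le f (C : R) : L4 P f -> 0 < C ->
  \int[P]_w (f w ^+ 4) <= C * (\int[P]_w (f w ^+ 2)) ^+ 2 -> 0 < \int[P]_w (f w ^+ 2) ->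
  (P [set w | (f w ^+ 2 <= (\int[P]_w (f w ^+ 2)) / 2)%R] <= (1 - (4 * C)^-1)%:E)%E.
Proof.
move=> hf C0; have [mf _] := hf; set mu := \int[P]_w (f w ^+ 2) => h4 mu0.
set A := [set w | _]; have mA : measurable A.
  rewrite (_ : A = (fun w => f w ^+ 2) @^-1` `]-oo, mu / 2]).
    by rewrite -[X in measurable X]setTI; apply: (measurable_funX 2 mf).
  by apply/seteqP; split => w /=; rewrite in_itv.
have mA' := measurableC mA; have i2 := L4_sqr hf.
have iA := integrable_rv_indic mA'.
have sq w : (\1_(~` A) w : R) ^+ 2 = \1_(~` A) w.
  by rewrite indicE; case: (_ \in _); rewrite ?expr1n ?expr0n.
have i4 : integrable_rv P (fun w => (f w ^+ 2) ^+ 2).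
  by apply: integrable_rv_eq hf.2 => w; rewrite -exprM.
have iA2 : integrable_rv P (fun w => (\1_(~` A) w : R) ^+ 2).
  by apply: integrable_rv_eq iA => w; rewrite sq.
have i2A : integrable_rv P (fun w => f w ^+ 2 * \1_(~` A) w).
  apply: (integrable_rv_le _ i2) => [|w].
    by apply: measurable_funM; [exact: measurable_funX|exact: measurable_indic].
  by rewrite indicE; case: (_ \in _); rewrite ?mulr1 ?mulr0 ?normr0 ?ger0_norm ?sqr_ge0.
have cs := expectation_cauchy_schwarz i4 iA2 i2A.
(* On [A] the square is at most [mu / 2], hence at least half of the second moment sits on the
   complement; Cauchy-Schwarz bounds that half by the fourth moment and the probability of the
   complement. *)
have le1 : mu <= mu / 2 + \int[P]_w (f w ^+ 2 * \1_(~` A) w).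
  rewrite -[mu / 2](Rintegral_prob_cst P) -RintegralD //; last exact: integrable_rv_cst.
  apply: le_Rintegral => //; first by apply: integrable_rvD => //; exact: integrable_rv_cst.
  move=> w _; rewrite indicE; case: (pselect (A w)) => Aw.
    by rewrite memNset ?mulr0 ?addr0 //= => /(_ Aw).
  by rewrite mem_set // mulr1 lerDr divr_ge0 // ltW.
have E4 : \int[P]_w ((f w ^+ 2) ^+ 2) = \int[P]_w (f w ^+ 4).
  by congr fine; apply: eq_integral => w _; rewrite -exprM.
have EA : \int[P]_w ((\1_(~` A) w : R) ^+ 2) = fine (P (~` A)).
  rewrite -(Rintegral_indicE mA'); congr fine; apply: eq_integral => w _; by rewrite sq.
rewrite E4 EA in cs; set J := \int[P]_w (f w ^+ 2 * _) in cs le1.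
have p0 : 0 <= fine (P (~` A)) by rewrite fine_ge0.
have : (4 * C)^-1 <= fine (P (~` A)).
  rewrite -[X in X <= _]mul1r ler_pdivrMr ?mulr_gt0 //.
  have h5 : (mu / 2) ^+ 2 <= C * mu ^+ 2 * fine (P (~` A)).
    apply: le_trans (_ : J ^+ 2 <= _); first by apply: lerXn2r; rewrite ?nnegrE; lra.
    by apply: le_trans cs _; rewrite ler_wpM2r.
  have mu2 : 0 < mu ^+ 2 by rewrite exprn_gt0.
  by move: h5 mu2; rewrite exprMn; move: (mu ^+ 2) => k; nra.
rewrite probability_setC //; have [a ->] : exists a, P A = a%:E.
  by exists (fine (P A)); rewrite fineK // fin_num_measure.
by rewrite lee_fin /=; lra.
Qed.

Lemma cylinder_block N m a (G : (nat -> R) -> R) : (a < m)%N -> cylinder N G ->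
  cylinder (m * N) (fun y => G (fun i => y (a * N + i)%N)).
Proof.
move=> am [h1 h2]; have aN i : (i < N)%N -> (a * N + i < m * N)%N.
  move=> iN; apply: leq_trans (_ : (a.+1 * N <= _)%N); last by rewrite leq_mul2r am orbT.
  by rewrite mulSn addnC ltn_add2r.
split=> [x y xy|d' T' g mg]; first by apply: h1 => i /aN; exact: xy.
by apply: (h2 _ _ (fun i => g (a * N + i)%N)) => i /aN; exact: mg.
Qed.

Lemma measurable_blocks_le N m (G : (nat -> R) -> R) (c : R) x : cylinder N G ->
  (forall i, (i < m * N)%N -> measurable_fun setT (x i)) ->
  measurable [set w : T | forall a, (a < m)%N -> G (fun i => x (a * N + i)%N w) <= c].
Proof.
move=> cG mx; rewrite (_ : [set _ | _] =
    \bigcap_(a in [set: 'I_m]) [set w | G (fun i => x (a * N + i)%N w) <= c]); last first.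
  apply/seteqP; split => w /= h a; first by move=> _; exact: h.
  by move=> am; exact: (h (Ordinal am) I).
apply: fin_bigcap_measurable => [|a _]; first exact: finite_finset.
have ma := (cylinder_block (ltn_ord a) cG).2 _ _ x mx.
rewrite (_ : [set _ | _] = (fun w => G (fun i => x (a * N + i)%N w)) @^-1` `]-oo, c]).
  by rewrite -[X in measurable X]setTI; exact: ma.
by apply/seteqP; split => w /=; rewrite in_itv.
Qed.

(* The m blocks are independent copies. *)
Lemma prob_blocks_le N m (G : (nat -> R) -> R) (c p : R) x : cylinder N G ->
  (forall g, gaussian_family P N g -> (P [set w | (G (g ^~ w) <= c)%R] <= p%:E)%E) ->
  gaussian_family P (m * N) x ->
  (P [set w | forall a, (a < m)%N -> (G (fun i => x (a * N + i)%N w) <= c)%R] <= (p ^+ m)%:E)%E.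
Proof.
move=> cG hp; elim: m x => [|m IH] x hx.
  rewrite expr0; apply: probability_le1; apply: measurable_blocks_le cG _ => i; by rewrite mul0n.
rewrite mulSn in hx; have hN := gaussian_family_sub (leq_addr _ _) hx.
have hM : gaussian_family P (m * N) (fun i => x (N + i)%N).
  by apply: gaussian_family_reindex hx => [i iM|i j _ _ /addnI //]; rewrite ltn_add2l.
have ind := gaussian_family_indep hx.
pose X : set (N.-tuple R) := [set t | G (nth 0 t) <= c].
pose Y : set ((m * N).-tuple R) :=
  [set t | forall a, (a < m)%N -> G (fun i => nth 0 t (a * N + i)%N) <= c].
have mX : measurable X.
  rewrite (_ : X = (fun t : N.-tuple R => G (nth 0 t)) @^-1` `]-oo, c]).
    by rewrite -[Z in measurable Z]setTI; exact: measurable_cylinder_tuple.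
  by apply/seteqP; split => w /=; rewrite in_itv.
have EX : [set w | G (x ^~ w) <= c] = first_terms N x @^-1` X.
  by apply/seteqP; split => w; rewrite /X /= first_terms_cylinder.
pose y i := x (N + i)%N.
have EY : [set w | forall a, (a < m)%N -> G (fun i => y (a * N + i)%N w) <= c] =
    first_terms (m * N) y @^-1` Y.
  apply/seteqP; split => w /= h a am; have := h a am;
  by have := @first_terms_cylinder _ _ T (m * N) y _ w (cylinder_block am cG) => ->.
have mY : measurable Y.
  suff : measurable (\bigcap_(a in [set: 'I_m]) [set t : (m * N).-tuple R |
      G (fun i => nth 0 t (a * N + i)%N) <= c]).
    congr measurable; apply/seteqP; split => w /= h a; last by move=> _; exact: h.
    by move=> am; exact: (h (Ordinal am) I).
  apply: fin_bigcap_measurable => [|a _]; first exact: finite_finset.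
  have ma := measurable_cylinder_tuple (cylinder_block (ltn_ord a) cG).
  rewrite (_ : [set _ | _] = (fun t : (m * N).-tuple R => G (fun i => nth 0 t (a * N + i)%N)) @^-1` `]-oo, c]).
    by rewrite -[Z in measurable Z]setTI; exact: ma.
  by apply/seteqP; split => w /=; rewrite in_itv.
rewrite (_ : [set w | _] = first_terms N x @^-1` X `&` first_terms (m * N) y @^-1` Y).
  rewrite ind // exprS EFinM -EX -EY; apply: lee_pmul => //; [exact: hp|exact: IH].
rewrite -EX -EY; apply/seteqP; split => w /=.
  move=> h; split; first by have := h 0%N isT; congr (G _ <= _); apply/funext => i; rewrite mul0n.
  by move=> a am; have := h a.+1 am; congr (G _ <= _); apply/funext => i; rewrite /y mulSn addnA.
move=> [h1 h2] [|a] am; first by move: h1; congr (G _ <= _).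
by have := h2 a am; congr (G _ <= _); apply/funext => i; rewrite /y mulSn addnA.
Qed.

End space.

Lemma geometric_small (p e : R) : 0 <= p -> p < 1 -> 0 < e -> exists m, p ^+ m.+1 <= e.
Proof.
move=> p0 p1 e0; have /cvgrPdist_le /(_ _ e0) [m _ hm] : p ^+ n @[n --> \oo] --> 0.
  by apply: cvg_expr; rewrite ger0_norm.
by exists m; have := hm m.+1 (leqnSn m); rewrite /= sub0r normrN ger0_norm // exprn_ge0.
Qed.

(* Independent copies [x_0, ..., x_(m-1)] of [g] are combined with the node
   weights; each combination has the law of a multiple of [g], and if many of
   the determinants of the combinations are small then so are the determinants
   of all the copies. *)
Lemma det_anticoncentration d0 (T0 : measurableType d0) (P0 : probability T0 R) n0
    (W : R -> T0 -> 'cV[R]_n0.+1) q (eta : R) : brownian_motion P0 W -> 0 < eta ->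
  exists2 e : R, 0 < e & forall N (u : nat -> 'cV[R]_q) (v : nat -> 'rV[R]_q)
    d (T : measurableType d) (P : probability T R) (g : nat -> T -> R),
    let F (x : nat -> R) := \det (\sum_(i < N) x i *: (u i *m v i)) in
    (0 < N)%N -> gaussian_family P N g -> 0 < \int[P]_w (F (g ^~ w) ^+ 2) ->
    (P [set w | (F (g ^~ w) ^+ 2 <= e * \int[P]_w (F (g ^~ w) ^+ 2))%R] <= eta%:E)%E.
Proof.
move=> hW eta0; pose C : R := hyper_cst ^+ q.
have C1 : 1 <= C.
  rewrite /C exprn_ege1 // /hyper_cst; have m20 := @normal_m2_gt0 R.
  have m40 : 0 <= @normal_m4 R by apply: Rintegral_ge0 => x _; rewrite exprn_even_ge0.
  by rewrite exprn_ege1 // (le_trans (_ : 1 <= 3)) ?ler1n // lerDl divr_ge0 // exprn_ge0 // ltW.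
(* The Paley-Zygmund bound on the probability that one copy is small; [m] copies are simultaneously
   small with probability at most [p ^+ m]. *)
pose p := 1 - (4 * C)^-1.
have p01 : 0 <= p < 1.
  rewrite /p subr_ge0 invf_le1 ?ltrBlDr ?ltrDl ?invr_gt0; lra.
have /andP[p0 p1] := p01.
have eta2 : 0 < eta / 2 by lra.
have [m' hm] := geometric_small p0 p1 eta2.
set m := m'.+1 in hm.
(* [D] is the number of nodes that determine the polynomial. Up to [D] of the [K.+1] combinations
   may be small without consequence, and [K] makes this proportion at most [eta / 2]. *)
pose D := (q * (m * 2)).+1; have [K hK] : exists K, 2 * D%:R / eta <= K.+1%:R.
  by exists (Num.truncn (2 * D%:R / eta)); apply/ltW/truncnS_gt.
pose b (n a : nat) : R := node_weight m a n%:R.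
(* Bounds the variance of every combination at once. *)
pose Bd := 1 + \sum_(j < K.+1) \sum_(a < m) b (m + j)%N a ^+ 2.
have Bd1 : 1 <= Bd by rewrite lerDl; do 2!(apply: sumr_ge0 => ? _); exact: sqr_ge0.
pose L := (1 + 2 * (m + K.+1)%:R : R) ^+ D.
have L1 : 1 <= L by rewrite exprn_ege1 // lerDl mulr_ge0.
(* Interpolation multiplies squared determinants by at most [L ^+ 2], and undoing the normalisation
   by at most [Bd ^+ q]; this [e] turns the level [e * mu] into [mu / 2]. *)
pose e := (2 * L ^+ 2 * Bd ^+ q)^-1.
have BL0 : 0 < 2 * L ^+ 2 * Bd ^+ q by rewrite !mulr_gt0 ?exprn_gt0 //; lra.
exists e; first by rewrite invr_gt0.
move=> N u v d T P g F N0 hg; set mu := \int[P]_w _ => mu0.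
have cF : cylinder N F := multiaffine_cylinder (multiaffine_det N u v).
have cF2 := cylinderX 2 cF.
have [x hx] : exists x, gaussian_family P0 (m * N) x.
  pose s n : R := n%:R / (m * N)%:R; have mN : (0 : R) < (m * N)%:R by rewrite ltr0n muln_gt0.
  exists (fun i w => (W (s i.+1) w 0 0 - W (s i) w 0 0) / Num.sqrt (s i.+1 - s i)).
  apply: brownian_increments hW _ _ _; rewrite /s ?mul0r // ?divff ?gt_eqF //.
  by move=> i _; rewrite ltr_pM2r ?invr_gt0 // ltr_nat.
pose y n i w := (\sum_(a < m) b n a * x (a * N + i)%N w) / Num.sqrt (\sum_(a < m) b n a ^+ 2).
have hy n : (m <= n)%N -> gaussian_family P0 N (y n).
  move=> mn; apply: gaussian_family_combine hW N0 _ _ hx => // a.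
  by apply: lt_le_trans (node_weight_ge1 _ mn).
pose A (k : 'I_K.+1) := [set w | F (y (m + k)%N ^~ w) ^+ 2 <= e * mu].
pose X : set (N.-tuple R) := [set t | F (nth 0 t) ^+ 2 <= e * mu].
have mX : measurable X.
  rewrite (_ : X = (fun t : N.-tuple R => F (nth 0 t) ^+ 2) @^-1` `]-oo, e * mu]).
    by rewrite -[Z in measurable Z]setTI; exact: measurable_cylinder_tuple cF2 _ _ _.
  by apply/seteqP; split => w /=; rewrite in_itv.
have XE d1 (T1 : measurableType d1) (f : nat -> T1 -> R) :
    [set w | F (f ^~ w) ^+ 2 <= e * mu] = first_terms N f @^-1` X.
  by apply/seteqP; split => w; rewrite /X /= (first_terms_cylinder _ _ cF).
have mA k : measurable (A k).
  by rewrite /A XE; apply: preimage_first_terms => //; case: (hy (m + k)%N (leq_addr _ _)).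
have PA k : P0 (A k) = P [set w | F (g ^~ w) ^+ 2 <= e * mu].
  by rewrite /A !XE; apply: gaussian_family_law => //; exact/hy/leq_addr.
pose Small := [set w | forall a, (a < m)%N -> F (fun i => x (a * N + i)%N w) ^+ 2 <= mu / 2].
have mSmall : measurable Small by apply: measurable_blocks_le cF2 _; case: hx.
have pSmall : (P0 Small <= (p ^+ m)%:E)%E.
  apply: (prob_blocks_le cF2) hx => g' hg'.
  have [l4 h4 _ _] := multiaffine_moments hg' (multiaffine_det N u v).
  (* The second moment depends only on the law, so it is the same on the auxiliary space. *)
  have e2 : \int[P0]_w (F (g' ^~ w) ^+ 2) = mu.
    congr fine; have mt (X1 : set (N.-tuple R)) : measurable X1 -> pushforward P0 (first_terms N g') X1 =
        pushforward P (first_terms N g) X1 by move=> mX1; exact: (gaussian_family_law hg' hg).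
    have m1 := measurable_first_terms hg'.1; have m2 := measurable_first_terms hg.1.
    pose f (t : N.-tuple R) := (F (nth 0 t) ^+ 2)%:E.
    have mf : measurable_fun setT f by apply/measurable_EFinP; exact: (measurable_cylinder_tuple cF2).
    have f0 t : (0 <= f t)%E by rewrite lee_fin sqr_ge0.
    transitivity (\int[P0]_w (f (first_terms N g' w)))%E.
      by apply: eq_integral => w _; rewrite /f (first_terms_cylinder _ _ cF).
    transitivity (\int[P]_w (f (first_terms N g w)))%E; last first.
      by apply: eq_integral => w _; rewrite /f (first_terms_cylinder _ _ cF).
    have i1 := ge0_integral_pushforward m1 P0 measurableT mf (fun t _ => f0 t).
    have i2 := ge0_integral_pushforward m2 P measurableT mf (fun t _ => f0 t).
    rewrite [LHS](_ : _ = \int[pushforward P0 (first_terms N g')]_t f t)%E; last exact/esym/i1.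
    rewrite [RHS](_ : _ = \int[pushforward P (first_terms N g)]_t f t)%E; last exact/esym/i2.
    by apply: eq_measure_integral => X1 mX1 _; exact: mt.
  have := prob_small_le l4 (lt_le_trans ltr01 C1) h4; rewrite e2; exact.
(* Unless all copies are small, at most [D] combinations are. Taking expectations bounds the common
   probability of the events [A k]. *)
have count w : \sum_(k < K.+1) \1_(A k) w <= D%:R + K.+1%:R * \1_Small w :> R.
  have [sw|nsw] := pselect (Small w).
    rewrite [\1_Small w]indicE mem_set // mulr1 -[X in _ <= _ + X]mulr1 mulr_natl.
    apply: le_trans (_ : \sum_(k < K.+1) 1 <= _); last by rewrite sumr_const card_ord lerDr.
    by apply: ler_sum => k _; rewrite indicE lern1 leq_b1.
  rewrite [\1_Small w]indicE memNset // mulr0 addr0.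
  pose s := [seq (m + k)%N | k : 'I_K.+1 <- enum 'I_K.+1 & w \in A k].
  have -> : \sum_(k < K.+1) \1_(A k) w = (size s)%:R :> R.
    rewrite size_map size_filter -sum1_count natr_sum [RHS]big_mkcond /= big_enum /=.
    by apply: eq_bigr => k _; rewrite indicE; case: (_ \in _).
  rewrite ler_nat leqNgt; apply/negP => Ds; apply: nsw => a am.
  pose e' := Num.sqrt (Bd ^+ q * (e * mu)).
  have e0 : 0 <= e by rewrite invr_ge0 ltW.
  have e'2 : e' ^+ 2 = Bd ^+ q * (e * mu).
    by rewrite sqr_sqrtr // !mulr_ge0 ?exprn_ge0 ?(ltW mu0) //; lra.
  pose Y a := \sum_(i < N) x (a * N + i)%N w *: (u i *m v i).
  have us : uniq s.
    rewrite map_inj_uniq; [exact/filter_uniq/enum_uniq|move=> k l /addnI; exact: val_inj].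
  have := @det_node_weight_bound _ m K.+1 q Y (take D s) e' a (sqrtr_ge0 _) (take_uniq D us) _ _ am _.
  rewrite -/D -/L => hdet.
  have {}hdet : `|\det (Y a)| <= L * e'.
    apply: hdet => [n|| n].
    - by move=> /mem_take /mapP[k _ ->]; rewrite leq_addr ltn_add2l ltn_ord.
    - by rewrite size_takel // ltnW.
    move=> /mem_take /mapP[k]; rewrite mem_filter => /andP[kA _] ->.
    rewrite -(@ler_pXn2r _ 2) ?nnegrE ?sqrtr_ge0 // e'2 real_normK ?num_real //.
    have S0 : 0 <= \sum_(a0 < m) b (m + k)%N a0 ^+ 2 by apply: sumr_ge0 => ? _; exact: sqr_ge0.
    have SB : \sum_(a0 < m) b (m + k)%N a0 ^+ 2 <= Bd.
      rewrite /Bd (bigD1 k) //= addrCA lerDl addr_ge0 // sumr_ge0 // => ? _.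
      by apply: sumr_ge0 => ? _; exact: sqr_ge0.
    have S1 : 0 < \sum_(a0 < m) b (m + k)%N a0 ^+ 2.
      rewrite /m big_ord_recl ltr_pwDl ?sumr_ge0 // ?exprn_gt0 //.
        by apply: lt_le_trans (node_weight_ge1 _ (leq_addr _ _)).
      by move=> ? _; exact: sqr_ge0.
    rewrite (_ : \sum_(b0 < m) _ = Num.sqrt (\sum_(a0 < m) b (m + k)%N a0 ^+ 2) *:
        \sum_(i < N) y (m + k)%N i w *: (u i *m v i)).
      rewrite detZ exprMn -exprM mulnC exprM sqr_sqrtr //; apply: ler_pM.
      - exact: exprn_ge0.
      - exact: sqr_ge0.
      - by apply: lerXn2r => //; rewrite nnegrE; lra.
      - by move: kA; rewrite inE.
    rewrite scaler_sumr /Y; under eq_bigr do rewrite scaler_sumr.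
    rewrite exchange_big /=; apply: eq_bigr => i _; rewrite scalerA /y mulrC divfK; last first.
      by rewrite gt_eqF // sqrtr_gt0.
    by rewrite scaler_suml; apply: eq_bigr => c _; rewrite scalerA.
  have -> : F (fun i => x (a * N + i)%N w) = \det (Y a) by [].
  rewrite -real_normK ?num_real //.
  apply: le_trans (_ : (L * e') ^+ 2 <= _); first by apply: lerXn2r; rewrite ?nnegrE ?mulr_ge0 ?sqrtr_ge0 //; lra.
  rewrite exprMn e'2 /e le_eqVlt; apply/orP; left; apply/eqP.
  have L2 : 0 < L ^+ 2 by rewrite exprn_gt0 //; lra.
  have Bq : 0 < Bd ^+ q by rewrite exprn_gt0 //; lra.
  by move: L2 Bq; move: (L ^+ 2) (Bd ^+ q) => x1 x2 x10 x20; field; rewrite !gt_eqF.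
have iA k : integrable_rv P0 (\1_(A k) : T0 -> R) by exact: integrable_rv_indic.
have iS := @integrable_rv_indic _ _ P0 _ mSmall.
have := @le_Rintegral _ _ _ P0 setT _ _ measurableT
  (integrable_rv_sum (index_enum 'I_K.+1) iA)
  (integrable_rvD (integrable_rv_cst P0 D%:R) (integrable_rvZ K.+1%:R iS)) (fun w _ => count w).
rewrite Rintegral_sum // RintegralD //; [|exact: integrable_rv_cst|exact: integrable_rvZ].
rewrite Rintegral_prob_cst RintegralZl // Rintegral_indicE //.
under eq_bigr => k _ do rewrite Rintegral_indicE // PA.
rewrite sumr_const card_ord -[X in X <= _ -> _]mulr_natl.
have mP : measurable [set w | F (g ^~ w) ^+ 2 <= e * mu].
  by rewrite XE; apply: preimage_first_terms => //; case: hg.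
rewrite -(@fineK _ (P _)) ?fin_num_measure // lee_fin => h.
have h2 : fine (P0 Small) <= p ^+ m by rewrite -lee_fin fineK // fin_num_measure.
set f := fine (P _) in h *; set f0 := fine (P0 _) in h h2.
have K0 : (0 : R) < K.+1%:R by rewrite ltr0n.
rewrite /= in h; rewrite -(ler_pM2l K0); apply: le_trans h _.
have : 2 * D%:R <= K.+1%:R * eta by rewrite -ler_pdivrMr.
have : K.+1%:R * f0 <= K.+1%:R * (eta / 2) by rewrite ler_pM2l //; lra.
by move: (K.+1%:R * f0) (K.+1%:R : R) => *; nra.
Qed.
End anticoncentration.

(** * The small ball estimate for an eigenvalue of a Gaussian matrix *)

Section gaussian_matrix.
Context {R : realType}.

Definition rank1_sum N d q (u : nat -> 'cV[R]_d) (v : nat -> 'rV[R]_q) (x : nat -> R) : 'M[R]_(d, q) :=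
  \sum_(i < N) x i *: (u i *m v i).

Lemma det_rank1_sum N d q (u : nat -> 'cV[R]_d) (v : nat -> 'rV[R]_q) (rho : 'I_q -> 'I_d) x :
  \det (rowsub rho (rank1_sum N u v x)) = \det (\sum_(i < N) x i *: (rowsub rho (u i) *m v i)).
Proof.
congr (\det _); apply/matrixP => k l; rewrite !mxE !summxE; apply: eq_bigr => i _.
by rewrite !mxE; congr (_ * _); apply: eq_bigr => j _; rewrite !mxE.
Qed.

Lemma minor_rank1_sum N d r (u : nat -> 'cV[R]_d) (v : nat -> 'rV[R]_r.+1) (rho : 'I_r -> 'I_d) k x :
  \det (rowsub rho (col' k (rank1_sum N u v x))) =
  \det (\sum_(i < N) x i *: (rowsub rho (u i) *m col' k (v i))).
Proof.
congr (\det _); apply/matrixP => j l; rewrite !mxE !summxE; apply: eq_bigr => i _.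
by rewrite !mxE; congr (_ * _); apply: eq_bigr => j' _; rewrite !mxE.
Qed.

Lemma measurable_rank1_sum d0 (T : measurableType d0) N d q (u : nat -> 'cV[R]_d)
    (v : nat -> 'rV[R]_q) (g : nat -> T -> R) i j :
  (forall i, (i < N)%N -> measurable_fun setT (g i)) ->
  measurable_fun setT (fun w => rank1_sum N u v (g ^~ w) i j).
Proof.
move=> mg; rewrite (_ : (fun w => _) = (fun w => \sum_(n < N) g n w * (u n *m v n) i j)).
  by apply: measurable_sum => n; apply: measurable_funM => //; exact: mg.
by apply/funext => w; rewrite summxE; apply: eq_bigr => n _; rewrite !mxE.
Qed.

Lemma measurable_gram d0 (T : measurableType d0) d q (S : T -> 'M[R]_(d, q)) i j :
  (forall i j, measurable_fun setT (fun w => S w i j)) ->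
  measurable_fun setT (fun w => (S w *m (S w)^T) i j).
Proof.
move=> mS; rewrite (_ : (fun w => _) = (fun w => \sum_k S w i k * S w j k)).
  by apply: measurable_sum => k; exact: measurable_funM.
by apply/funext => w; rewrite mxE; apply: eq_bigr => k _; rewrite mxE.
Qed.

Lemma gram_sym d q (S : 'M[R]_(d, q)) : (S *m S^T)^T = S *m S^T.
Proof. by rewrite trmx_mul trmxK. Qed.

Lemma exists_argmax (I : finType) (i0 : I) (a : I -> R) : exists i, forall j, a j <= a i.
Proof. by exists [arg max_(i > i0) a i]%O; case: arg_maxP => // i _ h j; exact: h. Qed.

(* The gradient condition bounds the mean of the squared cofactors by the mean
   square of the largest maximal minor, and the smallest relevant eigenvalue is
   at least the square of that minor divided by the squared norm of its
   adjugate. *)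
Lemma gaussian_lambda_small d0 (T0 : measurableType d0) (P0 : probability T0 R) n0
    (W : R -> T0 -> 'cV[R]_n0.+1) d r (eta : R) : brownian_motion P0 W -> 0 < eta -> (r < d)%N ->
  exists2 e : R, 0 < e & forall N (u : nat -> 'cV[R]_d) (v : nat -> 'rV[R]_r.+1)
    d1 (T : measurableType d1) (P : probability T R) (g : nat -> T -> R) (lam : R),
    (0 < N)%N -> gaussian_family P N g -> 0 < lam ->
    (forall S, lam * minors_sqsum S <= \sum_(i < N) minor_diff_sum S (u i) (v i)) ->
    (exists x (rho : {ffun 'I_r.+1 -> 'I_d}), \det (rowsub rho (rank1_sum N u v x)) != 0) ->
    (P [set w | (lambda r.+1 (rank1_sum N u v (g ^~ w) *m (rank1_sum N u v (g ^~ w))^T)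
                 <= e * lam)%R] <= eta%:E)%E.
Proof.
move=> hW eta0 rd; have eta2 : 0 < eta / 2 by lra.
have [e1 e10 he1] := det_anticoncentration r.+1 hW eta2.
pose K : R := #|{ffun 'I_r.+1 -> 'I_d}|%:R.
have K0 : 0 < K.
  by rewrite ltr0n card_ffun !card_ord expn_gt0 (leq_ltn_trans (leq0n r) rd).
have m20 := @normal_m2_gt0 R; pose m2 : R := normal_m2; rewrite -/m2 in m20.
pose q : R := r.+1%:R; have q0 : 0 < q by rewrite ltr0n.
(* Chosen so that this constant times [lam * (q * n1)] is [e1 * a rho], where [n1] below bounds the
   squared cofactors outside an event of probability [eta / 2]. *)
exists (e1 * eta * m2 / (2 * q ^+ 2 * K)).
  by rewrite divr_gt0 ?mulr_gt0 ?exprn_gt0.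
move=> N u v d1 T P g lam N0 hg lam0 hC [x0 [rho0 nz0]].
pose S w := rank1_sum N u v (g ^~ w).
pose f (rho : {ffun 'I_r.+1 -> 'I_d}) (x : nat -> R) :=
  \det (\sum_(i < N) x i *: (rowsub rho (u i) *m v i)).
have fE rho x : f rho x = \det (rowsub rho (rank1_sum N u v x)) by rewrite det_rank1_sum.
have hf rho := multiaffine_moments hg (multiaffine_det N (fun i => rowsub rho (u i)) v).
pose a rho := \int[P]_w (f rho (g ^~ w) ^+ 2).
have a_ge0 rho : 0 <= a rho by apply: Rintegral_ge0 => w _; exact: sqr_ge0.
(* The minor is selected by its second moment and not by its random size, so that a single
   anti-concentration estimate is enough. *)
have [rho amax] : exists rho, forall rho', a rho' <= a rho.
  exact: exists_argmax rho0 a.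
have a0 : 0 < a rho.
  apply: lt_le_trans (amax rho0); rewrite lt_neqAle a_ge0 andbT eq_sym.
  apply/eqP => a0; case: (hf rho0) => _ _ /(_ a0 x0) /eqP h _.
  by move: nz0; rewrite det_rank1_sum; apply/negP; rewrite negbK.
pose Nm w := minors_sqsum (S w).
have hmin (rho' : {ffun 'I_r -> 'I_d}) k :
    integrable_rv P (fun w => \det (rowsub rho' (col' k (S w))) ^+ 2).
  have [h _ _ _] := multiaffine_moments hg (multiaffine_det N (fun i => rowsub rho' (u i)) (fun i => col' k (v i))).
  apply: integrable_rv_eq (L4_sqr h) => w; by rewrite /S minor_rank1_sum.
have iN : integrable_rv P Nm.
  by apply: integrable_rv_sum => rho'; apply: integrable_rv_sum => k.
have N_ge0 w : 0 <= Nm w by do 2!(apply: sumr_ge0 => ? _); exact: sqr_ge0.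
have hsl (rho' : {ffun 'I_r.+1 -> 'I_d}) i : (i < N)%N ->
    forall w, slope i (f rho') (g ^~ w) ^+ 2 = minor_diff (S w) rho' (u i) (v i) ^+ 2.
  move=> iN1 w; rewrite /f (slope_det (fun i => rowsub rho' (u i)) v) // /minor_diff; congr ((_ *m \adj _ *m _) 0 0 ^+ 2).
  apply/matrixP => k l; rewrite !mxE !summxE; apply: eq_bigr => j _.
  by rewrite !mxE; congr (_ * _); apply: eq_bigr => j' _; rewrite !mxE.
have iD rho' (i : 'I_N) : integrable_rv P (fun w => minor_diff (S w) rho' (u i) (v i) ^+ 2).
  have [h _ _ _] := multiaffine_moments hg
    (multiaffine_slope i (multiaffine_det N (fun i => rowsub rho' (u i)) v)).
  by apply: integrable_rv_eq (L4_sqr h) => w; rewrite -hsl.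
(* Integrated gradient condition, then the bound on the slopes of each minor by its second moment,
   then maximality of [rho] over the [K] minors. *)
have EN : m2 * (lam * \int[P]_w Nm w) <= q * (K * a rho).
  have h1 : lam * \int[P]_w Nm w <= \sum_rho' \sum_(i < N) \int[P]_w (minor_diff (S w) rho' (u i) (v i) ^+ 2).
    rewrite -RintegralZl //.
    apply: le_trans (_ : \int[P]_w (\sum_rho' \sum_(i < N) minor_diff (S w) rho' (u i) (v i) ^+ 2) <= _).
      apply: le_Rintegral => //; first exact: integrable_rvZ.
        by apply: integrable_rv_sum => rho'; apply: integrable_rv_sum => i.
      by move=> w _; rewrite exchange_big; exact: hC.
    rewrite Rintegral_sum; last by move=> rho'; exact: integrable_rv_sum.
    by apply: ler_sum => rho' _; rewrite Rintegral_sum.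
  apply: le_trans (ler_wpM2l (ltW m20) h1) _; rewrite mulr_sumr.
  apply: le_trans (_ : \sum_rho' q * a rho' <= _).
    apply: ler_sum => rho' _; have [_ _ _ h] := hf rho'; apply: le_trans h.
    rewrite -/m2 ler_pM2l //; apply: ler_sum => i _; rewrite le_eqVlt; apply/orP; left.
    by apply/eqP; congr fine; apply: eq_integral => w _; rewrite -hsl.
  rewrite -mulr_sumr ler_pM2l // /K mulr_natl -sumr_const; exact: ler_sum.
(* Markov's inequality: [2 / eta] times the bound on the mean. *)
pose n1 := 2 / eta * (q * (K * a rho) / (m2 * lam)).
have n10 : 0 < n1.
  by apply: mulr_gt0; [exact: divr_gt0|apply: divr_gt0; do ?apply: mulr_gt0].
have mN : measurable_fun setT Nm := measurable_integrable_rv iN.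
pose A := [set w | f rho (g ^~ w) ^+ 2 <= e1 * a rho].
pose B := [set w | n1 <= Nm w].
have pA : (P A <= (eta / 2)%:E)%E 
  by exact: (he1 N (fun i => rowsub rho (u i)) v _ _ P g N0 hg a0).
have mA : measurable A.
  rewrite (_ : A = (fun w => f rho (g ^~ w) ^+ 2) @^-1` `]-oo, e1 * a rho]).
    by rewrite -[X in measurable X]setTI; have [[mf _] _ _ _] := hf rho; apply: (measurable_funX 2 mf).
  by apply/seteqP; split => w /=; rewrite in_itv.
have mB : measurable B.
  rewrite (_ : B = Nm @^-1` `[n1, +oo[).
    by rewrite -[X in measurable X]setTI; exact: mN.
  by apply/seteqP; split => w /=; rewrite in_itv /= andbT.
have pB : (P B <= (eta / 2)%:E)%E.
  have h1 := prob_ge_le P mN N_ge0 n10.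
  have E1 : (\int[P]_w (Nm w)%:E = (\int[P]_w Nm w)%:E)%E.
    rewrite /Rintegral fineK //; exact: (integrable_fin_num measurableT iN).
  rewrite E1 -/B in h1; move: h1; rewrite -(@fineK _ (P B)) ?fin_num_measure // -EFinM !lee_fin => h1.
  rewrite -(ler_pM2l n10); apply: le_trans h1 _; rewrite /n1.
  have : \int[P]_w Nm w <= q * (K * a rho) / (m2 * lam).
    by rewrite ler_pdivlMr ?mulr_gt0 // mulrC -mulrA.
  move=> h; apply: le_trans h _; rewrite le_eqVlt; apply/orP; left; apply/eqP.
  by move: (q * (K * a rho) / (m2 * lam)) => z; field; rewrite gt_eqF.
have mS i j : measurable_fun setT (fun w => S w i j) by apply: measurable_rank1_sum hg.1.
have mL k : measurable [set w | k < lambda r.+1 (S w *m (S w)^T)].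
  apply: measurable_lambda_gt => [|w|i j]; first by rewrite rd.
    exact: gram_sym.
  exact: measurable_gram.
have cpos : 0 <= e1 * eta * m2 / (2 * q ^+ 2 * K) * lam.
  by rewrite mulr_ge0 ?(ltW lam0) // ltW // divr_gt0 ?mulr_gt0 ?exprn_gt0.
apply: le_trans (_ : P (A `|` B) <= _)%E.
  apply: le_measure; rewrite ?inE //.
  - rewrite (_ : [set w | _] = ~` [set w | e1 * eta * m2 / (2 * q ^+ 2 * K) * lam < lambda r.+1 (S w *m (S w)^T)]).
      exact: measurableC.
    by apply/seteqP; split => w /=; [rewrite leNgt => /negP|move=> /negP; rewrite -leNgt].
  - exact: measurableU.
  move=> w /=; apply: contraPP => /not_orP[/negP]; rewrite -ltNge => h1 /negP; rewrite -ltNge => h2.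
  apply/negP; rewrite -ltNge; apply: (@lambda_gt_minor _ _ _ _ rho); rewrite ?rd //.
  rewrite -fE; apply: le_lt_trans h1.
  apply: le_trans (_ : e1 * eta * m2 / (2 * q ^+ 2 * K) * lam * (q * n1) <= _).
    rewrite ler_wpM2l //.
    by apply: le_trans (adj_minors _ _) _; rewrite ler_pM2l // ltW.
  rewrite le_eqVlt; apply/orP; left; apply/eqP; rewrite /n1; move: (a rho) => z.
  by field; rewrite !gt_eqF.
apply: le_trans (measureU2 P mA mB) _; apply: le_trans (leeD pA pB) _.
by rewrite -EFinD lee_fin; lra.
Qed.

End gaussian_matrix.

(** * Step functions, Riemann sums and Wiener integrals *)

Section grids.
Context {R : realType}.

Lemma gaussian_linear_moment d (T : measurableType d) (P : probability T R) N
    (g : nat -> T -> R) (a : nat -> R) : gaussian_family P N g ->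
  L4 P (fun w => \sum_(i < N) a i * g i w) /\
  \int[P]_w ((\sum_(i < N) a i * g i w) ^+ 2) = normal_m2 * \sum_(i < N) a i ^+ 2.
Proof.
elim: N => [|N IH] hg.
  rewrite big_ord0 mulr0 -[RHS](Rintegral_prob_cst P); split.
    rewrite (_ : (fun w => _) = (fun=> 0)); first exact: L4_cst.
    by apply/funext => w; rewrite big_ord0.
  by congr fine; apply: eq_integral => w _; rewrite big_ord0 expr0n.
have [La Ea] := IH (gaussian_family_sub (leqnSn N) hg).
have Lb := L4_cst P (a N).
have cb : cylinder N (fun=> a N) by split => // *; exact: measurable_cst.
pose F (x : nat -> R) := \sum_(i < N) a i * x i.
have ca : cylinder N F.
  split=> [x y xy|d' T' g' mg]; first by apply: eq_bigr => i _; rewrite xy.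
  by apply: measurable_sum => i; apply: measurable_funM => //; exact: mg.
have E w : F (g ^~ w) + g N w * a N = \sum_(i < N.+1) a i * g i w.
  by rewrite big_ord_recr /= mulrC.
split; first by have := top_L4 hg cb (La : L4 P (fun w => F (g ^~ w))) Lb; congr L4; apply/funext => w; rewrite E.
have := top_second_moment hg ca cb (La : L4 P (fun w => F (g ^~ w))) Lb; rewrite Ea big_ord_recr mulrDr Rintegral_prob_cst => <-.
by congr fine; apply: eq_integral => w _; rewrite E.
Qed.

Lemma gaussian_linear_tail d (T : measurableType d) (P : probability T R) N
    (g : nat -> T -> R) (a : nat -> R) (e : R) : gaussian_family P N g -> 0 < e ->
  (P [set w | (e <= `|\sum_(i < N) a i * g i w|)%R]
    <= (normal_m2 * (\sum_(i < N) a i ^+ 2) / e ^+ 2)%:E)%E.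
Proof.
move=> hg e0; have [La Ea] := gaussian_linear_moment a hg.
pose f w := (\sum_(i < N) a i * g i w) ^+ 2.
have i2 : integrable_rv P f := L4_sqr La.
have e2 : 0 < e ^+ 2 by rewrite exprn_gt0.
have := prob_ge_le P (measurable_integrable_rv i2) (fun w => sqr_ge0 _) e2.
have E1 : (\int[P]_w (f w)%:E = (\int[P]_w f w)%:E)%E.
  by rewrite /Rintegral fineK //; exact: (integrable_fin_num measurableT i2).
rewrite E1 Ea (_ : [set w | e ^+ 2 <= f w] = [set w | e <= `|\sum_(i < N) a i * g i w|]); last first.
  suff E2 w : (e ^+ 2 <= f w) = (e <= `|\sum_(i < N) a i * g i w|) by apply/seteqP; split => w /=; rewrite E2.
  by rewrite /f -[X in _ <= X]real_normK ?num_real // ler_pXn2r ?nnegrE ?(ltW e0) ?normr_ge0 //.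
set A := [set w | _]; have mA : measurable A.
  rewrite (_ : A = (fun w => \sum_(i < N) a i * g i w) @^-1` [set x | e <= `|x|]) //.
  rewrite -[X in measurable X]setTI; apply: La.1 => //.
  rewrite (_ : [set x | _] = (fun x : R => `|x|) @^-1` `[e, +oo[).
    by rewrite -[X in measurable X]setTI; exact: normr_measurable.
  by apply/seteqP; split => x /=; rewrite in_itv /= andbT.
rewrite -(@fineK _ (P A)) ?fin_num_measure // -EFinM !lee_fin => h.
by rewrite ler_pdivlMr // mulrC.
Qed.

(** [F] is read at the right end of each cell because cells are open on the left and closed on the
    right, as in [step_fun]. *)
Definition gridint (tau : nat -> R) n (F : R -> R) (Z : R -> R) : R :=
  \sum_(i < n) F (tau i.+1) * (Z (tau i.+1) - Z (tau i)).

Definition is_grid (tau : nat -> R) n : Prop :=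
  [/\ tau 0%N = 0, tau n = 1 & forall i, (i < n)%N -> tau i < tau i.+1].

Definition in_grid (tau : nat -> R) n (x : R) : Prop := exists2 k, (k <= n)%N & x = tau k.

Lemma grid_mono tau n i j : is_grid tau n -> (i < j <= n)%N -> tau i < tau j.
Proof.
move=> [_ _ h] /andP[]; elim: j => // j IH; rewrite ltnS leq_eqVlt => /orP[/eqP ->|ij] jn.
  exact: h.
by apply: lt_trans (IH ij (ltnW jn)) _; exact: h.
Qed.

Lemma grid_le tau n i j : is_grid tau n -> (i <= n)%N -> (j <= n)%N ->
  (tau i <= tau j) = (i <= j)%N.
Proof.
move=> hg iN jN; have [ij|ji|->] := ltngtP i j; last exact: lexx.
  by rewrite ltW // (grid_mono hg) // ij.
by apply/negbTE; rewrite -ltNge (grid_mono hg) // ji.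
Qed.

Lemma grid_lt tau n i j : is_grid tau n -> (i <= n)%N -> (j <= n)%N ->
  (tau i < tau j) = (i < j)%N.
Proof. by move=> hg iN jN; rewrite ltNge (grid_le hg) // -ltnNge. Qed.

Lemma grid_itv tau n i : is_grid tau n -> (i <= n)%N -> 0 <= tau i <= 1.
Proof. by move=> hg iN; have [<- <- _] := hg; rewrite !(grid_le hg) //= iN. Qed.

Lemma gridint_itv tau n a b Z : is_grid tau n -> in_grid tau n a -> in_grid tau n b -> a <= b ->
  gridint tau n (\1_(`]a, b])) Z = Z b - Z a.
Proof.
move=> hg [i iN ->] [j jN ->]; rewrite (grid_le hg) // => ij.
rewrite -(telescope_sumr (fun k => Z (tau k)) ij) /gridint.
rewrite (big_nat_widenl i 0) // (big_nat_widen 0 j n) // big_mkord.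
rewrite [RHS]big_mkcond /=; apply: eq_bigr => k _; rewrite indicE.
have kn := ltn_ord k.
rewrite (_ : (tau k.+1 \in `]tau i, tau j]%classic) = ((i <= k) && (k < j))%N); last first.
  apply/idP/idP; rewrite inE /= in_itv /= (grid_lt hg) // (grid_le hg) //.
by case: (_ && _); rewrite ?mul1r ?mul0r.
Qed.

(** Unlike in [is_grid], nodes may repeat and need not reach 0 or 1. *)
Definition is_step m (s : nat -> R) : Prop :=
  [/\ 0 <= s 0%N, s m <= 1 & forall i, (i < m)%N -> s i <= s i.+1].

Lemma step_mono m s i j : is_step m s -> (i <= j <= m)%N -> s i <= s j.
Proof.
move=> [_ _ h] /andP[]; elim: j => [|j IH]; first by rewrite leqn0 => /eqP ->.
rewrite leq_eqVlt => /orP[/eqP -> //|ij] jm.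
by apply: le_trans (IH ij (ltnW jm)) _; exact: h.
Qed.

Lemma step_itv m s i : is_step m s -> (i <= m)%N -> 0 <= s i <= 1.
Proof.
move=> hs im; have [h0 h1 _] := hs; apply/andP; split.
  by apply: le_trans h0 _; rewrite (step_mono hs).
by apply: le_trans _ h1; rewrite (step_mono hs) ?im ?leqnn.
Qed.

Lemma gridint_sum tau n (I : Type) (r : seq I) (c : I -> R) (F : I -> R -> R) Z :
  gridint tau n (fun x => \sum_(i <- r) c i * F i x) Z = \sum_(i <- r) c i * gridint tau n (F i) Z.
Proof.
rewrite /gridint; under eq_bigr do rewrite mulr_suml.
rewrite exchange_big /=; apply: eq_bigr => i _; rewrite mulr_sumr.
by apply: eq_bigr => k _; rewrite mulrA.
Qed.

(** Brings integrals of step functions with different nodes onto a common refinement, where they can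
    be added and multiplied cell by cell. *)
Lemma gridint_step tau n m s c T (Z : R -> T -> R) w : is_grid tau n -> is_step m s ->
  (forall i, (i <= m)%N -> in_grid tau n (s i)) ->
  step_integral Z m s c w = gridint tau n (step_fun m s c) (Z ^~ w).
Proof.
move=> hg hs sg; rewrite [RHS](gridint_sum tau n (index_enum 'I_m) (fun i => c i) (fun (i : 'I_m) x => \1_(`]s i, s i.+1]) x)).
apply: eq_bigr => i _; rewrite gridint_itv //; [exact/sg/ltnW|exact: sg|].
by rewrite (step_mono hs) // leqnSn ltn_ord.
Qed.

Lemma measurable_step_fun m s c : measurable_fun setT (step_fun m s c : R -> R).
Proof.
apply: measurable_sum => i; apply: measurable_funM; first exact: measurable_cst.
exact: measurable_indic.
Qed.

Lemma step_fun_cell tau n m s c k x : is_grid tau n ->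
  (forall i, (i <= m)%N -> in_grid tau n (s i)) -> (k < n)%N ->
  tau k < x <= tau k.+1 -> step_fun m s c x = step_fun m s c (tau k.+1).
Proof.
move=> hg sg kn /andP[kx xk]; apply: eq_bigr => i _; rewrite !indicE.
have [j jn sj] := sg _ (ltnW (ltn_ord i)); have [l ln sl] := sg _ (ltn_ord i).
congr (_ * (_ : bool)%:R); apply/idP/idP; rewrite !inE /= !in_itv /= sj sl.
  rewrite (grid_lt hg) // (grid_le hg) // => /andP[jx xl]; apply/andP; split.
    by rewrite -(grid_lt hg) //; apply: lt_le_trans xk.
  by rewrite -(grid_lt hg) ?(ltnW kn) //; apply: lt_le_trans xl.
rewrite (grid_lt hg) // (grid_le hg) // => /andP[jk kl]; apply/andP; split.
  by apply: le_lt_trans kx; rewrite (grid_le hg) // ltnW.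
by apply: le_trans xk _; rewrite (grid_le hg).
Qed.

Lemma common_grid (l : seq R) : (forall x, x \in l -> 0 <= x <= 1) ->
  exists n tau, [/\ is_grid tau n, (0 < n)%N & forall x, x \in l -> in_grid tau n x].
Proof.
move=> hl; pose s := sort <=%R (undup [:: 0, 1 & l]).
have us : uniq s by rewrite sort_uniq undup_uniq.
have ss : sorted <%R s by rewrite lt_sorted_uniq_le us sort_le_sorted.
have ms x : (x \in s) = (x \in [:: 0, 1 & l]) by rewrite mem_sort mem_undup.
have sz : (1 < size s)%N.
  have u01 : uniq [:: 0; 1 : R] by rewrite /= inE eq_sym oner_eq0.
  apply: (uniq_leq_size u01) => x; rewrite ms !inE => /orP[|] -> //; by rewrite orbT.
have inc i j : (i < size s)%N -> (j < size s)%N -> (nth 0 s i < nth 0 s j) = (i < j)%N.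
  by move=> iN jN; exact: lt_sorted_ltn_nth.
have bnd x : x \in s -> 0 <= x <= 1.
  by rewrite ms !inE => /or3P[/eqP ->|/eqP ->|/hl //]; rewrite ?lexx ?ler01.
have sz' : (size s).-1.+1 = size s by rewrite prednK // ltnW.
exists (size s).-1, (nth 0 s); split; last first.
- move=> x xl; exists (index x s); last by rewrite nth_index // ms !inE xl !orbT.
  by rewrite -ltnS sz' index_mem ms !inE xl !orbT.
- by rewrite -ltnS sz'.
split=> [||i i_s].
- have h0 : 0 \in s by rewrite ms mem_head.
  have b0 := bnd _ (mem_nth 0 (ltnW sz)).
  apply/eqP; rewrite eq_le (andP b0).1 andbT leNgt.
  by have := inc (index 0 s) 0%N; rewrite nth_index // ltn0 index_mem h0 => -> //; exact: ltnW.
- have h1 : 1 \in s by rewrite ms !inE eqxx orbT.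
  have lst : ((size s).-1 < size s)%N by rewrite sz'.
  have b1 := bnd _ (mem_nth 0 lst).
  apply/eqP; rewrite eq_le (andP b1).2 /= leNgt; have := inc (size s).-1 (index 1 s).
  rewrite (nth_index _ h1) index_mem h1 lst => -> //; rewrite -leqNgt -ltnS sz' index_mem //.
by rewrite inc ?ltnSn // -sz' ltnS // ltnW.
Qed.

Lemma common_grid_steps (I : finType) (m : I -> nat) (s : I -> nat -> R) :
  (forall i, is_step (m i) (s i)) ->
  exists n tau, [/\ is_grid tau n, (0 < n)%N &
    forall i j, (j <= m i)%N -> in_grid tau n (s i j)].
Proof.
move=> hs; pose l := [seq s i j | i <- enum I, j <- iota 0 (m i).+1].
have [x /allpairsPdep[i [j [_ jm ->]]]|n [tau [hg n0 tg]]] := @common_grid l.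
  by apply: (step_itv (hs i)); rewrite mem_iota in jm.
exists n, tau; split => // i j jm; apply/tg/allpairsPdep; exists i, j.
by rewrite mem_enum mem_iota.
Qed.

Lemma grid_integral tau n (F : R -> R) : is_grid tau n -> measurable_fun setT F ->
  (forall x, 0 <= F x) ->
  (forall k x, (k < n)%N -> tau k < x <= tau k.+1 -> F x = F (tau k.+1)) ->
  (\int[lebesgue_measure]_(x in `]0%R, 1%R]) (F x)%:E =
   (\sum_(i < n) F (tau i.+1) * (tau i.+1 - tau i))%:E)%E.
Proof.
move=> hg mF F0 hF; have [t0 t1 tS] := hg.
suff h k : (k <= n)%N -> (\int[lebesgue_measure]_(x in `]tau 0%N, tau k]) (F x)%:E =
   (\sum_(i < k) F (tau i.+1) * (tau i.+1 - tau i))%:E)%E by rewrite -h // t0 t1.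
elim: k => [_|k IH kn]; first by rewrite set_itvoc0 integral_set0 big_ord0.
have kn' := ltnW kn.
have h0 : tau 0%N <= tau k by rewrite (grid_le hg).
rewrite (@itv_bndbnd_setU _ _ _ (BRight (tau k))) ?bnd_simp //; last by rewrite ltW // tS.
rewrite ge0_integral_setU //=.
- rewrite IH // big_ord_recr EFinD; congr (_ + _)%E.
  rewrite (eq_integral (cst (F (tau k.+1))%:E)).
    by rewrite integral_cst //= lebesgue_measure_itv /= lte_fin tS // EFinD EFinN EFinM.
  by move=> x; rewrite inE /= in_itv /= => /hF ->.
- by apply/measurable_EFinP; apply: measurable_funTS.
- by move=> x _; rewrite lee_fin.
- apply/disj_setPS => y [/=]; rewrite 2!in_itv/= => /andP[_ yx] /andP[].
  by rewrite ltNge yx.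
Qed.

End grids.

(** * Wiener integrals and arbitrary step approximations *)

Section wiener.
Context {R : realType}.

Lemma cvge0_eventually (u : nat -> \bar R) (e : R) : u @ \oo --> 0%E -> 0 < e ->
  exists N, forall k, (N <= k)%N -> (u k <= e%:E)%E.
Proof.
move=> cu e0; have : \forall k \near \oo, (u k < e%:E)%E.
  apply: (cu [set x | (x < e%:E)%E]); exists e => //= x.
  by rewrite /ball_ /= sub0r normrN lte_fin; apply: le_lt_trans (ler_norm _).
by move=> [N _ hN]; exists N => k Nk; exact/ltW/hN.
Qed.

Lemma prob_union_le d (T : measurableType d) (P : probability T R) (A B C : set T) (b c : R) :
  measurable A -> measurable B -> measurable C -> A `<=` B `|` C ->
  (P B <= b%:E)%E -> (P C <= c%:E)%E -> (P A <= (b + c)%:E)%E.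
Proof.
move=> mA mB mC ABC hB hC; apply: le_trans (_ : P (B `|` C) <= _)%E.
  by apply: le_measure; rewrite ?inE //; exact: measurableU.
by apply: le_trans (measureU2 P mB mC) _; rewrite EFinD leeD.
Qed.

Lemma measurable_abs_ge d (T : measurableType d) (f : T -> R) (e : R) :
  measurable_fun setT f -> measurable [set w | e <= `|f w|].
Proof.
move=> mf; rewrite (_ : [set _ | _] = f @^-1` [set x | e <= `|x|]) //.
rewrite -[X in measurable X]setTI; apply: mf => //.
rewrite (_ : [set x | _] = (fun x : R => `|x|) @^-1` `[e, +oo[).
  by rewrite -[X in measurable X]setTI; exact: normr_measurable.
by apply/seteqP; split => x /=; rewrite in_itv /= andbT.
Qed.

Lemma sq_dist_triangle d (T : measurableType d) (mu : {measure set T -> \bar R}) (D : set T)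
    (f g h : T -> R) : measurable D ->
  measurable_fun D f -> measurable_fun D g -> measurable_fun D h ->
  (\int[mu]_(x in D) ((f x - g x) ^+ 2)%:E <= 2%:E * \int[mu]_(x in D) ((f x - h x) ^+ 2)%:E
    + 2%:E * \int[mu]_(x in D) ((g x - h x) ^+ 2)%:E)%E.
Proof.
move=> mD mf mg mh.
have m2 (k : T -> R) : measurable_fun D k -> measurable_fun D (fun x => ((k x - h x) ^+ 2)%:E).
  by move=> mk; apply/measurable_EFinP; apply: measurable_funX; exact: measurable_funB.
rewrite -!ge0_integralZl_EFin //; try exact: m2; try by move=> x _; rewrite lee_fin sqr_ge0.
rewrite -ge0_integralD //; last 4 first.
- by move=> x _; rewrite -EFinM lee_fin mulr_ge0 ?sqr_ge0.
- by apply: measurable_funeM; exact: m2.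
- by move=> x _; rewrite -EFinM lee_fin mulr_ge0 ?sqr_ge0.
- by apply: measurable_funeM; exact: m2.
apply: ge0_le_integral => //.
- by move=> x _; rewrite lee_fin sqr_ge0.
- by apply/measurable_EFinP; apply: measurable_funX; exact: measurable_funB.
- by apply: emeasurable_funD; apply: measurable_funeM; exact: m2.
by move=> x _; rewrite -!EFinM -EFinD lee_fin; have := sqr_ge0 (f x + g x - 2 * h x); nra.
Qed.

Section gridint_brownian.
Context d (T : measurableType d) (P : probability T R) p (B : R -> T -> 'cV[R]_p).
Hypothesis hB : brownian_motion P B.

Lemma measurable_gridint (tau : nat -> R) n (F : R -> R) (l : 'I_p) : is_grid tau n ->
  measurable_fun setT (fun w => gridint tau n F (fun u => B u w l 0)).
Proof.
move=> hg; have [mB _ _ _ _] := hB; apply: measurable_sum => i; apply: measurable_funM => //.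
by apply: measurable_funB; apply: mB; apply: (grid_itv hg) => //; exact: ltnW.
Qed.

Lemma gridint_tail (tau : nat -> R) n (F : R -> R) (l : 'I_p) (e : R) : is_grid tau n -> 0 < e ->
  (P [set w | (e <= `|gridint tau n F (fun u => B u w l 0)|)%R] <=
   (normal_m2 * (\sum_(i < n) F (tau i.+1) ^+ 2 * (tau i.+1 - tau i)) / e ^+ 2)%:E)%E.
Proof.
move=> hg e0; have [t0 t1 tS] := hg.
have t0' : 0 <= tau 0%N by rewrite t0.
have t1' : tau n <= 1 by rewrite t1.
have := gaussian_linear_tail (fun i => F (tau i.+1) * Num.sqrt (tau i.+1 - tau i))
  (brownian_increments l hB t0' t1' tS) e0.
have D0 (i : 'I_n) : 0 < tau i.+1 - tau i by rewrite subr_gt0; exact: tS.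
under [in X in (_ <= X)%E -> _]eq_bigr => i _ do rewrite exprMn sqr_sqrtr ?(ltW (D0 i)) //.
rewrite (_ : [set w | _] = [set w | e <= `|gridint tau n F (fun u => B u w l 0)|]) //.
apply/seteqP; split => w /=; congr (e <= `|_|); apply: eq_bigr => i _; rewrite -mulrA; congr (_ * _);
  by rewrite mulrC divfK // gt_eqF // sqrtr_gt0.
Qed.

Lemma measurable_step_integral m s c (l : 'I_p) : is_step m s ->
  measurable_fun setT (step_integral (fun u w => B u w l 0) m s c).
Proof.
move=> hs; have [mB _ _ _ _] := hB; apply: measurable_sum => i; apply: measurable_funM => //.
by apply: measurable_funB; apply: mB; apply: (step_itv hs) => //; exact: ltnW.
Qed.

(** [stoch_integral] supplies some approximating sequence of step functions; a given step function
    close to [f] is compared with a late member of it on a common grid, where the difference of the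
    integrals is Gaussian with controlled variance. *)
Lemma wiener_close (l : 'I_p) (b : R) (f : R -> R) J (e : R) : 0 <= b <= 1 -> 0 < e ->
  measurable_fun (`[0, b] : set R) f ->
  stoch_integral P (fun u w => B u w l 0) 0 b f J ->
  forall m s c, is_step m s -> s m <= b ->
    (\int[lebesgue_measure]_(x in `[0%R, b]) ((step_fun m s c x - f x) ^+ 2)%:E
      <= ((e / 2) ^+ 3 / (4 * normal_m2))%:E)%E ->
    (P [set w | (e <= `|J w - step_integral (fun u w => B u w l 0) m s c w|)%R] <= e%:E)%E.
Proof.
move=> /andP[b0 b1] e0 mf [mJ [m' [s' [c' [hs' cL2 cP]]]]].
have m20 := @normal_m2_gt0 R; pose m2 : R := normal_m2; rewrite -/m2 in m20.
(* Two functions within [dl] of [f] are at squared distance at most [4 * dl]; by Chebyshev's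
   inequality at level [e / 2] this costs exactly the probability [e / 2]. *)
pose dl := (e / 2) ^+ 3 / (4 * m2).
have e2 : 0 < e / 2 by lra.
have dl0 : 0 < dl by rewrite divr_gt0 ?exprn_gt0 // mulr_gt0.
move=> m s c hs sb; rewrite -/m2 -/dl => hF.
have [N1 hN1] := cvge0_eventually cL2 dl0.
have [N2 hN2] := cvge0_eventually (cP _ e2) e2.
pose K := maxn N1 N2; have {}hN1 := hN1 K (leq_maxl _ _); have {}hN2 := hN2 K (leq_maxr _ _).
have [sK0 sKm sKi] := hs' K.
have hsK : is_step (m' K) (s' K) by split => //; rewrite ?sK0 ?sKm.
have [|n [tau [hg n0 tg]]] := @common_grid_steps R bool (fun i => if i then m else m' K)
  (fun i => if i then s else s' K); first by case.
have sg := tg true; have sg' := tg false; rewrite /= in sg sg'.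
pose F := step_fun m s c; pose F' := step_fun (m' K) (s' K) (c' K).
pose D x := F x - F' x.
have gD w : gridint tau n D (fun u => B u w l 0) =
    step_integral (fun u w => B u w l 0) m s c w - step_integral (fun u w => B u w l 0) (m' K) (s' K) (c' K) w.
  rewrite (gridint_step c _ _ hg hs sg) (gridint_step (c' K) _ _ hg hsK sg') /gridint -sumrB.
  by apply: eq_bigr => i _; rewrite mulrBl.
have mD : measurable_fun setT D by apply: measurable_funB; exact: measurable_step_fun.
have tail := gridint_tail D l hg e2.
have DE : (\sum_(i < n) D (tau i.+1) ^+ 2 * (tau i.+1 - tau i) <= 4 * dl).
  rewrite -lee_fin -(grid_integral (F := fun x => D x ^+ 2) hg); last 3 first.
  - exact: measurable_funX.
  - by move=> x; exact: sqr_ge0.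
  - by move=> k x kn kx; rewrite /D /F /F' (step_fun_cell _ hg sg kn kx) (step_fun_cell _ hg sg' kn kx).
  (* Both step functions vanish outside []0, b]], so the variance computed on the whole grid only
     involves the domain on which [f] is approximated. *)
  have D0 x : x \notin `]0, b] -> D x = 0.
    move=> xb; rewrite /D /F /F' /step_fun !big1 ?subrr // => i _; rewrite indicE memNset ?mulr0 //=.
      rewrite in_itv /= => /andP[h1 h2]; move/negP: xb; apply; rewrite in_itv /=; apply/andP; split.
        by apply: le_lt_trans h1; have [] := andP (step_itv hsK (ltnW (ltn_ord i))).
      by apply: le_trans h2 _; rewrite -sKm (step_mono hsK) // leqnn ltn_ord.
    rewrite in_itv /= => /andP[h1 h2]; move/negP: xb; apply; rewrite in_itv /=; apply/andP; split.
      by apply: le_lt_trans h1; have [] := andP (step_itv hs (ltnW (ltn_ord i))).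
    by apply: le_trans h2 _; apply: le_trans sb; rewrite (step_mono hs) // leqnn ltn_ord.
  have mF' : measurable_fun (`[0, b] : set R) F' by apply: measurable_funTS; exact: measurable_step_fun.
  have mF1 : measurable_fun (`[0, b] : set R) F by apply: measurable_funTS; exact: measurable_step_fun.
  have -> : (\int[lebesgue_measure]_(x in `]0%R, 1%R]) (D x ^+ 2)%:E =
      \int[lebesgue_measure]_(x in `[0%R, b]) (D x ^+ 2)%:E)%E.
    rewrite integral_mkcond [RHS]integral_mkcond; apply: eq_integral => x _.
    rewrite !patchE; have [xb|xb] := boolP (x \in `]0, b]); last first.
      by rewrite D0 // expr0n /=; case: ifP => _; case: ifP.
    have x0 : 0 < x <= b by move: xb; rewrite in_itv.
    rewrite !mem_set //=; rewrite in_itv /=; first by rewrite ltW ?(andP x0).1 ?(andP x0).2.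
    by rewrite (andP x0).1 (le_trans (andP x0).2).
  have m0b : measurable (`[0, b] : set R) by [].
  apply: le_trans (sq_dist_triangle lebesgue_measure m0b mF1 mF' mf) _.
  have -> : ((4 * dl)%:E = 2%:E * dl%:E + 2%:E * dl%:E)%E by rewrite -!EFinM -EFinD; congr EFin; lra.
  by apply: leeD; apply: lee_wpmul2l; rewrite ?lee_fin.
have mS := measurable_step_integral c l hs; have mS' := measurable_step_integral (c' K) l hsK.
rewrite [X in (_ <= X)%E](_ : _ = (e / 2 + e / 2)%:E); last by congr _%:E; lra.
apply: prob_union_le (hN2) (le_trans tail _).
- by apply: measurable_abs_ge; exact: measurable_funB.
- by apply: measurable_abs_ge; exact: measurable_funB.
- by apply: measurable_abs_ge; exact: measurable_gridint.
- move=> w /=; rewrite gD; set x := J w; set y := step_integral _ _ _ _ _; set z := step_integral _ _ _ _ _ => h.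
  have [h1|h1] := leP (e / 2) `|z - x|; first by left.
  right; rewrite leNgt; apply/negP => h2; move: h; rewrite leNgt => /negP; apply.
  rewrite (_ : x - y = - (z - x) - (y - z)); last by lra.
  by apply: le_lt_trans (ler_normB _ _) _; rewrite normrN; lra.
rewrite lee_fin; apply: le_trans (_ : m2 * (4 * dl) / (e / 2) ^+ 2 <= _).
  by rewrite ler_pM2r ?invr_gt0 ?exprn_gt0 // ler_pM2l.
rewrite /dl le_eqVlt; apply/orP; left; apply/eqP; move: e2; move: (e / 2) => e' e'0.
by field; rewrite !gt_eqF.
Qed.

End gridint_brownian.

(** Signal increments on the first factor and noise increments on the second then form one
    family. *)
Lemma gaussian_fin_prod d1 (T1 : measurableType d1) (P1 : probability T1 R)
    d2 (T2 : measurableType d2) (P2 : probability T2 R) (I1 I2 : finType) g1 g2 :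
  gaussian_fin P1 (I := I1) g1 -> gaussian_fin P2 (I := I2) g2 ->
  gaussian_fin (P1 \x P2)%E (fun (i : I1 + I2) w =>
    match i with inl i => g1 i w.1 | inr i => g2 i w.2 end).
Proof.
move=> [m1 h1] [m2 h2]; split=> [[i|i]|A mA].
- by apply: measurableT_comp => //; exact: m1.
- by apply: measurableT_comp => //; exact: m2.
have mI1 : measurable [set w | forall i, A (inl i) (g1 i w)].
  rewrite (_ : [set _ | _] = \bigcap_(i in [set: I1]) (g1 i @^-1` A (inl i))).
    apply: fin_bigcap_measurable => [|i _]; first exact: finite_finset.
    by rewrite -[X in measurable X]setTI; exact: m1.
  by apply/seteqP; split => w /= h i; [move=> _; exact: h|exact: (h i I)].
have mI2 : measurable [set w | forall i, A (inr i) (g2 i w)].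
  rewrite (_ : [set _ | _] = \bigcap_(i in [set: I2]) (g2 i @^-1` A (inr i))).
    apply: fin_bigcap_measurable => [|i _]; first exact: finite_finset.
    by rewrite -[X in measurable X]setTI; exact: m2.
  by apply/seteqP; split => w /= h i; [move=> _; exact: h|exact: (h i I)].
rewrite (_ : [set w | _] = [set w | forall i, A (inl i) (g1 i w)] `*` [set w | forall i, A (inr i) (g2 i w)]).
  apply: etrans (product_measure1E P1 P2 mI1 mI2) _; rewrite big_sumType; congr (_ * _)%E.
    by apply: h1 => i; exact: mA.
  by apply: h2 => i; exact: mA.
apply/seteqP; split => w /=; first by move=> h; split => i; [exact: (h (inl i))|exact: (h (inr i))].
by move=> [h3 h4] [i|i]; [exact: h3|exact: h4].
Qed.
End wiener.

(** * Continuous paths and Riemann sums *)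

Section pathwise.
Context {R : realType}.
Notation mu := (@lebesgue_measure R).

(** The events that some later error reaches [e] decrease to the empty set. *)
Lemma cvg_pointwise_prob d (T : measurableType d) (P : probability T R)
    (f_ : nat -> T -> R) (f : T -> R) (e dl : R) : (forall k, measurable_fun setT (f_ k)) ->
  (forall w, f_ k w @[k --> \oo] --> f w) -> 0 < e -> 0 < dl ->
  measurable_fun setT f /\
  exists N, forall k, (N <= k)%N -> (P [set w | (e <= `|f_ k w - f w|)%R] <= dl%:E)%E.
Proof.
move=> mf_ cf e0 dl0; have mf : measurable_fun setT f.
  by apply: (measurable_fun_cvg mf_) => w _; exact: cf.
split=> //; pose A n := [set w | e <= `|f_ n w - f w|].
have mA n : measurable (A n) by apply: measurable_abs_ge; exact: measurable_funB.
pose E n := \bigcup_(k in [set k | (n <= k)%N]) A k.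
have mE n : measurable (E n) by apply: bigcup_measurable.
have E0 : \bigcap_n E n = set0.
  rewrite -subset0 => w hw; have /cvgrPdist_lt /(_ _ e0) [N _ hN] := cf w.
  have [k /= Nk] := hw N I; rewrite /A /= leNgt => /negP; apply; rewrite distrC; exact: hN.
have cE : P (E n) @[n --> \oo] --> 0%E.
  rewrite -(measure0 P) -E0; apply: nonincreasing_cvg_mu => //.
  - by apply: le_lt_trans (probability_le1 P (mE 0%N)) _; rewrite ltry.
  - by rewrite E0.
  - move=> n m nm; apply/subsetPset => w [k /= mk hk]; exists k => //=; exact: leq_trans nm mk.
have [N hN] := cvge0_eventually cE dl0; exists N => k Nk.
apply: le_trans (hN k Nk); apply: le_measure; rewrite ?inE //; first exact: mA.
by move=> w hw; exists k => /=.
Qed.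

Lemma bounded_integrable_oc (f : R -> R) (C a b : R) : measurable_fun `]a, b] f ->
  (forall x, a < x <= b -> `|f x| <= C) -> mu.-integrable `]a, b] (EFin \o f).
Proof.
move=> mf hf; apply: measurable_bounded_integrable => //.
  by rewrite /= lebesgue_measure_itv /=; case: ifP => _; rewrite ?ltry // -EFinB ltry.
exists C; split; first exact: num_real.
by move=> y hy x /=; rewrite in_itv /= => /hf h; apply/ltW; apply: le_lt_trans hy.
Qed.

Section path.
Variable X : R -> R.
Hypothesis cX : {within `[0, 1], continuous X}.

(** Heine's theorem, from compactness of the unit interval. *)
Lemma path_uniform_continuity (e : R) : 0 < e -> exists2 dl : R, 0 < dl &
  forall x y, 0 <= x <= 1 -> 0 <= y <= 1 -> `|x - y| < dl -> `|X x - X y| < e.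
Proof.
move=> e0; have /compact_near_coveringP nc := @segment_compact R 0 1.
pose Q (dl x : R) := 0 <= x <= 1 -> forall y, 0 <= y <= 1 -> `|x - y| < dl -> `|X x - X y| < e.
have nQ : \forall dl \near 0^'+, `[0, 1] `<=` Q dl.
  apply: nc.
  move=> x; rewrite /= in_itv /= => x01.
  have /subspace_continuousP := cX; move=> /(_ x); rewrite /= in_itv /= => /(_ x01).
  have e2 : 0 < e / 2 by lra.
  move=> /cvgrPdist_lt /(_ _ e2) [r /= r0 hr].
  have r2 : 0 < r / 2 by lra.
  exists (ball x (r / 2), [set dl | dl < r / 2]) => /=.
    split; first exact: nbhsx_ballx.
    by apply: nbhs_right_lt.
  move=> [x' dl] /= [hx' hdl] x'01 y y01 xy.
  have h1 : `|X x - X x'| < e / 2.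
    by apply: hr => /=; [move: hx'; rewrite /ball /=; lra|rewrite in_itv].
  have h2 : `|X x - X y| < e / 2.
    apply: hr => /=; last by rewrite in_itv.
    rewrite (_ : x - y = (x - x') + (x' - y)); last by lra.
    by apply: le_lt_trans (ler_normD _ _) _; move: hx'; rewrite /ball /=; lra.
  rewrite (_ : X x' - X y = - (X x - X x') + (X x - X y)); last by lra.
  by apply: le_lt_trans (ler_normD _ _) _; rewrite normrN; lra.
have [dl [dl0 hdl]] := filter_ex (filterI (nbhs_right_gt (0 : R)) nQ).
exists dl => // x y x01 y01; apply: (hdl x _) => //=; by rewrite in_itv.
Qed.

Lemma path_bounded : exists2 C : R, 0 < C & forall x, 0 <= x <= 1 -> `|X x| <= C.
Proof.
have [c _ hc] := EVT_max ler01 cX; have [c' _ hc'] := EVT_min ler01 cX.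
exists (1 + `|X c| + `|X c'|) => [|x x01]; first by rewrite -addrA ltr_pwDl // addr_ge0.
have x01' : x \in `[0, 1] by rewrite in_itv.
rewrite ler_norml; have := hc _ x01'; have := hc' _ x01'.
have := ler_norm (X c); have := ler_norm (- X c'); rewrite normrN.
have := normr_ge0 (X c); have := normr_ge0 (X c'); lra.
Qed.

Lemma path_measurable (a b : R) : 0 <= a -> b <= 1 -> measurable_fun `]a, b] X.
Proof.
move=> a0 b1; have mI : measurable (`[0, 1] : set R) by [].
apply: (measurable_funS mI _ (subspace_continuous_measurable_fun mI cX)).
by move=> x /=; rewrite !in_itv /= => /andP[ax xb]; rewrite (le_trans a0 (ltW ax)) (le_trans xb b1).
Qed.

Lemma path_integrable (g : R -> R) (C a b : R) : 0 <= a -> b <= 1 -> measurable_fun setT g ->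
  (forall x, a < x <= b -> `|g x| <= C) ->
  mu.-integrable `]a, b] (EFin \o (fun x => g x * X x)).
Proof.
move=> a0 b1 mg hg; have [K K0 hK] := path_bounded.
apply: (bounded_integrable_oc (C := C * K)).
  by apply: measurable_funM; [exact: measurable_funTS|exact: path_measurable].
move=> x /andP[ax xb]; rewrite normrM; apply: ler_pM => //; first by apply: hg; rewrite ax.
by apply: hK; rewrite (le_trans a0 (ltW ax)) (le_trans xb b1).
Qed.

End path.

Lemma FTC_oc (G g : R -> R) x y : (forall z : R, is_derive z 1 G (g z)) -> continuous g -> x <= y ->
  \int[mu]_(z in `]x, y]) g z = G y - G x.
Proof.
move=> dG cg; rewrite le_eqVlt => /orP[/eqP ->|xy].
  by rewrite set_itvoc0 Rintegral_set0 subrr.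
have cgxy : {within `[x, y], continuous g} by exact: continuous_subspaceT.
rewrite /Rintegral integral_itv_obnd_cbnd; last first.
  by apply/measurable_EFinP; apply: measurable_funTS; exact: continuous_measurable_fun.
have cG z : {for z, continuous G}.
  by apply: differentiable_continuous; apply/derivable1_diffP; case: (dG z).
rewrite (continuous_FTC2 (F := G) xy cgxy) //.
  by split=> [z _||]; [case: (dG z)|apply: cvg_at_right_filter; exact: cG|apply: cvg_at_left_filter; exact: cG].
by move=> z _; rewrite derive1E; case: (dG z).
Qed.

Section riemann.
Variables (X G g : R -> R) (a C : R).
Hypothesis cX : {within `[0, 1], continuous X}.
Hypothesis dG : forall z : R, is_derive z 1 G (g z).
Hypothesis cg : continuous g.
Hypothesis a0 : 0 <= a.
Hypothesis gC : forall x, 0 <= x <= 1 -> `|g x| <= C.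

Let mg : measurable_fun setT g := continuous_measurable_fun cg.

(** On a cell the increment of [G] is the integral of [g], so the error is the integral of [g]
    against the oscillation of [X]. *)
Lemma riemann_sum_error (s : nat -> R) m (e dl : R) : s 0%N = a -> s m <= 1 -> 0 <= e ->
  (forall i, (i < m)%N -> s i <= s i.+1) ->
  (forall x y, 0 <= x <= 1 -> 0 <= y <= 1 -> `|x - y| < dl -> `|X x - X y| < e) ->
  (forall i, (i < m)%N -> s i.+1 - s i < dl) ->
  `|\sum_(i < m) X (s i.+1) * (G (s i.+1) - G (s i)) - \int[mu]_(x in `]a, s m]) (g x * X x)|
    <= e * C * (s m - a).
Proof.
move=> s0 sm e0 smono hX hdl; have sa i : (i <= m)%N -> a <= s i.
  elim: i => [|i IH] im; first by rewrite s0.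
  by apply: le_trans (IH (ltnW im)) (smono i im).
elim: m sm smono hdl sa => [|m IH] sm smono hdl sa.
  by rewrite big_ord0 s0 set_itvoc0 Rintegral_set0 subr0 normr0 subrr mulr0.
have s_m : s m <= s m.+1 by exact: smono.
have sm1 : s m <= 1 := le_trans s_m sm.
have asm : a <= s m by apply: sa.
have {}IH := IH sm1 (fun i h => smono i (ltnW h)) (fun i h => hdl i (ltnW h)) (fun i h => sa i (leqW h)).
have iab x y : a <= x -> y <= 1 -> mu.-integrable `]x, y] (EFin \o (fun x => g x * X x)).
  move=> ax y1; apply: (path_integrable cX (C := C)) => //; first exact: le_trans ax.
  move=> z /andP[xz zy]; apply: gC; rewrite (le_trans zy y1) andbT.
  by apply: le_trans a0 _; apply: le_trans ax (ltW xz).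
have split_int : \int[mu]_(x in `]a, s m.+1]) (g x * X x) =
    \int[mu]_(x in `]a, s m]) (g x * X x) + \int[mu]_(x in `]s m, s m.+1]) (g x * X x).
  have := @Rintegral_itvB R (fun x => g x * X x) (BRight a) (BRight (s m.+1)) (s m) (iab _ _ (lexx a) sm).
  by rewrite !bnd_simp => <- //; rewrite addrC subrK.
have gC' z : s m < z <= s m.+1 -> 0 <= z <= 1.
  by move=> /andP[h1 h2]; rewrite (le_trans a0 (le_trans asm (ltW h1))) (le_trans h2 sm).
have ig : mu.-integrable `]s m, s m.+1] (EFin \o g).
  apply: (bounded_integrable_oc (C := C)); first exact: measurable_funTS.
  by move=> z /gC'; exact: gC.
have mI : measurable (`]s m, s m.+1] : set R) by [].
have cell : `|X (s m.+1) * (G (s m.+1) - G (s m)) - \int[mu]_(x in `]s m, s m.+1]) (g x * X x)|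
    <= e * C * (s m.+1 - s m).
  have i1 : mu.-integrable `]s m, s m.+1] (EFin \o (fun x => X (s m.+1) * g x)).
    by have := @integrableZl _ _ R mu _ mI (X (s m.+1)) _ ig; apply: eq_integrable.
  rewrite -(FTC_oc dG cg s_m) -RintegralZl // -RintegralB //; last exact: iab.
  have i2 : mu.-integrable `]s m, s m.+1] (EFin \o (fun x => X (s m.+1) * g x - g x * X x)).
    by have := @integrableB _ _ R mu _ mI _ _ i1 (iab _ _ asm sm); apply: eq_integrable.
  apply: le_trans (le_normr_Rintegral _ i2) _ => //.
  apply: (@le_trans _ _ (\int[mu]_(x in `]s m, s m.+1]) (e * C))).
    apply: le_Rintegral => //.
    - by have := integrable_norm i2; apply: eq_integrable.
    - apply: (bounded_integrable_oc (C := `|e * C|)) => //; exact: measurable_cst.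
    move=> x /=; rewrite in_itv /= => hx; rewrite (_ : _ - _ = (X (s m.+1) - X x) * g x); last by lra.
    rewrite normrM ler_pM //; last by apply: gC; exact: gC'.
    apply/ltW/hX; [|exact: gC'|].
      by rewrite sm andbT; apply: le_trans a0 (le_trans asm s_m).
    have /andP[h1 h2] := hx; rewrite ger0_norm ?subr_ge0 //.
    by apply: le_lt_trans (hdl m (ltnSn m)); lra.
  rewrite Rintegral_cst //= lebesgue_measure_itv /= lte_fin.
  case: ifP => h; first by rewrite -EFinB.
  have -> : s m.+1 = s m by apply/eqP; rewrite eq_le s_m andbT leNgt h.
  by rewrite /= subrr !mulr0.
rewrite big_ord_recr /= split_int.
rewrite (_ : _ + _ - _ = (\sum_(i < m) X (s i.+1) * (G (s i.+1) - G (s i)) - \int[mu]_(x in `]a, s m]) (g x * X x)) +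
  (X (s m.+1) * (G (s m.+1) - G (s m)) - \int[mu]_(x in `]s m, s m.+1]) (g x * X x))); last by lra.
apply: le_trans (ler_normD _ _) _; apply: le_trans (lerD IH cell) _; lra.
Qed.

Definition uniform_mesh (a b : R) m i : R := a + (b - a) * i%:R / m%:R.

Lemma riemann_sum_cvg b : a <= b <= 1 ->
  \sum_(i < m.+1) X (uniform_mesh a b m.+1 i.+1) *
     (G (uniform_mesh a b m.+1 i.+1) - G (uniform_mesh a b m.+1 i)) @[m --> \oo] -->
  \int[mu]_(x in `]a, b]) (g x * X x).
Proof.
move=> /andP[ab b1]; apply/cvgrPdist_le => e e0.
have C0 : 0 <= C.
  by apply: le_trans (normr_ge0 (g 0)) (gC _); rewrite lexx ler01.
have eC : 0 < e / (C + 1) by rewrite divr_gt0 //; lra.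
have [dl dl0 hdl] := path_uniform_continuity cX eC.
have mesh_n m : uniform_mesh a b m.+1 m.+1 = b by rewrite /uniform_mesh mulfK ?subrKC // pnatr_eq0.
have step m i : uniform_mesh a b m.+1 i.+1 - uniform_mesh a b m.+1 i = (b - a) / m.+1%:R.
  rewrite /uniform_mesh -[i.+1%:R]natr1; have : (m.+1%:R : R) != 0 by rewrite pnatr_eq0.
  by move: m.+1%:R => k k0; field.
exists (Num.truncn (1 / dl)) => // m /= hm.
have hm2 : (b - a) / m.+1%:R < dl.
  rewrite ltr_pdivrMr ?ltr0n // -ltr_pdivrMl //; apply: le_lt_trans (_ : 1 / dl < _).
    by rewrite mul1r ler_piMr ?invr_ge0 ?(ltW dl0) // lerBlDr (le_trans b1) // lerDl.
  by apply: lt_le_trans (truncnS_gt _) _; rewrite ler_nat ltnS.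
have := @riemann_sum_error (uniform_mesh a b m.+1) m.+1 (e / (C + 1)) dl.
rewrite mesh_n; move=> /(_ _ b1 (ltW eC) _ hdl _) h; rewrite distrC; apply: le_trans (h _ _ _) _.
- by rewrite /uniform_mesh mulr0 mul0r addr0.
- by move=> i _; rewrite -subr_ge0 step divr_ge0 // subr_ge0.
- by move=> i _; rewrite step.
apply: le_trans (_ : e / (C + 1) * C * 1 <= _).
  apply: ler_wpM2l; first by rewrite mulr_ge0 // ltW.
  by rewrite lerBlDr (le_trans b1) // lerDl.
by rewrite mulr1 mulrAC ler_pdivrMr ?ler_pM2l //; lra.
Qed.

End riemann.
End pathwise.

(** * The observed coefficients split into signal and noise *)

Section drift.
Context {R : realType}.
Notation mu := (@lebesgue_measure R).

Lemma step_fun_bounded m (s c : nat -> R) x : `|step_fun m s c x| <= \sum_(i < m) `|c i|.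
Proof.
apply: le_trans (ler_norm_sum _ _ _) _; apply: ler_sum => i _; rewrite normrM ler_piMr //.
by rewrite indicE normr_nat lern1 leq_b1.
Qed.

Section path.
Variable X : R -> R.
Hypothesis cX : {within `[0, 1], continuous X}.

Let U s := \int[mu]_(x in `[0, s]) X x.

Lemma path_integrable_cc b : b <= 1 -> mu.-integrable `[0, b] (EFin \o X).
Proof.
move=> b1; have m0 : measurable (`[0, 1] : set R) by [].
have mb : measurable (`[0, b] : set R) by [].
apply: (@integrableS _ _ R mu _ _ _ m0 mb); last by apply: continuous_compact_integrable => //; exact: segment_compact.
by move=> x /=; rewrite !in_itv /= => /andP[-> xb]; rewrite (le_trans xb b1).
Qed.

Lemma path_integral_increment x y : 0 <= x <= y -> y <= 1 ->
  U y - U x = \int[mu]_(z in `]x, y]) X z.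
Proof.
move=> /andP[x0 xy] y1; have := @Rintegral_itvB R X (BLeft 0) (BRight y) x (path_integrable_cc y1).
by rewrite !bnd_simp => ->.
Qed.

Lemma step_integral_drift m (s c : nat -> R) (a b : R) : is_step m s -> a <= s 0%N -> s m <= b -> 0 <= a -> b <= 1 ->
  \sum_(i < m) c i * (U (s i.+1) - U (s i)) = \int[mu]_(x in `]a, b]) (step_fun m s c x * X x).
Proof.
move=> hs as0 sb a0 b1.
have mab : measurable (`]a, b] : set R) by [].
suff h k : (k <= m)%N -> \sum_(i < k) c i * (U (s i.+1) - U (s i)) =
    \int[mu]_(x in `]a, b]) (step_fun k s c x * X x) by exact: h.
elim: k => [_|k IH km].
  rewrite big_ord0 -[LHS](mul0r (fine (mu `]a, b]))) -Rintegral_cst //.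
  by congr fine; apply: eq_integral => x _; rewrite /step_fun big_ord0 mul0r.
have km' := ltnW km.
have sk : 0 <= s k <= s k.+1.
  by rewrite (step_mono hs) ?leqnSn // andbT; have [] := andP (step_itv hs km').
have sk1 : s k.+1 <= 1 by have [] := andP (step_itv hs km).
rewrite big_ord_recr /= IH // path_integral_increment //.
have i1 n : mu.-integrable `]a, b] (EFin \o (fun x => step_fun n s c x * X x)).
  apply: (path_integrable cX a0 b1 (measurable_step_fun n s c)) => x _; exact: step_fun_bounded.
have i2 : mu.-integrable `]a, b] (EFin \o (fun x => (c k * \1_(`]s k, s k.+1]) x) * X x)).
  apply: (path_integrable (C := `|c k|) cX a0 b1).
    by apply: measurable_funM; [exact: measurable_cst|exact: measurable_indic].
  by move=> x _; rewrite normrM ler_piMr // indicE normr_nat lern1 leq_b1.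
have i3 : mu.-integrable `]s k, s k.+1] (EFin \o X).
  have m0 : measurable (`[0, 1] : set R) by [].
  have mk : measurable (`]s k, s k.+1] : set R) by [].
  apply: (@integrableS _ _ R mu _ _ _ m0 mk); last exact: (path_integrable_cc (lexx 1)).
  move=> x /=; rewrite !in_itv /= => /andP[h1 h2]; have /andP[h3 _] := sk.
  by rewrite (le_trans h3 (ltW h1)) (le_trans h2 sk1).
rewrite -RintegralZl // -[X in _ + X = _](_ : \int[mu]_(x in `]a, b]) ((c k * \1_(`]s k, s k.+1]) x) * X x) = _).
  rewrite -RintegralD //; congr fine; apply: eq_integral => x _.
  by rewrite [in RHS]/step_fun big_ord_recr /= mulrDl.
rewrite /Rintegral; congr fine; rewrite integral_mkcond [RHS]integral_mkcond; apply: eq_integral => x _.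
rewrite !patchE indicE; case: (boolP (x \in `]s k, s k.+1]%classic)) => hx.
  rewrite mem_set ?mulr1 //=; move: hx; rewrite inE /= !in_itv /= => /andP[h1 h2].
  apply/andP; split; first by apply: le_lt_trans h1; apply: le_trans as0 _; rewrite (step_mono hs) // km'.
  by apply: le_trans h2 _; apply: le_trans sb; rewrite (step_mono hs) // km leqnn.
by rewrite mulr0 mul0r; case: ifP.
Qed.

(** The mean square distance enters through the pointwise inequality [z <= e + e^-1 * z ^+ 2]. *)
Lemma step_drift_error m (s c : nat -> R) (a b : R) (g : R -> R) (C K e dl : R) : is_step m s -> s 0%N = a -> s m = b ->
  measurable_fun setT g -> (forall x, 0 <= x <= 1 -> `|g x| <= C) ->
  (forall x, 0 <= x <= 1 -> `|X x| <= K) -> 0 < e -> 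
  (\int[mu]_(x in `[a, b]) ((step_fun m s c x - g x) ^+ 2)%:E <= dl%:E)%E ->
  `|\sum_(i < m) c i * (U (s i.+1) - U (s i)) - \int[mu]_(x in `]a, b]) (g x * X x)|
    <= K * (e + e^-1 * dl).
Proof.
move=> hs sa sb mg hC hK e0 hdl.
have [a0 b1 _] := hs; rewrite sa in a0; rewrite sb in b1.
have ab : a <= b by rewrite -sa -sb (step_mono hs) ?leqnn.
rewrite (step_integral_drift c hs (a := a) (b := b)) ?sa ?sb //.
have mab : measurable (`]a, b] : set R) by [].
have oc x : a < x <= b -> 0 <= x <= 1.
  by move=> /andP[h1 h2]; rewrite (le_trans a0 (ltW h1)) (le_trans h2 b1).
pose F := step_fun m s c; have mF : measurable_fun setT F := measurable_step_fun m s c.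
have FC x : `|F x| <= \sum_(i < m) `|c i| := step_fun_bounded m s c x.
have i1 := path_integrable cX a0 b1 mF (fun x _ => FC x).
have i2 := path_integrable cX a0 b1 mg (fun x h => hC x (oc x h)).
have mD : measurable_fun setT (fun x => F x - g x) by exact: measurable_funB.
have DC x : a < x <= b -> `|F x - g x| <= \sum_(i < m) `|c i| + C.
  by move=> h; apply: le_trans (ler_normB _ _) _; rewrite lerD // hC // oc.
rewrite -RintegralB //.
have i3 : mu.-integrable `]a, b] (EFin \o (fun x => F x * X x - g x * X x)).
  by have := @integrableB _ _ R mu _ mab _ _ i1 i2; apply: eq_integrable.
apply: le_trans (le_normr_Rintegral _ i3) _ => //.
have K0 : 0 <= K by apply: le_trans (normr_ge0 (X 0)) (hK _ _); rewrite lexx ler01.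
pose q x := (F x - g x) ^+ 2.
have iq : mu.-integrable `]a, b] (EFin \o q).
  apply: (bounded_integrable_oc (C := (\sum_(i < m) `|c i| + C) ^+ 2)).
    by apply: measurable_funX; exact: measurable_funTS.
  move=> x hx; rewrite /q normrX lerXn2r ?nnegrE ?DC //.
  by apply: le_trans (DC x hx).
have iK : mu.-integrable `]a, b] (EFin \o (fun x => K * e + K / e * q x)).
  have ic : mu.-integrable `]a, b] (EFin \o (fun=> K * e)).
    by apply: (bounded_integrable_oc (C := `|K * e|)) => //; exact: measurable_cst.
  have iz := @integrableZl _ _ R mu _ mab (K / e) _ iq.
  by have := @integrableD _ _ R mu _ mab _ _ ic iz; apply: eq_integrable.
apply: (@le_trans _ _ (\int[mu]_(x in `]a, b]) (K * e + K / e * q x))).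
  apply: le_Rintegral => //; first by have := integrable_norm i3; apply: eq_integrable.
  move=> x /=; rewrite in_itv /= => hx; rewrite -mulrBl normrM mulrC.
  apply: le_trans (_ : K * `|F x - g x| <= _); first by rewrite ler_wpM2r // hK // oc.
  rewrite -mulrA -mulrDr ler_wpM2l // /q -[in X in _ <= X]real_normK ?num_real //.
  move: (normr_ge0 (F x - g x)); move: `|_| => z z0.
  rewrite -(ler_pM2l e0) mulrDr mulrA mulfV ?gt_eqF // mul1r; nra.
rewrite RintegralD //; last 2 first.
  by apply: (bounded_integrable_oc (C := `|K * e|)) => //; exact: measurable_cst.
  by have := @integrableZl _ _ R mu _ mab (K / e) _ iq; apply: eq_integrable.
rewrite Rintegral_cst // RintegralZl //= lebesgue_measure_itv /= lte_fin.
have hq : \int[mu]_(x in `]a, b]) q x <= dl.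
  rewrite -lee_fin /Rintegral fineK; last by apply: integrable_fin_num.
  rewrite integral_itv_obnd_cbnd //.
  by apply/measurable_EFinP; apply: measurable_funX; exact: measurable_funTS.
rewrite mulrDr [K * (e^-1 * dl)]mulrA lerD //; last by rewrite ler_wpM2l // divr_ge0 // ltW.
case: ifP => h; rewrite ?mulr0 ?mulr_ge0 ?(ltW e0) //.
by rewrite -EFinB /= ler_piMr ?mulr_ge0 ?(ltW e0) // lerBlDr (le_trans b1) // lerDl.
Qed.

End path.

Section process.
Context d (T : measurableType d) (P : probability T R) (X : R -> T -> R).
Hypothesis mX : forall s, 0 <= s <= 1 -> measurable_fun setT (X s).
Hypothesis cX : forall w, {within `[0, 1], continuous (fun s => X s w)}.

Lemma mesh_itv (a b : R) m i : 0 <= a -> a <= b <= 1 -> (i <= m.+1)%N ->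
  0 <= uniform_mesh a b m.+1 i <= 1.
Proof.
move=> a0 /andP[ab b1] im; rewrite /uniform_mesh.
have h : 0 <= (i%:R / m.+1%:R : R) <= 1.
  by rewrite divr_ge0 //= ler_pdivrMr ?ltr0n // mul1r ler_nat.
rewrite -mulrA; move: h => /andP[]; move: (_ / _) => z z0 z1.
have : 0 <= (b - a) * z by rewrite mulr_ge0 // subr_ge0.
have : (b - a) * z <= b - a by rewrite ler_piMr // subr_ge0.
by move=> h1 h2; apply/andP; split; lra.
Qed.

(** A Riemann-Stieltjes sum of [Z] against [G]; it involves [Z] at finitely many times only. *)
Definition mesh_sum (G : R -> R) a b m (Z : R -> R) : R :=
  \sum_(i < m.+1) Z (uniform_mesh a b m.+1 i.+1) *
     (G (uniform_mesh a b m.+1 i.+1) - G (uniform_mesh a b m.+1 i)).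

Lemma measurable_mesh_sum G (a b : R) m : 0 <= a -> a <= b <= 1 ->
  measurable_fun setT (fun w => mesh_sum G a b m (X ^~ w)).
Proof.
move=> a0 ab; apply: measurable_sum => i; apply: measurable_funM => //.
by apply: mX; exact: mesh_itv.
Qed.

(** A pointwise limit of Riemann sums with [G] the identity. *)
Lemma measurable_drift s : 0 <= s <= 1 ->
  measurable_fun setT (fun w => \int[mu]_(u in `[0, s]) X u w).
Proof.
move=> /andP[s0 s1].
have dI z : is_derive (z : R) 1 (id : R -> R) (1 : R) by exact: is_derive_id.
have cst1 : continuous (fun _ : R => 1 : R) by move=> x; exact: cvg_cst.
have h0s : (0 : R) <= s <= 1 by rewrite s0.
apply: (measurable_fun_cvg (h := fun m w => mesh_sum id 0 s m (X ^~ w))).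
  by move=> m; apply: measurable_mesh_sum.
move=> w _; have := riemann_sum_cvg (@cX w) dI cst1 (lexx 0) (C := 1) _ h0s.
have -> : \int[mu]_(x in `]0, s]) (1 * X x w) = \int[mu]_(u in `[0, s]) X u w.
  rewrite -Rintegral_itv_obnd_cbnd; last first.
    have := path_integrable (@cX w) (lexx 0) s1 (C := 1) (g := fun=> 1) _ _.
    rewrite (_ : EFin \o (fun x => 1 * X x w) = EFin \o (X ^~ w)); last first.
      by apply/funext => x /=; rewrite mul1r.
    by apply=> // x _; rewrite normr1.
  by congr fine; apply: eq_integral => x _; rewrite mul1r.
by apply=> x _; rewrite normr1.
Qed.

(** Abel summation. Since [G] vanishes at both ends no boundary term remains, and the process enters
    through its increments: the initial value of the signal disappears. *)
Lemma mesh_sum_by_parts G (a b : R) m Z : G a = 0 -> G b = 0 ->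
  mesh_sum G a b m Z = - \sum_(i < m.+1) G (uniform_mesh a b m.+1 i) *
    (Z (uniform_mesh a b m.+1 i.+1) - Z (uniform_mesh a b m.+1 i)).
Proof.
move=> Ga Gb; apply/eqP; rewrite -subr_eq0 opprK -big_split /=; apply/eqP.
pose H i := G (uniform_mesh a b m.+1 i) * Z (uniform_mesh a b m.+1 i).
rewrite (eq_bigr (fun i : 'I_m.+1 => H i.+1 - H i)); last by move=> i _; rewrite /H; ring.
rewrite -(big_mkord xpredT (fun i => H i.+1 - H i)) telescope_sumr // /H.
have -> : uniform_mesh a b m.+1 0 = a by rewrite /uniform_mesh mulr0 mul0r addr0.
have -> : uniform_mesh a b m.+1 m.+1 = b by rewrite /uniform_mesh mulfK ?subrKC // pnatr_eq0.
by rewrite Ga Gb !mul0r subrr.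
Qed.

(** The integrals of the step functions against the drift and the Riemann sums have the same
    pathwise limit, so the former may be exchanged for the latter and the step function is kept for
    [Z] only. The bound for all [M] past [M0] lets several coefficients share one mesh. *)
Lemma observed_coefficient_close (Z : R -> T -> R) (I : T -> R) (G g : R -> R) (C a b e : R) :
  (forall s, 0 <= s <= 1 -> measurable_fun setT (Z s)) ->
  (forall z : R, is_derive z 1 G (g z)) -> continuous g ->
  (forall x, 0 <= x <= 1 -> `|g x| <= C) -> 0 <= a -> a <= b <= 1 -> 0 < e ->
  stoch_integral P (fun s w => (\int[mu]_(u in `[0, s]) X u w) + Z s w) a b g I ->
  exists m s c, [/\ is_step m s, s 0%N = a, s m = b,
    (\int[mu]_(x in `[a, b]) ((step_fun m s c x - g x) ^+ 2)%:E <= e%:E)%E &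
    exists M0, forall M, (M0 <= M)%N ->
    (P [set w | (e <= `|I w - (mesh_sum G a b M (X ^~ w) + step_integral Z m s c w)|)%R] <= e%:E)%E].
Proof.
move=> mZ dG cg gC a0 ab e0 [mI [m_ [s_ [c_ [hs cL2 cP]]]]].
have e3 : 0 < e / 3 by lra.
have b1 : b <= 1 by case/andP: ab.
have hst k : is_step (m_ k) (s_ k).
  by have [h1 h2 h3] := hs k; split => //; rewrite ?h1 ?h2.
pose J w := \int[mu]_(x in `]a, b]) (g x * X x w).
pose U s w := \int[mu]_(u in `[0, s]) X u w.
pose D k w := \sum_(i < m_ k) c_ k i * (U (s_ k i.+1) w - U (s_ k i) w).
have mU s : 0 <= s <= 1 -> measurable_fun setT (U s) by exact: measurable_drift.
have mD k : measurable_fun setT (D k).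
  apply: measurable_sum => i; apply: measurable_funM => //.
  by apply: measurable_funB; apply: mU; apply: (step_itv (hst k)) => //; exact: ltnW.
have cD w : D k w @[k --> \oo] --> J w.
  apply/cvgrPdist_le => r r0; have [K K0 hK] := path_bounded (@cX w).
  pose q := r / (2 * K); have q0 : 0 < q by rewrite divr_gt0 // mulr_gt0.
  have q2 : 0 < q ^+ 2 by rewrite exprn_gt0.
  have [N hN] := cvge0_eventually cL2 q2; exists N => // k /= Nk.
  have [h1 h2 _] := hs k; rewrite distrC.
  apply: le_trans (step_drift_error (@cX w) (hst k) h1 h2 (continuous_measurable_fun cg) gC hK q0 (hN k Nk)) _.
  by rewrite /q le_eqVlt; apply/orP; left; apply/eqP; field; rewrite !gt_eqF.
have [mJ [N1 hN1]] := cvg_pointwise_prob P mD cD e3 e3.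
have mS m : measurable_fun setT (fun w => mesh_sum G a b m (X ^~ w)) by exact: measurable_mesh_sum.
have cS w : mesh_sum G a b m (X ^~ w) @[m --> \oo] --> J w.
  exact: (riemann_sum_cvg (@cX w) dG cg a0 gC).
have [_ [M0 hM0]] := cvg_pointwise_prob P mS cS e3 e3.
have [N2 hN2] := cvge0_eventually (cP _ e3) e3.
have [N3 hN3] := cvge0_eventually cL2 e0.
pose k := maxn N1 (maxn N2 N3).
have k1 : (N1 <= k)%N by rewrite leq_maxl.
have k2 : (N2 <= k)%N by rewrite /k maxnCA leq_maxl.
have k3 : (N3 <= k)%N by rewrite /k maxnA leq_maxr.
have [h1 h2 _] := hs k.
exists (m_ k), (s_ k), (c_ k); split => //; first exact: hN3.
exists M0 => M hM.
pose Y w := step_integral (fun s w => U s w + Z s w) (m_ k) (s_ k) (c_ k) w.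
pose V w := step_integral Z (m_ k) (s_ k) (c_ k) w.
have YE w : Y w = D k w + V w.
  by rewrite /Y /V /D /step_integral -big_split; apply: eq_bigr => i _ /=; ring.
have mV : measurable_fun setT V.
  apply: measurable_sum => i; apply: measurable_funM => //.
  by apply: measurable_funB; apply: mZ; apply: (step_itv (hst k)) => //; exact: ltnW.
have mY : measurable_fun setT Y.
  by rewrite (_ : Y = fun w => D k w + V w); [exact: measurable_funD|apply/funext].
rewrite [X in (_ <= X)%E](_ : _ = (e / 3 + (e / 3 + e / 3))%:E); last by congr _%:E; lra.
pose A := [set w | e / 3 <= `|Y w - I w|].
pose B1 := [set w | e / 3 <= `|D k w - J w|].
pose B2 := [set w | e / 3 <= `|mesh_sum G a b M (X ^~ w) - J w|].
have mA : measurable A by apply: measurable_abs_ge; exact: measurable_funB.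
have mB1 : measurable B1 by apply: measurable_abs_ge; exact: measurable_funB.
have mB2 : measurable B2 by apply: measurable_abs_ge; apply: measurable_funB => //; exact: mS.
have hB : (P (B1 `|` B2) <= (e / 3 + e / 3)%:E)%E.
  by apply: prob_union_le (hN1 k k1) (hM0 M hM) => //; exact: measurableU.
apply: prob_union_le (hN2 k k2) hB => //.
- by apply: measurable_abs_ge; apply: measurable_funB => //; apply: measurable_funD => //; exact: mS.
- exact: measurableU.
move=> w /=; rewrite /B1 /B2 -/(Y w) -/(V w) YE => h.
have [?|n1] := leP (e / 3) `|D k w + V w - I w|; first by left.
right; have [?|n2] := leP (e / 3) `|D k w - J w|; first by left.
right; rewrite /= leNgt; apply/negP => n3; move: h; rewrite leNgt => /negP; apply.
rewrite (_ : I w - _ = - (D k w + V w - I w) + ((D k w - J w) - (mesh_sum G a b M (X ^~ w) - J w))); last by lra.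
apply: le_lt_trans (ler_normD _ _) _; rewrite normrN.
apply: le_lt_trans (lerD (lexx _) (ler_normB _ _)) _; lra.
Qed.

End process.
End drift.

(** * The signal in terms of Brownian increments, and the separation from the noise *)

Section closeness.
Context {R : realType}.
Notation mu := (@lebesgue_measure R).

Lemma prob_exists_le (I : finType) d (T : measurableType d) (P : probability T R) (A : I -> set T) (e : R) :
  (forall i, measurable (A i)) -> (forall i, P (A i) <= e%:E)%E ->
  measurable [set w | exists i, A i w] /\
  (P [set w | exists i, A i w] <= (#|I|%:R * e)%:E)%E.
Proof.
move=> mA hA.
suff h (s : seq I) : measurable [set w | exists2 i, i \in s & A i w] /\
    (P [set w | exists2 i, i \in s & A i w] <= ((size s)%:R * e)%:E)%E.
  have [h1 h2] := h (enum I); rewrite -cardE in h2.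
  have E : [set w | exists i, A i w] = [set w | exists2 i, i \in enum I & A i w].
    apply/seteqP; split => w /=; first by move=> [i hi]; exists i => //; rewrite mem_enum.
    by move=> [i _ hi]; exists i.
  by rewrite E.
elim: s => [|i s [IH1 IH2]].
  rewrite (_ : [set w | _] = set0) ?measure0 ?mul0r //.
  by apply/seteqP; split => w // -[].
rewrite (_ : [set w | _] = A i `|` [set w | exists2 i, i \in s & A i w]).
  split; first exact: measurableU.
  rewrite /= -natr1 mulrDl mul1r addrC.
  by apply: prob_union_le (hA i) IH2 => //; exact: measurableU.
apply/seteqP; split => w /=.
  by move=> [k]; rewrite in_cons => /orP[/eqP ->|ks] hk; [left|right; exists k].
by move=> [hi|[k ks hk]]; [exists i|exists k]; rewrite // in_cons ?eqxx ?ks ?orbT.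
Qed.

Lemma close_linear (I : finType) (c : I -> R) (e : R) : 0 < e -> exists2 e' : R, 0 < e' &
  forall d (T : measurableType d) (P : probability T R) (f g : I -> T -> R),
  (forall i, measurable_fun setT (f i)) -> (forall i, measurable_fun setT (g i)) ->
  (forall i, P [set w | (e' <= `|f i w - g i w|)%R] <= e'%:E)%E ->
  (P [set w | (e <= `|\sum_i c i * f i w - \sum_i c i * g i w|)%R] <= e%:E)%E.
Proof.
(* Covers both the union bound over [I] and the total size of the coefficients. *)
move=> e0; pose C := 1 + #|I|%:R + \sum_i `|c i|.
have s0 : 0 <= \sum_i `|c i| by apply: sumr_ge0.
have n0 : 0 <= #|I|%:R :> R by [].
have C0 : 0 < C by rewrite /C; lra.
exists (e / C) => [|d T P f g mf mg h]; first exact: divr_gt0.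
have mA i : measurable [set w | e / C <= `|f i w - g i w|].
  by apply: measurable_abs_ge; exact: measurable_funB.
have [mU hU] := prob_exists_le mA h.
apply: (@le_trans _ _ (P [set w | exists i, e / C <= `|f i w - g i w|])); last first.
  apply: le_trans hU _; rewrite lee_fin mulrA ler_pdivrMr // mulrC ler_pM2l // /C; lra.
apply: le_measure; rewrite ?inE //.
  apply: measurable_abs_ge; apply: measurable_funB; apply: measurable_sum => i;
    by apply: measurable_funM.
move=> w /= hw; apply: contrapT => hn; move: hw; apply/negP; rewrite -ltNge.
rewrite -sumrB; apply: le_lt_trans (ler_norm_sum _ _ _) _.
apply: le_lt_trans (_ : \sum_i `|c i| * (e / C) < _).
  apply: ler_sum => i _; rewrite -mulrBr normrM ler_wpM2l // leNgt; apply/negP => h2; apply: hn.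
  by exists i; exact: ltW.
by rewrite -mulr_suml mulrA ltr_pdivrMr // mulrC ltr_pM2l // /C; lra.
Qed.

Lemma is_step_min m s (u : R) : is_step m s -> 0 <= u ->
  is_step m (fun i => Num.min (s i) u) /\ Num.min (s m) u <= u.
Proof.
move=> [h0 h1 h2] u0; split; last by rewrite ge_min lexx orbT.
split => [||i im]; first by rewrite le_min h0.
  by rewrite ge_min h1.
by rewrite le_min !ge_min h2 // lexx orbT.
Qed.

(** Capping the nodes at [u] empties the cells beyond [u] and shortens the one containing it. *)
Lemma step_fun_min m s c (u x : R) :
  step_fun m (fun i => Num.min (s i) u) c x = step_fun m s c x * (x <= u)%R%:R.
Proof.
rewrite /step_fun mulr_suml; apply: eq_bigr => i _; rewrite -mulrA !indicE -natrM mulnb; congr (_ * (_ : bool)%:R).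
apply/idP/idP.
  rewrite inE /= in_itv /= gt_min le_min => /andP[/orP[h|h] /andP[h1 h2]].
    by apply/andP; split=> //; rewrite inE /= in_itv /= h.
  by move: (lt_le_trans h h2); rewrite ltxx.
move=> /andP[]; rewrite !inE /= !in_itv /= => /andP[h1 h2] h3.
by rewrite gt_min h1 le_min h2 h3.
Qed.

(** A single approximation of the coefficients on [[0, 1]] serves every time [u], by truncation. *)
Lemma signal_close d (T : measurableType d) (P : probability T R) p (B : R -> T -> 'cV[R]_p)
    (Xk : R -> T -> R) (sig : 'I_p -> R -> R) (u e : R) :
  brownian_motion P B -> (forall s, 0 <= s <= 1 -> measurable_fun setT (Xk s)) ->
  0 <= u <= 1 -> (forall l, measurable_fun (`[0, 1] : set R) (sig l)) -> 0 < e ->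
  (exists J : 'I_p -> T -> R,
     (forall l, stoch_integral P (fun u w => B u w l 0) 0 u (sig l) (J l)) /\
     {ae P, forall w, Xk u w = Xk 0 w + \sum_(l < p) J l w}) ->
  exists2 dl : R, 0 < dl & forall (m : 'I_p -> nat) (s c : 'I_p -> nat -> R) n tau,
    (forall l, is_step (m l) (s l)) ->
    (forall l, (\int[mu]_(x in `[0%R, 1%R]) ((step_fun (m l) (s l) (c l) x - sig l x) ^+ 2)%:E <= dl%:E)%E) ->
    is_grid tau n -> in_grid tau n u -> (forall l i, (i <= m l)%N -> in_grid tau n (s l i)) ->
    (P [set w | (e <= `|(Xk u w - Xk 0 w) - \sum_(l < p)
       gridint tau n (fun x => step_fun (m l) (s l) (c l) x * (x <= u)%R%:R) (fun v => B v w l 0)|)%R] <= e%:E)%E.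
Proof.
move=> hB mX u01 msig e0 [J [hJ hX]]; have /andP[u0 u1] := u01.
have [e' e'0 hcl] := close_linear (fun _ : 'I_p => 1) e0.
have m20 := @normal_m2_gt0 R.
exists ((e' / 2) ^+ 3 / (4 * normal_m2)) => [|m s c n tau hs hF hg ug sg].
  by rewrite divr_gt0 ?exprn_gt0 ?mulr_gt0 ?divr_gt0.
have mgi l F : measurable_fun setT (fun w => gridint tau n F (fun v => B v w l 0)).
  exact: (measurable_gridint hB).
have mJ l : measurable_fun setT (J l) by case: (hJ l).
pose gi l w := gridint tau n (fun x => step_fun (m l) (s l) (c l) x * (x <= u)%R%:R) (fun v => B v w l 0).
have hl l : (P [set w | (e' <= `|J l w - gi l w|)%R] <= e'%:E)%E.
  have [hst hsu] := is_step_min (hs l) u0.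
  have giE w : gi l w = step_integral (fun v w => B v w l 0) (m l) (fun i => Num.min (s l i) u) (c l) w.
    rewrite (gridint_step (c l) _ _ hg hst); last first.
      by move=> i im; rewrite minEle; case: ifP => _ //; exact: sg.
    by apply: eq_bigr => i _; rewrite step_fun_min.
  have mb : measurable (`[0, u] : set R) by [].
  have m1 : measurable (`[0, 1] : set R) by [].
  have sub : `[0, u] `<=` (`[0, 1] : set R).
    by move=> x /=; rewrite !in_itv /= => /andP[-> h]; rewrite (le_trans h u1).
  have := wiener_close hB u01 e'0 (measurable_funS m1 sub (msig l)) (hJ l) (c := c l) hst hsu.
  rewrite (_ : [set w | e' <= _] = [set w | e' <= `|J l w - gi l w|]); last first.
    by apply/seteqP; split => w /=; rewrite giE.
  apply; apply: le_trans (hF l).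
  have mq : measurable_fun (`[0, 1] : set R) (fun x => ((step_fun (m l) (s l) (c l) x - sig l x) ^+ 2)%:E).
    apply/measurable_EFinP; apply: measurable_funX; apply: measurable_funB => //.
    by apply: measurable_funTS; exact: measurable_step_fun.
  apply: (@le_trans _ _ (\int[mu]_(x in `[0%R, u]) ((step_fun (m l) (s l) (c l) x - sig l x) ^+ 2)%:E)%E).
    rewrite le_eqVlt; apply/orP; left; apply/eqP; apply: eq_integral => x; rewrite inE /= in_itv /= => /andP[_ xu].
    by rewrite step_fun_min xu mulr1.
  apply: ge0_subset_integral => //.
  by move=> x _; rewrite lee_fin sqr_ge0.
have := hcl _ _ P J gi mJ (fun l => mgi l _) hl.
set E1 := [set w | _]; set E2 := [set w | _] => h1.
have mE1 : measurable E1.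
  by apply: measurable_abs_ge; apply: measurable_funB; apply: measurable_sum => l;
    apply: measurable_funM => //; exact: mgi.
have mE2 : measurable E2.
  apply: measurable_abs_ge; apply: measurable_funB; last by apply: measurable_sum => l; exact: mgi.
  by apply: measurable_funB; apply: mX; rewrite ?u01 // lexx ler01.
have [N [mN N0 hN]] := hX.
apply: le_trans (_ : P (E1 `|` N) <= _)%E.
  apply: le_measure; rewrite ?inE //; first exact: measurableU.
  move=> w hw; have [Nw|nN] := pselect (N w); first by right.
  left; have Xw : Xk u w = Xk 0 w + \sum_(l < p) J l w by apply: contrapT => h; apply/nN/hN.
  move: hw; rewrite /E1 /E2 /= (_ : Xk u w - Xk 0 w = \sum_(l < p) J l w); last by rewrite Xw; lra.
  by congr (e <= `|_ - _|); apply: eq_bigr => l _; rewrite mul1r.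
apply: le_trans (measureU2 P mE1 mN) _; rewrite -[e%:E]adde0; apply: (leeD h1).
by rewrite le_eqVlt; apply/orP; left; apply/eqP; exact: N0.
Qed.

(** After summation by parts the mesh sum is a combination of values of the signal relative to time
    0; replacing each by its truncated grid integral and recombining produces the product of the two
    step functions. The minus sign is that of the integration by parts. *)
Lemma signal_mesh_close d (T : measurableType d) (P : probability T R) p (B : R -> T -> 'cV[R]_p)
    (Xk : R -> T -> R) (sig : 'I_p -> R -> R) (G : R -> R) (a b e : R) M :
  brownian_motion P B -> (forall s, 0 <= s <= 1 -> measurable_fun setT (Xk s)) ->
  (forall l, measurable_fun (`[0, 1] : set R) (sig l)) -> 0 < e ->
  0 <= a -> a <= b <= 1 -> G a = 0 -> G b = 0 ->
  (forall u, 0 <= u <= 1 -> exists J : 'I_p -> T -> R,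
     (forall l, stoch_integral P (fun u w => B u w l 0) 0 u (sig l) (J l)) /\
     {ae P, forall w, Xk u w = Xk 0 w + \sum_(l < p) J l w}) ->
  exists2 dl : R, 0 < dl & forall (m : 'I_p -> nat) (s c : 'I_p -> nat -> R) n tau,
    (forall l, is_step (m l) (s l)) ->
    (forall l, (\int[mu]_(x in `[0%R, 1%R]) ((step_fun (m l) (s l) (c l) x - sig l x) ^+ 2)%:E <= dl%:E)%E) ->
    is_grid tau n -> (forall i, (i <= M.+1)%N -> in_grid tau n (uniform_mesh a b M.+1 i)) ->
    (forall l i, (i <= m l)%N -> in_grid tau n (s l i)) ->
    (P [set w | (e <= `|mesh_sum G a b M (Xk ^~ w) - \sum_(l < p)
       gridint tau n (fun x => - (step_fun (m l) (s l) (c l) x *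
         step_fun M.+1 (uniform_mesh a b M.+1) (fun i => G (uniform_mesh a b M.+1 i)) x))
         (fun v => B v w l 0)|)%R] <= e%:E)%E.
Proof.
move=> hB mX msig e0 a0 ab Ga Gb hX.
pose um := uniform_mesh a b M.+1; pose Gm i := G (um i).
have um01 i : (i <= M.+1)%N -> 0 <= um i <= 1 by move=> h; exact: mesh_itv.
have um_mono (i : 'I_M.+1) : um i <= um i.+1.
  rewrite /um /uniform_mesh lerD2l ler_pM2r ?invr_gt0 ?ltr0n // ler_wpM2l ?ler_nat //.
  by rewrite subr_ge0; case/andP: ab.
(* Both ends of every cell, with the coefficients that they carry after summation by parts. *)
pose cf (i : 'I_M.+1 + 'I_M.+1) := match i with inl i => Gm i | inr i => - Gm i end.
pose pt (i : 'I_M.+1 + 'I_M.+1) := match i with inl i => um i | inr i => um i.+1 end.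
have pt01 i : 0 <= pt i <= 1.
  by case: i => i; apply: um01 => //; exact: ltnW.
have [e' e'0 hcl] := close_linear cf e0.
have /choice [dl hdl] : forall i, exists dl : R, 0 < dl /\ forall (m : 'I_p -> nat) (s c : 'I_p -> nat -> R) n tau,
    (forall l, is_step (m l) (s l)) ->
    (forall l, (\int[mu]_(x in `[0%R, 1%R]) ((step_fun (m l) (s l) (c l) x - sig l x) ^+ 2)%:E <= dl%:E)%E) ->
    is_grid tau n -> in_grid tau n (pt i) -> (forall l i, (i <= m l)%N -> in_grid tau n (s l i)) ->
    (P [set w | (e' <= `|(Xk (pt i) w - Xk 0 w) - \sum_(l < p)
       gridint tau n (fun x => step_fun (m l) (s l) (c l) x * (x <= pt i)%R%:R) (fun v => B v w l 0)|)%R] <= e'%:E)%E.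
  by move=> i; have [dl dl0 h] := signal_close hB mX (pt01 i) msig e'0 (hX _ (pt01 i)); exists dl.
pose D := \big[Num.min/1]_i dl i.
have D0 : 0 < D.
  rewrite /D; elim/big_ind: _ => // [x y x0 y0|i _]; first by rewrite lt_min x0.
  by case: (hdl i).
exists D => // m s c n tau hs hF hg ug sg.
pose gi i w := \sum_(l < p) gridint tau n (fun x => step_fun (m l) (s l) (c l) x * (x <= pt i)%R%:R) (fun v => B v w l 0).
pose f i w := Xk (pt i) w - Xk 0 w.
have mgi i : measurable_fun setT (gi i).
  by apply: measurable_sum => l; exact: (measurable_gridint hB).
have mf i : measurable_fun setT (f i).
  by apply: measurable_funB; apply: mX => //; rewrite lexx ler01.
have hi i : (P [set w | (e' <= `|f i w - gi i w|)%R] <= e'%:E)%E.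
  have [_ h] := hdl i; apply: h => // [l|].
    by apply: le_trans (hF l) _; rewrite lee_fin /D bigmin_le_cond.
  by case: i => i; apply: ug => //; exact: ltnW.
have := hcl _ _ P f gi mf mgi hi.
have fE w : \sum_i cf i * f i w = mesh_sum G a b M (Xk ^~ w).
  rewrite mesh_sum_by_parts // big_sumType /= -big_split /= -sumrN; apply: eq_bigr => i _.
  by rewrite /f /= /Gm /um; ring.
have gE w : \sum_i cf i * gi i w = \sum_(l < p)
    gridint tau n (fun x => - (step_fun (m l) (s l) (c l) x * step_fun M.+1 um Gm x)) (fun v => B v w l 0).
  rewrite /gi; under eq_bigr do rewrite mulr_sumr.
  rewrite exchange_big /=; apply: eq_bigr => l _.
  rewrite -(gridint_sum tau n (index_enum _) cf
    (fun i x => step_fun (m l) (s l) (c l) x * (x <= pt i)%R%:R) (fun v => B v w l 0)).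
  apply: eq_bigr => k _; congr (_ * _); move: (tau k.+1) => x.
  rewrite big_sumType /= -big_split /= /step_fun mulr_sumr -sumrN; apply: eq_bigr => i _.
  (* The indicator of a cell as a difference of two half-line indicators, which undoes the
     truncations. *)
  rewrite -/(step_fun _ _ _ _) (_ : \1_(`]um i, um i.+1]) x = (x <= um i.+1)%R%:R - (x <= um i)%R%:R :> R).
    by move: (step_fun _ _ _ _) => y; ring.
  rewrite indicE; have h := um_mono i; have [xi|xi] := leP x (um i).
    rewrite (le_trans xi h) subrr memNset //= in_itv /= => /andP[h1 _].
    by move: (lt_le_trans h1 xi); rewrite ltxx.
  rewrite subr0; congr ((_ : bool)%:R); apply/idP/idP; rewrite inE /= in_itv /= xi //.
by congr (P _ <= _)%E; apply/seteqP; split => w /=; rewrite fE gE.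
Qed.

Section swap.
Context d (T : measurableType d) (P : probability T R).

(** Measurability for the sigma-algebra of the process, since [independent_processes] is stated for
    these sigma-algebras. *)
Definition process_measurable q (Z : R -> T -> 'cV[R]_q) (f : T -> R) : Prop :=
  forall A, measurable A -> process_sigma_algebra Z (f @^-1` A).

Let gen q (Z : R -> T -> 'cV[R]_q) : set (set T) :=
  [set E | exists s k (A : set R), [/\ 0 <= s <= 1, measurable A & E = (fun w => Z s w k 0) @^-1` A]].

Lemma process_measurableP q (Z : R -> T -> 'cV[R]_q) f :
  measurable_fun setT (f : g_sigma_algebraType (gen Z) -> R) -> process_measurable Z f.
Proof. by move=> mf A mA; have := mf measurableT A mA; rewrite setTI. Qed.

Lemma process_coordinate q (Z : R -> T -> 'cV[R]_q) s k : 0 <= s <= 1 ->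
  measurable_fun setT ((fun w => Z s w k 0) : g_sigma_algebraType (gen Z) -> R).
Proof.
by move=> s01 _ A mA; rewrite setTI; apply: sub_sigma_algebra; exists s, k, A.
Qed.

Lemma process_sigma_algebra_sub q (Z : R -> T -> 'cV[R]_q) E :
  measurable_process Z -> process_sigma_algebra Z E -> measurable E.
Proof.
move=> mZ; apply: smallest_sub; first exact: sigma_algebra_measurable.
by move=> _ [s [k [A [s01 mA ->]]]]; rewrite -[X in measurable X]setTI; exact: mZ.
Qed.

Lemma process_box q (Z : R -> T -> 'cV[R]_q) N (f : nat -> T -> R) (A : nat -> set R) :
  (forall i, (i < N)%N -> process_measurable Z (f i)) -> (forall i, measurable (A i)) ->
  process_sigma_algebra Z [set w | forall i, (i < N)%N -> A i (f i w)].
Proof.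
move=> mf mA; rewrite (_ : [set w | _] = \bigcap_(i in [set: 'I_N]) (f i @^-1` A i)).
  apply: (@fin_bigcap_measurable _ (g_sigma_algebraType (gen Z))) => [|i _].
    exact: finite_finset.
  exact: mf.
apply/seteqP; split => w /= h i; first by move=> _; exact: h.
by move=> iN; exact: (h (Ordinal iN) I).
Qed.

(* Independence allows to read the two processes on two copies of the space. *)
Lemma process_swap q1 q2 (X : R -> T -> 'cV[R]_q1) (W : R -> T -> 'cV[R]_q2) N1 N2
    (f g : nat -> T -> R) (E : set ((N1 + N2).-tuple R)) :
  measurable_process X -> measurable_process W -> independent_processes P X W ->
  (forall i, (i < N1)%N -> process_measurable X (f i)) ->
  (forall i, (i < N2)%N -> process_measurable W (g i)) -> measurable E ->
  P (first_terms (N1 + N2) (fun i w => if (i < N1)%N then f i w else g (i - N1)%N w) @^-1` E) =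
  (P \x P)%E (first_terms (N1 + N2)
    (fun i (w : T * T) => if (i < N1)%N then f i w.1 else g (i - N1)%N w.2) @^-1` E).
Proof.
move=> mX mW ind mf mg mE.
have mf' i : (i < N1)%N -> measurable_fun setT (f i).
  move=> iN _ A mA; rewrite setTI; apply: (process_sigma_algebra_sub mX); exact: mf.
have mg' i : (i < N2)%N -> measurable_fun setT (g i).
  move=> iN _ A mA; rewrite setTI; apply: (process_sigma_algebra_sub mW); exact: mg.
pose h i w := if (i < N1)%N then f i w else g (i - N1)%N w.
pose h2 i (w : T * T) := if (i < N1)%N then f i w.1 else g (i - N1)%N w.2.
have m1 : measurable_fun setT (first_terms (N1 + N2) h).
  apply: measurable_first_terms => i iN; rewrite /h; case: (ltnP i N1) => iN1; first exact: mf'.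
  by apply: mg'; rewrite ltn_subLR.
have m2 : measurable_fun setT (first_terms (N1 + N2) h2).
  apply: measurable_first_terms => i iN; rewrite /h2; case: (ltnP i N1) => iN1.
    by apply: measurableT_comp => //; exact: mf'.
  by apply: measurableT_comp => //; apply: mg'; rewrite ltn_subLR.
apply: (@box_measure_unique R _ (pushforward P (first_terms (N1 + N2) h))
  (pushforward (P \x P)%E (first_terms (N1 + N2) h2))) => //.
  apply: (@le_lt_trans _ _ (P setT)); last by rewrite probability_setT ltry.
  exact: lexx.
move=> A mA.
have EX := process_box mf mA; have EW := process_box mg (fun i => mA (N1 + i)%N).
have e1 : [set w | forall i, (i < N1 + N2)%N -> A i (h i w)] =
    [set w | forall i, (i < N1)%N -> A i (f i w)] `&` [set w | forall i, (i < N2)%N -> A (N1 + i)%N (g i w)].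
  apply/seteqP; split => w /=.
    move=> H; split=> i iN; first by have := H i (ltn_addr _ iN); rewrite /h iN.
    have := H (N1 + i)%N; rewrite ltn_add2l iN /h ltnNge leq_addr /= addKn; exact.
  move=> [H1 H2] i iN; rewrite /h; case: (ltnP i N1) => iN1; first exact: H1.
  by have := H2 (i - N1)%N; rewrite subnKC //; apply; rewrite ltn_subLR.
have e2 : [set w | forall i, (i < N1 + N2)%N -> A i (h2 i w)] =
    [set w | forall i, (i < N1)%N -> A i (f i w)] `*` [set w | forall i, (i < N2)%N -> A (N1 + i)%N (g i w)].
  apply/seteqP; split => w /=.
    move=> H; split=> i iN; first by have := H i (ltn_addr _ iN); rewrite /h2 iN.
    have := H (N1 + i)%N; rewrite ltn_add2l iN /h2 ltnNge leq_addr /= addKn; exact.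
  move=> [H1 H2] i iN; rewrite /h2; case: (ltnP i N1) => iN1; first exact: H1.
  by have := H2 (i - N1)%N; rewrite subnKC //; apply; rewrite ltn_subLR.
apply: etrans (congr1 P (etrans (first_terms_box (N1 + N2) h A) e1)) _.
apply: etrans _ (esym (congr1 (P \x P)%E (etrans (first_terms_box (N1 + N2) h2 A) e2))).
rewrite ind //; apply/esym.
exact: (product_measure1E P P (process_sigma_algebra_sub mX EX) (process_sigma_algebra_sub mW EW)).
Qed.

End swap.
End closeness.

(** * The gradient of the minors along the signal and the noise *)

Section gradient_condition.
Context {R : realType}.
Notation mu := (@lebesgue_measure R).

Lemma minor_diff_entries d q (S : 'M[R]_(d, q)) (rho : {ffun 'I_q -> 'I_d}) u v :
  minor_diff S rho u v =
  \sum_(x : 'I_q * 'I_q) (\adj (rowsub rho S)) x.1 x.2 * (u (rho x.2) 0 * v 0 x.1).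
Proof.
rewrite -(pair_bigA _ (fun i j => (\adj (rowsub rho S)) i j * (u (rho j) 0 * v 0 i))) /=.
rewrite /minor_diff mxE exchange_big /=; apply: eq_bigr => j _.
rewrite !mxE mulr_suml; apply: eq_bigr => i _.
by rewrite [u (rho j) 0 * _]mulrC mulrA [_ * v 0 i]mulrC.
Qed.

Lemma entries_sqsum_pair m n (A : 'M[R]_(m, n)) :
  \sum_(x : 'I_m * 'I_n) A x.1 x.2 ^+ 2 = entries_sqsum A.
Proof. by rewrite /entries_sqsum pair_bigA. Qed.

(** The square of a sum costs the factor 2; by Cauchy-Schwarz the discretisation error is
    proportional to the squared norm of the coefficients [a]. *)
Lemma grid_quadratic_ge (K : finType) (a : K -> R) (H M : K -> R -> R) n tau (e s0 s1 : R) :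
  is_grid tau n -> 0 <= s0 -> s1 <= 1 ->
  (forall k, measurable_fun setT (H k)) ->
  (forall k, measurable_fun (`[0, 1] : set R) (M k)) ->
  (forall k i x, (i < n)%N -> tau i < x <= tau i.+1 -> H k x = H k (tau i.+1)) ->
  (forall k, \int[mu]_(x in `[0%R, 1%R]) ((H k x - M k x) ^+ 2)%:E <= e%:E)%E ->
  (\int[mu]_(x in `]s0, s1]) ((\sum_k a k * M k x) ^+ 2)%:E <=
   (2 * (\sum_(i < n) (\sum_k a k * H k (tau i.+1)) ^+ 2 * (tau i.+1 - tau i))
    + 2 * ((\sum_k a k ^+ 2) * (#|K|%:R * e)))%:E)%E.
Proof.
move=> hg s00 s11 mH mM cH hHM.
pose D : set R := [set` `]s0, s1]].
have mD : measurable D by exact: measurable_itv.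
have m01 : measurable (`[0, 1] : set R) by [].
have m01' : measurable (`]0, 1] : set R) by [].
have D01 : D `<=` (`[0, 1] : set R).
  by move=> x; rewrite /D /= !in_itv /= => /andP[h1 h2]; rewrite (le_trans s00 (ltW h1)) (le_trans h2 s11).
have D01' : D `<=` (`]0, 1] : set R).
  by move=> x; rewrite /D /= !in_itv /= => /andP[h1 h2]; rewrite (le_lt_trans s00 h1) (le_trans h2 s11).
pose f x := \sum_k a k * M k x; pose g x := \sum_k a k * H k x.
have mMD k : measurable_fun D (M k) := measurable_funS m01 D01 (mM k).
have mg : measurable_fun setT g by apply: measurable_sum => k; apply: measurable_funM.
have mgD : measurable_fun D g := measurable_funTS mg.
have mf : measurable_fun D f by apply: measurable_sum => k; apply: measurable_funM.
have m0 : measurable_fun D (fun _ : R => 0 : R) by exact: measurable_cst.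
have := sq_dist_triangle mu mD mf m0 mgD.
rewrite (_ : \int[mu]_(x in D) ((f x - 0) ^+ 2)%:E = \int[mu]_(x in D) (f x ^+ 2)%:E)%E; last first.
  by apply: eq_integral => x _; rewrite subr0.
move=> h; apply: le_trans h _; rewrite [X in (_ <= X)%E]EFinD [X in (_ <= X)%E]addeC; apply: leeD; rewrite [X in (_ <= X)%E]EFinM; apply: lee_wpmul2l => //; last first.
  rewrite -(grid_integral (F := fun x => g x ^+ 2) hg); last 3 first.
  - exact: measurable_funX.
  - by move=> x; exact: sqr_ge0.
  - by move=> i x iN hx; rewrite /g; congr (_ ^+ 2); apply: eq_bigr => k _; rewrite (cH k i x).
  rewrite (_ : \int[mu]_(x in D) ((0 - g x) ^+ 2)%:E = \int[mu]_(x in D) (g x ^+ 2)%:E)%E; last first.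
    by apply: eq_integral => x _; rewrite sub0r sqrrN.
  apply: ge0_subset_integral => //.
    by apply/measurable_EFinP; apply: measurable_funTS; exact: measurable_funX.
  by move=> x _; rewrite lee_fin sqr_ge0.
have mq k : measurable_fun D (fun x => ((H k x - M k x) ^+ 2)%:E).
  apply/measurable_EFinP; apply: measurable_funX; apply: measurable_funB => //.
  exact: measurable_funTS.
have A0 : 0 <= \sum_k a k ^+ 2 by apply: sumr_ge0 => k _; exact: sqr_ge0.
apply: (@le_trans _ _ (\int[mu]_(x in D) ((\sum_k a k ^+ 2)%:E * \sum_k ((H k x - M k x) ^+ 2)%:E))%E).
  apply: ge0_le_integral => //.
  - by move=> x _; rewrite lee_fin sqr_ge0.
  - by apply/measurable_EFinP; apply: measurable_funX; exact: measurable_funB.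
  - by apply: measurable_funeM; apply: emeasurable_sum => k; exact: mq.
  move=> x _; rewrite sumEFin -EFinM lee_fin /f /g -sumrB.
  under eq_bigr do rewrite -mulrBr.
  apply: le_trans (sum_cauchy_schwarz _ _) _; rewrite ler_wpM2l //.
  by apply: ler_sum => k _; rewrite -sqrrN opprB.
rewrite ge0_integralZl_EFin //; last 2 first.
- by move=> x _; apply: sume_ge0 => k _; rewrite lee_fin sqr_ge0.
- by apply: emeasurable_sum => k; exact: mq.
rewrite EFinM; apply: lee_wpmul2l; first by rewrite lee_fin.
rewrite ge0_integral_sum //; last by move=> k x _; rewrite lee_fin sqr_ge0.
apply: (@le_trans _ _ (\sum_(k : K) e%:E)%E); last by rewrite sumEFin sumr_const mulr_natl lexx.
apply: lee_sum => k _; apply: le_trans (hHM k).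
apply: ge0_subset_integral => //; last by move=> x _; rewrite lee_fin sqr_ge0.
apply/measurable_EFinP; apply: measurable_funX; apply: measurable_funB => //.
  exact: (measurable_funTS (mH k)).
exact: mM.
Qed.

(** [minor_diff] is linear in the products of entries of [u] and [v], with the adjugate as
    coefficients. Hence the discretisation error is a multiple of [minors_sqsum S] and can later be
    absorbed, whatever the size of [S]. *)
Lemma minor_diff_sum_grid_ge d r p (S : 'M[R]_(d, r.+1)) n tau (e s0 s1 lam : R)
    (U Ug : 'I_p -> R -> 'cV[R]_d) (V Vg : 'I_p -> R -> 'rV[R]_r.+1) (phi : R -> 'rV[R]_r.+1) :
  is_grid tau n -> 0 <= s0 -> s1 <= 1 ->
  (forall l k, measurable_fun setT (fun x => Ug l x k 0)) ->
  (forall l j, measurable_fun setT (fun x => Vg l x 0 j)) ->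
  (forall l k, measurable_fun (`[0, 1] : set R) (fun x => U l x k 0)) ->
  (forall l j, measurable_fun (`[0, 1] : set R) (fun x => V l x 0 j)) ->
  (forall l i x, (i < n)%N -> tau i < x <= tau i.+1 -> Ug l x = Ug l (tau i.+1)) ->
  (forall l i x, (i < n)%N -> tau i < x <= tau i.+1 -> Vg l x = Vg l (tau i.+1)) ->
  (forall l k j, \int[mu]_(x in `[0%R, 1%R])
     ((Ug l x k 0 * Vg l x 0 j - U l x k 0 * V l x 0 j) ^+ 2)%:E <= e%:E)%E ->
  (forall x, s0 < x <= s1 -> lam * minor_row_sum S (phi x) <= \sum_l minor_diff_sum S (U l x) (V l x)) ->
  0 <= lam -> 0 <= e -> (forall j, measurable_fun setT (fun x => phi x 0 j)) ->
  (lam%:E * \int[mu]_(x in `]s0, s1]) (minor_row_sum S (phi x))%:E <=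
   (2 * (\sum_l \sum_(i < n) minor_diff_sum S (Ug l (tau i.+1)) (Vg l (tau i.+1)) * (tau i.+1 - tau i))
    + 2 * (p%:R * #|{ffun 'I_r.+1 -> 'I_d}|%:R * (r.+1%:R * minors_sqsum S)
           * (#|{: 'I_r.+1 * 'I_r.+1}|%:R * e)))%:E)%E.
Proof.
move=> hg s00 s11 mUg mVg mU mV cU cV hUV hlam lam0 e0 mphi.
pose D : set R := [set` `]s0, s1]].
have mD : measurable D by exact: measurable_itv.
have m01 : measurable (`[0, 1] : set R) by [].
have D01 : D `<=` (`[0, 1] : set R).
  by move=> x; rewrite /D /= !in_itv /= => /andP[h1 h2]; rewrite (le_trans s00 (ltW h1)) (le_trans h2 s11).
have mUD l k : measurable_fun D (fun x => U l x k 0) := measurable_funS m01 D01 (mU l k).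
have mVD l k : measurable_fun D (fun x => V l x 0 k) := measurable_funS m01 D01 (mV l k).
have mrow_ge0 v : 0 <= minor_row_sum S v by apply: sumr_ge0 => rho _; exact: sqr_ge0.
have mrow : measurable_fun D (fun x => (minor_row_sum S (phi x))%:E).
  apply/measurable_EFinP; apply: measurable_sum => rho; apply: measurable_funX.
  rewrite (_ : (fun x => minor_row S rho (phi x)) =
    (fun x => \sum_k phi x 0 k * ((-1) ^+ k * \det (rowsub rho (col' k S))))).
    by apply: measurable_sum => k; apply: measurable_funM => //; exact: measurable_funTS.
  by apply/funext => x; rewrite minor_rowE.
have mdiff l (rho : {ffun 'I_r.+1 -> 'I_d}) : measurable_fun D (fun x => (minor_diff S rho (U l x) (V l x) ^+ 2)%:E).
  apply/measurable_EFinP; apply: measurable_funX.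
  rewrite (_ : (fun x => minor_diff S rho (U l x) (V l x)) = (fun x => \sum_(y : 'I_r.+1 * 'I_r.+1)
    (\adj (rowsub rho S)) y.1 y.2 * (U l x (rho y.2) 0 * V l x 0 y.1))).
    apply: measurable_sum => y; apply: measurable_funM => //.
    by apply: measurable_funM; [exact: mUD|exact: mVD].
  by apply/funext => x; rewrite minor_diff_entries.
rewrite -ge0_integralZl_EFin //; last by move=> x _; rewrite lee_fin.
apply: (@le_trans _ _ (\int[mu]_(x in D) (\sum_l \sum_(rho : {ffun 'I_r.+1 -> 'I_d})
    (minor_diff S rho (U l x) (V l x) ^+ 2)%:E))%E).
  apply: ge0_le_integral => //.
  - by move=> x _; rewrite -EFinM lee_fin mulr_ge0.
  - exact: measurable_funeM.
  - by apply: emeasurable_sum => l; apply: emeasurable_sum => rho; exact: mdiff.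
  move=> x; rewrite /D /= in_itv /= => /hlam h; rewrite -EFinM.
  under eq_bigr do rewrite sumEFin; by rewrite sumEFin lee_fin.
rewrite ge0_integral_sum //; last 2 first.
- by move=> l; apply: emeasurable_sum => rho; exact: mdiff.
- by move=> l x _; apply: sume_ge0 => rho _; rewrite lee_fin sqr_ge0.
pose q2 : R := #|{: 'I_r.+1 * 'I_r.+1}|%:R.
apply: (@le_trans _ _ (\sum_(l < p) \sum_(rho : {ffun 'I_r.+1 -> 'I_d})
  (2 * (\sum_(i < n) minor_diff S rho (Ug l (tau i.+1)) (Vg l (tau i.+1)) ^+ 2 * (tau i.+1 - tau i))
   + 2 * (r.+1%:R * minors_sqsum S * (q2 * e)))%:E)%E).
  apply: lee_sum => l _; rewrite ge0_integral_sum //; last 2 first.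
  - by move=> rho; exact: mdiff.
  - by move=> rho x _; rewrite lee_fin sqr_ge0.
  apply: lee_sum => rho _.
  have := @grid_quadratic_ge _ (fun y : 'I_r.+1 * 'I_r.+1 => (\adj (rowsub rho S)) y.1 y.2)
    (fun y x => Ug l x (rho y.2) 0 * Vg l x 0 y.1) (fun y x => U l x (rho y.2) 0 * V l x 0 y.1)
    n tau e s0 s1 hg s00 s11.
  move=> h; under eq_integral do rewrite minor_diff_entries.
  apply: le_trans (h _ _ _ _) _.
  - by move=> y; apply: measurable_funM.
  - by move=> y; apply: measurable_funM.
  - by move=> y i x iN hx; rewrite (cU l i x) // (cV l i x).
  - by move=> y; exact: hUV.
  rewrite lee_fin; under [in X in _ <= X]eq_bigr do rewrite minor_diff_entries.
  rewrite lerD2l ler_wpM2l // ler_wpM2r ?mulr_ge0 // entries_sqsum_pair; exact: adj_minors.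
under eq_bigr do rewrite sumEFin; rewrite sumEFin lee_fin.
under eq_bigr do rewrite big_split /=; rewrite big_split /= lerD //.
  rewrite le_eqVlt; apply/orP; left; apply/eqP; rewrite mulr_sumr; apply: eq_bigr => l _.
  rewrite -mulr_sumr exchange_big /=; congr (_ * _); apply: eq_bigr => i _.
  by rewrite /minor_diff_sum mulr_suml.
have sc (x : R) : \sum_(l < p) \sum_(rho : {ffun 'I_r.+1 -> 'I_d}) x =
    p%:R * #|{ffun 'I_r.+1 -> 'I_d}|%:R * x.
  by rewrite sumr_const card_ord sumr_const -[LHS]mulr_natl -[X in _ * X]mulr_natl mulrA.
rewrite sc -/q2 le_eqVlt; apply/orP; left; apply/eqP.
set c1 := #|_|%:R; move: c1 q2 p%:R r.+1%:R (minors_sqsum S) => x1 x2 x3 x4 x5; ring.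
Qed.

End gradient_condition.

(** * Orthogonality of the sine basis and of its derivatives *)

Section trigonometric.
Context {R : realType}.
Notation mu := (@lebesgue_measure R).

Lemma Rintegral_sum_oc (a b : R) (I : Type) (s : seq I) (F : I -> R -> R) :
  (forall i, mu.-integrable `]a, b] (EFin \o F i)) ->
  \int[mu]_(x in `]a, b]) (\sum_(i <- s) F i x) = \sum_(i <- s) \int[mu]_(x in `]a, b]) F i x.
Proof.
move=> hF; have mD : measurable (`]a, b] : set R) by [].
suff [] : mu.-integrable `]a, b] (EFin \o (fun x => \sum_(i <- s) F i x)) /\
  \int[mu]_(x in `]a, b]) (\sum_(i <- s) F i x) = \sum_(i <- s) \int[mu]_(x in `]a, b]) F i x by [].
elim: s => [|i s [IH1 IH2]].
  rewrite big_nil; split.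
    rewrite (_ : EFin \o _ = EFin \o (fun _ : R => 0)); last by apply/funext => x /=; rewrite big_nil.
    by apply: (bounded_integrable_oc (C := 0)) => [|x _]; [exact: measurable_cst|rewrite normr0].
  rewrite -[RHS](mul0r (fine (mu `]a, b]))) -Rintegral_cst //.
  by congr fine; apply: eq_integral => x _; rewrite big_nil.
have E : (fun x => \sum_(i <- i :: s) F i x) = (fun x => F i x + \sum_(i <- s) F i x).
  by apply/funext => x; rewrite big_cons.
rewrite E big_cons -IH2; split; last exact: RintegralD.
by have := @integrableD _ _ R mu _ mD _ _ (hF i) IH1; apply: eq_integrable.
Qed.

Lemma orthogonal_combination_integral q (phi : 'I_q -> R -> R) (C a b : R) (w c : 'I_q -> R) :
  (forall j, measurable_fun setT (phi j)) -> (forall j x, `|phi j x| <= C) -> 0 <= C ->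
  (forall j k, \int[mu]_(x in `]a, b]) (phi j x * phi k x) = (j == k)%:R * w j) ->
  (\int[mu]_(x in `]a, b]) ((\sum_j c j * phi j x) ^+ 2)%:E = (\sum_j w j * c j ^+ 2)%:E)%E.
Proof.
move=> mphi hC C0 hw; have mD : measurable (`]a, b] : set R) by [].
have ijk j k : mu.-integrable `]a, b] (EFin \o (fun x => phi j x * phi k x)).
  apply: (bounded_integrable_oc (C := C * C)).
    by apply: measurable_funM; exact: measurable_funTS.
  by move=> x _; rewrite normrM ler_pM.
have E x : (\sum_j c j * phi j x) ^+ 2 =
    \sum_(y : 'I_q * 'I_q) c y.1 * c y.2 * (phi y.1 x * phi y.2 x).
  rewrite -(pair_bigA _ (fun j k => c j * c k * (phi j x * phi k x))) /= expr2 mulr_suml.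
  apply: eq_bigr => j _; rewrite mulr_sumr; apply: eq_bigr => k _; exact: mulrACA.
have iy (y : 'I_q * 'I_q) :
    mu.-integrable `]a, b] (EFin \o (fun x => c y.1 * c y.2 * (phi y.1 x * phi y.2 x))).
  by have := @integrableZl _ _ R mu _ mD (c y.1 * c y.2) _ (ijk y.1 y.2); apply: eq_integrable.
have iE : mu.-integrable `]a, b] (EFin \o (fun x => (\sum_j c j * phi j x) ^+ 2)).
  apply: (bounded_integrable_oc (C := \sum_(y : 'I_q * 'I_q) `|c y.1 * c y.2| * (C * C))).
    apply: measurable_funX; apply: measurable_sum => j; apply: measurable_funM => //.
    exact: measurable_funTS.
  move=> x _; rewrite E; apply: le_trans (ler_norm_sum _ _ _) _; apply: ler_sum => y _.
  by rewrite normrM ler_wpM2l // normrM ler_pM.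
rewrite -(@fineK _ (\int[mu]_(x in `]a, b]) _)%E); last by apply: integrable_fin_num.
rewrite -/(Rintegral mu _ _); congr EFin.
have -> : \int[mu]_(x in `]a, b]) (\sum_j c j * phi j x) ^+ 2 = \int[mu]_(x in `]a, b])
    (\sum_(y : 'I_q * 'I_q) c y.1 * c y.2 * (phi y.1 x * phi y.2 x)).
  by congr fine; apply: eq_integral => x _; rewrite E.
rewrite (Rintegral_sum_oc (index_enum _) iy).
rewrite (eq_bigr (fun y => c y.1 * c y.2 * ((y.1 == y.2)%:R * w y.1))); last first.
  by move=> y _; rewrite RintegralZl // hw.
rewrite -(pair_bigA _ (fun j k => c j * c k * ((j == k)%:R * w j))) /=.
apply: eq_bigr => j _; rewrite (bigD1 j) //= big1 ?addr0 => [|k kj].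
  by rewrite eqxx mul1r mulrC expr2.
by rewrite eq_sym (negPf kj) mul0r mulr0.
Qed.

(** Orthogonality removes the products of cofactors of different columns. It is applied with weights
    1 for [Phi] and squared frequencies for the derivatives. *)
Lemma minor_row_sum_integral d r (S : 'M[R]_(d, r.+1)) (phi : 'I_r.+1 -> R -> R) (C a b : R)
    (w : 'I_r.+1 -> R) :
  (forall j, measurable_fun setT (phi j)) -> (forall j x, `|phi j x| <= C) ->
  (forall j k, \int[mu]_(x in `]a, b]) (phi j x * phi k x) = (j == k)%:R * w j) ->
  (\int[mu]_(x in `]a, b]) (minor_row_sum S (\row_j phi j x))%:E =
   (\sum_(rho : {ffun 'I_r -> 'I_d}) \sum_k w k * \det (rowsub rho (col' k S)) ^+ 2)%:E)%E.
Proof.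
move=> mphi hC hw; have C0 : 0 <= C by apply: le_trans (hC ord0 0).
pose c (rho : {ffun 'I_r -> 'I_d}) (k : 'I_r.+1) := (-1) ^+ k * \det (rowsub rho (col' k S)).
have E x : (minor_row_sum S (\row_j phi j x))%:E =
    (\sum_(rho : {ffun 'I_r -> 'I_d}) ((\sum_k c rho k * phi k x) ^+ 2)%:E)%E.
  rewrite sumEFin; congr EFin; apply: eq_bigr => rho _; rewrite minor_rowE; congr (_ ^+ 2).
  by apply: eq_bigr => k _; rewrite mxE mulrC.
have mterm rho : measurable_fun (`]a, b] : set R) (fun x => ((\sum_k c rho k * phi k x) ^+ 2)%:E).
  apply/measurable_EFinP; apply: measurable_funX; apply: measurable_sum => k.
  by apply: measurable_funM => //; exact: measurable_funTS.
have mD : measurable (`]a, b] : set R) by [].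
under eq_integral do rewrite E.
rewrite ge0_integral_sum //; last by move=> rho x _; rewrite lee_fin sqr_ge0.
rewrite -sumEFin; apply: eq_bigr => rho _.
rewrite (orthogonal_combination_integral (c rho) mphi hC C0 hw); congr EFin.
by apply: eq_bigr => k _; rewrite /c exprMn sqrr_sign mul1r.
Qed.

Lemma sin_natpi m : sin (m%:R * pi : R) = 0.
Proof.
elim: m => [|m IH]; first by rewrite mul0r sin0.
by rewrite -natr1 mulrDl mul1r sinDpi IH oppr0.
Qed.

Lemma is_derive_sin_affine (a t : R) (s : R) :
  is_derive s 1 (fun x : R => sin (a * (x - t)) : R) (a * cos (a * (s - t))).
Proof.
have -> : (fun x : R => sin (a * (x - t))) = sin \o (fun x : R => a * (x - t)) by [].
have h : is_derive s 1 (fun x : R => a * (x - t) : R) a.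
  have := is_deriveZ a (is_deriveB (is_derive_id s (1 : R)) (is_derive_cst t s (1 : R))).
  by rewrite subr0 /GRing.scale /= mulr1.
have := @is_derive1_comp R sin (fun x : R => a * (x - t)) s _ _ (is_derive_sin _) h.
by rewrite mulrC.
Qed.

Lemma is_derive_cos_affine (a t : R) (s : R) :
  is_derive s 1 (fun x : R => cos (a * (x - t)) : R) (- (a * sin (a * (s - t)))).
Proof.
have -> : (fun x : R => cos (a * (x - t))) = cos \o (fun x : R => a * (x - t)) by [].
have h : is_derive s 1 (fun x : R => a * (x - t) : R) a.
  have := is_deriveZ a (is_deriveB (is_derive_id s (1 : R)) (is_derive_cst t s (1 : R))).
  by rewrite subr0 /GRing.scale /= mulr1.
have := @is_derive1_comp R cos (fun x : R => a * (x - t)) s _ _ (is_derive_cos _) h.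
by rewrite mulNr mulrC.
Qed.

Section basis.
Variables (t h : R).
Hypothesis h0 : 0 < h.

Let freq (j : nat) : R := j%:R * pi / h.

Lemma PhiE j s : Phi t h j s = Num.sqrt (2 / h) * sin (freq j * (s - t)).
Proof. by rewrite /Phi /freq mulrAC. Qed.

Definition dPhi j (s : R) : R := Num.sqrt (2 / h) * (freq j * cos (freq j * (s - t))).

Lemma is_derive_Phi j (s : R) : is_derive s 1 (Phi t h j : R -> R) (dPhi j s).
Proof.
have -> : (Phi t h j : R -> R) = Num.sqrt (2 / h) \*: (fun x : R => sin (freq j * (x - t))).
  by apply/funext => x; rewrite PhiE.
exact: (is_deriveZ (Num.sqrt (2 / h)) (is_derive_sin_affine (freq j) t s)).
Qed.

Lemma derive1_Phi j : derive1 (Phi t h j) = dPhi j.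
Proof. by apply/funext => s; rewrite derive1E; case: (is_derive_Phi j s). Qed.

Lemma continuous_Phi j : continuous (Phi t h j).
Proof.
by move=> s; apply: differentiable_continuous; apply/derivable1_diffP; case: (is_derive_Phi j s).
Qed.

Lemma continuous_dPhi j : continuous (dPhi j).
Proof.
have hd (s : R) : is_derive s 1 (dPhi j : R -> R) (Num.sqrt (2 / h) * (freq j * - (freq j * sin (freq j * (s - t))))).
  have -> : (dPhi j : R -> R) = Num.sqrt (2 / h) \*: (freq j \*: (fun x : R => cos (freq j * (x - t)))) by [].
  exact: (is_deriveZ (Num.sqrt (2 / h)) (is_deriveZ (freq j) (is_derive_cos_affine (freq j) t s))).
by move=> s; apply: differentiable_continuous; apply/derivable1_diffP; case: (hd s).
Qed.

Lemma Phi_left j : Phi t h j t = 0.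
Proof. by rewrite PhiE subrr mulr0 sin0 mulr0. Qed.

Lemma freq_h j : freq j * h = j%:R * pi.
Proof. by rewrite /freq divfK // gt_eqF. Qed.

Lemma Phi_right j : Phi t h j (t + h) = 0.
Proof. by rewrite PhiE [t + h]addrC addrK freq_h sin_natpi mulr0. Qed.

Lemma Phi_bounded j s : `|Phi t h j s| <= Num.sqrt (2 / h).
Proof. by rewrite PhiE normrM ger0_norm ?sqrtr_ge0 // ler_piMr ?sqrtr_ge0 // sin_max. Qed.

Lemma freq_ge0 j : 0 <= freq j.
Proof. by rewrite divr_ge0 ?mulr_ge0 ?pi_ge0 ?(ltW h0) ?ler0n. Qed.

Lemma dPhi_bounded j s : `|dPhi j s| <= Num.sqrt (2 / h) * freq j.
Proof.
rewrite normrM ger0_norm ?sqrtr_ge0 // ler_wpM2l ?sqrtr_ge0 // normrM ger0_norm ?freq_ge0 //.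
by rewrite ler_piMr ?freq_ge0 // cos_max.
Qed.

Let C m (s : R) : R := cos (freq m * (s - t)).

Lemma integral_cos_freq m : \int[mu]_(s in `]t, t + h]) C m s = (m == 0)%N%:R * h.
Proof.
have mD : measurable (`]t, (t + h)] : set R) by [].
case: m => [|m].
  have -> : \int[mu]_(s in `]t, t + h]) C 0 s = \int[mu]_(s in `]t, t + h]) (1 : R).
    by congr fine; apply: eq_integral => s _; rewrite /C /freq !mul0r cos0.
  rewrite Rintegral_cst //= lebesgue_measure_itv /= lte_fin ltrDl h0.
  by rewrite -EFinB /= addrC addKr.
have f0 : 0 < freq m.+1 by rewrite divr_gt0 ?mulr_gt0 ?ltr0n ?pi_gt0.
have hd (s : R) : is_derive s 1 ((freq m.+1)^-1 \*: (fun x : R => sin (freq m.+1 * (x - t))) : R -> R) (C m.+1 s).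
  have := is_deriveZ (freq m.+1)^-1 (is_derive_sin_affine (freq m.+1) t s).
  by rewrite /GRing.scale /= mulrA mulVf ?gt_eqF // mul1r.
have cC : continuous (C m.+1).
  have hc (s : R) := is_derive_cos_affine (freq m.+1) t s.
  by move=> s; apply: differentiable_continuous; apply/derivable1_diffP; case: (hc s).
rewrite (FTC_oc hd cC); last by rewrite lerDl ltW.
by rewrite /= /GRing.scale /= [t + h]addrC addrK subrr mulr0 sin0 freq_h sin_natpi !mulr0 subrr mul0r.
Qed.

(** [maxn j k - minn j k] is the distance between [j] and [k], which keeps the frequency indexed by
    [nat]. *)
Lemma cos_freq_dist j k s : cos (freq j * (s - t) - freq k * (s - t)) = C (maxn j k - minn j k) s.
Proof.
rewrite -mulrBl /C /freq -!mulrBl; have [jk|kj] := leqP j k.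
  by rewrite natrB // -opprB !mulNr cosN.
by rewrite natrB // ltnW.
Qed.

Lemma cos_freq_sum j k s : cos (freq j * (s - t) + freq k * (s - t)) = C (j + k) s.
Proof. by rewrite -mulrDl /C /freq -!mulrDl natrD. Qed.

Lemma integrable_cos_freq m : mu.-integrable `]t, t + h] (EFin \o C m).
Proof.
apply: (bounded_integrable_oc (C := 1)) => [|s _]; last exact: cos_max.
apply: measurable_funTS; apply: continuous_measurable_fun => s.
have hc := is_derive_cos_affine (freq m) t s.
by apply: differentiable_continuous; apply/derivable1_diffP; case: hc.
Qed.

Lemma dist_eq0 j k : (maxn j k - minn j k == 0)%N = (j == k).
Proof. by case: (ltngtP j k) => // h'; lia. Qed.

(** The product is a difference of two cosines, which integrate to 0 unless their frequency is 0.
    Indices are shifted because [Phi t h 0] vanishes. *)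
Lemma Phi_orthonormal j k : \int[mu]_(s in `]t, t + h]) (Phi t h j.+1 s * Phi t h k.+1 s) = (j == k)%:R.
Proof.
have mD : measurable (`]t, (t + h)] : set R) by [].
have i1 := integrable_cos_freq (maxn j.+1 k.+1 - minn j.+1 k.+1).
have i2 := integrable_cos_freq (j.+1 + k.+1).
have -> : \int[mu]_(s in `]t, t + h]) (Phi t h j.+1 s * Phi t h k.+1 s) =
    \int[mu]_(s in `]t, t + h]) (h^-1 * (C (maxn j.+1 k.+1 - minn j.+1 k.+1) s - C (j.+1 + k.+1) s)).
  congr fine; apply: eq_integral => s _; congr EFin.
  rewrite !PhiE mulrACA -expr2 sqr_sqrtr ?divr_ge0 ?ltW // -cos_freq_dist -cos_freq_sum cosB cosD.
  by move: (sin _) (sin _) (cos _) (cos _) => *; field; rewrite gt_eqF.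
rewrite RintegralZl //; last by have := @integrableB _ _ R mu _ mD _ _ i1 i2; apply: eq_integrable.
rewrite RintegralB // !integral_cos_freq dist_eq0 addSn mul0r subr0 eqSS.
by rewrite mulrCA mulVf ?mulr1 // gt_eqF.
Qed.

Lemma dPhi_orthogonal j k : \int[mu]_(s in `]t, t + h]) (dPhi j.+1 s * dPhi k.+1 s) =
  (j == k)%:R * freq j.+1 ^+ 2.
Proof.
have mD : measurable (`]t, (t + h)] : set R) by [].
have i1 := integrable_cos_freq (maxn j.+1 k.+1 - minn j.+1 k.+1).
have i2 := integrable_cos_freq (j.+1 + k.+1).
have -> : \int[mu]_(s in `]t, t + h]) (dPhi j.+1 s * dPhi k.+1 s) =
    \int[mu]_(s in `]t, t + h]) (h^-1 * (freq j.+1 * freq k.+1) * (C (maxn j.+1 k.+1 - minn j.+1 k.+1) s + C (j.+1 + k.+1) s)).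
  congr fine; apply: eq_integral => s _; congr EFin.
  rewrite /dPhi mulrACA -expr2 sqr_sqrtr ?divr_ge0 ?ltW // -cos_freq_dist -cos_freq_sum cosB cosD.
  by field; rewrite gt_eqF.
rewrite RintegralZl //; last by have := @integrableD _ _ R mu _ mD _ _ i1 i2; apply: eq_integrable.
rewrite RintegralD // !integral_cos_freq dist_eq0 addSn mul0r addr0 eqSS.
have [->|_] := eqVneq j k; last by rewrite !mul0r mulr0.
by rewrite !mul1r -expr2; move: (freq _) => f; field; rewrite gt_eqF.
Qed.

End basis.
End trigonometric.

(** * The gradient bound on a grid *)

Section noise_gradient.
Context {R : realType}.
Notation mu := (@lebesgue_measure R).

Lemma lambda_scalar_ge n q (a : R) : (0 < q <= n)%N -> a <= lambda q (a%:M : 'M[R]_n).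
Proof.
move=> qn; rewrite leNgt; apply/negP => lt.
have sA : (a%:M : 'M[R]_n)^T = a%:M by rewrite tr_scalar_mx.
have [V [V0 _]] := lambda_ge_space sA qn.
suff : lambda q (a%:M : 'M[R]_n) < lambda q (a%:M : 'M[R]_n) by rewrite ltxx.
apply: (lambda_gt (V := V)) => // x x0.
have -> : qform a%:M (x *m V) = a * sqnorm (x *m V).
  by rewrite /qform /sqnorm mul_mx_scalar -scalemxAl mxE.
by rewrite ltr_pM2r // V0.
Qed.

(** The factor 2 makes the bound independent of the size of the matrices, whose products are not
    uniformly close even if the matrices are. *)
Lemma lambda_gram_perturb d q m (A B : 'M[R]_(d, q)) (e : R) : (0 < m <= d)%N -> 0 <= e ->
  (forall i j, `|A i j - B i j| <= e) ->
  lambda m (A *m A^T) <= 2 * lambda m (B *m B^T) + 2 * ((d * q)%:R * e ^+ 2).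
Proof.
move=> md e0 h; apply: lambda_le => // [||x]; try exact: gram_sym.
have qE (M : 'M[R]_(d, q)) : qform (M *m M^T) x = sqnorm (x *m M).
  by rewrite /qform /sqnorm trmx_mul !mulmxA.
rewrite !qE -[A in X in X <= _](subrK B) mulmxDr.
have h1 : sqnorm (x *m (A - B)) <= sqnorm x * ((d * q)%:R * e ^+ 2).
  apply: le_trans (sqnorm_mulmx _ _) _; rewrite ler_wpM2l //; first exact: row_norm_ge0.
  rewrite /entries_sqsum; apply: le_trans (_ : \sum_(i < d) \sum_(j < q) e ^+ 2 <= _).
    apply: ler_sum => i _; apply: ler_sum => j _; rewrite !mxE -real_normK ?num_real //.
    by rewrite lerXn2r ?nnegrE.
  by rewrite !sumr_const !card_ord -mulrnA -[X in X <= _]mulr_natl [(q * d)%N]mulnC.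
apply: le_trans (_ : 2 * sqnorm (x *m B) + 2 * sqnorm (x *m (A - B)) <= _); last first.
  by rewrite lerD2l -mulrA ler_pM2l // mulrC.
move: (x *m (A - B)) (x *m B) => y z; rewrite !sqnormE !mulr_sumr -big_split /=; apply: ler_sum => i _.
rewrite mxE; have := sqr_ge0 (y 0 i - z 0 i); nra.
Qed.

Lemma row_full_of_inj n q (A : 'M[R]_(n, q)) :
  (forall y : 'cV[R]_q, A *m y = 0 -> y = 0) -> exists B : 'M[R]_(q, n), B *m A = 1%:M.
Proof.
move=> h; apply/row_fullP; rewrite /row_full -mxrank_tr -/(row_free A^T) -kermx_eq0.
apply/eqP/row_matrixP => i; rewrite row0; apply: trmx_inj; rewrite trmx0; apply: h.
by apply: trmx_inj; rewrite trmx_mul trmxK trmx0 -row_mul mulmx_ker row0.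
Qed.

Section grid_noise.
Variables (d p r n : nat) (tau : nat -> R) (t h c e lam : R) (sigma : R -> 'M[R]_(d, p)).
Variables (F : 'I_d -> 'I_p -> R -> R) (PhiM : 'I_r.+1 -> R -> R) (Psi : 'I_r.+1 -> 'I_d -> R -> R).
Hypothesis rd : (r < d)%N.
Hypothesis hg : is_grid tau n.
Hypothesis t0 : 0 <= t.
Hypothesis h0 : 0 < h.
Hypothesis th1 : t + h <= 1.
Hypothesis c0 : 0 < c.
Hypothesis e0 : 0 <= e.
Hypothesis lam0 : 0 <= lam.
Hypothesis mF : forall k l, measurable_fun setT (F k l).
Hypothesis mPhiM : forall j, measurable_fun setT (PhiM j).
Hypothesis mPsi : forall j k, measurable_fun setT (Psi j k).
Hypothesis msig : forall k l, measurable_fun (`[0, 1] : set R) (fun s => sigma s k l).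
Hypothesis cF : forall k l i x, (i < n)%N -> tau i < x <= tau i.+1 -> F k l x = F k l (tau i.+1).
Hypothesis cPhiM : forall j i x, (i < n)%N -> tau i < x <= tau i.+1 -> PhiM j x = PhiM j (tau i.+1).
Hypothesis cPsi : forall j k i x, (i < n)%N -> tau i < x <= tau i.+1 -> Psi j k x = Psi j k (tau i.+1).

(** Extended by 0 outside the window, so that errors are measured on all of [[0, 1]], where the grid
    lives. *)
Definition PhiD (j : nat) (x : R) : R := Phi t h j x * \1_(`]t, t + h]) x.
Definition dPhiD (j : nat) (x : R) : R := dPhi t h j x * \1_(`]t, t + h]) x.

Hypothesis hB : forall k l (j : 'I_r.+1), (\int[mu]_(x in `[0%R, 1%R])
  ((F k l x * PhiM j x - sigma x k l * PhiD j.+1 x) ^+ 2)%:E <= e%:E)%E.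
Hypothesis hW : forall (j : 'I_r.+1) k, (\int[mu]_(x in `[0%R, 1%R])
  ((Psi j k x - dPhiD j.+1 x) ^+ 2)%:E <= e%:E)%E.
Hypothesis hlam : forall s, t <= s <= t + h -> lam <= lambda r.+1 (sigma s *m (sigma s)^T).

(** Becomes [eps eta n h ^+ 2] when [c] is [eta / Num.sqrt n%:R]. *)
Let eps2 : R := (pi / h) ^+ 2 * c ^+ 2.
(** The combinatorial factor of the discretisation error: row selections, omitted rows, entries of
    the adjugate. *)
Let K1 : R := #|{ffun 'I_r.+1 -> 'I_d}|%:R * r.+1%:R * #|{: 'I_r.+1 * 'I_r.+1}|%:R.

Hypothesis he : (p%:R + c ^+ 2 * d%:R) * K1 * e <= eps2 / 4.

Let mPhiD j : measurable_fun setT (PhiD j).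
Proof.
apply: measurable_funM; last exact: measurable_indic.
by apply: continuous_measurable_fun; exact: continuous_Phi.
Qed.

Let mdPhiD j : measurable_fun setT (dPhiD j).
Proof.
apply: measurable_funM; last exact: measurable_indic.
by apply: continuous_measurable_fun; exact: continuous_dPhi.
Qed.

Let PhiD_in j x : t < x <= t + h -> PhiD j x = Phi t h j x.
Proof. by move=> hx; rewrite /PhiD indicE mem_set ?mulr1 //= in_itv. Qed.

Let dPhiD_in j x : t < x <= t + h -> dPhiD j x = dPhi t h j x.
Proof. by move=> hx; rewrite /dPhiD indicE mem_set ?mulr1 //= in_itv. Qed.

Definition signal_gradient (S : 'M[R]_(d, r.+1)) : R :=
  \sum_(l < p) \sum_(i < n) minor_diff_sum S (\col_k F k l (tau i.+1))
    (\row_j PhiM j (tau i.+1)) * (tau i.+1 - tau i).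

Definition noise_gradient (S : 'M[R]_(d, r.+1)) : R :=
  \sum_(k < d) \sum_(i < n) minor_diff_sum S (delta_mx k 0)
    (\row_j Psi j k (tau i.+1)) * (tau i.+1 - tau i).

Lemma minors_sqsum_ge0 (S : 'M[R]_(d, r.+1)) : 0 <= minors_sqsum S.
Proof. by apply: sumr_ge0 => rho _; apply: sumr_ge0 => k _; exact: sqr_ge0. Qed.

Lemma signal_gradient_ge S : lam * minors_sqsum S <=
  2 * signal_gradient S + 2 * (p%:R * K1 * e * minors_sqsum S).
Proof.
have := @minor_diff_sum_grid_ge R d r p S n tau e t (t + h) lam
  (fun l x => col l (sigma x)) (fun l x => \col_k F k l x)
  (fun l x => \row_j PhiD j.+1 x) (fun l x => \row_j PhiM j x) (fun x => \row_j Phi t h j.+1 x)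
  hg t0 th1.
rewrite (minor_row_sum_integral (phi := fun j : 'I_r.+1 => Phi t h j.+1) S (C := Num.sqrt (2 / h)) (w := fun=> 1)); last 3 first.
- by move=> j; apply: continuous_measurable_fun; exact: continuous_Phi.
- by move=> j x; exact: Phi_bounded.
- by move=> j k; rewrite Phi_orthonormal // mulr1.
have -> : \sum_(rho : {ffun 'I_r -> 'I_d}) \sum_k 1 * \det (rowsub rho (col' k S)) ^+ 2 = minors_sqsum S.
  by apply: eq_bigr => rho _; apply: eq_bigr => k _; rewrite mul1r.
rewrite -EFinM lee_fin => hh; apply: le_trans (hh _ _ _ _ _ _ _ _ lam0 e0 _) _.
- by move=> l k; under eq_fun do rewrite mxE; exact: mF.
- by move=> l j; under eq_fun do rewrite mxE; exact: mPhiM.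
- move=> l k; rewrite (_ : (fun x => col l (sigma x) k 0) = fun x => sigma x k l); first exact: msig.
  by apply/funext => x; rewrite mxE.
- move=> l j; rewrite (_ : (fun x => _) = PhiD j.+1); first by apply: measurable_funTS; exact: mPhiD.
  by apply/funext => x; rewrite mxE.
- by move=> l i x iN hx; apply/matrixP => a b; rewrite !mxE (cF _ _ iN hx).
- by move=> l i x iN hx; apply/matrixP => a b; rewrite !mxE (cPhiM _ iN hx).
- by move=> l k j; under eq_integral do rewrite !mxE; exact: hB.
- move=> x hx; rewrite [X in _ <= X](_ : _ = \sum_l minor_diff_sum S (col l (sigma x)) (\row_j Phi t h j.+1 x)).
    by apply: minor_diff_sum_ge => //; rewrite lam0 hlam //; move: hx => /andP[/ltW -> ->].
  apply: eq_bigr => l _; congr (minor_diff_sum _ _ _); apply/rowP => j; by rewrite !mxE PhiD_in.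
- by move=> j; under eq_fun do rewrite mxE; apply: continuous_measurable_fun; exact: continuous_Phi.
rewrite lerD2l ler_pM2l // /K1 le_eqVlt; apply/orP; left; apply/eqP.
set x1 := #|{ffun _}|%:R; set x2 := #|{: _}|%:R; move: x1 x2 (minors_sqsum S) p%:R r.+1%:R => *; ring.
Qed.

(** The noise behaves like a signal with identity covariance and kernel [dPhi] in place of [Phi];
    the squared frequencies are at least that of [j = 1], which is [(pi / h) ^+ 2]. *)
Lemma noise_gradient_ge S : (pi / h) ^+ 2 * minors_sqsum S <=
  2 * noise_gradient S + 2 * (d%:R * K1 * e * minors_sqsum S).
Proof.
have := @minor_diff_sum_grid_ge R d r d S n tau e t (t + h) 1
  (fun l x => delta_mx l 0) (fun l x => delta_mx l 0)
  (fun l x => \row_j dPhiD j.+1 x) (fun l x => \row_j Psi j l x) (fun x => \row_j dPhi t h j.+1 x)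
  hg t0 th1.
pose C := \sum_(j < r.+1) Num.sqrt (2 / h) * (j.+1%:R * pi / h).
have t_ge0 (j : 'I_r.+1) : 0 <= Num.sqrt (2 / h) * (j.+1%:R * pi / h).
  by rewrite mulr_ge0 ?sqrtr_ge0 // divr_ge0 ?mulr_ge0 ?pi_ge0 // ltW.
rewrite (minor_row_sum_integral (phi := fun j : 'I_r.+1 => dPhi t h j.+1) S (C := C)
  (w := fun j => (j.+1%:R * pi / h) ^+ 2)); last 3 first.
- by move=> j; apply: continuous_measurable_fun; exact: continuous_dPhi.
- move=> j x; apply: le_trans (dPhi_bounded t h0 _ _) _.
  by rewrite /C (bigD1 j) //= lerDl sumr_ge0.
- by move=> j k; rewrite dPhi_orthogonal.
rewrite mul1e lee_fin => hh.
apply: (@le_trans _ _ (\sum_(rho : {ffun 'I_r -> 'I_d}) \sum_(k < r.+1) (k.+1%:R * pi / h) ^+ 2 * \det (rowsub rho (col' k S)) ^+ 2)).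
  rewrite /minors_sqsum mulr_sumr; apply: ler_sum => rho _; rewrite mulr_sumr; apply: ler_sum => k _.
  rewrite ler_wpM2r ?sqr_ge0 // lerXn2r ?nnegrE ?divr_ge0 ?mulr_ge0 ?pi_ge0 ?(ltW h0) //.
  by rewrite ler_pM2r ?invr_gt0 // ler_peMl ?pi_ge0 // ler1n.
apply: le_trans (hh _ _ _ _ _ _ _ _ ler01 e0 _) _.
- by move=> l k; exact: measurable_cst.
- by move=> l j; under eq_fun do rewrite mxE; exact: mPsi.
- by move=> l k; exact: measurable_cst.
- move=> l j; rewrite (_ : (fun x => _) = dPhiD j.+1); first by apply: measurable_funTS; exact: mdPhiD.
  by apply/funext => x; rewrite mxE.
- by [].
- by move=> l i x iN hx; apply/matrixP => a b; rewrite !mxE (cPsi _ _ iN hx).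
- move=> l k j; have [->|kl] := eqVneq k l.
    under eq_integral do rewrite !mxE !eqxx !mul1r; exact: hW.
  under eq_integral do rewrite !mxE (negPf kl) /= !mul0r subr0 expr0n /=.
  by rewrite integral0 lee_fin.
- move=> x hx; rewrite [X in _ <= X](_ : _ = \sum_l minor_diff_sum S (col l (1%:M : 'M[R]_d)) (\row_j dPhi t h j.+1 x)).
    apply: minor_diff_sum_ge => //; rewrite ler01 trmx1 mulmx1; exact: lambda_scalar_ge.
  apply: eq_bigr => l _; congr (minor_diff_sum _ _ _); first by apply/colP => j; rewrite !mxE andbT.
  by apply/rowP => j; rewrite !mxE dPhiD_in.
- by move=> j; under eq_fun do rewrite mxE; apply: continuous_measurable_fun; exact: continuous_dPhi.
rewrite lerD2l ler_pM2l // /K1 le_eqVlt; apply/orP; left; apply/eqP.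
set x1 := #|{ffun _}|%:R; set x2 := #|{: _}|%:R; move: x1 x2 (minors_sqsum S) d%:R r.+1%:R => *; ring.
Qed.

(** Discretisation loses a factor 2; by [he] the errors of both parts are absorbed in the noise
    term, which is where another half goes. *)
Lemma total_gradient_ge S : (lam + eps2) / 4 * minors_sqsum S <=
  signal_gradient S + c ^+ 2 * noise_gradient S.
Proof.
have h1 := signal_gradient_ge S; have h2 := noise_gradient_ge S.
have N0 := minors_sqsum_ge0 S; have c2 : 0 < c ^+ 2 by rewrite exprn_gt0.
have h3 : (p%:R + c ^+ 2 * d%:R) * K1 * e * minors_sqsum S <= eps2 / 4 * minors_sqsum S.
  by rewrite ler_wpM2r.
have h4 : eps2 * minors_sqsum S <= c ^+ 2 * (2 * noise_gradient S + 2 * (d%:R * K1 * e * minors_sqsum S)).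
  by rewrite /eps2 mulrAC [leLHS]mulrC ler_pM2l.
have h5 : 0 <= lam * minors_sqsum S by rewrite mulr_ge0.
move: h1 h3 h4 h5; rewrite !mulrDl mulrDr.
rewrite (_ : c ^+ 2 * d%:R * K1 * e * minors_sqsum S = c ^+ 2 * (d%:R * K1 * e * minors_sqsum S)); last by rewrite !mulrA.
move: (signal_gradient S) (noise_gradient S) (d%:R * K1 * e * minors_sqsum S) (p%:R * K1 * e * minors_sqsum S).
move: (c ^+ 2) c2 => C2 C20 x y z z'; move: (minors_sqsum S) N0 (eps2) => N N0 ee *; nra.
Qed.

(** A combination of the [Psi] vanishing on the grid would approximate a combination of the [dPhi],
    whose squared norm is at least [(pi / h) ^+ 2] times that of [y], more than the error allows.
    The left inverse yields a nonzero maximal minor below. *)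
Lemma noise_rows_full k : 2 * (r.+1%:R * e) < (pi / h) ^+ 2 ->
  exists Y : 'M[R]_(r.+1, n), Y *m (\matrix_(i < n, j < r.+1) Psi j k (tau i.+1)) = 1%:M.
Proof.
move=> small; apply: row_full_of_inj => y Ay.
have := @grid_quadratic_ge R _ (fun j : 'I_r.+1 => y j 0) (fun j => Psi j k) (fun j => dPhiD j.+1)
  n tau e t (t + h) hg t0 th1.
pose C := \sum_(j < r.+1) Num.sqrt (2 / h) * (j.+1%:R * pi / h).
have t_ge0 (j : 'I_r.+1) : 0 <= Num.sqrt (2 / h) * (j.+1%:R * pi / h).
  by rewrite mulr_ge0 ?sqrtr_ge0 // divr_ge0 ?mulr_ge0 ?pi_ge0 // ltW.
have -> : (\int[mu]_(x in `]t, (t + h)%R]) ((\sum_j y j 0 * dPhiD j.+1 x) ^+ 2)%:E =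
  \int[mu]_(x in `]t, (t + h)%R]) ((\sum_(j < r.+1) y j 0 * dPhi t h j.+1 x) ^+ 2)%:E)%E.
  apply: eq_integral => x; rewrite inE /= in_itv /= => hx; congr (_ ^+ 2)%:E.
  by apply: eq_bigr => j _; rewrite dPhiD_in.
rewrite (orthogonal_combination_integral (phi := fun j : 'I_r.+1 => dPhi t h j.+1) (C := C)
  (w := fun j => (j.+1%:R * pi / h) ^+ 2)); last 4 first.
- by move=> j; apply: continuous_measurable_fun; exact: continuous_dPhi.
- move=> j x; apply: le_trans (dPhi_bounded t h0 _ _) _.
  by rewrite /C (bigD1 j) //= lerDl sumr_ge0.
- exact: sumr_ge0.
- by move=> i j; rewrite dPhi_orthogonal.
rewrite [X in 2 * X + _]big1 ?mulr0 ?add0r; last first.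
  move=> i _; have := congr1 (fun M : 'cV[R]_n => M i 0) Ay; rewrite !mxE => hi.
  rewrite (_ : \sum_j y j 0 * Psi j k (tau i.+1) = 0) ?expr0n ?mul0r //.
  by rewrite -[RHS]hi; apply: eq_bigr => j _; rewrite !mxE mulrC.
rewrite lee_fin card_ord => hh.
have {}hh : (pi / h) ^+ 2 * \sum_j y j 0 ^+ 2 <= 2 * (r.+1%:R * e) * \sum_j y j 0 ^+ 2.
  rewrite -mulrA [X in _ <= 2 * X]mulrC; apply: le_trans (hh _ _ _ _).
  - rewrite mulr_sumr; apply: ler_sum => j _; rewrite ler_wpM2r ?sqr_ge0 //.
    rewrite lerXn2r ?nnegrE ?divr_ge0 ?mulr_ge0 ?pi_ge0 ?(ltW h0) //.
    by rewrite ler_pM2r ?invr_gt0 // ler_peMl ?pi_ge0 // ler1n.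
  - by [].
  - by move=> j; exact: measurable_funTS.
  - by move=> j i x iN hx; exact: cPsi iN hx.
  - by move=> j; exact: hW.
have y0 : \sum_j y j 0 ^+ 2 = 0.
  apply/eqP; rewrite eq_le sumr_ge0 ?andbT => [|j _]; last exact: sqr_ge0.
  by rewrite leNgt; apply/negP => y1; move: hh; rewrite ler_pM2r // leNgt small.
apply/colP => j; rewrite mxE; apply/eqP; rewrite -sqrf_eq0.
have := y0; move/eqP; rewrite psumr_eq0 => [/allP /(_ j)|i _]; last exact: sqr_ge0.
by rewrite mem_index_enum => /(_ isT).
Qed.

End grid_noise.
End noise_gradient.

(** * Signal and noise increments as one Gaussian matrix *)

Section grid_gaussian.
Context {R : realType}.
Notation mu := (@lebesgue_measure R).

Lemma measurable_lambda_le d0 (T : measurableType d0) d q m (A : T -> 'M[R]_(d, q)) (x : R) :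
  (0 < m <= d)%N -> (forall i j, measurable_fun setT (fun w => A w i j)) ->
  measurable [set w | lambda m (A w *m (A w)^T) <= x].
Proof.
move=> md mA; rewrite (_ : [set w | _] = ~` [set w | x < lambda m (A w *m (A w)^T)]).
  apply: measurableC; apply: measurable_lambda_gt => // [w|i j]; first exact: gram_sym.
  exact: measurable_gram.
by apply/seteqP; split => w /=; rewrite leNgt => /negP.
Qed.

Lemma prob_lambda_perturb d0 (T : measurableType d0) (P : probability T R) d q m
    (A B : T -> 'M[R]_(d, q)) (x rho e e1 : R) : (0 < m <= d)%N -> 0 <= rho ->
  (forall i j, measurable_fun setT (fun w => A w i j)) ->
  (forall i j, measurable_fun setT (fun w => B w i j)) ->
  (forall i j, P [set w | (rho <= `|A w i j - B w i j|)%R] <= e%:E)%E ->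
  (P [set w | (lambda m (B w *m (B w)^T) <= 2 * x + 2 * ((d * q)%:R * rho ^+ 2))%R] <= e1%:E)%E ->
  (P [set w | (lambda m (A w *m (A w)^T) <= x)%R] <= (e1 + (d * q)%:R * e)%:E)%E.
Proof.
move=> md rho0 mA mB hAB hB.
have mC (ij : 'I_d * 'I_q) : measurable [set w | rho <= `|A w ij.1 ij.2 - B w ij.1 ij.2|].
  by apply: measurable_abs_ge; exact: measurable_funB.
have [mU hU] := prob_exists_le mC (fun ij => hAB ij.1 ij.2).
rewrite card_prod !card_ord in hU.
apply: prob_union_le hB hU => //; try exact: measurable_lambda_le.
move=> w /= hw; have [h|h] := pselect (exists i : 'I_d * 'I_q, rho <= `|A w i.1 i.2 - B w i.1 i.2|).
  by right.
left; apply: le_trans (lambda_gram_perturb (A := B w) (B := A w) (e := rho) md rho0 _) _.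
  move=> i j; rewrite distrC leNgt; apply/negP => h1; apply: h; exists (i, j); exact: ltW.
by rewrite lerD2r ler_pM2l.
Qed.

Lemma minor_diffZ d q (S : 'M[R]_(d, q)) rho u (a : R) v :
  minor_diff S rho u (a *: v) = a * minor_diff S rho u v.
Proof. by rewrite /minor_diff -!scalemxAl mxE. Qed.

Lemma minor_diff_sumZ d q (S : 'M[R]_(d, q)) u (a : R) v :
  minor_diff_sum S u (a *: v) = a ^+ 2 * minor_diff_sum S u v.
Proof.
by rewrite /minor_diff_sum mulr_sumr; apply: eq_bigr => rho _; rewrite minor_diffZ exprMn.
Qed.

Lemma sum_nth_enum (V : zmodType) (I : finType) (i0 : I) (H : I -> V) :
  \sum_(i < #|I|) H (nth i0 (enum I) i) = \sum_x H x.
Proof.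
by rewrite -[RHS]big_enum (big_nth i0) big_mkord -cardE.
Qed.

(* The constant of [gaussian_lambda_small], which does not depend on the law. *)
Definition rank1_bound d r (e eta : R) : Prop :=
  forall N (u : nat -> 'cV[R]_d) (v : nat -> 'rV[R]_r.+1)
    d1 (T : measurableType d1) (P : probability T R) (g : nat -> T -> R) (lam : R),
    (0 < N)%N -> gaussian_family P N g -> 0 < lam ->
    (forall S, lam * minors_sqsum S <= \sum_(i < N) minor_diff_sum S (u i) (v i)) ->
    (exists x (rho : {ffun 'I_r.+1 -> 'I_d}), \det (rowsub rho (rank1_sum N u v x)) != 0) ->
    (P [set w | (lambda r.+1 (rank1_sum N u v (g ^~ w) *m (rank1_sum N u v (g ^~ w))^T)
                 <= e * lam)%R] <= eta%:E)%E.

Section grid_sum.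
Variables (d p r n : nat) (tau : nat -> R) (c : R).
Variables (F : 'I_d -> 'I_p -> R -> R) (PhiM : 'I_r.+1 -> R -> R) (Psi : 'I_r.+1 -> 'I_d -> R -> R).
Hypothesis rd : (r < d)%N.
Hypothesis n0 : (0 < n)%N.
Hypothesis hg : is_grid tau n.
Hypothesis c0 : 0 < c.

Definition grid_matrix (B : R -> 'cV[R]_p) (W : R -> 'cV[R]_d) : 'M[R]_(d, r.+1) :=
  \matrix_(k, j) (\sum_(l < p) gridint tau n (fun x => - (F k l x * PhiM j x)) (fun s => B s l 0)
    + c * gridint tau n (Psi j k) (fun s => W s k 0)).

Let I : finType := (('I_p * 'I_n) + ('I_d * 'I_n))%type.
Let i0 : I := inr (Ordinal rd, Ordinal n0).
Let dt (a : 'I_n) : R := Num.sqrt (tau a.+1 - tau a).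

Let dt_gt0 a : 0 < dt a.
Proof. by rewrite sqrtr_gt0 subr_gt0; case: hg => _ _; apply. Qed.

Let dt2 a : dt a ^+ 2 = tau a.+1 - tau a.
Proof. by rewrite sqr_sqrtr // subr_ge0 ltW //; case: hg => _ _; apply. Qed.

(** [U x] and [V x] are the two factors of the rank one matrix carried by the normalised increment
    [x]: [dt] restores the scale of the increment, and the sign for the signal stems from summation
    by parts. *)
Let U (x : I) : 'cV[R]_d :=
  match x with inl (l, a) => \col_k F k l (tau a.+1) | inr (k, a) => delta_mx k 0 end.
Let V (x : I) : 'rV[R]_r.+1 :=
  match x with inl (l, a) => (- dt a) *: \row_j PhiM j (tau a.+1)
  | inr (k, a) => (c * dt a) *: \row_j Psi j k (tau a.+1) end.
Let u i := U (nth i0 (enum I) i).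
Let v i := V (nth i0 (enum I) i).

Let sumE (g : I -> R) : rank1_sum #|I| u v (fun i => g (nth i0 (enum I) i)) =
  \sum_x g x *: (U x *m V x).
Proof. by rewrite /rank1_sum -[RHS](sum_nth_enum i0). Qed.

Let sum_split (W : nmodType) (H : I -> W) : \sum_x H x =
  \sum_(l < p) \sum_(a < n) H (inl (l, a)) + \sum_(k < d) \sum_(a < n) H (inr (k, a)).
Proof. by rewrite big_sumType /=; congr (_ + _); rewrite pair_bigA; apply: eq_bigr => -[]. Qed.

Let incr (B : R -> 'cV[R]_p) (W : R -> 'cV[R]_d) (x : I) : R := match x with
  | inl i => (B (tau i.2.+1) i.1 0 - B (tau i.2) i.1 0) / Num.sqrt (tau i.2.+1 - tau i.2)
  | inr i => (W (tau i.2.+1) i.1 0 - W (tau i.2) i.1 0) / Num.sqrt (tau i.2.+1 - tau i.2) end.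

Let grid_matrixE (B : R -> 'cV[R]_p) (W : R -> 'cV[R]_d) :
  grid_matrix B W = \sum_x incr B W x *: (U x *m V x).
Proof.
apply/matrixP => k j; rewrite mxE sum_split mxE !summxE; congr (_ + _).
  apply: eq_bigr => l _; rewrite summxE; apply: eq_bigr => a _.
  rewrite /incr /= -[Num.sqrt _]/(dt a) -scalemxAr !mxE big_ord1 !mxE.
  have := gt_eqF (dt_gt0 a); set D := dt a => D0; field; exact: negbT.
rewrite (bigD1 k) //= [X in _ = _ + X]big1 ?addr0 => [|k' kk'].
  rewrite summxE mulr_sumr; apply: eq_bigr => a _.
  rewrite /incr /= -[Num.sqrt _]/(dt a) -scalemxAr !mxE big_ord1 !mxE !eqxx mul1r.
  have := gt_eqF (dt_gt0 a); set D := dt a => D0; field; exact: negbT.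
rewrite summxE big1 // => a _.
by rewrite -scalemxAr !mxE big_ord1 !mxE eq_sym (negPf kk') mul0r !mulr0.
Qed.

Let gradientE (S : 'M[R]_(d, r.+1)) : \sum_(i < #|I|) minor_diff_sum S (u i) (v i) =
  signal_gradient n tau F PhiM S + c ^+ 2 * noise_gradient n tau Psi S.
Proof.
rewrite (sum_nth_enum i0 (fun x => minor_diff_sum S (U x) (V x))) sum_split /=; congr (_ + _).
  apply: eq_bigr => l _; apply: eq_bigr => a _.
  by rewrite minor_diff_sumZ sqrrN dt2 mulrC.
rewrite mulr_sumr; apply: eq_bigr => k _; rewrite mulr_sumr; apply: eq_bigr => a _.
by rewrite minor_diff_sumZ exprMn dt2 mulrAC mulrA.
Qed.

Hypothesis rows : forall k, exists Y : 'M[R]_(r.+1, n),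
  Y *m (\matrix_(i < n, j < r.+1) Psi j k (tau i.+1)) = 1%:M.

(** The noise is sufficient: signal coefficients are set to 0, and the left inverses of the noise
    rows give coefficients for which the first [r.+1] rows form the identity. *)
Let rank1_nonsingular :
  exists x (rho : {ffun 'I_r.+1 -> 'I_d}), \det (rowsub rho (rank1_sum #|I| u v x)) != 0.
Proof.
have [Y hY] := choice rows.
pose g (x : I) : R := match x with inl _ => 0
  | inr (k, a) => if insub (k : nat) is Some k' then Y k k' a / (c * dt a) else 0 end.
exists (fun i => g (nth i0 (enum I) i)), [ffun k => widen_ord rd k].
rewrite sumE (_ : rowsub _ _ = 1%:M) ?det1 ?oner_eq0 //.
apply/matrixP => b j; rewrite mxE ffunE sum_split mxE.
rewrite [X in X + _](_ : _ = 0) ?add0r; last first.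
  by rewrite summxE big1 // => l _; rewrite summxE big1 // => a _; rewrite /= scale0r mxE.
rewrite summxE (bigD1 (widen_ord rd b)) //= [X in _ + X]big1 ?addr0 => [|k' kk']; last first.
  rewrite summxE big1 // => a _.
  by rewrite -scalemxAr !mxE big_ord1 !mxE eq_sym (negPf kk') mul0r !mulr0.
rewrite summxE insubT //= => hb.
have := congr1 (fun A : 'M[R]_(r.+1) => A b j) (hY (widen_ord rd b)); rewrite mxE => <-.
apply: eq_bigr => a _; rewrite -scalemxAr !mxE big_ord1 !mxE !eqxx mul1r.
rewrite (_ : Sub _ _ = b); last by apply: val_inj.
have := gt_eqF (dt_gt0 a); set D := dt a => D0; field; apply/andP; split; [exact: negbT | exact: lt0r_neq0].
Qed.

(** [B] and [W] are read on different factors, so that their increments are jointly independent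
    whatever their dependence under [P]. *)
Lemma grid_matrix_small d0 (T : measurableType d0) (P : probability T R)
    (B : R -> T -> 'cV[R]_p) (W : R -> T -> 'cV[R]_d) (e eta lam : R) :
  brownian_motion P B -> brownian_motion P W -> rank1_bound d r e eta -> 0 < lam ->
  (forall S, lam * minors_sqsum S <=
     signal_gradient n tau F PhiM S + c ^+ 2 * noise_gradient n tau Psi S) ->
  ((P \x P)%E [set w | (lambda r.+1 (grid_matrix (B ^~ w.1) (W ^~ w.2) *m
     (grid_matrix (B ^~ w.1) (W ^~ w.2))^T) <= e * lam)%R] <= eta%:E)%E.
Proof.
move=> hB hW hb lam0 hgrad; have [tau0 tau1 tauS] := hg.
have gB := brownian_gaussian_fin hB (eq_ind_r (fun x => 0 <= x) (lexx 0) tau0)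
  (eq_ind_r (fun x => x <= 1) (lexx 1) tau1) tauS.
have gW := brownian_gaussian_fin hW (eq_ind_r (fun x => 0 <= x) (lexx 0) tau0)
  (eq_ind_r (fun x => x <= 1) (lexx 1) tau1) tauS.
have gP := gaussian_fin_prod gB gW.
have inj i j : (i < #|I|)%N -> (j < #|I|)%N -> nth i0 (enum I) i = nth i0 (enum I) j -> i = j.
  by rewrite cardE => iN jN /eqP; rewrite nth_uniq ?enum_uniq // => /eqP.
have gI := gaussian_fin_family inj gP.
have I0 : (0 < #|I|)%N by rewrite cardE; have := mem_enum I i0; case: (enum I).
have h S : lam * minors_sqsum S <= \sum_(i < #|I|) minor_diff_sum S (u i) (v i) by rewrite gradientE.
apply: le_trans (hb _ u v _ _ _ _ _ I0 gI lam0 h rank1_nonsingular).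
rewrite le_eqVlt; apply/orP; left; apply/eqP; apply: (congr1 (P \x P)%E).
apply/funext => w /=; rewrite !grid_matrixE -(sumE (incr (B ^~ w.1) (W ^~ w.2))).
congr (is_true (lambda _ (_ *m _^T) <= _)); apply: eq_bigr => i _; congr (_ *: _);
  by rewrite /incr; case: (nth _ _ _).
Qed.

End grid_sum.
End grid_gaussian.

(** * From the observations to Gaussian matrices *)

Section approximations.
Context {R : realType}.
Notation mu := (@lebesgue_measure R).

Lemma sum_indic_cells m (s : nat -> R) x : (forall i, (i < m)%N -> s i <= s i.+1) ->
  \sum_(i < m) \1_(`]s i, s i.+1]) x = \1_(`]s 0%N, s m]) x :> R.
Proof.
move=> hs.
have E a b : a <= b -> \1_(`]a, b]) x = (x <= b)%R%:R - (x <= a)%R%:R :> R.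
  move=> ab; rewrite indicE mem_setE in_itv /=.
  have [xa|ax] := leP x a; last by rewrite /= subr0.
  by rewrite /= (le_trans xa ab) subrr.
have s0 : s 0%N <= s m.
  elim: m hs => // m IH hs; apply: le_trans (hs m _) => //; apply: IH => i im; apply: hs; exact: leqW.
rewrite E // -(telescope_sumr (fun i => (x <= s i)%R%:R)) // big_mkord.
by apply: eq_bigr => i _; rewrite E // hs.
Qed.

Lemma uniform_mesh_step (a b : R) m : 0 <= a -> a <= b <= 1 ->
  is_step m.+1 (uniform_mesh a b m.+1).
Proof.
move=> a0 /andP[ab b1]; rewrite /uniform_mesh; split => [||i _].
- by rewrite mulr0 mul0r addr0.
- by rewrite mulfK ?pnatr_eq0 // subrKC.
- by rewrite lerD2l ler_pM2r ?invr_gt0 ?ltr0n // ler_wpM2l ?subr_ge0 // ler_nat.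
Qed.

Lemma uniform_mesh0 (a b : R) m : uniform_mesh a b m 0 = a.
Proof. by rewrite /uniform_mesh mulr0 mul0r addr0. Qed.

Lemma uniform_meshm (a b : R) m : uniform_mesh a b m.+1 m.+1 = b.
Proof. by rewrite /uniform_mesh mulfK ?pnatr_eq0 // subrKC. Qed.

Lemma mesh_step_close (G : R -> R) (a b w : R) : {within `[0, 1], continuous G} ->
  0 <= a -> a <= b <= 1 -> 0 < w ->
  exists M0, forall M, (M0 <= M)%N -> forall x,
  `|step_fun M.+1 (uniform_mesh a b M.+1) (fun i => G (uniform_mesh a b M.+1 i)) x
    - G x * \1_(`]a, b]) x| <= w.
Proof.
move=> cG a0 ab1 w0; have /andP[ab b1] := ab1.
have [dl dl0 hdl] := path_uniform_continuity cG w0.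
exists (Num.bound (dl^-1)) => M hM x.
set s := uniform_mesh a b M.+1.
have hs : is_step M.+1 s by exact: uniform_mesh_step.
have [_ _ smono] := hs.
have mesh_lt i : s i.+1 - s i < dl.
  rewrite /s /uniform_mesh opprD addrACA subrr add0r -mulrBl -mulrBr -natrB // subSnn mulr1.
  rewrite ltr_pdivrMr ?ltr0n //; apply: (@le_lt_trans _ _ 1); first by lra.
  rewrite mulrC -ltr_pdivrMr // mul1r; apply: lt_le_trans (archi_boundP _) _.
    by rewrite invr_ge0 ltW.
  by rewrite ler_nat; apply: leqW.
rewrite (_ : \1_(`]a, b]) x = \sum_(i < M.+1) \1_(`]s i, s i.+1]) x); last first.
  by rewrite sum_indic_cells // /s uniform_mesh0 uniform_meshm.
rewrite /step_fun mulr_sumr -sumrB; apply: le_trans (ler_norm_sum _ _ _) _.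
apply: le_trans (_ : \sum_(i < M.+1) w * \1_(`]s i, s i.+1]) x <= _).
  apply: ler_sum => i _; rewrite -mulrBl normrM indicE mem_setE in_itv /=.
  case: (boolP (_ < _ <= _)) => [/andP[h1 h2]|_]; last by rewrite normr0 !mulr0.
  rewrite normr1 !mulr1; apply/ltW/hdl.
  - by apply: (step_itv hs); rewrite ltnW.
  - have /andP[h3 _] := step_itv hs (ltnW (ltn_ord i)); have /andP[_ h4] := step_itv hs (ltn_ord i).
    by rewrite (le_trans h3 (ltW h1)) (le_trans h2 h4).
  - have := mesh_lt i; rewrite distrC ger0_norm ?subr_ge0 ?(ltW h1) //; lra.
rewrite -mulr_sumr sum_indic_cells // indicE; case: (_ \in _) => /=; lra.
Qed.

Lemma integral_sq_mul_le (D : set R) (f g : R -> R) (K : R) (V : \bar R) : measurable D ->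
  measurable_fun D f -> measurable_fun D g -> (forall x, `|g x| <= K) ->
  (\int[mu]_(x in D) (f x ^+ 2)%:E <= V)%E ->
  (\int[mu]_(x in D) ((f x * g x) ^+ 2)%:E <= (K ^+ 2)%:E * V)%E.
Proof.
move=> mD mf mg hg hV; have K0 : 0 <= K by apply: le_trans (hg 0).
have mf2 : measurable_fun D (fun x => (f x ^+ 2)%:E).
  by apply/measurable_EFinP; exact: measurable_funX.
have mfg : measurable_fun D (fun x => ((f x * g x) ^+ 2)%:E).
  by apply/measurable_EFinP; apply: measurable_funX; exact: measurable_funM.
have mKf : measurable_fun D (fun x => ((K ^+ 2)%:E * (f x ^+ 2)%:E)%E).
  apply/measurable_EFinP; apply: measurable_funM => //; exact: measurable_funX.
apply: (@le_trans _ _ (\int[mu]_(x in D) ((K ^+ 2)%:E * (f x ^+ 2)%:E))%E).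
  apply: ge0_le_integral => //.
  - by move=> x _; rewrite lee_fin sqr_ge0.
  - move=> x _; rewrite -EFinM lee_fin exprMn mulrC ler_wpM2r ?sqr_ge0 //.
    by rewrite -real_normK ?num_real // lerXn2r ?nnegrE.
rewrite ge0_integralZl // => [|x _|]; rewrite ?lee_fin ?sqr_ge0 //.
by apply: lee_wpmul2l; rewrite ?lee_fin ?sqr_ge0.
Qed.

(** The intermediate function is [sg * phiM]: the first error uses the supremum of [phiM], the
    second the norm of [sg]. *)
Lemma product_L2_close (D : set R) (F sg phiM phi : R -> R) (K w dl V : R) : measurable D ->
  measurable_fun D F -> measurable_fun D sg -> measurable_fun D phiM -> measurable_fun D phi ->
  (forall x, `|phiM x| <= K) -> (forall x, `|phiM x - phi x| <= w) ->
  (\int[mu]_(x in D) ((F x - sg x) ^+ 2)%:E <= dl%:E)%E ->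
  (\int[mu]_(x in D) (sg x ^+ 2)%:E <= V%:E)%E ->
  (\int[mu]_(x in D) ((F x * phiM x - sg x * phi x) ^+ 2)%:E
    <= (2 * (K ^+ 2 * dl) + 2 * (w ^+ 2 * V))%:E)%E.
Proof.
move=> mD mF ms mM mp hK hw hdl hV.
have mFM : measurable_fun D (fun x => F x * phiM x) by exact: measurable_funM.
have msp : measurable_fun D (fun x => sg x * phi x) by exact: measurable_funM.
have msM : measurable_fun D (fun x => sg x * phiM x) by exact: measurable_funM.
apply: le_trans (sq_dist_triangle mu mD mFM msp msM) _.
rewrite [X in (_ <= X)%E]EFinD; apply: leeD; rewrite [X in (_ <= X)%E]EFinM; apply: lee_wpmul2l => //.
  have mFs : measurable_fun D (fun x => F x - sg x) by exact: measurable_funB.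
  under eq_integral do rewrite -mulrBl.
  rewrite EFinM; exact: (integral_sq_mul_le mD mFs mM hK hdl).
have mpM : measurable_fun D (fun x => phi x - phiM x) by exact: measurable_funB.
under eq_integral do rewrite -mulrBr.
by rewrite EFinM; apply: (integral_sq_mul_le mD ms mpM _ hV) => x; rewrite distrC.
Qed.

Lemma step_L2_extend m (s c : nat -> R) (t h e : R) (phi : R -> R) : is_step m s ->
  s 0%N = t -> s m = t + h -> measurable_fun setT phi ->
  (\int[mu]_(x in `[t, (t + h)%R]) ((step_fun m s c x - phi x) ^+ 2)%:E <= e%:E)%E ->
  (\int[mu]_(x in `[0%R, 1%R])
     ((step_fun m s c x - phi x * \1_(`]t, t + h]) x) ^+ 2)%:E <= e%:E)%E.
Proof.
move=> hs s0 sm mphi hint; apply: le_trans hint.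
have mI : measurable_fun setT (fun x : R => \1_(`]t, t + h]) x : R) by exact: measurable_indic.
have mf : measurable_fun setT (fun x => ((step_fun m s c x - phi x) ^+ 2)%:E).
  by apply/measurable_EFinP; apply: measurable_funX; apply: measurable_funB => //; exact: measurable_step_fun.
have mf1 : measurable_fun setT (fun x => ((step_fun m s c x - phi x * \1_(`]t, t + h]) x) ^+ 2)%:E).
  apply/measurable_EFinP; apply: measurable_funX; apply: measurable_funB; first exact: measurable_step_fun.
  exact: measurable_funM.
rewrite [leRHS]integral_mkcond [leLHS]integral_mkcond; apply: ge0_le_integral => //.
- by move=> x _; rewrite patchE; case: ifP; rewrite // lee_fin sqr_ge0.
- by apply/(measurable_restrictT _ _).1 => //; exact: measurable_funTS.
- by apply/(measurable_restrictT _ _).1 => //; exact: measurable_funTS.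
move=> x _; rewrite !patchE.
have step0 : ~~ (t < x <= t + h) -> step_fun m s c x = 0.
  move=> hx; have [_ _ smono] := hs; rewrite /step_fun big1 // => i _.
  rewrite indicE mem_setE in_itv /=; case: (boolP (_ < _ <= _)) => [/andP[h1 h2]|_]; last by rewrite mulr0.
  move: hx; rewrite -sm -s0 => /negP[].
  have i0 := step_mono (i := 0%N) (j := i) hs (ltnW (ltn_ord i)).
  have im := step_mono (i := i.+1) (j := m) hs (_ : (i < m <= m)%N).
  by rewrite (le_lt_trans i0 h1) (le_trans h2) // im // ltn_ord leqnn.
case: (boolP (t < x <= t + h)) => hx; last first.
  have -> : \1_(`]t, t + h]) x = 0 :> R by rewrite indicE mem_setE in_itv /= (negPf hx).
  rewrite step0 // mulr0 subr0 expr0n /=.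
  by case: ifP => _; case: ifP => _ //; rewrite lee_fin ?sqr_ge0.
have -> : x \in `[t, (t + h)%R]%classic.
  by rewrite mem_setE in_itv /=; move: hx => /andP[/ltW -> ->].
have -> : \1_(`]t, t + h]) x = 1 :> R by rewrite indicE mem_setE in_itv /= hx.
rewrite mulr1; case: ifP => // _; by rewrite lee_fin sqr_ge0.
Qed.

Lemma exists_pos_lower_bound (I : finType) (f : I -> R) : (forall i, 0 < f i) ->
  exists2 x : R, 0 < x & forall i, x <= f i.
Proof.
move=> f0; exists (\big[Num.min/1]_i f i) => [|i]; last exact: bigmin_le.
by elim/big_ind: _ => // x y x0 y0; rewrite lt_min x0.
Qed.

Lemma exists_nat_upper_bound (I : finType) (f : I -> nat) : exists M, forall i, (f i <= M)%N.
Proof. by exists (\max_i f i)%N => i; exact: leq_bigmax. Qed.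

(** Two successive uses of [prob_lambda_perturb] turn a threshold [x] into [4 * x] plus six times
    the squared tolerance times the number of entries. *)
Lemma exists_tolerance (N a b : R) : 0 <= N -> 0 < a -> 0 < b ->
  exists2 x : R, 0 < x & 6 * (N * x ^+ 2) <= a /\ N * x <= b.
Proof.
move=> N0 a0 b0; have h1 : 0 < 6 * N + 1 by lra.
have h2 : 0 < N + 1 by lra.
exists (Num.min 1 (Num.min (a / (6 * N + 1)) (b / (N + 1)))).
  by rewrite !lt_min ltr01 !divr_gt0.
set x := Num.min _ _; have x0 : 0 <= x by rewrite !le_min ler01 !divr_ge0 // ltW.
have : x <= 1 by rewrite ge_min lexx.
have : x * (6 * N + 1) <= a by rewrite -ler_pdivlMr // !ge_min lexx orbT.
have : x * (N + 1) <= b by rewrite -ler_pdivlMr // !ge_min lexx !orbT.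
by move: x x0 => x *; split; nra.
Qed.

Lemma step_integralZ (T : Type) (Z : R -> T -> R) m s c (a : R) w :
  step_integral (fun u w => a * Z u w) m s c w = a * step_integral Z m s c w.
Proof. by rewrite /step_integral mulr_sumr; apply: eq_bigr => i _; rewrite -mulrBr mulrCA. Qed.

Lemma product_fst_prob d (T : measurableType d) (P : probability T R) (A : set T) : measurable A ->
  ((P \x P)%E [set w | A w.1] = P A).
Proof.
move=> mA; rewrite (_ : [set w | _] = A `*` setT); last by apply/seteqP; split => w //= -[].
apply: etrans (product_measure1E P P mA measurableT) _; apply: etrans (congr1 (fun x => P A * x)%E (probability_setT P)) _; exact: mule1.
Qed.

End approximations.

(** * Reading signal and noise on two copies of the space *)

Section spectral.
Context {R : realType}.
Notation mu := (@lebesgue_measure R).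
Context d0 (T : measurableType d0) (P : probability T R).

Lemma process_measurable_fun q (Z : R -> T -> 'cV[R]_q) f : measurable_process Z ->
  process_measurable Z f -> measurable_fun setT f.
Proof.
move=> mZ hf _ A mA; rewrite setTI; apply: process_sigma_algebra_sub mZ _; exact: hf.
Qed.

(** The entries of both families are enumerated into tuples, and the event becomes a measurable set
    of tuples, as [process_swap] requires. *)
Lemma lambda_swap q1 q2 (X : R -> T -> 'cV[R]_q1) (W : R -> T -> 'cV[R]_q2) d q m (c y : R)
    (f g : 'I_d -> 'I_q.+1 -> T -> R) : (0 < m <= d)%N ->
  measurable_process X -> measurable_process W -> independent_processes P X W ->
  (forall k j, process_measurable X (f k j)) -> (forall k j, process_measurable W (g k j)) ->
  P [set w | lambda m ((\matrix_(k, j) (f k j w + c * g k j w)) *m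
                       (\matrix_(k, j) (f k j w + c * g k j w))^T) <= y] =
  (P \x P)%E [set w | lambda m ((\matrix_(k, j) (f k j w.1 + c * g k j w.2)) *m
                       (\matrix_(k, j) (f k j w.1 + c * g k j w.2))^T) <= y].
Proof.
move=> md mX mW XW mf mg.
pose I : finType := ('I_d * 'I_q.+1)%type; pose N := #|I|.
have d1 : (0 < d)%N by case/andP: md; exact: leq_trans.
pose i0 : I := (Ordinal d1, ord0).
pose F i := let x := nth i0 (enum I) i in f x.1 x.2.
pose G i := let x := nth i0 (enum I) i in g x.1 x.2.
pose A (v : (N + N).-tuple R) : 'M[R]_(d, q.+1) :=
  \matrix_(k, j) (tnth v (lshift N (enum_rank ((k, j) : I))) + c * tnth v (rshift N (enum_rank ((k, j) : I)))).
have mA k j : measurable_fun setT (fun v => A v k j).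
  under eq_fun do rewrite mxE; apply: measurable_funD; first exact: measurable_tnth.
  apply: measurable_funM => //; exact: measurable_tnth.
have mE := measurable_lambda_le y md mA.
have := process_swap mX mW XW (f := F) (g := G) (N1 := N) (N2 := N) (fun i _ => mf _ _) (fun i _ => mg _ _) mE.
have nthr (x : I) : nth i0 (enum I) (enum_rank x) = x by rewrite nth_enum_rank.
have EA (h : nat -> R) (w1 w2 : T) : (forall i, h i = if (i < N)%N then F i w1 else G (i - N)%N w2) ->
    \matrix_(k, j) (f k j w1 + c * g k j w2) = A [tuple h i | i < N + N].
  move=> hh; apply/matrixP => k j; rewrite !mxE !tnth_mktuple !hh /=.
  by rewrite ltn_ord ltnNge leq_addr /= addKn /F /G /= nthr.
move=> h; apply: etrans (etrans _ h) _.
  apply: (congr1 P); apply/seteqP; split => w /=; rewrite (EA _ w w (fun i => erefl)) //.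
apply: (congr1 (P \x P)%E); apply/seteqP; split => w /=; rewrite (EA _ w.1 w.2 (fun i => erefl)) //.
Qed.

(** Measurability of mesh sums is reused over the space carrying only the sigma-algebra generated by
    [X]. *)
Lemma mesh_sum_process q (X : R -> T -> 'cV[R]_q) (G : R -> R) (a b : R) M k :
  0 <= a -> a <= b <= 1 -> process_measurable X (fun w => mesh_sum G a b M (fun s => X s w k 0)).
Proof.
move=> a0 ab; apply: process_measurableP.
apply: (measurable_mesh_sum (X := fun s (w : g_sigma_algebraType _) => X s w k 0)) => // s hs.
exact: process_coordinate.
Qed.

Lemma step_integral_process q (W : R -> T -> 'cV[R]_q) m (s c : nat -> R) k :
  is_step m s -> process_measurable W (step_integral (fun u w => W u w k 0) m s c).
Proof.
move=> hs; apply: process_measurableP; rewrite /step_integral.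
apply: measurable_sum => i; apply: measurable_funM; first exact: measurable_cst.
by apply: measurable_funB; apply: process_coordinate; apply: (step_itv hs) => //; exact: ltnW.
Qed.

End spectral.

(** * The small ball estimate for finitely many spectral statistics *)

Section spectral_bound.
Context {R : realType}.
Notation mu := (@lebesgue_measure R).

(** The approximating step functions are read off the definition of the stochastic integral. *)
Lemma step_approximation d0 (T : measurableType d0) (P : probability T R) (Z : R -> T -> R)
    (f : R -> R) I (e : R) : stoch_integral P Z 0 1 f I -> 0 < e ->
  exists y : nat * (nat -> R) * (nat -> R), is_step y.1.1 y.1.2 /\
    (\int[mu]_(x in `[0%R, 1%R]) ((step_fun y.1.1 y.1.2 y.2 x - f x) ^+ 2)%:E <= e%:E)%E.
Proof.
move=> [_ [m [s [c [hs hL _]]]]] e0; have [N hN] := cvge0_eventually hL e0.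
have [s0 sm smono] := hs N.
by exists (m N, s N, c N); split; [split; rewrite /= ?s0 ?sm | exact: hN].
Qed.

Lemma exists_small (A b : R) : 0 <= A -> 0 < b -> exists2 x : R, 0 < x & x <= 1 /\ A * x <= b.
Proof.
move=> A0 b0; have h1 : 0 < A + 1 by lra.
exists (Num.min 1 (b / (A + 1))); first by rewrite lt_min ltr01 divr_gt0.
set x := Num.min _ _; have x0 : 0 <= x by rewrite le_min ler01 divr_ge0 // ltW.
have x1 : x <= 1 by rewrite ge_min lexx.
have : x * (A + 1) <= b by rewrite -ler_pdivlMr // ge_min lexx orbT.
split=> //; nra.
Qed.

Lemma prob_close_weaken d0 (T : measurableType d0) (P : probability T R) (f : T -> R) (e e' : R) :
  measurable_fun setT f -> e <= e' -> (P [set w | (e <= `|f w|)%R] <= e%:E)%E ->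
  (P [set w | (e' <= `|f w|)%R] <= e'%:E)%E.
Proof.
move=> mf ee h; apply: (@le_trans _ _ (P [set w | (e <= `|f w|)%R])).
  apply: le_measure; rewrite ?inE; try exact: measurable_abs_ge.
  by move=> w /=; exact: le_trans.
by apply: le_trans h _; rewrite lee_fin.
Qed.

(** The spectral matrix is replaced by one built from a mesh sum of [X] and a step integral of [W],
    and on the product space by the grid matrix. The two replacements multiply the threshold by 4
    and add at most [e1 / 20 * (lam + eps ^+ 2)], so that the factor [e1 / 20] grows to [e1 / 4],
    which is [e1 * Lam]. *)
Lemma spectral_lambda_small d0 (T : measurableType d0) (P : probability T R) d r (rd : (r < d)%N)
    (Sigma : R -> 'M[R]_d) (X W : R -> T -> 'cV[R]_d) (eta : R) n (t h : R)
    (S : nat -> T -> 'cV[R]_d) (lam e1 eta2 : R) :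
  observation_law P Sigma X W -> 0 < eta -> (0 < n)%N -> 0 <= t -> 0 < h <= 1 - t ->
  (forall j k, (0 < j)%N -> stoch_integral P (fun s w => observation eta X W n s w k 0) t (t + h)
      (fun s => derive1 (Phi t h j) s) (fun w => S j w k 0)) ->
  0 <= lam -> (forall s, t <= s <= t + h -> lam <= lambda r.+1 (Sigma s)) ->
  rank1_bound d r e1 eta2 -> 0 < e1 -> 0 < eta2 ->
  (P [set w | (lambda r.+1 ((\matrix_(k < d, j < r.+1) S j.+1 w k 0) *m
       (\matrix_(k < d, j < r.+1) S j.+1 w k 0)^T)
      <= e1 / 20 * (lam + eps eta n h ^+ 2))%R] <= (2 * eta2)%:E)%E.
Proof.
move=> [[mX cX [p [sigma [B [hB L2s SigE sig]]]]] hW XW] eta0 n0 t0 /andP[h0 h1] hS lam0 hlam hb e10 eta20.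
have th1 : t + h <= 1 by lra.
have tth : t <= t + h <= 1 by rewrite lerDl ltW.
pose c := eta / Num.sqrt n%:R.
have c0 : 0 < c by rewrite divr_gt0 // sqrtr_gt0 ltr0n.
have epsE : eps eta n h ^+ 2 = (pi / h) ^+ 2 * c ^+ 2 by rewrite /eps exprMn.
have eps0 : 0 < eps eta n h ^+ 2.
  by rewrite epsE mulr_gt0 // exprn_gt0 // divr_gt0 // pi_gt0.
pose Lam := (lam + eps eta n h ^+ 2) / 4.
have Lam0 : 0 < Lam by rewrite divr_gt0 //; lra.
have mW : measurable_process W by case: hW.
have N0 : 0 <= (d * r.+1)%:R :> R by [].
(* Small enough for the threshold and for the [d * r.+1] exceptional events of each of the two
   replacements. *)
have [tol tol0 [htol1 htol2]] := exists_tolerance N0 (divr_gt0 (mulr_gt0 e10 Lam0) (ltr0n R 5)) (divr_gt0 eta20 (ltr0n R 2)).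
pose K1 : R := #|{ffun 'I_r.+1 -> 'I_d}|%:R * r.+1%:R * #|{: 'I_r.+1 * 'I_r.+1}|%:R.
have K10 : 0 <= (p%:R + c ^+ 2 * d%:R) * K1.
  apply: mulr_ge0; last by rewrite /K1 !mulr_ge0.
  by apply: addr_ge0 => //; apply: mulr_ge0 => //; exact: sqr_ge0.
have pih : 0 < (pi / h) ^+ 2 by rewrite exprn_gt0 // divr_gt0 // pi_gt0.
have [eL eL0 [heL1 heL2]] : exists2 eL : R, 0 < eL &
    (p%:R + c ^+ 2 * d%:R) * K1 * eL <= (pi / h) ^+ 2 * c ^+ 2 / 4 /\ 2 * (r.+1%:R * eL) < (pi / h) ^+ 2.
  have b0 : 0 < (pi / h) ^+ 2 * c ^+ 2 / 4 by rewrite -epsE divr_gt0.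
  have [x1 x10 [_ hx1]] := exists_small K10 b0.
  have [x2 x20 [_ hx2]] := exists_small (ler0n R r.+1) (divr_gt0 pih (ltr0n R 4)).
  exists (Num.min x1 x2); first by rewrite lt_min x10.
  split; first by apply: le_trans hx1; rewrite ler_wpM2l // ge_min lexx.
  apply: (@le_lt_trans _ _ (2 * ((pi / h) ^+ 2 / 4))); last by lra.
  rewrite ler_pM2l //; apply: le_trans hx2; by rewrite ler_wpM2l // ge_min lexx orbT.
(* [observed_coefficient_close] uses one number for the mean square error and for the error in
   probability. *)
pose eO := Num.min eL tol.
have eO0 : 0 < eO by rewrite lt_min eL0.
have hobs (kj : 'I_d * 'I_r.+1) : exists y : nat * (nat -> R) * (nat -> R) * nat,
    [/\ is_step y.1.1.1 y.1.1.2, y.1.1.2 0%N = t, y.1.1.2 y.1.1.1 = t + h,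
    (\int[mu]_(x in `[t, (t + h)%R]) ((step_fun y.1.1.1 y.1.1.2 y.1.2 x - dPhi t h kj.2.+1 x) ^+ 2)%:E <= eL%:E)%E &
    forall M, (y.2 <= M)%N -> (P [set w | (tol <= `|S kj.2.+1 w kj.1 0 -
      (mesh_sum (Phi t h kj.2.+1) t (t + h) M (fun s => X s w kj.1 0) +
        c * step_integral (fun u w => W u w kj.1 0) y.1.1.1 y.1.1.2 y.1.2 w)|)%R] <= tol%:E)%E].
  have hd := dPhi_bounded t h0 kj.2.+1.
  have hst : stoch_integral P (fun s w => (\int[mu]_(u in `[0, s]) X u w kj.1 0) + c * W s w kj.1 0)
      t (t + h) (dPhi t h kj.2.+1) (fun w => S kj.2.+1 w kj.1 0).
    have := hS kj.2.+1 kj.1 isT; rewrite -(derive1_Phi t h).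
    rewrite (_ : (fun s w => observation eta X W n s w kj.1 0) =
      fun s w => (\int[mu]_(u in `[0, s]) X u w kj.1 0) + c * W s w kj.1 0) //.
    by apply/funext => s; apply/funext => w; rewrite mxE.
  have mcW s : 0 <= s <= 1 -> measurable_fun setT (fun w => c * W s w kj.1 0).
    by move=> hs; apply: measurable_funM => //; exact: mW.
  have [m [s [cc [hs s0 sm hL [M0 hM0]]]]] := @observed_coefficient_close R _ T P (fun s w => X s w kj.1 0)
    (fun s hs => mX s kj.1 hs) (fun w => cX w kj.1) (fun s w => c * W s w kj.1 0) _ (Phi t h kj.2.+1) _ _
    t (t + h) eO mcW (is_derive_Phi t h kj.2.+1) (@continuous_dPhi R t h kj.2.+1) (fun x _ => hd x) t0 tth eO0 hst.
  exists (m, s, cc, M0); split => //=; first by apply: le_trans hL _; rewrite lee_fin ge_min lexx.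
  move=> M hM; apply: prob_close_weaken (_ : eO <= tol) _; last first.
  - by have := hM0 M hM; under eq_set do rewrite step_integralZ.
  - by rewrite ge_min lexx orbT.
  apply: measurable_funB; first by have [] := hS kj.2.+1 kj.1 isT.
  apply: measurable_funD.
    by apply: (measurable_mesh_sum (X := fun s w => X s w kj.1 0)) => // u hu; exact: mX.
  by apply: measurable_funM => //; exact: (measurable_step_integral hW).
have [Y hY] := choice hobs.
pose V := \sum_(kl : 'I_d * 'I_p) fine (\int[mu]_(x in `[0%R, 1%R]) (sigma x kl.1 kl.2 ^+ 2)%:E)%E.
have hV k l : (\int[mu]_(x in `[0%R, 1%R]) (sigma x k l ^+ 2)%:E <= V%:E)%E.
  rewrite /V (bigD1 (k, l)) //= EFinD fineK; last first.
    by apply: integrable_fin_num => //; exact: (L2s k l).2.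
  rewrite leeDl // lee_fin; apply: sumr_ge0 => kl _; apply: fine_ge0.
  by apply: integral_ge0 => x _; rewrite lee_fin sqr_ge0.
have V0 : 0 <= V.
  apply: sumr_ge0 => kl _; apply: fine_ge0.
  by apply: integral_ge0 => x _; rewrite lee_fin sqr_ge0.
(* The supremum of [Phi] plus the approximation error [om], which is at most 1. *)
pose K := Num.sqrt (2 / h) + 1.
have K0 : 0 < K by rewrite ltr_wpDl ?sqrtr_ge0.
have [om om0 [om1 hom]] : exists2 om : R, 0 < om & om <= 1 /\ 2 * (om ^+ 2 * V) <= eL / 2.
  have [om om0 [om1 hom]] := exists_small (mulr_ge0 (ler0n R 2) V0) (divr_gt0 eL0 (ltr0n R 2)).
  exists om => //; split=> //; nra.
have [dl0 dl00 hdl0] : exists2 dl0 : R, 0 < dl0 & 2 * (K ^+ 2 * dl0) <= eL / 2.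
  have [x x0 [_ hx]] := exists_small (mulr_ge0 (ler0n R 2) (sqr_ge0 K)) (divr_gt0 eL0 (ltr0n R 2)).
  by exists x; rewrite // mulrA.
have cPhi (j : nat) : {within `[0, 1], continuous (Phi t h j : R -> R)}.
  by apply: continuous_subspaceT; exact: continuous_Phi.
have hmesh (j : 'I_r.+1) := mesh_step_close (cPhi j.+1) t0 tth om0.
have [M1 hM1] := choice hmesh.
have [M2 hM2] := exists_nat_upper_bound (fun kj => (Y kj).2).
have [M3 hM3] := exists_nat_upper_bound M1.
(* One mesh for all entries, past every threshold of the coefficients and fine enough for every
   [PhiM]. *)
pose M := maxn M2 M3.
pose PhiM (j : 'I_r.+1) : R -> R := step_fun M.+1 (uniform_mesh t (t + h) M.+1)
  (fun i => Phi t h j.+1 (uniform_mesh t (t + h) M.+1 i)).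
have PhiM_close j x : `|PhiM j x - PhiD t h j.+1 x| <= om.
  by apply: hM1; apply: leq_trans (hM3 j) (leq_maxr _ _).
have PhiM_bound j x : `|PhiM j x| <= K.
  have h2 : `|PhiD t h j.+1 x| <= Num.sqrt (2 / h).
    rewrite /PhiD normrM indicE; case: (_ \in _); rewrite ?normr1 ?mulr1 ?normr0 ?mulr0 ?sqrtr_ge0 //.
    exact: Phi_bounded.
  have := ler_normD (PhiM j x - PhiD t h j.+1 x) (PhiD t h j.+1 x); rewrite subrK.
  have := PhiM_close j x; rewrite /K; clear -h2 om1; lra.
have hsig (kj : 'I_d * 'I_r.+1) := @signal_mesh_close R _ T P p B (fun s w => X s w kj.1 0)
  (fun l s => sigma s kj.1 l) (Phi t h kj.2.+1) t (t + h) tol M hB.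
have [dl1 hdl1] : exists dl1 : 'I_d * 'I_r.+1 -> R, forall kj, 0 < dl1 kj /\
    forall (m : 'I_p -> nat) (s c : 'I_p -> nat -> R) n tau,
    (forall l, is_step (m l) (s l)) ->
    (forall l, (\int[mu]_(x in `[0%R, 1%R]) ((step_fun (m l) (s l) (c l) x - sigma x kj.1 l) ^+ 2)%:E <= (dl1 kj)%:E)%E) ->
    is_grid tau n -> (forall i, (i <= M.+1)%N -> in_grid tau n (uniform_mesh t (t + h) M.+1 i)) ->
    (forall l i, (i <= m l)%N -> in_grid tau n (s l i)) ->
    (P [set w | (tol <= `|mesh_sum (Phi t h kj.2.+1) t (t + h) M (fun s => X s w kj.1 0) - \sum_(l < p)
       gridint tau n (fun x => - (step_fun (m l) (s l) (c l) x * PhiM kj.2 x))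
         (fun v => B v w l 0)|)%R] <= tol%:E)%E.
  have hx (kj : 'I_d * 'I_r.+1) : exists x, 0 < x /\ forall (m : 'I_p -> nat) (s c : 'I_p -> nat -> R) n tau,
    (forall l, is_step (m l) (s l)) ->
    (forall l, (\int[mu]_(x in `[0%R, 1%R]) ((step_fun (m l) (s l) (c l) x - sigma x kj.1 l) ^+ 2)%:E <= x%:E)%E) ->
    is_grid tau n -> (forall i, (i <= M.+1)%N -> in_grid tau n (uniform_mesh t (t + h) M.+1 i)) ->
    (forall l i, (i <= m l)%N -> in_grid tau n (s l i)) ->
    (P [set w | (tol <= `|mesh_sum (Phi t h kj.2.+1) t (t + h) M (fun s => X s w kj.1 0) - \sum_(l < p)
       gridint tau n (fun x => - (step_fun (m l) (s l) (c l) x * PhiM kj.2 x))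
         (fun v => B v w l 0)|)%R] <= tol%:E)%E.
    have [|l||||||u hu|x x0 hx] := hsig kj => //.
    - by move=> s hs; exact: mX.
    - exact: (L2s kj.1 l).1.
    - exact: Phi_left.
    - exact: Phi_right.
    - have [J [hJ hXJ]] := sig u hu; exists (J kj.1); split; first exact: hJ.
      by apply: filterS hXJ => w; exact.
    by exists x.
  by have [dl1 hdl1] := choice hx; exists dl1.
have [dl2 dl20 hdl2] := exists_pos_lower_bound (fun kj => (hdl1 kj).1).
pose dl := Num.min dl0 dl2.
have dl_gt0 : 0 < dl by rewrite lt_min dl00.
have hF (kl : 'I_d * 'I_p) : exists y : nat * (nat -> R) * (nat -> R), is_step y.1.1 y.1.2 /\
    (\int[mu]_(x in `[0%R, 1%R]) ((step_fun y.1.1 y.1.2 y.2 x - sigma x kl.1 kl.2) ^+ 2)%:E <= dl%:E)%E.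
  (* The signal at time 1 provides approximations of [sigma] on the whole interval. *)
  have [J [hJ _]] := sig 1 (introT andP (conj ler01 (lexx 1))).
  exact: step_approximation (hJ kl.1 kl.2) dl_gt0.
have [Z hZ] := choice hF.
pose F k l : R -> R := step_fun (Z (k, l)).1.1 (Z (k, l)).1.2 (Z (k, l)).2.
pose Psi (j : 'I_r.+1) (k : 'I_d) : R -> R := step_fun (Y (k, j)).1.1.1 (Y (k, j)).1.1.2 (Y (k, j)).1.2.
(* The grid refines the steps for [sigma], those for the noise and, through the [unit] summand, the
   mesh. *)
have [nn [tau [hg nn0 hnodes]]] := @common_grid_steps R
  ((('I_d * 'I_p) + ('I_d * 'I_r.+1)) + unit)%type
  (fun x => match x with inl (inl kl) => (Z kl).1.1 | inl (inr kj) => (Y kj).1.1.1 | inr _ => M.+1 end)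
  (fun x => match x with inl (inl kl) => (Z kl).1.2 | inl (inr kj) => (Y kj).1.1.2
    | inr _ => uniform_mesh t (t + h) M.+1 end)
  (fun x => match x with inl (inl kl) => (hZ kl).1
    | inl (inr kj) => let: And5 hs _ _ _ _ := hY kj in hs
    | inr _ => uniform_mesh_step M t0 tth end).
have nodeF k l i : (i <= (Z (k, l)).1.1)%N -> in_grid tau nn ((Z (k, l)).1.2 i).
  exact: (hnodes (inl (inl (k, l)))).
have nodeP k j i : (i <= (Y (k, j)).1.1.1)%N -> in_grid tau nn ((Y (k, j)).1.1.2 i).
  exact: (hnodes (inl (inr (k, j)))).
have nodeM i : (i <= M.+1)%N -> in_grid tau nn (uniform_mesh t (t + h) M.+1 i).
  exact: (hnodes (inr tt)).
pose f (k : 'I_d) (j : 'I_r.+1) w := mesh_sum (Phi t h j.+1) t (t + h) M (fun s => X s w k 0).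
pose g (k : 'I_d) (j : 'I_r.+1) := step_integral (fun u w => W u w k 0) (Y (k, j)).1.1.1 (Y (k, j)).1.1.2 (Y (k, j)).1.2.
have stepY k j : is_step (Y (k, j)).1.1.1 (Y (k, j)).1.1.2 by case: (hY (k, j)).
have pf k j : process_measurable X (f k j) by exact: mesh_sum_process.
have pg k j : process_measurable W (g k j) by exact: step_integral_process.
have mf k j : measurable_fun setT (f k j) by exact: (process_measurable_fun mX (pf k j)).
have mg k j : measurable_fun setT (g k j) by exact: (process_measurable_fun mW (pg k j)).
have rd' : (0 < r.+1 <= d)%N by [].
(* The Gaussian estimate costs [eta2], each of the two replacements [(d * r.+1)%:R * tol]; the rest
   is slack. *)
rewrite (_ : 2 * eta2 = eta2 + (d * r.+1)%:R * tol + (d * r.+1)%:R * tol + (eta2 - 2 * ((d * r.+1)%:R * tol))); last by ring.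
have slack : 0 <= eta2 - 2 * ((d * r.+1)%:R * tol).
  by move: htol2; clear; set z := _%:R * tol; lra.
apply: le_trans (_ : _ <= (eta2 + (d * r.+1)%:R * tol + (d * r.+1)%:R * tol)%:E)%E _; last by rewrite lee_fin lerDl.
apply: (prob_lambda_perturb (B := fun w => \matrix_(k, j) (f k j w + c * g k j w)) (rho := tol)) => //.
- exact: ltW.
- by move=> k j; under eq_fun do rewrite mxE; have [] := hS j.+1 k isT.
- move=> k j; under eq_fun do rewrite mxE.
  apply: measurable_funD => //; exact: measurable_funM.
- move=> k j; have [_ _ _ _] := hY (k, j); have hM : ((Y (k, j)).2 <= M)%N.
    by apply: leq_trans (hM2 (k, j)) (leq_maxl _ _).
  by move=> /(_ M hM) hh; under eq_set do rewrite !mxE; exact: hh.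
(* [B] is only introduced after this passage to the product space, because its independence of [W]
   under [P] is not granted. *)
rewrite (lambda_swap c _ rd' mX mW XW pf pg).
pose G (w : T * T) := grid_matrix nn tau c F PhiM Psi (B ^~ w.1) (W ^~ w.2).
have mB : measurable_process B by case: hB.
have mBf l (F' : R -> R) : measurable_fun setT (fun w : T * T => gridint tau nn F' (fun s => B s w.1 l 0)).
  exact: (measurableT_comp (measurable_gridint hB F' l hg) measurable_fst).
have mWf k (F' : R -> R) : measurable_fun setT (fun w : T * T => gridint tau nn F' (fun s => W s w.2 k 0)).
  exact: (measurableT_comp (measurable_gridint hW F' k hg) measurable_snd).
apply: (prob_lambda_perturb (B := G) (rho := tol)) => //.
- exact: ltW.
- move=> k j; under eq_fun do rewrite mxE.
  apply: measurable_funD; first exact: (measurableT_comp (mf k j) measurable_fst).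
  by apply: measurable_funM => //; exact: (measurableT_comp (mg k j) measurable_snd).
- move=> k j; under eq_fun do rewrite mxE; apply: measurable_funD; last exact: measurable_funM.
  by apply: measurable_sum => l; exact: mBf.
- move=> k j; pose A := [set w1 | tol <= `|f k j w1 - \sum_(l < p)
       gridint tau nn (fun x => - (F k l x * PhiM j x)) (fun v => B v w1 l 0)|].
  have mA : measurable A.
    apply: measurable_abs_ge; apply: measurable_funB; first exact: mf.
    by apply: measurable_sum => l; exact: (measurable_gridint hB).
  apply: (@le_trans _ _ (P A)).
    rewrite le_eqVlt; apply/orP; left; apply/eqP; apply: etrans (product_fst_prob P mA).
    apply: (congr1 (P \x P)%E); apply/funext => w /=.
    rewrite /A /= !mxE /g (gridint_step _ _ _ hg (stepY k j)); last by move=> i; exact: nodeP.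
    by rewrite -/(Psi j k) opprD addrACA subrr addr0.
  apply: (hdl1 (k, j)).2 => // l.
  - exact: (hZ (k, l)).1.
  - apply: le_trans (hZ (k, l)).2 _; rewrite lee_fin; apply: le_trans (hdl2 (k, j)).
    by rewrite ge_min lexx orbT.
  - by move=> i; exact: nodeF.
have L2B k l (j : 'I_r.+1) : (\int[mu]_(x in `[0%R, 1%R])
    ((F k l x * PhiM j x - sigma x k l * PhiD t h j.+1 x) ^+ 2)%:E <= eL%:E)%E.
  have mD : measurable (`[0, 1] : set R) by [].
  apply: le_trans (product_L2_close mD _ (L2s k l).1 _ _ (PhiM_bound j) (PhiM_close j) (hZ (k, l)).2 (hV k l)) _.
  - by apply: measurable_funTS; exact: measurable_step_fun.
  - by apply: measurable_funTS; exact: measurable_step_fun.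
  - apply: measurable_funTS; apply: measurable_funM; last exact: measurable_indic.
    by apply: continuous_measurable_fun; exact: continuous_Phi.
  have : dl <= dl0 by rewrite ge_min lexx.
  rewrite lee_fin => hdl; have : 2 * (K ^+ 2 * dl) <= 2 * (K ^+ 2 * dl0).
    by rewrite ler_pM2l // ler_wpM2l ?sqr_ge0.
  clear -hdl0 hom; lra.
have L2W (j : 'I_r.+1) k : (\int[mu]_(x in `[0%R, 1%R])
    ((Psi j k x - dPhiD t h j.+1 x) ^+ 2)%:E <= eL%:E)%E.
  have [hs s0 sm hL _] := hY (k, j); apply: step_L2_extend => //.
  by apply: continuous_measurable_fun; exact: continuous_dPhi.
have mF k l : measurable_fun setT (F k l) by exact: measurable_step_fun.
have mPhiM j : measurable_fun setT (PhiM j) by exact: measurable_step_fun.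
have mPsi j k : measurable_fun setT (Psi j k) by exact: measurable_step_fun.
have cF k l i x : (i < nn)%N -> tau i < x <= tau i.+1 -> F k l x = F k l (tau i.+1).
  by move=> iN; apply: step_fun_cell hg _ iN => a; exact: nodeF.
have cPhiM j i x : (i < nn)%N -> tau i < x <= tau i.+1 -> PhiM j x = PhiM j (tau i.+1).
  by move=> iN; apply: step_fun_cell hg _ iN => a; exact: nodeM.
have cPsi j k i x : (i < nn)%N -> tau i < x <= tau i.+1 -> Psi j k x = Psi j k (tau i.+1).
  by move=> iN; apply: step_fun_cell hg _ iN => a; exact: nodeP.
have hlam' s : t <= s <= t + h -> lam <= lambda r.+1 (sigma s *m (sigma s)^T).
  move=> hs; rewrite -SigE; first exact: hlam.
  by move: hs => /andP[h2 h3]; rewrite (le_trans t0 h2) (le_trans h3 th1).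
have rows k : exists Q : 'M[R]_(r.+1, nn), Q *m (\matrix_(i < nn, j < r.+1) Psi j k (tau i.+1)) = 1%:M.
  exact: (noise_rows_full hg t0 h0 th1 mPsi cPsi L2W k heL2).
have grad S' := total_gradient_ge rd hg t0 h0 th1 c0 (ltW eL0) lam0 mF mPhiM mPsi
  (fun k l => (L2s k l).1) cF cPhiM cPsi L2B L2W hlam' heL1 S'.
have := grid_matrix_small rd nn0 hg c0 rows hB hW hb Lam0.
rewrite {1}/Lam epsE => /(_ F PhiM grad); apply: le_trans; apply: le_measure; rewrite ?inE.
- apply: measurable_lambda_le => // k j; under eq_fun do rewrite mxE; apply: measurable_funD; last exact: measurable_funM.
  by apply: measurable_sum => l; exact: mBf.
- apply: measurable_lambda_le => // k j; under eq_fun do rewrite mxE; apply: measurable_funD; last exact: measurable_funM.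
  by apply: measurable_sum => l; exact: mBf.
move=> w /= hw; apply: le_trans hw _.
move: htol1; rewrite /Lam epsE; clear; lra.
Qed.
End spectral_bound.

(** * The weighted covariance matrix *)

Section weights.
Context {R : realType}.

(** By the Cauchy criterion the set of convergence is measurable; outside it [limn] takes the
    default value 0, so multiplying the sequence by the indicator of the set makes it converge
    everywhere to [limn]. *)
Lemma measurable_limn d0 (T : measurableType d0) (f : nat -> T -> R) :
  (forall n, measurable_fun setT (f n)) -> measurable_fun setT (fun w => limn (f ^~ w)).
Proof.
move=> mf.
have cauchyE (u : nat -> R) : cvgn u <-> forall k, exists N, forall n, `|u (N + n)%N - u N| <= k.+1%:R^-1.
  split=> [/cvgrPdist_lt cu k|h].
    have k0 : 0 < k.+1%:R^-1 / 2 :> R by rewrite divr_gt0 // invr_gt0.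
    have [N _ hN] := cu _ k0.
    exists N => n; rewrite -[u _](subKr (limn u)) addrAC; apply: le_trans (ler_normB _ _) _.
    rewrite [leRHS]splitr; apply: lerD; apply/ltW; first exact: (hN N (leqnn N)).
    exact: (hN _ (leq_addr n N)).
  apply/cauchy_cvgP; apply: cauchy_exP => e e0.
  have [N hN] := h (Num.bound (e^-1)); exists (u N); exists N => // n /= Nn.
  rewrite /ball /= distrC -(subnKC Nn); apply: le_lt_trans (hN _) _.
  rewrite invf_plt ?posrE //; apply: lt_le_trans (archi_boundP _) _; first by rewrite invr_ge0 ltW.
  by rewrite ler_nat.
pose C := \bigcap_k \bigcup_N \bigcap_n [set w | `|f (N + n)%N w - f N w| <= k.+1%:R^-1].
have CE w : C w <-> cvgn (f ^~ w).
  rewrite cauchyE; split=> [hw k|hw k _]; first by have [N _ hN] := hw k I; exists N => n; exact: hN.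
  by have [N hN] := hw k; exists N => // n _; exact: hN.
have mC : measurable C.
  apply: bigcap_measurable => // k _; apply: bigcup_measurable => N _; apply: bigcap_measurable => // n _.
  rewrite (_ : [set w | _] = ~` [set w | k.+1%:R^-1 < `|f (N + n)%N w - f N w|]); last first.
    by apply/seteqP; split => w /=; rewrite leNgt => /negP.
  apply: measurableC; rewrite -[X in measurable X]setTI.
  have mg : measurable_fun setT (fun w => `|f (N + n)%N w - f N w|).
    by apply: measurableT_comp => //; exact: measurable_funB.
  rewrite (_ : [set w | _] = (fun w => `|f (N + n)%N w - f N w|) @^-1` `]k.+1%:R^-1, +oo[); first exact: mg.
  by apply/seteqP; split => w /=; rewrite in_itv /= andbT.
apply: (@measurable_fun_cvg _ _ _ _ (fun n w => f n w * \1_C w)) => // [n|w _].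
  by apply: measurable_funM => //; exact: measurable_indic.
rewrite indicE; have [hw|hw] := pselect (C w).
  by rewrite mem_set //; under eq_fun do rewrite mulr1; exact: (CE w).1.
rewrite memNset //; under eq_fun do rewrite mulr0.
rewrite (_ : limn _ = 0); first exact: cvg_cst.
by apply: dvgP => /(CE w).2.
Qed.

Let base (M : R) j : R := M^-1 * (1 + j%:R ^+ 2 / M ^+ 2) ^- 2.

Lemma base_gt0 M j : 0 < M -> 0 < base M j.
Proof.
move=> M0; rewrite mulr_gt0 ?invr_gt0 // exprn_gt0 // ltr_wpDr // divr_ge0 ?sqr_ge0 //.
Qed.

(* M^-1 (1 + j^2 / M^2)^-2 <= M / (M^2 + j^2) <= 2 M (1 / (M + j - 1) - 1 / (M + j)) *)
Lemma base_sum_le2 M n : 0 < M -> \sum_(1 <= j < n.+1) base M j <= 2.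
Proof.
move=> M0; apply: (@le_trans _ _ (2 * M * (M^-1 - (M + n%:R)^-1))); last first.
  have : 0 <= (M + n%:R)^-1 by rewrite invr_ge0 addr_ge0 // ltW.
  move=> h; rewrite mulrBr mulfK ?gt_eqF // gerBl mulr_ge0 // mulr_ge0 // ltW //.
elim: n => [|n IH]; first by rewrite big_geq // addr0 subrr mulr0.
rewrite big_nat_recr //=; apply: (@le_trans _ _ (2 * M * (M^-1 - (M + n%:R)^-1) + 2 * M * ((M + n%:R)^-1 - (M + n.+1%:R)^-1))); last first.
  by rewrite -mulrDr addrA subrK.
apply: lerD => //.
set x := n%:R; have x0 : 0 <= x by rewrite /x.
rewrite /base -natr1 -/x.
have a0 : 0 < M + x by lra.
have b0 : 0 < M + (x + 1) by lra.
have q1 : 1 <= 1 + (x + 1) ^+ 2 / M ^+ 2 by rewrite lerDl divr_ge0 // sqr_ge0.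
have q0 : 0 < 1 + (x + 1) ^+ 2 / M ^+ 2 by apply: lt_le_trans q1.
apply: (@le_trans _ _ (M^-1 * (1 + (x + 1) ^+ 2 / M ^+ 2)^-1)).
  rewrite ler_pM2l ?invr_gt0 // lef_pV2 ?posrE ?exprn_gt0 // expr2 ler_peMl // ltW //.
rewrite (_ : M^-1 * _ = M / (M ^+ 2 + (x + 1) ^+ 2)); last first.
  have c0 : 0 < M ^+ 2 + (x + 1) ^+ 2 by rewrite addr_gt0 ?exprn_gt0 //; lra.
  by field; rewrite !gt_eqF.
rewrite (_ : _ - _ = ((M + x) * (M + (x + 1)))^-1); last first.
  by field; rewrite !gt_eqF.
have c0 : 0 < M ^+ 2 + (x + 1) ^+ 2 by rewrite addr_gt0 ?exprn_gt0 //; lra.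
rewrite -mulrA mulrCA ler_pM2l // -[leLHS]mul1r ler_pdivrMr // -mulrA -ler_pdivrMl // mulr1.
rewrite [leRHS]mulrC ler_pdivlMr ?mulr_gt0 //; have := sqr_ge0 (M - (x + 1)); nra.
Qed.

Let base_partial_mono M : 0 < M -> nondecreasing_seq (fun n => \sum_(1 <= j < n) base M j).
Proof.
move=> M0; apply/nondecreasing_seqP => n; case: n => [|n]; first by rewrite !big_geq.
by rewrite [leRHS]big_nat_recr //= lerDl ltW // base_gt0.
Qed.

(** The unnormalised weights have sum at most 2, uniformly in [M]. *)
Lemma cw_bounds (M : R) : 0 < M -> 1 / 2 <= cw M.
Proof.
move=> M0; rewrite /cw /series_from1.
have mono := base_partial_mono M0.
have ub n : \sum_(1 <= j < n) base M j <= 2.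
  by case: n => [|n]; [rewrite big_geq | exact: base_sum_le2].
have cv : cvgn (fun n => \sum_(1 <= j < n) base M j).
  by apply: nondecreasing_is_cvgn => //; exists 2 => _ [n _ <-].
have le2 : limn (fun n => \sum_(1 <= j < n) base M j) <= 2.
  by apply: limr_le => //; exact: nearW.
have gt0 : 0 < limn (fun n => \sum_(1 <= j < n) base M j).
  have := nondecreasing_cvgn_le mono cv 2%N; rewrite big_nat1; apply: lt_le_trans; exact: base_gt0.
by rewrite mul1r lef_pV2 // posrE.
Qed.

Lemma weightE (M : R) j : weight M j = cw M * base M j.
Proof. by rewrite /weight /base mulrA. Qed.

Lemma weight_ge0 (M : R) j : 0 < M -> 0 <= weight M j.
Proof.
move=> M0; rewrite weightE mulr_ge0 ?(ltW (base_gt0 _ M0)) //; have := cw_bounds M0; lra.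
Qed.

(** The first weights are of order [1 / M]: [cw] is at least one half, and [1 <= M] bounds [j / M]
    by [q]. This is where the factor [M] of the separation rate comes from. *)
Lemma weight_ge (M : R) q j : 1 <= M -> (j <= q)%N -> (1 / 2 * (1 + q%:R ^+ 2) ^- 2) / M <= weight M j.
Proof.
move=> M1 jq; have M0 : 0 < M by lra.
rewrite weightE /base; have c0 := cw_bounds M0.
rewrite -mulrA [X in _ * X]mulrC; apply: ler_pM => //.
  by rewrite mulr_ge0 ?invr_ge0 ?ltW // exprn_ge0 // addr_ge0 // sqr_ge0.
rewrite ler_pM2l ?invr_gt0 //.
have j0 : 0 <= j%:R ^+ 2 / M ^+ 2 :> R by rewrite divr_ge0 ?sqr_ge0.
have q0 : 0 <= q%:R ^+ 2 :> R by rewrite sqr_ge0.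
rewrite lef_pV2 ?posrE ?exprn_gt0 //; try lra.
rewrite lerXn2r ?nnegrE; try lra.
rewrite lerD2l; apply: (@le_trans _ _ (j%:R ^+ 2)).
  rewrite ler_piMr ?sqr_ge0 // invf_le1 ?exprn_gt0 // expr_ge1 //; lra.
by rewrite lerXn2r ?nnegrE // ler_nat.
Qed.

Lemma inv_sq_sum_le n : \sum_(1 <= j < n.+2) (j%:R ^+ 2)^-1 <= 2 - n.+1%:R^-1 :> R.
Proof.
elim: n => [|n IH]; first by rewrite big_nat1 expr1n invr1; lra.
rewrite big_nat_recr //=; apply: le_trans (lerD IH (lexx _)) _.
rewrite -addrA lerD2l -!natr1; set x : R := n%:R; have x0 : 0 <= x by rewrite /x.
rewrite -subr_ge0 (_ : _ - _ = ((x + 1 + 1) ^+ 2 * (x + 1))^-1).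
  by rewrite invr_ge0 mulr_ge0 ?sqr_ge0 //; lra.
have x1 : x + 1 != 0 by rewrite gt_eqF //; lra.
have x2 : x + 1 + 1 != 0 by rewrite gt_eqF //; lra.
by field; rewrite x1 x2.
Qed.

(** The weights decay like [j ^- 4], while the second moments of the spectral statistics grow like
    [j ^+ 2]. *)
Lemma weight_moment_bound (M : R) : 1 <= M -> exists B, forall n,
  \sum_(1 <= j < n) weight M j * (1 + j%:R ^+ 2) <= B.
Proof.
move=> M1; have M0 : 0 < M by lra.
have c0 : 0 < cw M by have := cw_bounds M0; lra.
exists (cw M * (2 * M ^+ 3) * 2) => n; case: n => [|[|n]].
- by rewrite big_geq // !mulr_ge0 ?exprn_ge0 ?ltW.
- by rewrite big_geq // !mulr_ge0 ?exprn_ge0 ?ltW.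
apply: (@le_trans _ _ (\sum_(1 <= j < n.+2) cw M * (2 * M ^+ 3) * (j%:R ^+ 2)^-1)); last first.
  rewrite -mulr_sumr ler_pM2l ?mulr_gt0 ?exprn_gt0 //; apply: le_trans (inv_sq_sum_le n) _.
  by rewrite gerBl invr_ge0.
rewrite !big_nat; apply: ler_sum => j /andP[j1 _].
rewrite weightE -[leLHS]mulrA -[leRHS]mulrA ler_pM2l //.
have x1 : 1 <= j%:R ^+ 2 :> R by rewrite expr_ge1 // ler1n.
have hb : base M j <= M ^+ 3 / (j%:R ^+ 2) ^+ 2.
  rewrite /base (_ : M ^+ 3 / _ = M^-1 * (j%:R ^+ 2 / M ^+ 2) ^- 2); last first.
    by field; rewrite ?pnatr_eq0 -?lt0n ?j1 ?gt_eqF.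
  rewrite ler_pM2l ?invr_gt0 // lef_pV2 ?posrE ?exprn_gt0 ?divr_gt0 ?(lt_le_trans _ x1) ?exprn_gt0 //; last first.
    by rewrite ltr_wpDr // divr_ge0 ?sqr_ge0.
  by rewrite lerXn2r ?nnegrE ?addr_ge0 ?divr_ge0 ?sqr_ge0 // lerDr.
move: hb x1; move: (base M j) (j%:R ^+ 2) => v y hb y1; have y0 : 0 < y by lra.
apply: (@le_trans _ _ (M ^+ 3 / y ^+ 2 * (2 * y))).
  apply: le_trans (ler_wpM2r _ hb) _; first by lra.
  by rewrite ler_pM2l ?divr_gt0 ?exprn_gt0 //; lra.
by rewrite le_eqVlt; apply/orP; left; apply/eqP; field; rewrite gt_eqF.
Qed.

Lemma weighted_cvg (w a : nat -> R) B : (forall j, 0 <= w j) ->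
  (forall n, \sum_(1 <= j < n) w j * a j ^+ 2 <= B) -> cvgn (fun n => \sum_(1 <= j < n) w j * a j ^+ 2).
Proof.
move=> w0 hB; apply: nondecreasing_is_cvgn; last by exists B => _ [n _ <-].
apply/nondecreasing_seqP => n; case: n => [|n]; first by rewrite !big_geq.
by rewrite [leRHS]big_nat_recr //= lerDl mulr_ge0 ?sqr_ge0.
Qed.

(** Polarisation: the product is a combination of squares, whose weighted series are monotone and
    bounded. *)
Lemma weighted_product_cvg (w a b : nat -> R) A B : (forall j, 0 <= w j) ->
  (forall n, \sum_(1 <= j < n) w j * a j ^+ 2 <= A) ->
  (forall n, \sum_(1 <= j < n) w j * b j ^+ 2 <= B) ->
  cvgn (fun n => \sum_(1 <= j < n) w j * (a j * b j)).
Proof.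
move=> w0 hA hB; have ca := weighted_cvg w0 hA; have cb := weighted_cvg w0 hB.
have cab : cvgn (fun n => \sum_(1 <= j < n) w j * (a j + b j) ^+ 2).
  apply: (@weighted_cvg _ _ (2 * A + 2 * B)) => // n.
  apply: (@le_trans _ _ (2 * (\sum_(1 <= j < n) w j * a j ^+ 2) + 2 * (\sum_(1 <= j < n) w j * b j ^+ 2))).
    rewrite !mulr_sumr -big_split /=; apply: ler_sum => j _.
    have := mulr_ge0 (w0 j) (sqr_ge0 (a j - b j)); nra.
  by rewrite lerD // ler_pM2l.
rewrite (_ : (fun n => _) = (fun n => 2^-1 * (\sum_(1 <= j < n) w j * (a j + b j) ^+ 2 -
  \sum_(1 <= j < n) w j * a j ^+ 2 - \sum_(1 <= j < n) w j * b j ^+ 2))).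
  apply: (cvgP (2^-1 * (limn (fun n => \sum_(1 <= j < n) w j * (a j + b j) ^+ 2) -
    limn (fun n => \sum_(1 <= j < n) w j * a j ^+ 2) - limn (fun n => \sum_(1 <= j < n) w j * b j ^+ 2)))).
  apply: cvgMr; apply: (cvgB (cvgB _ _) _); [exact: cab | exact: ca | exact: cb].
by apply/funext => n; rewrite -!sumrB mulr_sumr; apply: eq_bigr => j _; field.
Qed.

Lemma Chat_sym d (M : R) (S : nat -> 'cV[R]_d) : (Chat M S)^T = Chat M S.
Proof.
apply/matrixP => i k; rewrite !mxE; congr series_from1; apply/funext => j.
by congr (_ * _); rewrite !mxE !big_ord1 !mxE mulrC.
Qed.

(** The bounds on the diagonal series give convergence of all entries, so the form of [Chat] is a
    limit of weighted sums of squares; the terms after the first [q] are dropped and the others use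
    [weight_ge]. *)
Lemma Chat_lambda_ge d q m (M : R) (S : nat -> 'cV[R]_d) : (0 < m <= d)%N -> 1 <= M ->
  (forall i, exists B, forall n, \sum_(1 <= j < n) weight M j * S j i 0 ^+ 2 <= B) ->
  (1 / 2 * (1 + q%:R ^+ 2) ^- 2) / M *
    lambda m ((\matrix_(k < d, j < q) S j.+1 k 0) *m (\matrix_(k < d, j < q) S j.+1 k 0)^T) <=
  lambda m (Chat M S).
Proof.
move=> md M1 hB; have M0 : 0 < M by lra.
set cq := _ / M; set A := \matrix_(k, j) _.
have q0 : 0 <= q%:R ^+ 2 :> R by rewrite sqr_ge0.
have cq0 : 0 < cq by rewrite divr_gt0 // mulr_gt0 // invr_gt0 exprn_gt0 //; lra.
have w0 j := weight_ge0 j M0.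
rewrite mulrC -ler_pdivlMr // mulrC -[leRHS]addr0.
apply: (@lambda_le R d _ _ m _ 0); rewrite ?gram_sym ?Chat_sym ?invr_gt0 // => x.
rewrite mul0r addr0 ler_pdivlMl //.
have cv i k : cvgn (fun n => \sum_(1 <= j < n) weight M j * (S j *m (S j)^T) i k).
  have [Bi hBi] := hB i; have [Bk hBk] := hB k.
  rewrite (_ : (fun n => _) = fun n => \sum_(1 <= j < n) weight M j * (S j i 0 * S j k 0)).
    exact: weighted_product_cvg hBi hBk.
  by apply/funext => n; apply: eq_bigr => j _; rewrite !mxE big_ord1 !mxE.
pose u n := \sum_k (\sum_i x 0 i * (\sum_(1 <= j < n) weight M j * (S j *m (S j)^T) i k)) * x 0 k.
have cu : u @ \oo --> qform (Chat M S) x.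
  rewrite /qform mxE (_ : \sum_j _ = \sum_k (\sum_i x 0 i * Chat M S i k) * x 0 k); last first.
    by apply: eq_bigr => k _; rewrite !mxE.
  apply: (cvg_big add_continuous) => k _; apply: cvgMl.
  apply: (cvg_big add_continuous) => i _; apply: cvgMr.
  by rewrite mxE; exact: cv.
have uE n : u n = \sum_(1 <= j < n) weight M j * (x *m S j) 0 0 ^+ 2.
  rewrite /u (eq_bigr (fun k => \sum_(1 <= j < n) \sum_i weight M j * (x 0 i * S j i 0 * (x 0 k * S j k 0)))).
    rewrite exchange_big /=; apply: eq_bigr => j _; rewrite mxE expr2 !mulr_suml mulr_sumr exchange_big.
    apply: eq_bigr => i _; rewrite mulr_sumr mulr_sumr; apply: eq_bigr => k _; ring.
  move=> k _; rewrite mulr_suml; under eq_bigr do rewrite mulr_sumr mulr_suml.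
  rewrite exchange_big /=; apply: eq_bigr => j _; apply: eq_bigr => i _.
  rewrite !mxE big_ord1 !mxE; ring.
have -> : qform (A *m A^T) x = \sum_(1 <= j < q.+1) (x *m S j) 0 0 ^+ 2.
  rewrite /qform mulmxA -mulmxA -trmx_mul mxE big_add1 big_mkord; apply: eq_bigr => j _.
  rewrite mxE expr2; congr (_ * _); rewrite !mxE; apply: eq_bigr => k _; by rewrite mxE.
apply: (cvgr_to_ge cu); exists q.+1 => // n /= qn.
rewrite uE [leRHS](big_cat_nat (n := q.+1)) //= mulr_sumr.
rewrite -[leLHS]addr0; apply: lerD; last by apply: sumr_ge0 => j _; rewrite mulr_ge0 ?sqr_ge0.
rewrite !big_nat; apply: ler_sum => j /andP[_ jq]; rewrite ler_wpM2r ?sqr_ge0 //.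
exact: weight_ge.
Qed.

Lemma measurable_test d0 (T : measurableType d0) d (r : 'I_d) (kap M : R) (S : nat -> T -> 'cV[R]_d) :
  (forall j k, (0 < j)%N -> measurable_fun setT (fun w => S j w k 0)) ->
  measurable [set w | test r kap M (fun j => S j w)].
Proof.
move=> mS; apply: measurable_lambda_gt => [|w|i j]; [exact: ltn_ord | exact: Chat_sym |].
under eq_fun do rewrite mxE; apply: measurable_limn => n.
under eq_fun do rewrite big_nat big_mkcond.
apply: measurable_sum => l; case: (boolP (1 <= l < n)%N) => [/andP[l1 _]|_]; last exact: measurable_cst.
under eq_fun do rewrite !mxE big_ord1 !mxE.
apply: measurable_funM => //; apply: measurable_funM; exact: mS.
Qed.

End weights.

(** * Almost sure convergence of the weighted series *)

Section almost_sure.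
Context {R : realType}.
Notation mu := (@lebesgue_measure R).

(** Second moments pass to limits in probability. [Z] is truncated at [K]; where [z] is within 1 of
    [Z] the square is at most [2 * z ^+ 2 + 2], and the exceptional event contributes at most 1. *)
Lemma second_moment_le d0 (T : measurableType d0) (P : probability T R) (Z : T -> R) (C : R) :
  measurable_fun setT Z -> 0 <= C ->
  (forall e : R, 0 < e -> exists z : T -> R, [/\ measurable_fun setT z,
     (\int[P]_w (z w ^+ 2)%:E <= C%:E)%E & (P [set w | (e <= `|Z w - z w|)%R] <= e%:E)%E]) ->
  (\int[P]_w (Z w ^+ 2)%:E <= (2 * C + 3)%:E)%E.
Proof.
move=> mZ C0 hz.
pose A (K : nat) := [set w | `|Z w| <= K%:R].
have mA K : measurable (A K).
  rewrite (_ : A K = Z @^-1` `[- K%:R, K%:R]); first by rewrite -[X in measurable X]setTI; exact: mZ.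
  by apply/seteqP; split => w; rewrite /A /= in_itv /= ler_norml.
pose f (K : nat) w := (Z w ^+ 2 * \1_(A K) w)%:E.
have mf K : measurable_fun setT (f K).
  apply/measurable_EFinP; apply: measurable_funM; last exact: measurable_indic.
  exact: measurable_funX.
have f0 K w : setT w -> (0 <= f K w)%E by move=> _; rewrite lee_fin mulr_ge0 ?sqr_ge0.
have mono w : setT w -> {homo f ^~ w : n m / (n <= m)%N >-> (n <= m)%E}.
  move=> _ n m nm; rewrite lee_fin ler_wpM2l ?sqr_ge0 // !indicE ler_nat.
  case: (boolP (w \in A n)) => //; rewrite inE /A /= => h.
  by rewrite mem_set //= (le_trans h) // ler_nat.
have fK K : (\int[P]_w f K w <= (2 * C + 3)%:E)%E.
  (* The truncated square is at most [K ^+ 2], so an event of probability [e] contributes at most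
     1. *)
  pose e := (K.+1%:R ^+ 2)^-1 : R; have K0 : 0 < K.+1%:R ^+ 2 :> R by rewrite exprn_gt0.
  have e0 : 0 < e by rewrite invr_gt0.
  have e1 : e <= 1 by rewrite invf_le1 // expr_ge1 // ler1n.
  have Ke : K%:R ^+ 2 * e <= 1.
    by rewrite ler_pdivrMr // mul1r lerXn2r ?nnegrE // ler_nat.
  have [z [mz hz2 hzP]] := hz e e0.
  have mE : measurable [set w | e <= `|Z w - z w|].
    by apply: measurable_abs_ge; exact: measurable_funB.
  set E := [set w | _] in mE hzP.
  have mz2 : measurable_fun setT (fun w => (z w ^+ 2)%:E) by apply/measurable_EFinP; exact: measurable_funX.
  have mc : measurable_fun setT (fun w => (2 + K%:R ^+ 2 * \1_E w : R)%:E).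
    apply/measurable_EFinP; apply: measurable_funD => //; apply: measurable_funM => //; exact: measurable_indic.
  have h1 : (\int[P]_w f K w <= \int[P]_w (2%:E * (z w ^+ 2)%:E + (2 + K%:R ^+ 2 * \1_E w : R)%:E))%E.
    apply: ge0_le_integral => //; first by move=> w; exact: f0.
      by apply: emeasurable_funD => //; exact: measurable_funeM.
    move=> w _; rewrite -EFinM -EFinD lee_fin !indicE.
    case: (boolP (w \in A K)) => [|_]; last first.
      by rewrite mulr0; case: (w \in E); have := sqr_ge0 (z w); have := sqr_ge0 (K%:R : R); rewrite /=; lra.
    rewrite inE /A /= mulr1 => hA; case: (boolP (w \in E)) => hE.
      rewrite mulr1; apply: le_trans (_ : K%:R ^+ 2 <= _).
        by rewrite -real_normK ?num_real // lerXn2r ?nnegrE.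
      by have := sqr_ge0 (z w); lra.
    rewrite mulr0 addr0; have : `|Z w - z w| < 1.
      rewrite ltNge; apply/negP => h; move/negP: hE; apply; rewrite inE /E /=; exact: le_trans h.
    rewrite ltr_norml => /andP[h2 h3]; have := sqr_ge0 (z w - (Z w - z w)); nra.
  apply: le_trans h1 _.
  have c0 w : setT w -> (0 <= (2 + K%:R ^+ 2 * \1_E w : R)%:E)%E.
    by move=> _; rewrite lee_fin addr_ge0 // mulr_ge0 // sqr_ge0.
  have z0 w : setT w -> (0 <= (z w ^+ 2)%:E)%E by move=> _; rewrite lee_fin sqr_ge0.
  have z20 w : setT w -> (0 <= 2%:E * (z w ^+ 2)%:E)%E.
    by move=> _; rewrite -EFinM lee_fin mulr_ge0 ?sqr_ge0.
  have mz22 : measurable_fun setT (fun w => (2%:E * (z w ^+ 2)%:E)%E) by exact: measurable_funeM.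
  rewrite (ge0_integralD P measurableT z20 mz22 c0 mc).
  rewrite (_ : 2 * C + 3 = 2 * C + (2 + 1)); last by ring.
  rewrite [X in (_ <= X)%E]EFinD; apply: leeD.
    rewrite (ge0_integralZl P measurableT mz2 z0) ?lee_fin //.
    by rewrite [X in (_ <= X)%E]EFinM; apply: lee_wpmul2l.
  have KE0 w : setT w -> (0 <= (K%:R ^+ 2)%:E * (\1_E w : R)%:E)%E.
    by move=> _; rewrite -EFinM lee_fin mulr_ge0 ?sqr_ge0.
  have E0 w : setT w -> (0 <= (\1_E w : R)%:E)%E by rewrite lee_fin.
  have mE1 : measurable_fun setT (fun w => (\1_E w : R)%:E).
    by apply/measurable_EFinP; exact: measurable_indic.
  have mKE : measurable_fun setT (fun w => ((K%:R ^+ 2)%:E * (\1_E w : R)%:E)%E) by exact: measurable_funeM.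
  have two0 (w : T) : setT w -> (0 <= (2 : R)%:E)%E by rewrite lee_fin.
  under eq_integral do rewrite EFinD EFinM.
  rewrite (ge0_integralD P measurableT two0 (measurable_cst _) KE0 mKE).
  have -> : (\int[P]_(_ in setT) (2 : R)%:E = (2 : R)%:E)%E.
    rewrite integral_cst //; exact: etrans (congr1 (fun x => (2 : R)%:E * x)%E (probability_setT P)) (mule1 _).
  rewrite [X in (_ <= X)%E]EFinD; apply: leeD => //.
  rewrite (ge0_integralZl P measurableT mE1 E0) ?lee_fin ?sqr_ge0 //.
  rewrite integral_indic // setIT; apply: le_trans (_ : (K%:R ^+ 2)%:E * e%:E <= _)%E.
    by apply: lee_wpmul2l; rewrite // lee_fin sqr_ge0.
  by rewrite -EFinM lee_fin.
have <- : (\int[P]_w limn (f ^~ w) = \int[P]_w (Z w ^+ 2)%:E)%E.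
  apply: eq_integral => w _; apply: cvg_lim => //; apply: cvg_near_cst.
  exists (Num.bound `|Z w|) => // n /= hn; rewrite /f indicE mem_set ?mulr1 //.
  rewrite /A /=; apply/ltW; apply: lt_le_trans (archi_boundP _) _ => //; by rewrite ler_nat.
rewrite (monotone_convergence P measurableT mf f0 mono).
apply: lime_le; last by apply: nearW => n; exact: fK.
apply: ereal_nondecreasing_is_cvgn => n m nm; apply: ge0_le_integral => //.
- by move=> w; exact: f0.
- by move=> w _; exact: mono.
Qed.

Lemma gridint_second_moment d0 (T : measurableType d0) (P : probability T R) p
    (B : R -> T -> 'cV[R]_p) (tau : nat -> R) n (F : R -> R) (l : 'I_p) :
  brownian_motion P B -> is_grid tau n ->
  (\int[P]_w (gridint tau n F (fun u => B u w l 0) ^+ 2)%:E =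
    (normal_m2 * \sum_(i < n) F (tau i.+1) ^+ 2 * (tau i.+1 - tau i))%:E)%E.
Proof.
move=> hB hg; have [t0 t1 tS] := hg.
have t0' : 0 <= tau 0%N by rewrite t0.
have t1' : tau n <= 1 by rewrite t1.
have [L4f E] := gaussian_linear_moment (fun i => F (tau i.+1) * Num.sqrt (tau i.+1 - tau i))
  (brownian_increments l hB t0' t1' tS).
have D0 (i : 'I_n) : 0 < tau i.+1 - tau i by rewrite subr_gt0; exact: tS.
rewrite (_ : \sum_(i < n) F _ ^+ 2 * _ =
  \sum_(i < n) (F (tau i.+1) * Num.sqrt (tau i.+1 - tau i)) ^+ 2); last first.
  by apply: eq_bigr => i _; rewrite exprMn sqr_sqrtr // ltW.
rewrite -E /Rintegral fineK; last exact: (integrable_fin_num measurableT (L4_sqr L4f)).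
apply: eq_integral => w _; congr (_ ^+ 2)%:E; apply: eq_bigr => i _.
by rewrite -mulrA; congr (_ * _); rewrite mulrC divfK // gt_eqF // sqrtr_gt0.
Qed.

(** The series of squares has finite expectation, hence is finite almost surely. *)
Lemma weighted_series_ae d0 (T : measurableType d0) (P : probability T R) (wt a : nat -> R) (B : R)
    (Z : nat -> T -> R) :
  (forall j, 0 <= wt j) -> (forall j, measurable_fun setT (Z j)) ->
  (forall j, (\int[P]_w (Z j w ^+ 2)%:E <= (a j)%:E)%E) ->
  (forall n, \sum_(j < n) wt j * a j <= B) ->
  {ae P, forall w, exists B', forall n, \sum_(j < n) wt j * Z j w ^+ 2 <= B'}.
Proof.
move=> w0 mZ hZ hB.
pose f j w := (wt j * Z j w ^+ 2)%:E.
have mf j : measurable_fun setT (f j).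
  by apply/measurable_EFinP; apply: measurable_funM => //; exact: measurable_funX.
have f0 j w : setT w -> (0 <= f j w)%E by move=> _; rewrite lee_fin mulr_ge0 ?sqr_ge0.
pose g w := (\sum_(0 <= j <oo) f j w)%E.
have g0 w : (0 <= g w)%E by apply: nneseries_ge0 => j _ _; exact: f0.
have mg : measurable_fun setT g.
  by apply: ge0_emeasurable_sum => [j w _ _|j _]; [exact: f0 | exact: mf].
have ig : P.-integrable setT g.
  apply/integrableP; split => //.
  rewrite (_ : (\int[P]_w `|g w| = \int[P]_w g w)%E); last first.
    by apply: eq_integral => w _; rewrite gee0_abs.
  rewrite (integral_nneseries P measurableT mf f0).
  apply: (@le_lt_trans _ _ B%:E); last exact: ltry.
  apply: lime_le; first by apply: is_cvg_nneseries => j _ _; apply: integral_ge0 => w; exact: f0.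
  apply: nearW => n; apply: le_trans (_ : (\sum_(j < n) wt j * a j)%:E <= _)%E; last by rewrite lee_fin.
  rewrite big_mkord -sumEFin; apply: lee_sum => j _.
  rewrite /f; under eq_integral do rewrite EFinM.
  rewrite ge0_integralZl // ?lee_fin //; last 2 first.
  - by apply/measurable_EFinP; exact: measurable_funX.
  - by move=> w _; rewrite lee_fin sqr_ge0.
  by rewrite [X in (_ <= X)%E]EFinM; apply: lee_wpmul2l; rewrite ?lee_fin.
have := integrable_ae measurableT ig; apply: filterS => w /(_ I) hw.
exists (fine (g w)) => n; rewrite -lee_fin fineK // -sumEFin -(big_mkord xpredT (fun j => f j w)).
by apply: nneseries_lim_ge => j _ _; exact: (f0 j w I).
Qed.

Section coefficients.
Context d0 (T : measurableType d0) (P : probability T R) (d : nat).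
Variables (X W : R -> T -> 'cV[R]_d) (eta t h : R) (n : nat) (S : nat -> T -> 'cV[R]_d).
Hypothesis mX : measurable_process X.
Hypothesis cX : continuous_paths X.
Hypothesis hW : brownian_motion P W.
Hypothesis eta0 : 0 < eta.
Hypothesis n0 : (0 < n)%N.
Hypothesis t0 : 0 <= t.
Hypothesis h0 : 0 < h.
Hypothesis th1 : t + h <= 1.
Hypothesis hS : forall j k, (0 < j)%N -> stoch_integral P (fun s w => observation eta X W n s w k 0) t (t + h)
      (fun s => derive1 (Phi t h j) s) (fun w => S j w k 0).

Let c := eta / Num.sqrt n%:R.

Lemma observed_stoch_integral j k : (0 < j)%N ->
  stoch_integral P (fun s w => (\int[mu]_(u in `[0, s]) X u w k 0) + c * W s w k 0)
      t (t + h) (dPhi t h j) (fun w => S j w k 0).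
Proof.
move=> j0; have := hS k j0; rewrite -(derive1_Phi t h).
rewrite (_ : (fun s w => observation eta X W n s w k 0) =
  fun s w => (\int[mu]_(u in `[0, s]) X u w k 0) + c * W s w k 0) //.
by apply/funext => s; apply/funext => w; rewrite mxE.
Qed.

Let tth : t <= t + h <= 1.
Proof. by rewrite lerDl ltW. Qed.

(** Split off so that the signal is controlled path by path, by the supremum of a continuous path,
    and only the noise in mean square. *)
Definition drift_coefficient j k w : R := \int[mu]_(x in `]t, (t + h)%R]) (dPhi t h j x * X x w k 0).

Let bnd j : R := Num.sqrt (2 / h) * (j%:R * pi / h).

Let bnd_ge0 j : 0 <= bnd j.
Proof. by rewrite mulr_ge0 ?sqrtr_ge0 // divr_ge0 ?mulr_ge0 ?pi_ge0 // ltW. Qed.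

Let mesh_close j k (e dl : R) : 0 < e -> 0 < dl -> measurable_fun setT (drift_coefficient j k) /\
  exists N, forall M, (N <= M)%N ->
    (P [set w | (e <= `|mesh_sum (Phi t h j) t (t + h) M (fun s => X s w k 0) - drift_coefficient j k w|)%R] <= dl%:E)%E.
Proof.
move=> e0 dl0; apply: cvg_pointwise_prob => // [M|w].
  by apply: (measurable_mesh_sum (X := fun s w => X s w k 0)) => // s hs; exact: mX.
apply: (riemann_sum_cvg (C := bnd j) (@cX w k) (is_derive_Phi t h j) (@continuous_dPhi R t h j) t0 _ tth).
by move=> x _; exact: dPhi_bounded.
Qed.

Lemma measurable_drift_coefficient j k : measurable_fun setT (drift_coefficient j k).
Proof. by have [] := mesh_close j k ltr01 ltr01. Qed.

Lemma drift_coefficient_bound w k : exists2 K : R, 0 <= K &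
  forall j, drift_coefficient j k w ^+ 2 <= K * j%:R ^+ 2.
Proof.
have [C C0 hC] := path_bounded (@cX w k).
exists ((Num.sqrt (2 / h) * (pi / h) * C) ^+ 2) => [|j]; first exact: sqr_ge0.
rewrite -exprMn -[leLHS]real_normK ?num_real //.
have r0 : 0 <= Num.sqrt (2 / h) * (pi / h) * C * j%:R.
  by rewrite !mulr_ge0 ?sqrtr_ge0 ?invr_ge0 ?pi_ge0 // ltW.
rewrite lerXn2r ?nnegrE //.
have md : measurable_fun setT (dPhi t h j) by apply: continuous_measurable_fun; exact: continuous_dPhi.
have i1 : mu.-integrable `]t, (t + h)] (EFin \o (fun x => dPhi t h j x * X x w k 0)).
  by apply: (path_integrable (@cX w k) t0 th1 md (C := bnd j)) => x _; exact: dPhi_bounded.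
have mD : measurable (`]t, (t + h)] : set R) by [].
rewrite /drift_coefficient; apply: le_trans (le_normr_Rintegral _ i1) _ => //.
have E : bnd j * C * h <= Num.sqrt (2 / h) * (pi / h) * C * j%:R.
  have h1 : h <= 1 by have := t0; have := th1; lra.
  rewrite (_ : _ * j%:R = bnd j * C); last by rewrite /bnd; ring.
  by rewrite ler_piMr // mulr_ge0 // ltW.
apply: le_trans E; rewrite -[h in leRHS](addrK t) [h + t]addrC.
have -> : bnd j * C * (t + h - t) = \int[mu]_(x in `]t, (t + h)%R]) (bnd j * C).
  by rewrite Rintegral_cst //= lebesgue_measure_itv /= lte_fin ltrDl h0 -EFinB.
apply: le_Rintegral => //.
- by have := integrable_norm i1; apply: eq_integrable.
- by apply: (bounded_integrable_oc (C := `|bnd j * C|)) => //; exact: measurable_cst.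
move=> x; rewrite /= in_itv /= => /andP[hx1 hx2]; rewrite normrM; apply: ler_pM => //.
  exact: dPhi_bounded.
by apply: hC; rewrite (le_trans t0 (ltW hx1)) (le_trans hx2 th1).
Qed.

Let A : R := 2 * (c ^+ 2 * (normal_m2 * (2 + 4 / h * (pi / h) ^+ 2))) + 3.

(** What remains after the drift is the noise integral of [dPhi]. Its step approximations have
    second moments given by the isometry on a grid, and [second_moment_le] passes to the limit. *)
Lemma martingale_coefficient_moment j k : (0 < j)%N ->
  (\int[P]_w ((S j w k 0 - drift_coefficient j k w) ^+ 2)%:E <= (A * (1 + j%:R ^+ 2))%:E)%E.
Proof.
move=> j0; have m20 := @normal_m2_gt0 R.
pose C : R := c ^+ 2 * (normal_m2 * (2 + 2 * bnd j ^+ 2)).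
have C0 : 0 <= C := mulr_ge0 (sqr_ge0 _) (mulr_ge0 (ltW m20) (addr_ge0 (ler0n _ 2) (mulr_ge0 (ler0n _ 2) (sqr_ge0 _)))).
have mS : measurable_fun setT (fun w => S j w k 0) by have [] := hS k j0.
apply: le_trans (second_moment_le (C := C) _ C0 _) _.
- by apply: measurable_funB => //; exact: measurable_drift_coefficient.
(* The bound 1 keeps the norm of the step function under control independently of [e]; half of [e]
   is left for each of the two approximations. *)
- move=> e e0; pose e' := Num.min 1 (e / 2).
  have e'0 : 0 < e' by rewrite lt_min ltr01 divr_gt0.
  have mcW s : 0 <= s <= 1 -> measurable_fun setT (fun w => c * W s w k 0).
    by move=> hs; apply: measurable_funM => //; case: hW => + _ _ _ _; exact.
  have [m [s [cc [hs s0 sm hL [M0 hM0]]]]] := @observed_coefficient_close R _ T P (fun s w => X s w k 0)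
    (fun s hs => mX k hs) (fun w => @cX w k) (fun s w => c * W s w k 0) _ (Phi t h j) _ (bnd j)
    t (t + h) e' mcW (is_derive_Phi t h j) (@continuous_dPhi R t h j) (fun x _ => dPhi_bounded t h0 j x)
    t0 tth e'0 (observed_stoch_integral k j0).
  have [_ [N hN]] := mesh_close j k e'0 e'0.
  pose M := maxn M0 N; pose z := step_integral (fun u w => W u w k 0) m s cc.
  have mz : measurable_fun setT (fun w => c * z w).
    by apply: measurable_funM => //; exact: (measurable_step_integral hW).
  exists (fun w => c * z w); split => //; last first.
    have hx1 := hM0 M (leq_maxl _ _); have hx2 := hN M (leq_maxr _ _).
    have mm : measurable_fun setT (fun w => mesh_sum (Phi t h j) t (t + h) M (fun s => X s w k 0)).
      by apply: (measurable_mesh_sum (X := fun s w => X s w k 0)) => // u hu; exact: mX.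
    have md := measurable_drift_coefficient j k.
    apply: (@le_trans _ _ (e' + e')%:E); last first.
      by rewrite lee_fin; have : e' <= e / 2 by [rewrite ge_min lexx orbT]; lra.
    apply: prob_union_le hx1 hx2.
    - by apply: measurable_abs_ge; apply: measurable_funB => //; exact: measurable_funB.
    - apply: measurable_abs_ge; apply: measurable_funB => //; apply: measurable_funD => //.
      rewrite (_ : step_integral _ _ _ _ = fun w => c * z w) //.
      by apply/funext => w; exact: step_integralZ.
    - by apply: measurable_abs_ge; exact: measurable_funB.
    move=> w /= hw; rewrite step_integralZ -/(z w).
    move: (mesh_sum _ _ _ _ _) (drift_coefficient j k w) (c * z w) (S j w k 0) hw => a b x y hw.
    have [?|lt1] := leP e' `|y - (a + x)|; first by left.
    right; rewrite leNgt; apply/negP => lt2; move: hw; apply/negP; rewrite -ltNge.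
    rewrite (_ : y - b - x = (y - (a + x)) + (a - b)); last by ring.
    apply: le_lt_trans (ler_normD _ _) _; have : e' <= e / 2 by rewrite ge_min lexx orbT.
    by move: lt1 lt2; lra.
  have [nn [tau [hg _ hnodes]]] := @common_grid_steps R unit (fun=> m) (fun=> s) (fun=> hs).
  have zE w : z w = gridint tau nn (step_fun m s cc) (fun u => W u w k 0).
    by apply: gridint_step => // i; exact: (hnodes tt).
  under eq_integral do rewrite zE exprMn EFinM.
  rewrite ge0_integralZl ?lee_fin ?sqr_ge0 //; last 2 first.
  - by apply/measurable_EFinP; apply: measurable_funX; exact: (measurable_gridint hW).
  - by move=> w _; rewrite lee_fin sqr_ge0.
  rewrite gridint_second_moment // /C [X in (_ <= X)%E]EFinM; apply: lee_wpmul2l; first by rewrite lee_fin sqr_ge0.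
  rewrite lee_fin ler_pM2l // -lee_fin.
  have mF : measurable_fun setT (step_fun m s cc : R -> R) by exact: measurable_step_fun.
  have mdP : measurable_fun setT (dPhiD t h j).
    apply: measurable_funM; last exact: measurable_indic.
    by apply: continuous_measurable_fun; exact: continuous_dPhi.
  have md01 : measurable (`[0, 1] : set R) by [].
  have <- := grid_integral (F := fun x => step_fun m s cc x ^+ 2) hg; last 3 first.
  - exact: measurable_funX.
  - by move=> x; exact: sqr_ge0.
  - by move=> i x iN hx; rewrite (step_fun_cell _ hg _ iN hx) // => a; exact: (hnodes tt).
  rewrite integral_itv_obnd_cbnd; last by apply/measurable_EFinP; apply: measurable_funTS; exact: measurable_funX.
  have := sq_dist_triangle mu md01 (measurable_funTS mF) (measurable_cst (0 : R)) (measurable_funTS mdP).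
  under eq_integral do rewrite subr0; move=> h2; apply: le_trans h2 _.
  rewrite [X in (_ <= X)%E]EFinD; apply: leeD.
    apply: (@le_trans _ _ (2%:E * e'%:E)%E); last by rewrite -EFinM lee_fin; have : e' <= 1 by [rewrite ge_min lexx]; lra.
    apply: lee_wpmul2l => //; apply: step_L2_extend => //.
    by apply: continuous_measurable_fun; exact: continuous_dPhi.
  rewrite [X in (_ <= X)%E]EFinM; apply: lee_wpmul2l => //.
  have mN : measurable_fun (`[0, 1] : set R) (fun x => - dPhiD t h j x).
    by apply: measurable_funTS; exact: measurableT_comp.
  have hdN x : `|- dPhiD t h j x| <= bnd j.
    rewrite normrN /dPhiD normrM indicE; case: (_ \in _); rewrite ?normr1 ?mulr1 ?normr0 ?mulr0 //.
    exact: dPhi_bounded.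
  have := integral_sq_mul_le (V := 1%:E) md01 (measurable_cst (1 : R)) mN hdN.
  under [X in (X <= _)%E -> _]eq_integral do rewrite expr1n.
  have m1 : (\int[mu]_(_ in `[0%R, 1%R]) (1 : R)%:E <= 1%:E)%E.
    by rewrite integral_cst //= lebesgue_measure_itv /= lte_fin ltr01 -EFinB subr0 mule1.
  move=> /(_ m1).
  rewrite mule1; apply: le_trans; rewrite le_eqVlt; apply/orP; left; apply/eqP.
  by apply: eq_integral => x _; rewrite /= mul1r sub0r.
have bE : bnd j ^+ 2 = 2 / h * (j%:R * pi / h) ^+ 2.
  by rewrite /bnd exprMn sqr_sqrtr // divr_ge0 // ltW.
rewrite lee_fin /A /C bE.
rewrite (_ : 2 + 2 * (2 / h * (j%:R * pi / h) ^+ 2) = 2 + (4 / h * (pi / h) ^+ 2) * j%:R ^+ 2); last by ring.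
have q0 : 0 <= 4 / h * (pi / h) ^+ 2 by rewrite mulr_ge0 ?sqr_ge0 // divr_ge0 // ltW.
move: (c ^+ 2) (sqr_ge0 c) normal_m2 m20 (4 / h * (pi / h) ^+ 2) q0 (j%:R ^+ 2) (sqr_ge0 (j%:R : R)).
clear => u u0 v v0 b b0 y y0; rewrite -subr_ge0.
rewrite (_ : _ - _ = 4 * (u * v * y) + 2 * (u * v * b) + 3 * y); last by ring.
have := ltW v0 => {}v0.
by rewrite !addr_ge0 ?mulr_ge0.
Qed.

(** Drift and noise parts both have squares of order [j ^+ 2], the former on each path, the latter
    in expectation. *)
Lemma spectral_series_bounded M : 1 <= M ->
  {ae P, forall w, forall i, exists B, forall n, \sum_(1 <= j < n) weight M j * S j w i 0 ^+ 2 <= B}.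
Proof.
move=> M1; have M0 : 0 < M by lra.
apply: filter_forall => i.
have [B hB] := weight_moment_bound M1.
have A0 : 0 <= A.
  have q0 : 0 <= 4 / h * (pi / h) ^+ 2 by rewrite mulr_ge0 ?sqr_ge0 // divr_ge0 // ltW.
  exact: addr_ge0 (mulr_ge0 (ler0n _ 2) (mulr_ge0 (sqr_ge0 _) (mulr_ge0 (ltW (@normal_m2_gt0 R)) (addr_ge0 (ler0n _ 2) q0)))) (ler0n _ 3).
have := weighted_series_ae (P := P) (wt := fun j => weight M j.+1)
  (a := fun j => A * (1 + j.+1%:R ^+ 2)) (B := A * B)
  (Z := fun j w => S j.+1 w i 0 - drift_coefficient j.+1 i w)
  (fun j => weight_ge0 _ M0).
move=> /(_ _ _ _)/Wrap[|j|n'|].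
- move=> j; apply: measurable_funB; last exact: measurable_drift_coefficient.
  by have [] := hS i (ltn0Sn j).
- exact: martingale_coefficient_moment.
- apply: le_trans (_ : A * (\sum_(1 <= j < n'.+1) weight M j * (1 + j%:R ^+ 2)) <= _); last by rewrite ler_wpM2l.
  by rewrite big_add1 big_mkord mulr_sumr; apply: ler_sum => j _; rewrite mulrCA.
apply: filterS => w [B1 hB1]; have [K K0 hK] := drift_coefficient_bound w i.
exists (2 * (K * B) + 2 * B1) => n'; case: n' => [|n'].
  have := hB 0%N; have := hB1 0%N; rewrite !big_geq // big_ord0 => B10 B0.
  by rewrite addr_ge0 // !mulr_ge0.
apply: (@le_trans _ _ (2 * (K * (\sum_(1 <= j < n'.+1) weight M j * (1 + j%:R ^+ 2))) +
  2 * \sum_(j < n') weight M j.+1 * (S j.+1 w i 0 - drift_coefficient j.+1 i w) ^+ 2)); last first.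
  by rewrite lerD // ler_pM2l // ler_wpM2l.
rewrite !big_add1 !big_mkord !mulr_sumr -big_split /=; apply: ler_sum => j _.
set D := drift_coefficient _ _ _; set s := S _ _ _ _; set v := weight _ _.
have v0 : 0 <= v by exact: weight_ge0.
have hD : D ^+ 2 <= K * (1 + j.+1%:R ^+ 2).
  by apply: le_trans (hK j.+1) _; rewrite ler_wpM2l // lerDr.
have h1 : s ^+ 2 <= 2 * D ^+ 2 + 2 * (s - D) ^+ 2 by have := sqr_ge0 (s - 2 * D); nra.
apply: le_trans (ler_wpM2l v0 h1) _; rewrite mulrDr; apply: lerD; last by rewrite mulrCA.
have := ler_wpM2l v0 hD; lra.
Qed.

End coefficients.
End almost_sure.

(** * Power of the test *)

Section test_power.
Context {R : realType}.

Lemma lambda_psd_ge0 n q (A : 'M[R]_n) : (0 < q <= n)%N -> spd A -> 0 <= lambda q A.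
Proof.
move=> qn [/symmetricmxP sA pA]; rewrite leNgt; apply/negP => lt.
have [V [V0 _]] := lambda_ge_space sA qn.
suff : lambda q A < lambda q A by rewrite ltxx.
apply: (lambda_gt (V := V)) => // x x0.
apply: (@lt_le_trans _ _ 0); first by rewrite nmulr_rlt0 // V0.
by have := pA (x *m V)^T; rewrite trmxK.
Qed.

Lemma brownian_rank1_bound d0 (T : measurableType d0) (P : probability T R) d (W : R -> T -> 'cV[R]_d)
    r (eta : R) : brownian_motion P W -> (r < d)%N -> 0 < eta ->
  exists2 e : R, 0 < e & rank1_bound d r e eta.
Proof.
case: d W => [|d] W hW rd eta0; first by [].
by have [e e0 he] := gaussian_lambda_small hW eta0 rd; exists e.
Qed.

(** Off a null set a failure of the test forces the eigenvalue of the first [r.+1] statistics below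
    the small ball threshold. The level is clipped at 0 because [lam] may be negative. *)
Lemma Chat_lambda_small d0 (T : measurableType d0) (P : probability T R) d r (rd : (r < d)%N)
    (Sigma : R -> 'M[R]_d) (X W : R -> T -> 'cV[R]_d) (eta : R) n (t h : R)
    (S : nat -> T -> 'cV[R]_d) (lam e1 eta2 M kap : R) :
  observation_law P Sigma X W -> 0 < eta -> (0 < n)%N -> 0 <= t -> 0 < h <= 1 - t ->
  (forall j k, (0 < j)%N -> stoch_integral P (fun s w => observation eta X W n s w k 0) t (t + h)
      (fun s => derive1 (Phi t h j) s) (fun w => S j w k 0)) ->
  L1_spd Sigma -> (forall s, t <= s <= t + h -> lam <= lambda r.+1 (Sigma s)) ->
  rank1_bound d r e1 eta2 -> 0 < e1 -> 0 < eta2 -> 1 <= M ->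
  M * kap <= 1 / 2 * (1 + r.+1%:R ^+ 2) ^- 2 * (e1 / 20) * Num.max lam 0 ->
  measurable [set w | test (Ordinal rd) kap M (S ^~ w)] /\
  ((1 - 2 * eta2)%:E <= P [set w | test (Ordinal rd) kap M (S ^~ w)])%E.
Proof.
move=> hobs eta0 n0 t0 hh hS [_ hspd] hlam hb e10 eta20 M1 hkap.
have M0 : 0 < M by lra.
have rd' : (0 < r.+1 <= d)%N by [].
have mS j k : (0 < j)%N -> measurable_fun setT (fun w => S j w k 0) by move=> j0; have [] := hS j k j0.
have mphi := measurable_test (Ordinal rd) kap M mS; split => //.
set phi := [set w | _] in mphi *.
have /andP[h0 h1] := hh; have th1 : t + h <= 1 by lra.
have lam'0 : 0 <= Num.max lam 0 by rewrite le_max lexx orbT.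
(* For negative [lam] the lower bound 0 comes from positive semi-definiteness. *)
have hlam' s : t <= s <= t + h -> Num.max lam 0 <= lambda r.+1 (Sigma s).
  move=> hs; rewrite ge_max hlam //=; apply: lambda_psd_ge0 => //; apply: hspd.
  by move: hs => /andP[h2 h3]; rewrite (le_trans t0 h2) (le_trans h3 th1).
have hSS := spectral_lambda_small rd hobs eta0 n0 t0 hh hS lam'0 hlam' hb e10 eta20.
have [[mX cX _] hW _] := hobs.
have [N [mN PN hN]] := spectral_series_bounded mX cX hW t0 h0 th1 hS M1.
set A := [set w | _] in hSS.
have mA : measurable A.
  by apply: measurable_lambda_le => // i j; under eq_fun do rewrite mxE; exact: mS.
have hC : ~` phi `<=` A `|` N.
  move=> w hw; have [Nw|Nw] := pselect (N w); [by right | left].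
  have hbd : forall i, exists B, forall n, \sum_(1 <= j < n) weight M j * S j w i 0 ^+ 2 <= B.
    by apply: contrapT => hn; apply: Nw; apply: hN.
  have := Chat_lambda_ge r.+1 rd' M1 hbd.
  move: hw; rewrite /phi /test /= => /negP; rewrite -leNgt => hw1 /le_trans /(_ hw1).
  set cq := 1 / 2 * _ in hkap *; have cq0 : 0 < cq.
    by rewrite mulr_gt0 // invr_gt0 exprn_gt0 // ltr_wpDr // sqr_ge0.
  rewrite mulrAC ler_pdivrMr // [kap * M]mulrC => /le_trans /(_ hkap).
  rewrite -mulrA ler_pM2l // /A /= => /le_trans; apply.
  by rewrite ler_pM2l ?divr_gt0 // lerDl sqr_ge0.
have PN0 : (P N <= 0%:E)%E by rewrite PN.
have := prob_union_le (measurableC mphi) mA mN hC hSS PN0; rewrite addr0 => hle.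
move: hle; rewrite probability_setC // -(@fineK _ (P phi)) ?fin_num_measure // -EFinB !lee_fin; lra.
Qed.

(** The infimum over an empty alternative would be [+oo]. The lemma also supplies a law under which
    a Brownian motion is available. *)
Lemma H1_nonempty d (r : 'I_d) (t h lam : R) : exists Sigma, @H1 R d r t h lam Sigma.
Proof.
pose a := Num.max lam 0; have a0 : 0 <= a by rewrite le_max lexx orbT.
exists (fun=> a%:M); split; last first.
  move=> s _; have rd : (0 < r.+1 <= d)%N by exact: ltn_ord.
  by apply: le_trans (lambda_scalar_ge a rd); rewrite le_max lexx.
split=> [i k|s _].
  apply: measurable_bounded_integrable => //.
  - by rewrite /= lebesgue_measure_itv /= lte_fin ltr01 -EFinB ltry.
  - exact: bounded_cst.
split=> [|v]; first by apply/symmetricmxP; rewrite tr_scalar_mx.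
rewrite mul_mx_scalar -scalemxAl mxE mulr_ge0 // mxE; apply: sumr_ge0 => i _.
by rewrite mxE -expr2 sqr_ge0.
Qed.

Lemma cvge_to_one (T : Type) (F : set_system T) (FF : Filter F) (f : T -> \bar R) :
  (\forall x \near F, f x <= 1)%E ->
  (forall e : R, 0 < e -> \forall x \near F, ((1 - e)%:E <= f x)%E) -> f @ F --> 1%E.
Proof.
move=> f1 hf; apply/fine_cvgP; split.
  apply: filterS2 f1 (hf 1 ltr01) => x; case: (f x) => //.
apply/cvgrPdist_le => e e0; apply: filterS2 f1 (hf e e0) => x /=.
case: (f x) => //= y; rewrite !lee_fin => y1 y2; rewrite ger0_norm ?subr_ge0 //; lra.
Qed.

Lemma ereal_inf_bounds (I : Type) (A : set I) (f : I -> \bar R) (a b : \bar R) : A !=set0 ->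
  (forall i, A i -> (a <= f i)%E) -> (forall i, A i -> (f i <= b)%E) ->
  (a <= ereal_inf [set f i | i in A] <= b)%E.
Proof.
move=> [i Ai] ha hb; apply/andP; split.
  by apply: le_ereal_inf_tmp => _ [k Ak <-]; exact: ha.
by apply: le_trans (hb i Ai); apply: ereal_inf_lbound; exists i.
Qed.

End test_power.

Theorem theorem4p2
  (R : realType) (d : nat) (hd : (1 <= d)%N) (r : 'I_d)
  (eta : R) (heta : 0 < eta)
  (alpha : R) (halpha : 0 < alpha < 1) (i : 'I_3)
  (beta L lam_r : R) (hbeta : 0 < beta <= 1) (hL : 0 < L) (hlam_r : 0 <= lam_r)
  (t : R) (ht : 0 <= t < 1)
  (* auxiliary space for the quantiles *)
  (dispQ : measure_display) (TQ : measurableType dispQ) (Q : probability TQ R)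
  (Z : TQ -> 'M[R]_(d - r)) (hZ : GOE Q Z)
  (zeta : nat -> TQ -> 'cV[R]_(d - r)) (hzeta : iid_standard_normal Q zeta)
  (* statistical experiment (Omega, (P Sigma)_Sigma) *)
  (disp : measure_display) (Omega : measurableType disp)
  (P : (R -> 'M[R]_d) -> probability Omega R)
  (X W : R -> Omega -> 'cV[R]_d)
  (hP : forall Sigma, L1_spd Sigma -> observation_law (P Sigma) Sigma X W)
  (S : nat -> R -> nat -> Omega -> 'cV[R]_d)
  (hS : forall Sigma, L1_spd Sigma ->
     spectral_statistics (P Sigma) t (observation eta X W) S) :
  let kap := kappa Q Z zeta alpha eta beta L lam_r i in
  let phi n h M w := test r (kap n h M) M (fun j => S n h j w) in
  (forall (n : nat -> nat) (h M lam : nat -> R),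
     (forall m, [/\ (1 <= n m)%N, 0 < h m <= 1 - t, 1 <= M m & 0 < lam m]) ->
     M m * kap (n m) (h m) (M m) / lam m @[m --> \oo] --> 0 ->
     ereal_inf [set P Sigma [set w | phi (n m) (h m) (M m) w] |
                  Sigma in @H1 R d r t (h m) (lam m)] @[m --> \oo] --> 1%E)
  /\
  (forall (n : R -> nat) (h M : R -> R),
     (forall rho, [/\ (1 <= n rho)%N, 0 < h rho <= 1 - t & r.+1%:R <= M rho]) ->
     ereal_inf [set P Sigma [set w | phi (n rho) (h rho) (M rho) w] |
                  Sigma in @H1 R d r t (h rho)
                    (rho * M rho * kap (n rho) (h rho) (M rho))]
       @[rho --> +oo] --> 1%E).
Proof.
move=> kap phi; have /andP[t0 t1] := ht.
have P1 Sigma n h M : L1_spd Sigma -> (1 <= n)%N -> 0 < h <= 1 - t ->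
    (P Sigma [set w | phi n h M w] <= 1)%E.
  move=> hSig n1 hh; apply: probability_le1; apply: measurable_test => j k j0.
  by have [] := hS Sigma hSig n h j k n1 hh j0.
have key e : 0 < e -> exists2 K : R, 0 < K & forall n h M lam,
    (1 <= n)%N -> 0 < h <= 1 - t -> 1 <= M -> M * kap n h M <= K * Num.max lam 0 ->
    ((1 - e)%:E <= ereal_inf [set P Sigma [set w | phi n h M w] | Sigma in @H1 R d r t h lam] <= 1)%E.
  (* One law of the experiment provides the Brownian motion on which independent copies are
     realised; the constant obtained from it holds for all laws. *)
  move=> e0; have [Sig0 [hSig0 _]] := H1_nonempty r t 1 0.
  have [_ hW _] := hP Sig0 hSig0.
  have [e1 e10 hb] := brownian_rank1_bound hW (ltn_ord r) (divr_gt0 e0 (ltr0n R 2)).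
  exists (1 / 2 * (1 + r.+1%:R ^+ 2) ^- 2 * (e1 / 20)).
    by rewrite !mulr_gt0 ?divr_gt0 ?invr_gt0 ?exprn_gt0 // ltr_wpDr // sqr_ge0.
  move=> n h M lam n1 hh M1 hkap; apply: ereal_inf_bounds => [|Sigma [hSig hlam]|Sigma [hSig _]].
  - exact: H1_nonempty.
  - have [_] := Chat_lambda_small (ltn_ord r) (hP Sigma hSig) heta n1 t0 hh
      (fun j k j0 => hS Sigma hSig n h j k n1 hh j0) hSig hlam hb e10 (divr_gt0 e0 (ltr0n R 2)) M1 hkap.
    rewrite (_ : Ordinal (ltn_ord r) = r); last exact: val_inj.
    by rewrite (_ : 2 * (e / 2) = e) //; field.
  - exact: P1.
split=> [n h M lam hyp cv|n h M hyp].
- have near_key e : 0 < e -> \forall m \near \oo, ((1 - e)%:E <=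
      ereal_inf [set P Sigma [set w | phi (n m) (h m) (M m) w] |
        Sigma in @H1 R d r t (h m) (lam m)] <= 1)%E.
    move=> e0; have [K K0 hK] := key e e0.
    have near_K : \forall m \near \oo, M m * kap (n m) (h m) (M m) / lam m <= K.
      by move: K0; apply: cvgr_le; exact: cv.
    apply: filterS near_K => m hm; have [n1 hh M1 lam0] := hyp m.
    apply: hK => //.
    by rewrite max_l ?(ltW lam0) // -ler_pdivrMr.
  apply: cvge_to_one => [|e e0].
    by apply: filterS (near_key 1 ltr01) => m /andP[].
  by apply: filterS (near_key e e0) => m /andP[].
- have near_key e : 0 < e -> \forall rho \near +oo, ((1 - e)%:E <=
      ereal_inf [set P Sigma [set w | phi (n rho) (h rho) (M rho) w] |
        Sigma in @H1 R d r t (h rho) (rho * M rho * kap (n rho) (h rho) (M rho))] <= 1)%E.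
    move=> e0; have [K K0 hK] := key e e0.
    apply: filterS (nbhs_pinfty_ge (num_real K^-1)) => rho Krho; have [n1 hh M1] := hyp rho.
    have {}M1 : 1 <= M rho by apply: le_trans M1; rewrite ler1n.
    apply: hK => //.
    (* A negative critical value satisfies the requirement because the level is clipped at 0;
       otherwise the factor [rho] exceeds [K^-1]. *)
    have [pos|neg] := leP 0 (M rho * kap (n rho) (h rho) (M rho)).
      apply: le_trans (_ : K * (rho * M rho * kap (n rho) (h rho) (M rho)) <= _); last first.
        by rewrite ler_pM2l // le_max lexx.
      by rewrite -!mulrA [leRHS]mulrA ler_peMl // -ler_pdivrMl // mulr1.
    by apply: le_trans (ltW neg) _; rewrite mulr_ge0 ?(ltW K0) // le_max lexx orbT.
  apply: cvge_to_one => [|e e0].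
    by apply: filterS (near_key 1 ltr01) => rho /andP[].
  by apply: filterS (near_key e e0) => rho /andP[].
Qed.
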